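(* Assume: (1) $\mathcal L$ generates a strongly continuous semigroup $\{e^{t\mathcal L}\}_{t\ge 0}$ of contractions on $X$; $\mathcal A=-\mathcal L+\overline{\mathcal L}$ generates a group $\{e^{t\mathcal A}\}_{t\in\mathbb R}$ of unitary operators on $X$; and $[\mathcal L,\overline{\mathcal L}]=0$. (2) There are $a_1>a_0\ge 0$ such that for every $\alpha\in[a_0,a_1]$ $$\|f(u,\overline u)\|_\alpha\le C_\alpha(\|u\|_{a_0})\|u\|_\alpha,\qquad \|f(u,\overline u)-f(v,\overline v)\|_{a_0}\le C_{a_0}(\|u\|_{a_0},\|v\|_{a_0})\|u-v\|_{a_0}.$$ Let $\alpha_0\in[0,a_1]$ and suppose that for some $\alpha_1\in(a_0,a_1]$ the following hold. (3) For all $v,w\in X^{\alpha_1}$, $$\|\mathcal C[f,\mathcal L](v,w)\|_{\alpha_0}\le C_{\alpha_0}(\|v\|_{\alpha_1},\|w\|_{\alpha_1}),$$ $$\|\mathcal B(F(v)\cdot e^{s\mathcal A}\mathcal C[G,\mathcal A](w))\|_{\alpha_0}\le C_{\alpha_0}(\|v\|_{\alpha_1},\|w\|_{\alpha_1})\quad\text{for all } s\in\mathbb R,$$ the second estimate being uniform in $s$. (4) $\|f(u,\overline u)-f(v,\overline v)\|_{\alpha_0}\le C_{\alpha_0}(\|u\|_{a_0},\|v\|_{a_0})\|u-v\|_{\alpha_0}$ and $\|f(u,\overline u)\|_{\alpha_0}\le C_{\alpha_0}(\|u\|_{\alpha_1})$; and, with $\Psi^\tau_{\mathrm{num},1}(v)=\mathcal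 B(F(v)\cdot\varphi_1(\tau\mathcal A)G(\overline v))$ and constants independent of $\tau\in(0,1]$, $$\|\Psi^\tau_{\mathrm{num},1}(u)\|_{\alpha_1}\le C_{\alpha_1}(\|u\|_{\alpha_1}),$$ $$\|\Psi^\tau_{\mathrm{num},1}(u)-\Psi^\tau_{\mathrm{num},1}(v)\|_{\alpha_0}\le C_{\alpha_0}(\|u\|_{a_0},\|v\|_{a_0})\|u-v\|_{\alpha_0},$$ $$\|\Psi^\tau_{\mathrm{num},1}(u)-\Psi^\tau_{\mathrm{num},1}(v)\|_{a_0}\le C_{a_0}(\|u\|_{a_0},\|v\|_{a_0})\|u-v\|_{a_0}.$$ Let $u_0\in X^{\alpha_1}$, let $T>0$ and let $u\in\mathcal C([0,T],X^{\alpha_1})$ be the unique solution of $$u(t)=e^{t\mathcal L}u_0+\int_0^t e^{(t-\xi)\mathcal L}f(u(\xi),\overline u(\xi))\,d\xi .$$ For a step size $\tau\in(0,1]$ define $u^0=u_0$ and $$u^{\ell+1}=e^{\tau\mathcal L}\Big(u^\ell+\tau\,\mathcal B\big(F(u^\ell)\cdot\varphi_1(\tau\mathcal A)G(\overline{u^\ell})\big)\Big),\qquad \ell\ge0 .$$ Then there exists $C_T>0$ (independent of $\tau$ and $n$) such that $$\|u(n\tau)-u^n\|_{\alpha_0}\le C_T\,\tau,\qquad 0\le n\tau\le T.$$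
   Context: $\Omega\subset\mathbb R^d$; $X$ is a Hilbert space of complex-valued functions on $\Omega$ with norm $\|\cdot\|$, on which complex conjugation $u\mapsto\overline u$ is an isometry. $\mathcal L$ is a linear operator on $X$ with domain $\mathcal D(\mathcal L)$ (homogeneous boundary conditions, if any, are encoded in the domain), $\overline{\mathcal L}u=\overline{\mathcal L\overline u}$, and $\mathcal A=-\mathcal L+\overline{\mathcal L}$. For $\alpha\ge0$, $X^\alpha=\mathcal D(\mathcal L^\alpha)$ with norm $\|u\|_\alpha=\|u\|+\|\mathcal L^\alpha u\|$, $X^0=X$ (fractional powers are those of the generator of a contraction semigroup, i.e. taken of $-\mathcal L$). The nonlinearity is $f(v,w)=\mathcal B(F(v)\cdot G(w))$ with $F,G:\mathbb C\to\mathbb C^J$ (acting pointwise on functions), $Y\cdot Z=\sum_kY_kZ_k$, and $\mathcal B$ a linear operator; operators act componentwise on vector-valued functions. $C_\alpha(\cdot)$ denotes a continuous non-decreasing function of its arguments, possibly different at each occurrence. The estimates in the hypotheses are required for all functions for which the right-hand side norms are finite. $\varphi_1(z)=(e^z-1)/z$; since $\mathcal A=i\mathcal M$ with $\mathcal M$ self-adjoint, $\varphi_1(\tau\mathcal A)$ is a bounded operator defined by functional calculus. For a function $H(v_1,\dots,v_n)$, $n\ge1$, and a linear operator $L$, $$\mathcal C[H,L](v_1,\dots,v_n)=-L(H(v_1,\dots,v_n))+\sum_{i=1}^nD_iH(v_1,\dots,v_n)\cdot Lv_i,$$ where $D_iH$ is the partial differential of $H$ in $v_i$. ($F$, $G$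 are smooth enough for this to make sense; for arguments not in the domain of $L$ the commutator is understood by continuous extension from regular arguments.)
   Formalization: Added, since the claim fails without them: complex conjugation is bounded on X^{α1}, and B is closed (Y ↦ B(F(v)·Y) is a closed operator for regular v). [L, conj L] = 0 is read as commutation of the two semigroups. *)

(* Defs.v *)
From Stdlib Require Import Reals.
From Coquelicot Require Import Coquelicot.
Set Implicit Arguments.
Unset Strict Implicit.
Open Scope R_scope.

Definition Rd (d : nat) : Type := {i : nat | (i < d)%nat} -> R.

Definition pt (d : nat) (Omega : Rd d -> Prop) : Type :=
  {x : Rd d | Omega x}.

Definition cfun (d : nat) (Omega : Rd d -> Prop) : Type :=
  pt Omega -> C.

(* Functions are identified when they differ only on a negligible set, and
   [hs_fun u] is a representative of [u].  With [hs_negl] the null sets this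
   covers L^2 and Sobolev spaces; with only the empty set negligible the
   elements are genuine functions.  The real normed module structure is the one
   that Coquelicot's vector-valued Riemann integral needs. *)
Record fun_hilbert (d : nat) (Omega : Rd d -> Prop) := {
  hs_car :> CompleteNormedModule R_AbsRing;
  hs_cscal : C -> hs_car -> hs_car;
  hs_inner : hs_car -> hs_car -> C;
  hs_conj : hs_car -> hs_car;
  hs_negl : (pt Omega -> Prop) -> Prop;
  hs_fun : hs_car -> cfun Omega;
  hs_negl_empty : hs_negl (fun _ => False);
  hs_negl_sub : forall P Q : pt Omega -> Prop,
    (forall x, P x -> Q x) -> hs_negl Q -> hs_negl P;
  hs_negl_union : forall P Q : pt Omega -> Prop,
    hs_negl P -> hs_negl Q -> hs_negl (fun x => P x \/ Q x);
  hs_cscal_real : forall (r : R) u, hs_cscal (RtoC r) u = scal r u;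
  hs_fun_plus : forall u v, hs_negl (fun x =>
    hs_fun (plus u v) x <> Cplus (hs_fun u x) (hs_fun v x));
  hs_fun_cscal : forall c u, hs_negl (fun x =>
    hs_fun (hs_cscal c u) x <> Cmult c (hs_fun u x));
  hs_fun_inj : forall u, hs_negl (fun x => hs_fun u x <> RtoC 0) -> u = zero;
  hs_fun_conj : forall u, hs_negl (fun x =>
    hs_fun (hs_conj u) x <> Cconj (hs_fun u x));
  hs_conj_isometry : forall u, norm (hs_conj u) = norm u;
  hs_inner_plus : forall u v w,
    hs_inner (plus u v) w = Cplus (hs_inner u w) (hs_inner v w);
  hs_inner_cscal : forall c u v,
    hs_inner (hs_cscal c u) v = Cmult c (hs_inner u v);
  hs_inner_sym : forall u v, hs_inner v u = Cconj (hs_inner u v);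
  hs_inner_norm : forall u, hs_inner u u = RtoC (norm u ^ 2)
}.

Definition eqae (d : nat) (Omega : Rd d -> Prop) (X : fun_hilbert Omega)
    (phi psi : cfun Omega) : Prop :=
  hs_negl X (fun x => phi x <> psi x).

(* Unbounded operators are given by their graphs: [K u z] means that u is in the
   domain of K and K u = z. *)

Definition op (X : Type) := X -> X -> Prop.

Definition clinear (d : nat) (Omega : Rd d -> Prop)
    (X : fun_hilbert Omega) (T : X -> X) : Prop :=
  (forall u v, T (plus u v) = plus (T u) (T v)) /\
  (forall c u, T (hs_cscal c u) = hs_cscal c (T u)).

Definition closure_op (V : NormedModule R_AbsRing) (K : op V) : op V :=
  fun u z => exists (un zn : nat -> V),
    (forall n, K (un n) (zn n)) /\
    filterlim un eventually (locally u) /\ filterlim zn eventually (locally z).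

Definition contraction_semigroup (d : nat) (Omega : Rd d -> Prop)
    (X : fun_hilbert Omega) (S : R -> X -> X) : Prop :=
  (forall t, 0 <= t -> clinear (S t)) /\
  (forall u, S 0 u = u) /\
  (forall s t u, 0 <= s -> 0 <= t -> S (s + t) u = S s (S t u)) /\
  (forall t u, 0 <= t -> norm (S t u) <= norm u) /\
  (forall u, filterlim (fun t => S t u) (at_right 0) (locally u)).

Definition unitary_group (d : nat) (Omega : Rd d -> Prop)
    (X : fun_hilbert Omega) (U : R -> X -> X) : Prop :=
  (forall t, clinear (U t)) /\
  (forall u, U 0 u = u) /\
  (forall s t u, U (s + t) u = U s (U t u)) /\
  (forall t u v, hs_inner (U t u) (U t v) = hs_inner u v) /\
  (forall u, filterlim (fun t => U t u) (locally 0) (locally u)).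

Definition generates_semigroup (V : NormedModule R_AbsRing)
    (K : op V) (S : R -> V -> V) : Prop :=
  forall u z, K u z <->
    filterlim (fun t => scal (/ t) (minus (S t u) u)) (at_right 0) (locally z).

Definition generates_group (V : NormedModule R_AbsRing)
    (K : op V) (U : R -> V -> V) : Prop :=
  forall u z, K u z <->
    filterlim (fun t => scal (/ t) (minus (U t u) u)) (locally' 0) (locally z).

Definition bar_op (d : nat) (Omega : Rd d -> Prop)
    (X : fun_hilbert Omega) (L : op X) : op X :=
  fun u z => L (hs_conj u) (hs_conj z).

(* The closure is taken because -L + conj L, with domain D(L) /\ D(conj L), need
   not be closed: it is zero on D(L) when L is a real operator.  If it is
   already closed, in particular a generator, the closure changes nothing. *)
Definition A_op (d : nat) (Omega : Rd d -> Prop)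
    (X : fun_hilbert Omega) (L : op X) : op X :=
  closure_op (fun u z => exists a b : X,
    L u a /\ bar_op L u b /\ z = plus (opp a) b).

(* [L, conj L] = 0 as strong commutation of unbounded generators, that is,
   commutation of the semigroups e^{tL} and e^{t conj L} u = conj (e^{tL} conj u);
   commutation of the products on their common domain is too weak in general
   (Nelson). *)
Definition commutes_with_bar (d : nat) (Omega : Rd d -> Prop)
    (X : fun_hilbert Omega) (S : R -> X -> X) : Prop :=
  forall s t u, 0 <= s -> 0 <= t ->
    S s (hs_conj (S t (hs_conj u))) = hs_conj (S t (hs_conj (S s u))).

(* Balakrishnan's formula for (-L)^b u, 0 < b < 1 and u in D(L); here g l = (l - L)^{-1} (-L u):
   (-L)^b u = sin(pi b)/pi * int_0^oo l^{b-1} (l - L)^{-1} (-L u) dl. *)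
Definition balakrishnan (V : NormedModule R_AbsRing) (L : op V) (b : R) : op V :=
  fun u w => exists (z : V) (g : R -> V),
    L u z /\
    (forall l, 0 < l ->
       exists y, L (g l) y /\ minus (scal l (g l)) y = opp z) /\
    is_RInt_gen (fun l => scal (Rpower l (b - 1)) (g l))
      (at_right 0) (Rbar_locally p_infty) (scal (PI / sin (PI * b)) w).

Fixpoint neg_pow (V : NormedModule R_AbsRing) (L : op V) (n : nat) : op V :=
  match n with
  | O => fun u w => w = u
  | S n => fun u w => exists y, neg_pow L n u y /\ L y (opp w)
  end.

(* (-L)^a = (-L)^n (-L)^b, where n is the integer part of a, and b = a - n *)
Definition frac_pow (V : NormedModule R_AbsRing) (L : op V) (a : R) : op V :=
  fun u w => exists (n : nat) (b : R) (v : V),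
    a = INR n + b /\ 0 <= b < 1 /\
    ((b = 0 /\ v = u) \/ (0 < b /\ closure_op (balakrishnan L b) u v)) /\
    neg_pow L n v w.

(* [has_norm L a u r]: u is in X^a and r = ||u|| + ||(-L)^a u|| is its norm there.
   For a = 0 this is X with twice its norm. *)
Definition has_norm (V : NormedModule R_AbsRing) (L : op V) (a : R)
    (u : V) (r : R) : Prop :=
  exists w, frac_pow L a u w /\ r = norm u + norm w.

Definition in_X (V : NormedModule R_AbsRing) (L : op V) (a : R) (u : V) : Prop :=
  exists r, has_norm L a u r.

(* An expression that may be undefined is given by the predicate E "z is its
   value"; [bounded_in L a E r] says that it is defined, that its value is in
   X^a, and that its norm there is at most r. *)
Definition bounded_in (V : NormedModule R_AbsRing) (L : op V) (a : R)
    (E : V -> Prop) (r : R) : Prop :=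
  exists z q, E z /\ has_norm L a z q /\ q <= r.

Definition sub_expr (V : NormedModule R_AbsRing) (E1 E2 : V -> Prop) : V -> Prop :=
  fun z => exists z1 z2, E1 z1 /\ E2 z2 /\ z = minus z1 z2.

Definition cvg_X (V : NormedModule R_AbsRing) (L : op V) (a : R)
    (vn : nat -> V) (v : V) : Prop :=
  exists r : nat -> R,
    (forall n, has_norm L a (minus (vn n) v) (r n)) /\ is_lim_seq r 0.

Definition const1 (c : R -> R) : Prop :=
  (forall x, continuous c x) /\ (forall x y, x <= y -> c x <= c y).

Definition const2 (c : R -> R -> R) : Prop :=
  (forall p : R * R, continuous (fun q : R * R => c (fst q) (snd q)) p) /\
  (forall x x' y y', x <= x' -> y <= y' -> c x y <= c x' y').

Definition cexp (z : C) : C :=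
  (exp (fst z) * cos (snd z), exp (fst z) * sin (snd z)).

Definition phi1 (z : C) : C :=
  if Ceq_dec z (RtoC 0) then RtoC 1 else Cdiv (Cminus (cexp z) (RtoC 1)) z.

Definition bounded_cont (g : R -> C) : Prop :=
  (forall x, continuous g x) /\ (exists K, forall x, Cmod (g x) <= K).

(* [Phi g] = g(M) for bounded continuous g, where U(t) = e^{tA} and A = iM *)
Definition functional_calculus (d : nat) (Omega : Rd d -> Prop)
    (X : fun_hilbert Omega) (U : R -> X -> X)
    (Phi : (R -> C) -> X -> X) : Prop :=
  (forall t u, Phi (fun l => cexp (0, t * l)) u = U t u) /\
  (forall g, bounded_cont g -> clinear (Phi g)) /\
  (forall g h u, bounded_cont g -> bounded_cont h ->
     Phi (fun l => Cplus (g l) (h l)) u = plus (Phi g u) (Phi h u)) /\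
  (forall c g u, bounded_cont g ->
     Phi (fun l => Cmult c (g l)) u = hs_cscal c (Phi g u)) /\
  (forall g h u, bounded_cont g -> bounded_cont h ->
     Phi (fun l => Cmult (g l) (h l)) u = Phi g (Phi h u)) /\
  (forall g u v, bounded_cont g ->
     hs_inner (Phi (fun l => Cconj (g l)) u) v = hs_inner u (Phi g v)) /\
  (forall g K u, bounded_cont g -> (forall l, Cmod (g l) <= K) ->
     norm (Phi g u) <= K * norm u) /\
  (forall (gn : nat -> R -> C) g K u,
     (forall n, bounded_cont (gn n)) -> bounded_cont g ->
     (forall n l, Cmod (gn n l) <= K) ->
     (forall l, filterlim (fun n => gn n l) eventually (locally (g l))) ->
     filterlim (fun n => Phi (gn n) u) eventually (locally (Phi g u))).

(* Only the components 1, ..., J are used. *)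

Definition cdot (J : nat) (Y Z : nat -> C) : C :=
  sum_n_m (fun k => Cmult (Y k) (Z k)) 1 J.

(* B acts on functions, which need not belong to X, and takes values in X. *)
Definition linear_fun_op (d : nat) (Omega : Rd d -> Prop)
    (X : fun_hilbert Omega) (B : cfun Omega -> X -> Prop) : Prop :=
  (forall phi z z', B phi z -> B phi z' -> z = z') /\
  (forall phi psi z, eqae X phi psi -> B phi z -> B psi z) /\
  (forall phi psi z y, B phi z -> B psi y ->
     B (fun x => Cplus (phi x) (psi x)) (plus z y)) /\
  (forall c phi z, B phi z -> B (fun x => Cmult c (phi x)) (hs_cscal c z)).

(* [BF B F J v Y z]: z = B(F(v) . Y), where Y is a J-tuple of elements of X *)
Definition BF (d : nat) (Omega : Rd d -> Prop) (X : fun_hilbert Omega)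
    (B : cfun Omega -> X -> Prop) (F : C -> nat -> C) (J : nat)
    (v : X) (Y : nat -> X) (z : X) : Prop :=
  B (fun x => cdot J (F (hs_fun v x)) (fun k => hs_fun (Y k) x)) z.

(* f(v, w) = B(F(v) . G(w)) *)
Definition nonlin (d : nat) (Omega : Rd d -> Prop) (X : fun_hilbert Omega)
    (B : cfun Omega -> X -> Prop) (F G : C -> nat -> C) (J : nat)
    (v w : X) (z : X) : Prop :=
  B (fun x => cdot J (F (hs_fun v x)) (G (hs_fun w x))) z.

(* y is the k-th component of G(w), as an element of X *)
Definition comp_fun (d : nat) (Omega : Rd d -> Prop) (X : fun_hilbert Omega)
    (G : C -> nat -> C) (k : nat) (w y : X) : Prop :=
  eqae X (hs_fun y) (fun x => G (hs_fun w x) k).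

(* Psi^tau_{num,1}(v) = B(F(v) . phi_1(tau A) G(conj v)) *)
Definition Psi_num (d : nat) (Omega : Rd d -> Prop) (X : fun_hilbert Omega)
    (Phi : (R -> C) -> X -> X) (B : cfun Omega -> X -> Prop)
    (F G : C -> nat -> C) (J : nat) (tau : R) (v z : X) : Prop :=
  exists y : nat -> X,
    (forall k, (1 <= k <= J)%nat -> comp_fun G k (hs_conj v) (y k)) /\
    BF B F J v (fun k => Phi (fun l => phi1 (0, tau * l)) (y k)) z.

(* [graph_norm L N u r]: all words of length at most N in L and conj L are
   defined at u, and r is the associated graph norm of u. *)
Fixpoint graph_norm (d : nat) (Omega : Rd d -> Prop)
    (X : fun_hilbert Omega) (L : op X) (N : nat) (u : X) (r : R) : Prop :=
  match N with
  | O => r = norm u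
  | S N => exists (a b : X) (r0 r1 r2 : R),
      L u a /\ bar_op L u b /\
      graph_norm L N u r0 /\ graph_norm L N a r1 /\ graph_norm L N b r2 /\
      r = r0 + r1 + r2
  end.

Definition regular (d : nat) (Omega : Rd d -> Prop)
    (X : fun_hilbert Omega) (L : op X) (u : X) : Prop :=
  forall N, exists r, graph_norm L N u r.

(* A function H of n + 1 variables v_0, ..., v_n is given by its graph.
   [differential L n H v D]: H is (real) Fréchet differentiable at v along the
   regular elements, for one of the graph norms, and D i is its partial
   differential in v_i. *)
Definition differential (d : nat) (Omega : Rd d -> Prop)
    (X : fun_hilbert Omega) (L : op X) (n : nat)
    (H : (nat -> X) -> X -> Prop) (v : nat -> X) (D : nat -> X -> X) : Prop :=
  (forall i h k, (i <= n)%nat -> regular L h -> regular L k ->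
     D i (plus h k) = plus (D i h) (D i k)) /\
  (forall i (c : R) h, (i <= n)%nat -> regular L h ->
     D i (scal c h) = scal c (D i h)) /\
  exists N : nat,
    (exists K, forall i h r, (i <= n)%nat -> regular L h ->
       graph_norm L N h r -> norm (D i h) <= K * r) /\
    exists z0, H v z0 /\
      forall eps, 0 < eps -> exists delta, 0 < delta /\
        forall (h : nat -> X) (r : nat -> R),
          (forall i, (i <= n)%nat ->
             regular L (h i) /\ graph_norm L N (h i) (r i)) ->
          sum_n r n < delta ->
          exists z, H (fun i => plus (v i) (h i)) z /\
            norm (minus (minus z z0) (sum_n (fun i => D i (h i)) n))
              <= eps * sum_n r n.

(* C[H, K](v_0, ..., v_n) = - K(H(v_0, ..., v_n)) + sum_i D_i H(v) . K v_i at
   regular arguments *)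
Definition commutator (d : nat) (Omega : Rd d -> Prop)
    (X : fun_hilbert Omega) (L : op X) (n : nat)
    (H : (nat -> X) -> X -> Prop) (K : op X) (v : nat -> X) (c : X) : Prop :=
  exists (z y : X) (Kv : nat -> X) (D : nat -> X -> X),
    (forall i, (i <= n)%nat -> regular L (v i)) /\
    H v z /\ K z y /\
    (forall i, (i <= n)%nat -> K (v i) (Kv i)) /\
    differential L n H v D /\
    c = plus (opp y) (sum_n (fun i => D i (Kv i)) n).

(* Continuous extension to X^a x X^a of an expression E(v, w) that is defined at
   regular v, w: c is the limit in X of E along all regular approximations. *)
Definition cont_ext (d : nat) (Omega : Rd d -> Prop)
    (X : fun_hilbert Omega) (L : op X) (a : R) (E : X -> X -> X -> Prop)
    (v w c : X) : Prop :=
  forall vn wn : nat -> X,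
    (forall n, regular L (vn n) /\ regular L (wn n)) ->
    cvg_X L a vn v -> cvg_X L a wn w ->
    exists zn : nat -> X,
      (forall n, E (vn n) (wn n) (zn n)) /\ filterlim zn eventually (locally c).

(* C[f, L](v, w) *)
Definition comm_f (d : nat) (Omega : Rd d -> Prop)
    (X : fun_hilbert Omega) (L : op X) (B : cfun Omega -> X -> Prop)
    (F G : C -> nat -> C) (J : nat) (v w c : X) : Prop :=
  commutator L 1 (fun p => nonlin B F G J (p O) (p 1%nat)) L
    (fun i => match i with O => v | _ => w end) c.

(* B(F(v) . e^{sA} C[G, A](w)) *)
Definition B_comm_G (d : nat) (Omega : Rd d -> Prop)
    (X : fun_hilbert Omega) (L : op X) (U : R -> X -> X)
    (B : cfun Omega -> X -> Prop) (F G : C -> nat -> C) (J : nat)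
    (s : R) (v w z : X) : Prop :=
  exists c : nat -> X,
    (forall k, (1 <= k <= J)%nat ->
       commutator L 0 (fun p => comp_fun G k (p O)) (A_op L) (fun _ => w) (c k)) /\
    BF B F J v (fun k => U s (c k)) z.

(* B is a closed operator: for regular v, so is Y |-> B(F(v) . Y) from X^J to X. *)
Definition closed_fun_op (d : nat) (Omega : Rd d -> Prop)
    (X : fun_hilbert Omega) (L : op X) (B : cfun Omega -> X -> Prop)
    (F : C -> nat -> C) (J : nat) : Prop :=
  forall (v : X) (Yn : nat -> nat -> X) (Y : nat -> X) (zn : nat -> X) (z : X),
    regular L v ->
    (forall n, BF B F J v (Yn n) (zn n)) ->
    (forall k, (1 <= k <= J)%nat ->
       filterlim (fun n => Yn n k) eventually (locally (Y k))) ->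
    filterlim zn eventually (locally z) ->
    BF B F J v Y z.

(* u is in C([0,T], X^a) and is a mild solution with initial value u0 *)
Definition mild_solution (d : nat) (Omega : Rd d -> Prop)
    (X : fun_hilbert Omega) (L : op X) (S : R -> X -> X)
    (B : cfun Omega -> X -> Prop) (F G : C -> nat -> C) (J : nat)
    (a T : R) (u0 : X) (u : R -> X) : Prop :=
  (forall t, 0 <= t <= T -> in_X L a (u t)) /\
  (forall t, 0 <= t <= T -> forall eps, 0 < eps -> exists delta, 0 < delta /\
     forall s, 0 <= s <= T -> Rabs (s - t) < delta ->
       exists r, has_norm L a (minus (u s) (u t)) r /\ r < eps) /\
  exists g : R -> X,
    (forall xi, 0 <= xi <= T -> nonlin B F G J (u xi) (hs_conj (u xi)) (g xi)) /\
    forall t, 0 <= t <= T ->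
      exists I, is_RInt (fun xi => S (t - xi) (g xi)) 0 t I /\
        u t = plus (S t u0) I.

Definition scheme (d : nat) (Omega : Rd d -> Prop)
    (X : fun_hilbert Omega) (S : R -> X -> X) (Phi : (R -> C) -> X -> X)
    (B : cfun Omega -> X -> Prop) (F G : C -> nat -> C) (J : nat)
    (tau : R) (u0 : X) (un : nat -> X) : Prop :=
  un O = u0 /\
  forall l, exists p, Psi_num Phi B F G J tau (un l) p /\
    un (Datatypes.S l) = S tau (plus (un l) (scal tau p)).

(* Main.v *)
Require Import Defs.
From Stdlib Require Import Reals Lra Lia List ClassicalEpsilon FunctionalExtensionality.
From Coquelicot Require Import Coquelicot.
Open Scope R_scope.

(** A step of the scheme differs from the exact flow by three errors of order [tau^2].

    Let a step start at [v] and let [w = conj v].  Duhamel's formula integrates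
    [e^{(tau-s)L} f(u(s), conj u(s))] over [[0, tau]].  Replacing the solution [u(s)] by the linear
    flow [e^{sL} v] is paid for by the Lipschitz bound of [f] ([defect_bound]).  By strong
    commutation [conj(e^{sL} v) = e^{s conj L} w = e^{sL} e^{sA} w] ([S_U_Sb]), so the integrand has
    become [e^{(tau-s)L} f(e^{sL} v, e^{sL} e^{sA} w)].  Moving [e^{sL}] out of [f] costs [s] times a mean
    of commutators [C[f,L]] ([step_nonlin]), which leaves [e^{tau L} B(F(v) . G(e^{sA} w))].  Moving
    [e^{sA}] out of [G] costs [s] times a mean of values [B(F . e^{rA} C[G,A])] ([step_G]).  As
    [int_0^tau e^{sA} ds = tau phi_1(tau A)] ([orbit_RInt_phi]), what remains is the scheme.  Since the
    scheme is stable, Gronwall's lemma turns defects of order [tau^2] into an error of order [tau]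
    ([first_order_convergence]).

    The commutators are defined, and the nonlinearity is differentiable, at regular vectors only, and
    they are bounded only in balls of [X^alpha0].  These balls are convex and closed in [X]
    ([xball_closed]), so that a mean value theorem for closed convex sets ([convex_mean_value]) applies
    to curves of regular vectors.  The resulting estimate extends to [X^alpha1] by approximation with
    [mollify], a bounded operator that commutes with all the semigroups and has regular values, because
    it is an infinite product of averages over shrinking time intervals ([local_error]).

    Fractional powers enter through their graph norms: their graphs are closed ([frac_pow_closed]),
    they commute with bounded operators that commute with the semigroup, and the norm of [X^a] is at most
    a small multiple of that of [X^c], [c > a], plus a multiple of that of [X] ([frac_embed]).  All this
    follows from one estimate: if [(-L)^b u = w], then [(nu - L)^{-1} L u] is at most of size
    [nu^{-b} |w|].  In a
    Hilbert space this can be read off from Balakrishnan's integral by pairing it with a resolvent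
    ([balak_key]).

    The Lipschitz constants depend on norms in [X^a0], where the defect need not be quadratic.  But it is
    linear in [tau] in [X^alpha1] and quadratic in [X], hence it is [o(tau)] in [X^a0], and this
    suffices to keep the iterates bounded there ([iterates_bounded]). *)

(** * Identities in modules *)

(** An equation between linear combinations is decided by reflection: both sides are read as
    expressions over the same atoms, and it suffices that the coefficients of every atom agree,
    which [ring] and [field] can check. *)
Inductive vexp : Type :=
| VVar (n : nat) | VZero | VPlus (a b : vexp) | VOpp (a : vexp)
| VMinus (a b : vexp) | VScal (r : R) (a : vexp).

Section VecReflection.
Context {V : ModuleSpace R_Ring}.

Fixpoint veval (env : list V) (e : vexp) : V :=
  match e with
  | VVar n => nth n env zero
  | VZero => zero
  | VPlus a b => plus (veval env a) (veval env b)
  | VOpp a => opp (veval env a)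
  | VMinus a b => minus (veval env a) (veval env b)
  | VScal r a => scal r (veval env a)
  end.

Fixpoint vcoef (e : vexp) (i : nat) : R :=
  match e with
  | VVar n => if Nat.eqb n i then 1 else 0
  | VZero => 0
  | VPlus a b => vcoef a i + vcoef b i
  | VOpp a => - vcoef a i
  | VMinus a b => vcoef a i - vcoef b i
  | VScal r a => r * vcoef a i
  end.

Fixpoint lincomb (env : list V) (k : nat) (c : nat -> R) : V :=
  match env with
  | nil => zero
  | v :: env => plus (scal (c k) v) (lincomb env (S k) c)
  end.

Lemma lincomb_ext env k c c' :
  (forall i, c i = c' i) -> lincomb env k c = lincomb env k c'.
Proof.
  intros H. revert k. induction env as [|v env IH]; intros k; simpl; auto.
  now rewrite H, IH.
Qed.

Lemma lincomb_zero env k : lincomb env k (fun _ => 0) = zero.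
Proof.
  revert k. induction env as [|v env IH]; intros k; simpl; auto.
  rewrite IH, plus_zero_r. exact (scal_zero_l v).
Qed.

Lemma lincomb_plus env k c c' :
  lincomb env k (fun i => c i + c' i) = plus (lincomb env k c) (lincomb env k c').
Proof.
  revert k. induction env as [|v env IH]; intros k; simpl.
  - now rewrite plus_zero_r.
  - rewrite IH.
    replace (scal (c k + c' k) v) with (plus (scal (c k) v) (scal (c' k) v))
      by (symmetry; exact (scal_distr_r (c k) (c' k) v)).
    rewrite <- !plus_assoc. f_equal. rewrite !plus_assoc. f_equal. apply plus_comm.
Qed.

Lemma lincomb_scal env k r c :
  lincomb env k (fun i => r * c i) = scal r (lincomb env k c).
Proof.
  revert k. induction env as [|v env IH]; intros k; simpl.
  - symmetry. exact (scal_zero_r r).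
  - rewrite IH. rewrite (scal_distr_l (K := R_Ring) r). f_equal.
    symmetry. exact (scal_assoc r (c k) v).
Qed.

Lemma scal_opp1 (v : V) : scal (-1) v = opp v.
Proof. exact (scal_opp_one v). Qed.

Lemma lincomb_opp env k c :
  lincomb env k (fun i => - c i) = opp (lincomb env k c).
Proof.
  rewrite <- scal_opp1, <- lincomb_scal. apply lincomb_ext. intros i. ring.
Qed.

Lemma lincomb_var env k n :
  lincomb env k (fun i => if Nat.eqb (n + k) i then 1 else 0) = nth n env zero.
Proof.
  revert k n. induction env as [|v env IH]; intros k n; simpl.
  - now destruct n.
  - destruct n as [|n].
    + simpl. rewrite Nat.eqb_refl.
      replace (lincomb env (S k) _) with (@zero V).
      * rewrite plus_zero_r. exact (scal_one v).
      * symmetry. clear IH.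
        assert (H : forall j, (k < j)%nat ->
          lincomb env j (fun i => if Nat.eqb k i then 1 else 0) = zero).
        { induction env as [|w env IH]; intros j Hj; simpl; auto.
          rewrite IH by lia. rewrite (proj2 (Nat.eqb_neq k j)) by lia.
          rewrite plus_zero_r. exact (scal_zero_l w). }
        apply H. lia.
    + rewrite (proj2 (Nat.eqb_neq _ k)) by lia.
      replace (S n + k)%nat with (n + S k)%nat by lia.
      rewrite IH.
      replace (scal 0 v) with (@zero V) by (symmetry; exact (scal_zero_l v)).
      apply plus_zero_l.
Qed.

Lemma veval_lincomb env e : veval env e = lincomb env 0 (vcoef e).
Proof.
  induction e as [n | | a IHa b IHb | a IHa | a IHa b IHb | r a IHa]; simpl.
  - rewrite <- (lincomb_var env 0 n). apply lincomb_ext.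
    intros i. now rewrite Nat.add_0_r.
  - symmetry. apply lincomb_zero.
  - now rewrite IHa, IHb, <- lincomb_plus.
  - now rewrite IHa, <- lincomb_opp.
  - unfold minus. rewrite IHa, IHb, <- lincomb_opp, <- lincomb_plus.
    now apply lincomb_ext.
  - now rewrite IHa, <- lincomb_scal.
Qed.

Fixpoint vcoefs_eq (n : nat) (e e' : vexp) : Prop :=
  match n with
  | O => True
  | S n => vcoef e n = vcoef e' n /\ vcoefs_eq n e e'
  end.

Lemma veval_eq env e e' :
  vcoefs_eq (length env) e e' -> veval env e = veval env e'.
Proof.
  intros H. rewrite !veval_lincomb.
  assert (H' : forall i, (i < length env)%nat -> vcoef e i = vcoef e' i).
  { revert H. generalize (length env) as n. induction n as [|n IH]; intros H i Hi; [lia|].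
    destruct H as [H1 H2]. destruct (Nat.eq_dec i n) as [->|]; auto.
    apply IH; auto; lia. }
  clear H.
  assert (H : forall l k, (forall i, (k <= i < k + length l)%nat -> vcoef e i = vcoef e' i) ->
    lincomb l k (vcoef e) = lincomb l k (vcoef e')).
  { induction l as [|v l IH]; intros k Hl; simpl; auto.
    f_equal; [rewrite Hl by (simpl; lia); reflexivity|].
    apply IH. intros i Hi. apply Hl. simpl. lia. }
  apply H. intros i Hi. apply H'. lia.
Qed.
End VecReflection.

Ltac vec_mem v env :=
  match env with
  | nil => constr:(false)
  | v :: _ => constr:(true)
  | _ :: ?l => vec_mem v l
  end.
Ltac vec_env env t :=
  match t with
  | plus ?a ?b => let env := vec_env env a in vec_env env b
  | minus ?a ?b => let env := vec_env env a in vec_env env b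
  | opp ?a => vec_env env a
  | scal _ ?a => vec_env env a
  | zero => env
  | _ => match vec_mem t env with
         | true => env
         | false => constr:(t :: env)
         end
  end.
Ltac vec_idx v env :=
  match env with
  | v :: _ => constr:(O)
  | _ :: ?l => let n := vec_idx v l in constr:(S n)
  end.
Ltac vec_reify env t :=
  match t with
  | plus ?a ?b => let a := vec_reify env a in let b := vec_reify env b in
                  constr:(VPlus a b)
  | minus ?a ?b => let a := vec_reify env a in let b := vec_reify env b in
                  constr:(VMinus a b)
  | opp ?a => let a := vec_reify env a in constr:(VOpp a)
  | scal ?r ?a => let a := vec_reify env a in constr:(VScal r a)
  | zero => constr:(VZero)
  | _ => let n := vec_idx t env in constr:(VVar n)
  end.
Ltac vec_side := try reflexivity; try ring; try (field; repeat split; solve [auto | lra]).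
Ltac vec :=
  match goal with
  | |- @eq ?V ?a ?b =>
    let env := vec_env (@nil V) a in
    let env := vec_env env b in
    let ea := vec_reify env a in
    let eb := vec_reify env b in
    refine (veval_eq (V := _) env ea eb _);
    cbn [vcoefs_eq vcoef length Nat.eqb]; repeat split; vec_side
  end.

Ltac canon_step :=
  match goal with
  | |- context [CompleteNormedModule.AbelianGroup ?K ?V] =>
    change (CompleteNormedModule.AbelianGroup K V) with (NormedModule.AbelianGroup K (CompleteNormedModule.NormedModule K V))
  | |- context [CompleteNormedModule.AbelianMonoid ?K ?V] =>
    change (CompleteNormedModule.AbelianMonoid K V) with (NormedModule.AbelianMonoid K (CompleteNormedModule.NormedModule K V))
  | |- context [CompleteNormedModule.ModuleSpace ?K ?V] =>
    change (CompleteNormedModule.ModuleSpace K V) with (NormedModule.ModuleSpace K (CompleteNormedModule.NormedModule K V))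
  | |- context [AbelianMonoid.Pack (AbelianGroup.sort (NormedModule.AbelianGroup ?K ?V)) ?b ?c] =>
    change (AbelianMonoid.Pack (AbelianGroup.sort (NormedModule.AbelianGroup K V)) b c) with (NormedModule.AbelianMonoid K V)
  | |- context [ModuleSpace.AbelianGroup ?L (NormedModule.ModuleSpace ?K ?V)] =>
    change (ModuleSpace.AbelianGroup L (NormedModule.ModuleSpace K V)) with (NormedModule.AbelianGroup K V)
  | |- context [ModuleSpace.AbelianMonoid ?L (NormedModule.ModuleSpace ?K ?V)] =>
    change (ModuleSpace.AbelianMonoid L (NormedModule.ModuleSpace K V)) with (NormedModule.AbelianMonoid K V)
  end.
Ltac canon_step_in H :=
  match type of H with
  | context [CompleteNormedModule.AbelianGroup ?K ?V] =>
    change (CompleteNormedModule.AbelianGroup K V) with (NormedModule.AbelianGroup K (CompleteNormedModule.NormedModule K V)) in H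
  | context [CompleteNormedModule.AbelianMonoid ?K ?V] =>
    change (CompleteNormedModule.AbelianMonoid K V) with (NormedModule.AbelianMonoid K (CompleteNormedModule.NormedModule K V)) in H
  | context [CompleteNormedModule.ModuleSpace ?K ?V] =>
    change (CompleteNormedModule.ModuleSpace K V) with (NormedModule.ModuleSpace K (CompleteNormedModule.NormedModule K V)) in H
  | context [AbelianMonoid.Pack (AbelianGroup.sort (NormedModule.AbelianGroup ?K ?V)) ?b ?c] =>
    change (AbelianMonoid.Pack (AbelianGroup.sort (NormedModule.AbelianGroup K V)) b c) with (NormedModule.AbelianMonoid K V) in H
  | context [ModuleSpace.AbelianGroup ?L (NormedModule.ModuleSpace ?K ?V)] =>
    change (ModuleSpace.AbelianGroup L (NormedModule.ModuleSpace K V)) with (NormedModule.AbelianGroup K V) in H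
  | context [ModuleSpace.AbelianMonoid ?L (NormedModule.ModuleSpace ?K ?V)] =>
    change (ModuleSpace.AbelianMonoid L (NormedModule.ModuleSpace K V)) with (NormedModule.AbelianMonoid K V) in H
  end.
(** The operations of a complete normed module are reachable along several inheritance paths,
    which are convertible but which rewriting and [lra] take for different terms. *)
Ltac canon := repeat canon_step.
Tactic Notation "canon" "in" hyp(H) := repeat canon_step_in H.

Ltac vfind a k :=
  match goal with
  | |- context [@minus ?G ?x ?y] => unify (@minus G x y) a; k (@minus G x y)
  | |- context [@plus ?G ?x ?y] => unify (@plus G x y) a; k (@plus G x y)
  | |- context [@scal ?K ?G ?x ?y] => unify (@scal K G x y) a; k (@scal K G x y)
  | |- context [@opp ?G ?x] => unify (@opp G x) a; k (@opp G x)
  | |- context [@norm ?K ?G ?x] => unify x a; k x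
  end.
Ltac vfind_in H a k :=
  match type of H with
  | context [@minus ?G ?x ?y] => unify (@minus G x y) a; k (@minus G x y)
  | context [@plus ?G ?x ?y] => unify (@plus G x y) a; k (@plus G x y)
  | context [@scal ?K ?G ?x ?y] => unify (@scal K G x y) a; k (@scal K G x y)
  | context [@opp ?G ?x] => unify (@opp G x) a; k (@opp G x)
  | context [@norm ?K ?G ?x] => unify x a; k x
  end.
(** The subterm is found up to conversion, so that its inheritance path does not matter. *)
Tactic Notation "vrep" uconstr(a) "with" uconstr(b) :=
  let a' := constr:(a) in
  vfind a' ltac:(fun t => let E := fresh in assert (E : t = b) by vec; rewrite E; clear E); canon.
Tactic Notation "vrep" uconstr(a) "with" uconstr(b) "in" hyp(H) :=
  let a' := constr:(a) in
  vfind_in H a' ltac:(fun t => let E := fresh in assert (E : t = b) by vec; rewrite E in H; clear E); canon in H.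

Ltac canon_all := canon; repeat match goal with H : _ |- _ => progress (canon in H) end.
Ltac clra := canon_all; lra.

(** * Limits of vectors *)

Section Limits.
Context {V : NormedModule R_AbsRing}.
Implicit Types (u v w : V) (un vn : nat -> V).

Lemma norm_scal_eq (r : R) u : norm (scal r u) = Rabs r * norm u.
Proof.
  assert (H : forall (a : R) (x : V), norm (scal a x) <= Rabs a * norm x) by (intros a x; exact (norm_scal a x)).
  apply Rle_antisym; auto.
  destruct (Req_dec r 0) as [->|Hr]; [rewrite Rabs_R0, Rmult_0_l; apply norm_ge_0|].
  assert (Hx := H (/ r) (scal r u)).
  vrep (scal (/ r) (scal r u)) with u in Hx.
  rewrite Rabs_inv in Hx. assert (Hr' : 0 < Rabs r) by now apply Rabs_pos_lt.
  apply (Rmult_le_compat_l (Rabs r)) in Hx; [|lra].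
  replace (Rabs r * (/ Rabs r * norm (scal r u))) with (norm (scal r u)) in Hx by (field; lra).
  exact Hx.
Qed.

Lemma norm_0 u : u = zero -> norm u = 0.
Proof. intros ->. apply norm_zero. Qed.

Lemma norm_pos u : 0 <= norm u.
Proof. exact (norm_ge_0 u). Qed.

Lemma norm_le2 u v w : u = plus v w -> norm u <= norm v + norm w.
Proof. intros ->. exact (norm_triangle v w). Qed.

Lemma norm_le2m u v w : u = minus v w -> norm u <= norm v + norm w.
Proof. intros ->. rewrite <- (norm_opp w). exact (norm_triangle v (opp w)). Qed.

Lemma norm_le3 u v w z : u = plus v (plus w z) -> norm u <= norm v + norm w + norm z.
Proof.
  intros ->. apply Rle_trans with (1 := norm_triangle _ _).
  generalize (norm_triangle w z). unfold AbsRing.sort in *. intros H. rewrite Rplus_assoc. now apply Rplus_le_compat_l.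
Qed.

Lemma norm_minus_sym u v : norm (minus u v) = norm (minus v u).
Proof. rewrite <- norm_opp. f_equal. vec. Qed.

Lemma minus_eq u v : norm (minus u v) <= 0 -> u = v.
Proof.
  intros H. assert (H0 : norm (minus u v) = 0) by (apply Rle_antisym; auto; apply norm_pos).
  apply norm_eq_zero in H0. transitivity (plus (minus u v) v); [vec|].
  rewrite H0. vec.
Qed.

Lemma vec_from (k : R) (a b c d : V) : c = d -> minus a b = scal k (minus c d) -> a = b.
Proof.
  intros -> H. transitivity (plus (minus a b) b); [vec|]. rewrite H. vec.
Qed.

Definition lim_to un u : Prop :=
  forall eps, 0 < eps -> exists N, forall n, (N <= n)%nat -> norm (minus (un n) u) < eps.

Lemma lim_to_filterlim un u : lim_to un u <-> filterlim un eventually (locally u).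
Proof.
  rewrite (filterlim_locally_ball_norm (F := eventually)). split.
  - intros H eps. destruct (H eps (cond_pos eps)) as [N HN]. exists N. exact HN.
  - intros H eps Heps. exact (H (mkposreal eps Heps)).
Qed.

Lemma right_lim_iff (f : R -> V) z :
  filterlim f (at_right 0) (locally z) <->
  forall eps, 0 < eps -> exists delta, 0 < delta /\
    forall t, 0 < t < delta -> norm (minus (f t) z) < eps.
Proof.
  rewrite (filterlim_locally_ball_norm (F := at_right 0)). split.
  - intros H eps Heps. destruct (H (mkposreal eps Heps)) as [d Hd].
    exists d. split; [apply cond_pos|]. intros t Ht. apply Hd; [|apply Ht].
    change (Rabs (t - 0) < d). rewrite Rabs_right; lra.
  - intros H eps. destruct (H eps (cond_pos eps)) as [d [Hd H']].
    exists (mkposreal d Hd). intros t Ht Ht0.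
    change (Rabs (t - 0) < d) in Ht. apply H'. rewrite Rabs_right in Ht; lra.
Qed.

Lemma punctured_lim_iff (f : R -> V) z :
  filterlim f (locally' 0) (locally z) <->
  forall eps, 0 < eps -> exists delta, 0 < delta /\
    forall t, t <> 0 -> Rabs t < delta -> norm (minus (f t) z) < eps.
Proof.
  rewrite (filterlim_locally_ball_norm (F := locally' 0)). split.
  - intros H eps Heps. destruct (H (mkposreal eps Heps)) as [d Hd].
    exists d. split; [apply cond_pos|]. intros t Ht0 Ht. apply Hd; [|apply Ht0].
    change (Rabs (t - 0) < d). now rewrite Rminus_0_r.
  - intros H eps. destruct (H eps (cond_pos eps)) as [d [Hd H']].
    exists (mkposreal d Hd). intros t Ht Ht0.
    change (Rabs (t - 0) < d) in Ht. rewrite Rminus_0_r in Ht. now apply H'.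
Qed.

Lemma continuous_iff (f : R -> V) x :
  continuous f x <->
  forall eps, 0 < eps -> exists delta, 0 < delta /\
    forall t, Rabs (t - x) < delta -> norm (minus (f t) (f x)) < eps.
Proof.
  assert (E := filterlim_locally_ball_norm (F := @locally R_UniformSpace x) f (f x)).
  split.
  - intros H eps Heps. destruct (proj1 E H (mkposreal eps Heps)) as [d Hd].
    exists d. split; [apply cond_pos|]. intros t Ht. now apply Hd.
  - intros H. apply (proj2 E). intros eps. destruct (H eps (cond_pos eps)) as [d [Hd H']].
    exists (mkposreal d Hd). intros t Ht. now apply H'.
Qed.

Lemma lim_to_const u : lim_to (fun _ => u) u.
Proof.
  intros eps Heps. exists O. intros n _. vrep (minus u u) with (@zero V).
  rewrite norm_zero. auto.
Qed.

Lemma lim_to_ext un vn u : (forall n, un n = vn n) -> lim_to un u -> lim_to vn u.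
Proof. intros H Hu eps Heps. destruct (Hu eps Heps) as [N HN]. exists N. intros n Hn. rewrite <- H. auto. Qed.

Lemma lim_to_plus un vn u v :
  lim_to un u -> lim_to vn v -> lim_to (fun n => plus (un n) (vn n)) (plus u v).
Proof.
  intros Hu Hv eps Heps.
  destruct (Hu (eps / 2)) as [N1 H1]; [lra|]. destruct (Hv (eps / 2)) as [N2 H2]; [lra|].
  exists (max N1 N2). intros n Hn.
  assert (Hn1 := H1 n ltac:(lia)). assert (Hn2 := H2 n ltac:(lia)).
  apply Rle_lt_trans with (norm (minus (un n) u) + norm (minus (vn n) v)); [|lra].
  apply norm_le2. vec.
Qed.

Lemma lim_to_lip {W : NormedModule R_AbsRing} (T : V -> W) k un u :
  (forall x y, norm (minus (T x) (T y)) <= k * norm (minus x y)) ->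
  lim_to un u -> forall eps, 0 < eps -> exists N, forall n, (N <= n)%nat ->
    norm (minus (T (un n)) (T u)) < eps.
Proof.
  intros HT Hu eps Heps.
  assert (Hk : 0 < Rabs k + 1) by (generalize (Rabs_pos k); lra).
  destruct (Hu (eps / (Rabs k + 1))) as [N HN]; [now apply Rdiv_lt_0_compat|].
  exists N. intros n Hn. apply Rle_lt_trans with (1 := HT _ _).
  specialize (HN n Hn).
  assert (H1 : k * norm (minus (un n) u) <= (Rabs k + 1) * norm (minus (un n) u)).
  { apply Rmult_le_compat_r; [apply norm_pos|]. generalize (Rle_abs k); lra. }
  apply Rle_lt_trans with (1 := H1).
  apply (Rmult_lt_compat_l (Rabs k + 1)) in HN; auto.
  replace ((Rabs k + 1) * (eps / (Rabs k + 1))) with eps in HN by (field; lra). auto.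
Qed.

Lemma lim_to_scal (r : R) un u : lim_to un u -> lim_to (fun n => scal r (un n)) (scal r u).
Proof.
  intros Hu eps Heps. apply (lim_to_lip (fun x : V => scal r x : V) (Rabs r) un u); auto.
  intros x y. rewrite <- norm_scal_eq. right. f_equal. vec.
Qed.

Lemma lim_to_opp un u : lim_to un u -> lim_to (fun n => opp (un n)) (opp u).
Proof.
  intros H. apply lim_to_ext with (fun n => scal (-1) (un n)); [intros n; vec|].
  vrep (opp u) with (scal (-1) u). now apply lim_to_scal.
Qed.

Lemma lim_to_minus un vn u v :
  lim_to un u -> lim_to vn v -> lim_to (fun n => minus (un n) (vn n)) (minus u v).
Proof. intros Hu Hv. unfold minus. apply lim_to_plus; auto. now apply lim_to_opp. Qed.

Lemma le_eps (a b : R) : (forall eps, 0 < eps -> a <= b + eps) -> a <= b.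
Proof. intros H. apply Rnot_lt_le. intros Hab. specialize (H ((a - b) / 2)). lra. Qed.

Lemma lim_to_unique un u v : lim_to un u -> lim_to un v -> u = v.
Proof.
  intros Hu Hv. apply minus_eq, le_eps. intros eps Heps.
  destruct (Hu (eps / 2)) as [N1 H1]; [lra|]. destruct (Hv (eps / 2)) as [N2 H2]; [lra|].
  set (n := max N1 N2).
  assert (Hn1 := H1 n ltac:(lia)). assert (Hn2 := H2 n ltac:(lia)).
  rewrite norm_minus_sym in Hn1.
  apply Rle_trans with (norm (minus u (un n)) + norm (minus (un n) v)); [|lra].
  apply norm_le2. vec.
Qed.

Lemma lim_to_norm_le un u r :
  lim_to un u -> (forall eps, 0 < eps -> exists N, forall n, (N <= n)%nat -> norm (un n) <= r + eps) ->
  norm u <= r.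
Proof.
  intros Hu Hr. apply le_eps. intros eps Heps.
  destruct (Hu (eps / 2)) as [N1 H1]; [lra|]. destruct (Hr (eps / 2)) as [N2 H2]; [lra|].
  set (n := max N1 N2).
  assert (Hn1 := H1 n ltac:(lia)). assert (Hn2 := H2 n ltac:(lia)).
  rewrite norm_minus_sym in Hn1.
  apply Rle_trans with (norm (minus u (un n)) + norm (un n)); [|lra].
  apply norm_le2. vec.
Qed.

Lemma inv_INR_small eps : 0 < eps -> exists N, forall n, (N <= n)%nat -> / (INR n + 1) < eps.
Proof.
  intros Heps. destruct (INR_archimed 1 (/ eps)) as [N HN]; [lra|].
  exists N. intros n Hn. rewrite <- (Rinv_inv eps). apply Rinv_lt_contravar.
  - apply Rmult_lt_0_compat; [now apply Rinv_0_lt_compat|]. generalize (pos_INR n); lra.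
  - apply le_INR in Hn. lra.
Qed.

Lemma inv_INR_pos n : 0 < / (INR n + 1).
Proof. apply Rinv_0_lt_compat. generalize (pos_INR n). lra. Qed.

Lemma lim_to_inv un u : (forall n, norm (minus (un n) u) <= / (INR n + 1)) -> lim_to un u.
Proof.
  intros H eps Heps. destruct (inv_INR_small eps Heps) as [N HN]. exists N. intros n Hn.
  apply Rle_lt_trans with (1 := H n). auto.
Qed.
End Limits.

Lemma cauchy_lim {V : CompleteNormedModule R_AbsRing} (un : nat -> V) :
  (forall eps, 0 < eps -> exists N, forall n m, (N <= n)%nat -> (N <= m)%nat ->
     norm (minus (un n) (un m)) < eps) ->
  exists u, lim_to un u.
Proof.
  intros H. destruct (proj1 (filterlim_locally_cauchy (F := eventually) un)) as [u Hu].
  - intros eps. destruct (H eps (cond_pos eps)) as [N HN].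
    exists (fun n => (N <= n)%nat). split; [now exists N|].
    intros n m Hn Hm. apply (norm_compat1 (V := V) (un n) (un m) eps). auto.
  - exists u. now apply lim_to_filterlim.
Qed.

(** * Convex sets *)

(** The supremum of the points that can be reached from [a] is reached itself, and it can only be
    [b].  This glues estimates on small intervals together, without a compactness argument. *)
Lemma interval_induction (P : R -> R -> Prop) a b :
  a <= b ->
  (forall s m t, a <= s <= m -> m <= t <= b -> P s m -> P m t -> P s t) ->
  (forall x, a <= x <= b -> exists delta, 0 < delta /\
     forall s t, a <= s <= x -> x <= t <= b -> t - s < delta -> P s t) ->
  P a b.
Proof.
  intros Hab Htr Hloc.
  set (E := fun t => a <= t <= b /\ P a t).
  destruct (completeness E) as [m [Hub Hlub]].
  - exists b. intros t [Ht _]. lra.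
  - exists a. split; [lra|]. destruct (Hloc a) as [d [Hd H]]; [lra|]. apply H; lra.
  - assert (Ham : a <= m).
    { apply Hub. split; [lra|]. destruct (Hloc a) as [d [Hd H]]; [lra|]. apply H; lra. }
    assert (Hmb : m <= b) by (apply Hlub; intros t [Ht _]; lra).
    destruct (Hloc m) as [d [Hd H]]; [lra|].
    assert (Hex : exists s, E s /\ m - d / 2 < s <= m).
    { destruct (classic (exists s, E s /\ m - d / 2 < s)) as [[s [Hs Hs']]|Hn].
      - exists s. split; [exact Hs|]. split; [exact Hs'|]. now apply Hub.
      - exfalso. assert (m <= m - d / 2); [|lra]. apply Hlub. intros t Ht.
        apply Rnot_lt_le. intros Hlt. apply Hn. now exists t. }
    destruct Hex as [s [[Hs1 Hs2] Hs3]].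
    set (t := Rmin b (m + d / 2)).
    assert (Htb : t <= b) by apply Rmin_l.
    assert (Htd : t <= m + d / 2) by apply Rmin_r.
    assert (Hmt : m <= t) by (apply Rmin_glb; lra).
    assert (Hat : E t).
    { split; [lra|]. apply (Htr a s t); auto; try lra. apply H; lra. }
    assert (Htm : t <= m) by now apply Hub.
    unfold t, Rmin in *. destruct (Rle_dec b (m + d / 2)) as [Hc|Hc]; [|lra].
    apply Hat.
Qed.

Section Convex.
Context {V : NormedModule R_AbsRing}.

(** Tuples of vectors are sequences of which only the components [0, ..., J] count.  Component [0]
    later carries a value that the other components determine. *)
Definition fam_convex (K : (nat -> V) -> Prop) : Prop :=
  forall x y t, 0 <= t <= 1 -> K x -> K y ->
    K (fun k => plus (scal t (x k)) (scal (1 - t) (y k))).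

Definition fam_closed (J : nat) (K : (nat -> V) -> Prop) : Prop :=
  forall xn x, (forall n, K (xn n)) ->
    (forall k, (k <= J)%nat -> lim_to (fun n => xn n k) (x k)) -> K x.

Lemma fam_closed_approx J K x :
  fam_closed J K ->
  (forall eps, 0 < eps -> exists y, K y /\ forall k, (k <= J)%nat -> norm (minus (y k) (x k)) <= eps) ->
  K x.
Proof.
  intros HK H.
  assert (Hc : forall n : nat, exists y, K y /\
    forall k, (k <= J)%nat -> norm (minus (y k) (x k)) <= / (INR n + 1)).
  { intros n. apply H, inv_INR_pos. }
  destruct (choice _ Hc) as [y Hy].
  apply (HK y); [intros n; apply Hy|]. intros k Hk. apply lim_to_inv. intros n. now apply Hy.
Qed.

(** The increment is compared with step times a point of [K] on small intervals, and these
    comparisons add up because [K] is convex. *)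
Lemma convex_mean_value J K (h : R -> nat -> V) a b :
  a < b -> fam_convex K -> fam_closed J K ->
  (forall x eps, a <= x <= b -> 0 < eps -> exists delta d, 0 < delta /\ K d /\
     forall s t k, a <= s <= x -> x <= t <= b -> t - s < delta -> (k <= J)%nat ->
       norm (minus (minus (h t k) (h s k)) (scal (t - s) (d k))) <= eps * (t - s)) ->
  K (fun k => scal (/ (b - a)) (minus (h b k) (h a k))).
Proof.
  intros Hab Hcv Hcl Hloc. apply (fam_closed_approx J); auto. intros eps Heps.
  set (P := fun s t => exists d, K d /\ forall k, (k <= J)%nat ->
    norm (minus (minus (h t k) (h s k)) (scal (t - s) (d k))) <= eps * (t - s)).
  assert (HP : P a b).
  { apply interval_induction; [lra| |].
    - intros s m t Hs Ht [d1 [K1 H1]] [d2 [K2 H2]].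
      destruct (Req_dec s t) as [->|Hst].
      { replace m with t in * by lra. now exists d1. }
      exists (fun k => plus (scal ((m - s) / (t - s)) (d1 k)) (scal (1 - (m - s) / (t - s)) (d2 k))).
      split.
      + apply Hcv; auto. split.
        * apply Rdiv_le_0_compat; lra.
        * apply Rle_div_l; lra.
      + intros k Hk. specialize (H1 k Hk). specialize (H2 k Hk).
        replace (eps * (t - s)) with (eps * (m - s) + eps * (t - m)) by ring.
        eapply Rle_trans; [|apply Rplus_le_compat; eassumption].
        apply norm_le2. vec.
    - intros x Hx. destruct (Hloc x eps Hx Heps) as [delta [d [Hd [Kd H]]]].
      exists delta. split; auto. intros s t Hs Ht Hst. exists d. split; auto. }
  destruct HP as [d [Kd Hd]]. exists d. split; auto. intros k Hk. specialize (Hd k Hk).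
  rewrite norm_minus_sym.
  vrep (minus (scal (/ (b - a)) (minus (h b k) (h a k))) (d k))
    with (scal (/ (b - a)) (minus (minus (h b k) (h a k)) (scal (b - a) (d k)))).
  rewrite norm_scal_eq, Rabs_right by (apply Rle_ge, Rlt_le, Rinv_0_lt_compat; lra).
  apply (Rmult_le_compat_l (/ (b - a))) in Hd; [|apply Rlt_le, Rinv_0_lt_compat; lra].
  replace eps with (/ (b - a) * (eps * (b - a))) by (field; lra). exact Hd.
Qed.

(** A Riemann sum divided by the length of the interval is a convex combination of values. *)
Lemma riemann_sum_convex K (f : R -> nat -> V) ptd :
  fam_convex K -> pointed_subdiv ptd ->
  (forall x, SF_h ptd <= x <= seq.last (SF_h ptd) (SF_lx ptd) -> K (f x)) ->
  SF_h ptd <= seq.last (SF_h ptd) (SF_lx ptd) /\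
  exists d, K d /\ forall k, Riemann_sum (fun x => f x k) ptd =
    scal (seq.last (SF_h ptd) (SF_lx ptd) - SF_h ptd) (d k).
Proof.
  intros Hcv. induction ptd as [x0 | [x0 y0] s IH] using SF_cons_ind; intros Hp Hf.
  - simpl in *. split; [lra|]. exists (f x0). split; [apply Hf; lra|].
    intros k. unfold Riemann_sum. simpl. vec.
  - assert (Hh : x0 <= y0 <= SF_h s).
    { exact (Hp O (Nat.lt_0_succ _)). }
    assert (Hps : pointed_subdiv s) by (apply ptd_cons in Hp; auto).
    assert (Elast : seq.last (SF_h (SF_cons (x0, y0) s)) (SF_lx (SF_cons (x0, y0) s))
                    = seq.last (SF_h s) (SF_lx s)) by reflexivity.
    rewrite Elast in *. change (SF_h (SF_cons (x0, y0) s)) with x0 in *.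
    destruct IH as [Hle [d [Kd Hd]]]; auto.
    { intros x Hx. apply Hf. lra. }
    split; [lra|].
    set (l := seq.last (SF_h s) (SF_lx s)) in *.
    destruct (Req_dec x0 l) as [E|E].
    + exists d. split; auto. intros k. rewrite Riemann_sum_cons, Hd. simpl fst; simpl snd.
      replace (SF_h s) with x0 by lra. rewrite <- E. vec.
    + exists (fun k => plus (scal ((SF_h s - x0) / (l - x0)) (f y0 k))
                            (scal (1 - (SF_h s - x0) / (l - x0)) (d k))).
      split.
      * apply Hcv; auto; [|apply Hf; lra]. split.
        -- apply Rdiv_le_0_compat; lra.
        -- apply Rle_div_l; lra.
      * intros k. rewrite Riemann_sum_cons, Hd. simpl fst; simpl snd.
        vec.
Qed.

Lemma riemann_mean J K (f : R -> nat -> V) (I : nat -> V) a b :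
  a < b -> fam_convex K -> fam_closed J K ->
  (forall x, a <= x <= b -> K (f x)) ->
  (forall k, (k <= J)%nat -> is_RInt (fun x => f x k) a b (I k)) ->
  K (fun k => scal (/ (b - a)) (I k)).
Proof.
  intros Hab Hcv Hcl Hf HI. apply (fam_closed_approx J); auto. intros eps Heps.
  assert (He : 0 < eps * (b - a)) by (apply Rmult_lt_0_compat; lra).
  assert (HF : Riemann_fine a b (fun ptd => forall k, (k <= J)%nat ->
     norm (minus (scal (sign (b - a)) (Riemann_sum (fun x => f x k) ptd)) (I k)) <= eps * (b - a))).
  { clear Hcl. induction J as [|J IH].
    - generalize (proj1 (filterlim_locally_ball_norm (F := Riemann_fine a b) _ _)
        (HI O (le_n O)) (mkposreal _ He)).
      apply filter_imp. intros ptd Hptd k Hk. replace k with O by lia. now apply Rlt_le.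
    - generalize (proj1 (filterlim_locally_ball_norm (F := Riemann_fine a b) _ _)
        (HI (S J) (le_n _)) (mkposreal _ He)). intros H1.
      assert (H2 := IH (fun k Hk => HI k (Nat.le_le_succ_r _ _ Hk))).
      generalize (filter_and _ _ H1 H2). apply filter_imp.
      intros ptd [G1 G2] k Hk. destruct (Nat.eq_dec k (S J)) as [->|].
      + now apply Rlt_le.
      + apply G2. lia. }
  assert (HF2 : Riemann_fine a b (fun ptd => pointed_subdiv ptd /\
     SF_h ptd = Rmin a b /\ seq.last (SF_h ptd) (SF_lx ptd) = Rmax a b)).
  { exists (mkposreal 1 Rlt_0_1). intros y _ Hy. exact Hy. }
  destruct (filter_ex _ (filter_and _ _ HF HF2)) as [ptd [H1 [Hp [Hh Hl]]]].
  rewrite Rmin_left in Hh by lra. rewrite Rmax_right in Hl by lra.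
  destruct (riemann_sum_convex K f ptd Hcv Hp) as [_ [d [Kd Hd]]].
  { rewrite Hl, Hh. exact Hf. }
  rewrite Hl, Hh in Hd.
  exists d. split; auto. intros k Hk. specialize (H1 k Hk). rewrite Hd in H1.
  rewrite sign_eq_1 in H1 by lra.
  vrep (minus (d k) (scal (/ (b - a)) (I k))) with
    (scal (/ (b - a)) (minus (scal 1 (scal (b - a) (d k))) (I k))).
  rewrite norm_scal_eq, Rabs_right by (apply Rle_ge, Rlt_le, Rinv_0_lt_compat; lra).
  apply (Rmult_le_compat_l (/ (b - a))) in H1; [|apply Rlt_le, Rinv_0_lt_compat; lra].
  replace eps with (/ (b - a) * (eps * (b - a))) by (field; lra). exact H1.
Qed.

Definition convex (K : V -> Prop) : Prop :=
  forall x y t, 0 <= t <= 1 -> K x -> K y -> K (plus (scal t x) (scal (1 - t) y)).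

Definition closed_set (K : V -> Prop) : Prop :=
  forall xn x, (forall n, K (xn n)) -> lim_to xn x -> K x.

Lemma convex_mean_value1 (K : V -> Prop) (h : R -> V) a b :
  a < b -> convex K -> closed_set K ->
  (forall x eps, a <= x <= b -> 0 < eps -> exists delta d, 0 < delta /\ K d /\
     forall s t, a <= s <= x -> x <= t <= b -> t - s < delta ->
       norm (minus (minus (h t) (h s)) (scal (t - s) d)) <= eps * (t - s)) ->
  K (scal (/ (b - a)) (minus (h b) (h a))).
Proof.
  intros Hab Hcv Hcl Hloc.
  apply (convex_mean_value 0 (fun x => K (x O)) (fun t _ => h t) a b); auto.
  - intros x y t Ht Hx Hy. now apply Hcv.
  - intros xn x Hxn Hx. apply (Hcl (fun n => xn n O)); auto.
  - intros x eps Hx Heps. destruct (Hloc x eps Hx Heps) as [delta [d [Hd [Kd H]]]].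
    exists delta, (fun _ => d). auto.
Qed.

Lemma riemann_mean1 (K : V -> Prop) (f : R -> V) (I : V) a b :
  a < b -> convex K -> closed_set K ->
  (forall x, a <= x <= b -> K (f x)) -> is_RInt f a b I -> K (scal (/ (b - a)) I).
Proof.
  intros Hab Hcv Hcl Hf HI.
  apply (riemann_mean 0 (fun x => K (x O)) (fun t _ => f t) (fun _ => I) a b); auto.
  - intros x y t Ht Hx Hy. now apply Hcv.
  - intros xn x Hxn Hx. apply (Hcl (fun n => xn n O)); auto.
Qed.
Lemma convex_ball (c : V) r : convex (fun x : V => norm (minus x c) <= r).
Proof.
  intros x y t Ht Hx Hy. cbv beta in *.
  apply Rle_trans with (norm (scal t (minus x c)) + norm (scal (1 - t) (minus y c))).
  { apply norm_le2. vec. }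
  rewrite !norm_scal_eq, !Rabs_right by lra. nra.
Qed.

Lemma closed_ball (c : V) r : closed_set (fun x : V => norm (minus x c) <= r).
Proof.
  intros xn x H Hx. apply (lim_to_norm_le (fun n => minus (xn n) c)).
  - apply lim_to_minus; auto. apply lim_to_const.
  - intros eps Heps. exists O. intros n _. specialize (H n). lra.
Qed.

End Convex.

Lemma small_const {V : NormedModule R_AbsRing} (h : R -> V) a b : a <= b ->
  (forall eps, 0 < eps -> exists delta, 0 < delta /\ forall s t, a <= s <= t -> t <= b -> t - s < delta ->
     norm (minus (h t) (h s)) <= eps * (t - s)) -> h b = h a.
Proof.
  intros Hab H. destruct (Req_dec a b) as [->|Hne]; auto.
  assert (Hm := convex_mean_value1 (fun x : V => norm (minus x zero) <= 0) h a b ltac:(lra)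
    (convex_ball zero 0) (closed_ball zero 0)).
  assert (Hz : norm (minus (scal (/ (b - a)) (minus (h b) (h a))) zero) <= 0).
  { apply Hm. intros x eps Hx Heps. destruct (H eps Heps) as [delta [Hd D]].
    exists delta, zero. split; auto.
    split. { rewrite norm_0 by vec. lra. }
    intros s t Hs Ht Hst.
    vrep (minus (minus (h t) (h s)) (scal (t - s) zero)) with (minus (h t) (h s)).
    apply D; lra. }
  apply minus_eq in Hz. apply (vec_from (b - a) _ _ _ _ Hz). vec.
Qed.

(** * Real inner products *)

Definition real_inner (V : NormedModule R_AbsRing) (ip : V -> V -> R) : Prop :=
  (forall u v, ip u v = ip v u) /\
  (forall u v w, ip (plus u v) w = ip u w + ip v w) /\
  (forall (r : R) u v, ip (scal r u) v = r * ip u v) /\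
  (forall u, ip u u = norm u ^ 2).

Section RealInner.
Context {V : NormedModule R_AbsRing} {ip : V -> V -> R} (Hip : real_inner V ip).

Lemma ip_sym u v : ip u v = ip v u.
Proof. apply Hip. Qed.
Lemma ip_plus_l u v w : ip (plus u v) w = ip u w + ip v w.
Proof. apply Hip. Qed.
Lemma ip_scal_l (r : R) u v : ip (scal r u) v = r * ip u v.
Proof. apply Hip. Qed.
Lemma ip_norm u : ip u u = norm u ^ 2.
Proof. apply Hip. Qed.
Lemma ip_plus_r u v w : ip u (plus v w) = ip u v + ip u w.
Proof. now rewrite ip_sym, ip_plus_l, (ip_sym v), (ip_sym w). Qed.
Lemma ip_scal_r (r : R) u v : ip u (scal r v) = r * ip u v.
Proof. now rewrite ip_sym, ip_scal_l, (ip_sym v). Qed.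
Lemma ip_minus_l u v w : ip (minus u v) w = ip u w - ip v w.
Proof. vrep (minus u v) with (plus u (scal (-1) v)). rewrite ip_plus_l, ip_scal_l. ring. Qed.
Lemma ip_minus_r u v w : ip u (minus v w) = ip u v - ip u w.
Proof. now rewrite ip_sym, ip_minus_l, (ip_sym v), (ip_sym w). Qed.

Lemma ip_zero_l v : ip zero v = 0.
Proof. replace (@zero V) with (scal 0 (@zero V)) by vec. rewrite ip_scal_l. ring. Qed.

Lemma cauchy_schwarz (u v : V) : ip u v <= norm u * norm v.
Proof.
  assert (Hu := norm_pos u). assert (Hv := norm_pos v).
  destruct (Req_dec (norm v) 0) as [E|E].
  - apply norm_eq_zero in E. subst v. rewrite norm_zero.
    rewrite ip_sym, ip_zero_l. lra.
  - assert (H : 0 <= ip (minus (scal (norm v) u) (scal (norm u) v)) (minus (scal (norm v) u) (scal (norm u) v))).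
    { rewrite ip_norm. apply pow2_ge_0. }
    rewrite ip_minus_l, !ip_minus_r, !ip_scal_l, !ip_scal_r, (ip_sym v u), !ip_norm in H.
    assert (Hp : 0 < norm v) by lra.
    destruct (Req_dec (norm u) 0) as [E'|E'].
    + apply norm_eq_zero in E'. subst u. rewrite norm_zero.
      rewrite ip_zero_l. lra.
    + assert (0 < norm u * norm v) by (apply Rmult_lt_0_compat; lra). nra.
Qed.

Lemma cauchy_schwarz_abs (u v : V) : Rabs (ip u v) <= norm u * norm v.
Proof.
  apply Rabs_le. split; [|apply cauchy_schwarz].
  assert (H := cauchy_schwarz (opp u) v). rewrite norm_opp in H.
  vrep (opp u) with (scal (-1) u) in H. rewrite ip_scal_l in H. lra.
Qed.

Lemma parallelogram (u v : V) :
  norm (minus u v) ^ 2 = 2 * norm u ^ 2 + 2 * norm v ^ 2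
    - 4 * norm (plus (scal (/ 2) u) (scal (1 - / 2) v)) ^ 2.
Proof.
  rewrite <- !ip_norm, ip_minus_l, !ip_minus_r, !ip_plus_l, !ip_plus_r, !ip_scal_l, !ip_scal_r,
    (ip_sym v u). field.
Qed.
End RealInner.

(** Points of almost least norm of the sets form a Cauchy sequence by the parallelogram identity.
    The lemma does the work of weak compactness of balls together with Mazur's lemma. *)
Lemma nested_convex_limit {V : CompleteNormedModule R_AbsRing} {ip : V -> V -> R}
    (Hip : real_inner V ip) (P : nat -> V -> Prop) (rho : R) :
  (forall n, convex (P n)) ->
  (forall n x, P (S n) x -> P n x) ->
  (forall n, exists x, P n x /\ norm x <= rho) ->
  exists xn x, (forall n, P n (xn n)) /\ lim_to xn x.
Proof.
  intros Hcv Hnest Hne.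
  assert (Hmono : forall n m x, (n <= m)%nat -> P m x -> P n x).
  { intros n m x Hnm. induction Hnm; auto. }
  (* [- l n] is going to be the infimum of the squared norms on [P n] *)
  set (E := fun n y => exists x, P n x /\ y = - norm x ^ 2).
  assert (Hlub : forall n, exists l, is_lub (E n) l).
  { intros n. destruct (completeness (E n)) as [l Hl]; [| |now exists l].
    - exists 0. intros y [x [_ ->]]. generalize (pow2_ge_0 (norm x)). lra.
    - destruct (Hne n) as [x [Hx _]]. exists (- norm x ^ 2). now exists x. }
  destruct (choice _ Hlub) as [l Hl].
  assert (Hlow : forall n x, P n x -> - l n <= norm x ^ 2).
  { intros n x Hx. assert (- norm x ^ 2 <= l n); [|lra]. apply (Hl n). now exists x. }
  assert (Hdecr : Un_decreasing l).
  { intros n. apply (Hl (S n)). intros y [x [Hx ->]]. generalize (Hlow n x (Hnest _ _ Hx)). lra. }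
  assert (Hbd : has_lb l).
  { exists (rho ^ 2). intros y [n ->]. unfold opp_seq. destruct (Hne n) as [x [Hx Hxr]].
    apply Rle_trans with (norm x ^ 2); [now apply Hlow|].
    apply pow_incr. split; auto. apply norm_pos. }
  destruct (decreasing_cv l Hdecr Hbd) as [l0 Hl0].
  assert (Hpick : forall n, exists x, P n x /\ norm x ^ 2 <= - l n + / (INR n + 1)).
  { intros n. destruct (classic (exists x, P n x /\ norm x ^ 2 <= - l n + / (INR n + 1))) as [|Hn]; auto.
    exfalso. assert (Hp := inv_INR_pos n).
    assert (l n <= l n - / (INR n + 1)); [|lra].
    apply (Hl n). intros y [x [Hx ->]]. apply Rnot_lt_le. intros Hlt. apply Hn.
    exists x. split; auto. lra. }
  destruct (choice _ Hpick) as [xn Hxn].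
  exists xn. destruct (cauchy_lim xn) as [x Hx].
  - assert (Hlim : forall eps, 0 < eps -> exists N, forall n m, (N <= n)%nat -> (n <= m)%nat ->
      norm (minus (xn n) (xn m)) < eps).
    { intros eps Heps. assert (He2 : 0 < eps ^ 2) by (apply pow_lt; auto).
      destruct (Hl0 (eps ^ 2 / 16)) as [N1 H1]; [lra|].
      destruct (inv_INR_small (eps ^ 2 / 16)) as [N2 H2]; [lra|].
      exists (max N1 N2). intros n m Hn Hm.
      assert (D1 := H1 n ltac:(lia)). assert (D2 := H1 m ltac:(lia)).
      assert (I1 := H2 n ltac:(lia)). assert (I2 := H2 m ltac:(lia)).
      unfold R_dist, Rdist in D1, D2. apply Rabs_def2 in D1. apply Rabs_def2 in D2.
      destruct (Hxn n) as [P1 B1]. destruct (Hxn m) as [P2 B2].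
      assert (Hpar := parallelogram Hip (xn n) (xn m)).
      set (z := plus _ _) in Hpar. set (w := minus _ _) in Hpar. change (norm w < eps).
      assert (Hmid : - l n <= norm z ^ 2).
      { apply Hlow. apply Hcv; auto; [lra|]. now apply Hmono with m. }
      apply Rsqr_incrst_0; [|apply norm_pos|lra]. unfold Rsqr. simpl in *. lra. }
    intros eps Heps. destruct (Hlim eps Heps) as [N HN]. exists N. intros n m Hn Hm.
    destruct (Nat.le_ge_cases n m); [now apply HN|]. canon. rewrite norm_minus_sym. now apply HN.
  - exists x. split; auto. intros n. apply Hxn.
Qed.

(** * Bounded operators *)

Definition linear {V W : NormedModule R_AbsRing} (A : V -> W) : Prop :=
  (forall u v, A (plus u v) = plus (A u) (A v)) /\
  (forall (r : R) u, A (scal r u) = scal r (A u)).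

Definition bounded {V W : NormedModule R_AbsRing} (A : V -> W) : Prop :=
  linear A /\ exists k, forall u, norm (A u) <= k * norm u.

Definition contraction {V : NormedModule R_AbsRing} (A : V -> V) : Prop :=
  linear A /\ forall u, norm (A u) <= norm u.

Section Bounded.
Context {V W : NormedModule R_AbsRing}.
Implicit Type A : V -> W.

Lemma lin_plus A u v : linear A -> A (plus u v) = plus (A u) (A v).
Proof. intros H. apply H. Qed.
Lemma lin_scal A (r : R) u : linear A -> A (scal r u) = scal r (A u).
Proof. intros H. apply H. Qed.
Lemma lin_zero A : linear A -> A zero = zero.
Proof.
  intros H. transitivity (A (scal 0 zero)); [f_equal; vec|].
  rewrite lin_scal by auto. vec.
Qed.
Lemma lin_opp A u : linear A -> A (opp u) = opp (A u).
Proof.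
  intros H. transitivity (A (scal (-1) u)); [f_equal; vec|].
  rewrite lin_scal by auto. vec.
Qed.
Lemma lin_minus A u v : linear A -> A (minus u v) = minus (A u) (A v).
Proof. intros H. unfold minus. now rewrite lin_plus, lin_opp. Qed.

Lemma bounded_pos A : bounded A -> exists k, 0 < k /\ forall u, norm (A u) <= k * norm u.
Proof.
  intros [_ [k Hk]]. exists (Rabs k + 1). split; [generalize (Rabs_pos k); lra|].
  intros u. apply Rle_trans with (1 := Hk u). apply Rmult_le_compat_r; [apply norm_pos|].
  generalize (Rle_abs k); lra.
Qed.

Lemma bounded_lim A un u : bounded A -> lim_to un u -> lim_to (fun n => A (un n)) (A u).
Proof.
  intros HA Hu. destruct (bounded_pos A HA) as [k [_ Hk]]. destruct HA as [HA _].
  intros eps Heps. apply (lim_to_lip A k un u); auto.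
  intros x y. rewrite <- lin_minus by auto. apply Hk.
Qed.

Lemma riemann_sum_lin A (f : R -> V) ptd :
  linear A -> Riemann_sum (fun x => A (f x)) ptd = A (Riemann_sum f ptd).
Proof.
  intros HA. induction ptd as [x0 | h s IH] using SF_cons_ind.
  - symmetry. now apply lin_zero.
  - rewrite !Riemann_sum_cons, IH. symmetry.
    etransitivity; [now apply lin_plus|]. f_equal. now apply lin_scal.
Qed.

Lemma is_RInt_bounded A (f : R -> V) a b I :
  bounded A -> is_RInt f a b I -> is_RInt (fun x => A (f x)) a b (A I).
Proof.
  intros HA HI. destruct (bounded_pos A HA) as [k [Hk0 Hk]]. destruct HA as [HA _].
  apply (filterlim_locally_ball_norm (F := Riemann_fine a b)). intros eps.
  assert (He : 0 < eps / k) by (apply Rdiv_lt_0_compat; [apply cond_pos|auto]).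
  generalize (proj1 (filterlim_locally_ball_norm (F := Riemann_fine a b) _ _) HI (mkposreal _ He)).
  apply filter_imp. intros ptd H. unfold ball_norm in *. simpl in H.
  rewrite riemann_sum_lin, <- lin_scal, <- lin_minus by auto.
  apply Rle_lt_trans with (1 := Hk _).
  apply (Rmult_lt_compat_l k) in H; auto.
  replace (k * (eps / k)) with (pos eps) in H by (field; lra). exact H.
Qed.
End Bounded.

Lemma contraction_bounded {V : NormedModule R_AbsRing} (A : V -> V) :
  contraction A -> bounded A.
Proof. intros [H1 H2]. split; auto. exists 1. intros u. rewrite Rmult_1_l. apply H2. Qed.

Lemma contraction_comp {V : NormedModule R_AbsRing} (A B : V -> V) :
  contraction A -> contraction B -> contraction (fun u => A (B u)).
Proof.
  intros [[A1 A2] A3] [[B1 B2] B3]. repeat split.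
  - intros u v. now rewrite B1, A1.
  - intros r u. now rewrite B2, A2.
  - intros u. apply Rle_trans with (1 := A3 _). apply B3.
Qed.

(** * Contraction semigroups and their generators *)

Definition csg {V : NormedModule R_AbsRing} (T : R -> V -> V) : Prop :=
  (forall t, 0 <= t -> contraction (T t)) /\
  (forall u, T 0 u = u) /\
  (forall s t u, 0 <= s -> 0 <= t -> T (s + t) u = T s (T t u)) /\
  (forall u eps, 0 < eps -> exists delta, 0 < delta /\
     forall t, 0 < t < delta -> norm (minus (T t u) u) < eps).

(** The inequality includes [t = 0] and is weak, so that nothing is divided by [t]. *)
Definition gen {V : NormedModule R_AbsRing} (K : op V) (T : R -> V -> V) : Prop :=
  forall u z, K u z <->
    forall eps, 0 < eps -> exists delta, 0 < delta /\
      forall t, 0 <= t < delta -> norm (minus (minus (T t u) u) (scal t z)) <= eps * t.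

Section Semigroup.
Context {V : CompleteNormedModule R_AbsRing} {T : R -> V -> V} {K : op V}.
Context (HT : csg T) (HK : gen K T).
Implicit Types u v z w : V.

Lemma csg_contr t : 0 <= t -> contraction (T t).
Proof. apply HT. Qed.
Lemma csg_lin t : 0 <= t -> linear (T t).
Proof. intros Ht. now apply HT. Qed.
Lemma csg_norm t u : 0 <= t -> norm (T t u) <= norm u.
Proof. intros Ht. now apply HT. Qed.
Lemma csg_add t u v : 0 <= t -> T t (plus u v) = plus (T t u) (T t v).
Proof. intros Ht. now apply (csg_lin t). Qed.
Lemma csg_scal t (r : R) u : 0 <= t -> T t (scal r u) = scal r (T t u).
Proof. intros Ht. now apply (csg_lin t). Qed.
Lemma csg_sub t u v : 0 <= t -> T t (minus u v) = minus (T t u) (T t v).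
Proof. intros Ht. apply (lin_minus (T t)). now apply csg_lin. Qed.
Lemma csg_zero t : 0 <= t -> T t zero = zero.
Proof. intros Ht. apply (lin_zero (T t)). now apply csg_lin. Qed.
Lemma csg_0 u : T 0 u = u.
Proof. apply HT. Qed.
Lemma csg_plus s t u : 0 <= s -> 0 <= t -> T (s + t) u = T s (T t u).
Proof. apply HT. Qed.
Lemma csg_comm s t u : 0 <= s -> 0 <= t -> T s (T t u) = T t (T s u).
Proof. intros Hs Ht. rewrite <- !csg_plus by auto. f_equal. ring. Qed.

Lemma csg_cont0 u eps : 0 < eps -> exists delta, 0 < delta /\
  forall t, 0 <= t < delta -> norm (minus (T t u) u) < eps.
Proof.
  intros Heps. destruct HT as [_ [_ [_ H]]]. destruct (H u eps Heps) as [d [Hd H']].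
  exists d. split; auto. intros t Ht. destruct (Req_dec t 0) as [->|]; [|apply H'; lra].
  rewrite csg_0. now rewrite norm_0 by vec.
Qed.

Lemma csg_cont u eps : 0 < eps -> exists delta, 0 < delta /\
  forall s t, 0 <= s -> 0 <= t -> Rabs (t - s) < delta -> norm (minus (T t u) (T s u)) < eps.
Proof.
  intros Heps. destruct (csg_cont0 u eps Heps) as [d [Hd H]]. exists d. split; auto.
  assert (W : forall s t, 0 <= s <= t -> t - s < d -> norm (minus (T t u) (T s u)) < eps).
  { intros s t Hs Hst. replace t with (s + (t - s)) by ring.
    rewrite csg_plus by lra. canon. rewrite <- csg_sub by lra.
    apply Rle_lt_trans with (1 := csg_norm s _ ltac:(lra)). apply H. lra. }
  intros s t Hs Ht Hst. apply Rabs_def2 in Hst. destruct (Rle_dec s t).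
  - apply W; lra.
  - canon. rewrite norm_minus_sym. apply W; lra.
Qed.

Lemma csg_continuous u x : continuous (fun s => T (Rabs s) u) x.
Proof.
  apply (proj2 (continuous_iff (V := V) (fun s => T (Rabs s) u) x)). intros eps Heps. destruct (csg_cont u eps Heps) as [d [Hd H]].
  exists d. split; auto. intros t Ht. apply H; try apply Rabs_pos.
  apply Rle_lt_trans with (2 := Ht). apply Rabs_triang_inv2.
Qed.

Lemma gen_approx u z eps : K u z -> 0 < eps -> exists delta, 0 < delta /\
  forall t, 0 <= t < delta -> norm (minus (minus (T t u) u) (scal t z)) <= eps * t.
Proof. intros H. now apply (HK u z). Qed.

Lemma gen_unique u z z' : K u z -> K u z' -> z = z'.
Proof.
  intros H H'. apply minus_eq, le_eps. intros eps Heps.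
  destruct (gen_approx u z (eps / 2) H) as [d [Hd D]]; [lra|].
  destruct (gen_approx u z' (eps / 2) H') as [d' [Hd' D']]; [lra|].
  set (t := Rmin d d' / 2).
  assert (Ht : 0 < t < d /\ t < d').
  { unfold t. generalize (Rmin_l d d') (Rmin_r d d') (Rmin_pos d d' Hd Hd'). lra. }
  assert (E := D t ltac:(lra)). assert (E' := D' t ltac:(lra)).
  assert (Hn : norm (scal t (minus z z')) <= eps * t).
  { apply Rle_trans with (norm (minus (minus (T t u) u) (scal t z))
      + norm (minus (minus (T t u) u) (scal t z'))); [|lra].
    canon. rewrite (norm_minus_sym _ (scal t z)). apply norm_le2. vec. }
  canon in Hn. rewrite norm_scal_eq, Rabs_right in Hn by lra.
  apply Rmult_le_reg_l with t; [lra|]. canon. lra.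
Qed.

Lemma gen_linear u z u' z' (a b : R) :
  K u z -> K u' z' -> K (plus (scal a u) (scal b u')) (plus (scal a z) (scal b z')).
Proof.
  intros H H'. apply HK. intros eps Heps.
  assert (Hc : 0 < Rabs a + Rabs b + 1) by (generalize (Rabs_pos a) (Rabs_pos b); lra).
  set (e := eps / (Rabs a + Rabs b + 1)).
  assert (He : 0 < e) by now apply Rdiv_lt_0_compat.
  destruct (gen_approx u z e H He) as [d [Hd D]].
  destruct (gen_approx u' z' e H' He) as [d' [Hd' D']].
  exists (Rmin d d'). split; [now apply Rmin_pos|]. intros t Ht.
  assert (Ht1 : t < d) by (generalize (Rmin_l d d'); lra).
  assert (Ht2 : t < d') by (generalize (Rmin_r d d'); lra).
  specialize (D t ltac:(lra)). specialize (D' t ltac:(lra)).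
  canon. rewrite csg_add, !csg_scal by lra.
  apply Rle_trans with (norm (scal a (minus (minus (T t u) u) (scal t z)))
    + norm (scal b (minus (minus (T t u') u') (scal t z')))).
  { apply norm_le2. vec. }
  canon. rewrite !norm_scal_eq.
  apply Rle_trans with (Rabs a * (e * t) + Rabs b * (e * t)).
  { apply Rplus_le_compat; apply Rmult_le_compat_l; auto; apply Rabs_pos. }
  replace (eps * t) with ((Rabs a + Rabs b + 1) * (e * t)) by (unfold e; field; lra).
  assert (0 <= e * t) by (apply Rmult_le_pos; lra). lra.
Qed.

Lemma gen_scal u z (a : R) : K u z -> K (scal a u) (scal a z).
Proof.
  intros H. generalize (gen_linear u z u z a 0 H H).
  replace (plus (scal a u) (scal 0 u)) with (scal a u) by vec.
  now replace (plus (scal a z) (scal 0 z)) with (scal a z) by vec.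
Qed.
Lemma gen_opp u z : K u z -> K (opp u) (opp z).
Proof.
  intros H. generalize (gen_scal u z (-1) H).
  now replace (scal (-1) u) with (opp u) by vec; replace (scal (-1) z) with (opp z) by vec.
Qed.
Lemma gen_plus u z u' z' : K u z -> K u' z' -> K (plus u u') (plus z z').
Proof.
  intros H H'. generalize (gen_linear u z u' z' 1 1 H H').
  replace (plus (scal 1 u) (scal 1 u')) with (plus u u') by vec.
  now replace (plus (scal 1 z) (scal 1 z')) with (plus z z') by vec.
Qed.
Lemma gen_minus u z u' z' : K u z -> K u' z' -> K (minus u u') (minus z z').
Proof. intros H H'. apply gen_plus; auto. now apply gen_opp. Qed.
Lemma gen_zero : K zero zero.
Proof.
  apply HK. intros eps Heps. exists 1. split; [lra|]. intros t Ht.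
  canon. rewrite csg_zero by lra.
  rewrite norm_0 by vec.
  apply Rmult_le_pos; lra.
Qed.

Lemma gen_commute A u z :
  bounded A -> (forall t x, 0 <= t -> A (T t x) = T t (A x)) -> K u z -> K (A u) (A z).
Proof.
  intros HA HC H. apply HK. intros eps Heps.
  destruct (bounded_pos A HA) as [k [Hk Hb]]. destruct HA as [HA _].
  destruct (gen_approx u z (eps / k) H) as [d [Hd D]]; [now apply Rdiv_lt_0_compat|].
  exists d. split; auto. intros t Ht. specialize (D t Ht).
  rewrite <- HC by lra. canon. rewrite <- (lin_scal A) by auto. canon. rewrite <- !(lin_minus A) by auto.
  apply Rle_trans with (1 := Hb _). apply (Rmult_le_compat_l k) in D; [|lra].
  replace (k * (eps / k * t)) with (eps * t) in D by (field; lra). exact D.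
Qed.

Lemma gen_orbit t u z : 0 <= t -> K u z -> K (T t u) (T t z).
Proof.
  intros Ht. apply gen_commute; [apply contraction_bounded, csg_contr; auto|].
  intros s x Hs. now apply csg_comm.
Qed.

(** Contractions carry the estimate at time [0] along the orbit, hence the uniformity; a step back
    from [x] is a step forward from [y]. *)
Lemma gen_derive u z eps : K u z -> 0 < eps -> exists delta, 0 < delta /\
  forall x y, 0 <= x -> 0 <= y -> Rabs (y - x) < delta ->
    norm (minus (minus (T y u) (T x u)) (scal (y - x) (T x z))) <= eps * Rabs (y - x).
Proof.
  intros H Heps.
  destruct (gen_approx u z (eps / 2) H) as [d [Hd D]]; [lra|].
  destruct (csg_cont0 z (eps / 2)) as [d' [Hd' D']]; [lra|].
  exists (Rmin d d'). split; [now apply Rmin_pos|]. intros x y Hx Hy Hxy.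
  assert (Hxy1 : Rabs (y - x) < d) by (generalize (Rmin_l d d'); lra).
  assert (Hxy2 : Rabs (y - x) < d') by (generalize (Rmin_r d d'); lra).
  clear Hxy. destruct (Rle_dec x y) as [Hle|Hle].
  - rewrite Rabs_right in * by lra. set (t := y - x) in *.
    replace y with (x + t) by (unfold t; ring). rewrite csg_plus by (unfold t; lra).
    specialize (D t ltac:(unfold t in *; lra)).
    canon. rewrite <- csg_scal by lra. canon. rewrite <- !csg_sub by lra.
    apply Rle_trans with (1 := csg_norm x _ Hx).
    apply Rle_trans with (1 := D). apply Rmult_le_compat_r; unfold t; lra.
  - rewrite Rabs_left in * by lra. set (t := x - y) in *.
    replace (- (y - x)) with t in * by (unfold t; ring).
    replace (y - x) with (- t) by (unfold t; ring).
    replace x with (y + t) by (unfold t; ring). rewrite !csg_plus by (unfold t; lra).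
    specialize (D t ltac:(unfold t in *; lra)). specialize (D' t ltac:(unfold t in *; lra)).
    apply Rle_trans with (norm (T y (minus (minus (T t u) u) (scal t z)))
       + norm (T y (scal t (minus (T t z) z)))).
    { rewrite <- (norm_opp (T y (minus (minus (T t u) u) (scal t z)))). apply norm_le2. canon.
      canon. rewrite !csg_sub, !csg_scal, !csg_sub by lra. vec. }
    apply Rle_trans with (eps / 2 * t + t * (eps / 2)); [|right; field].
    apply Rplus_le_compat.
    + apply Rle_trans with (1 := csg_norm y _ Hy). exact D.
    + apply Rle_trans with (1 := csg_norm y _ Hy). canon. rewrite norm_scal_eq, Rabs_right by (unfold t; lra).
      apply Rmult_le_compat_l; [unfold t; lra|]. now left.
Qed.

(** The difference quotient lies in the closed convex hull of the derivatives. *)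
Lemma gen_taylor u z c t rho : K u z -> 0 <= t ->
  (forall s, 0 <= s <= t -> norm (minus (T s z) c) <= rho) ->
  norm (minus (minus (T t u) u) (scal t c)) <= t * rho.
Proof.
  intros H Ht Hr. destruct (Req_dec t 0) as [->|Hn].
  { rewrite csg_0. rewrite norm_0 by vec. lra. }
  assert (Hm := convex_mean_value1 (fun x : V => norm (minus x c) <= rho) (fun s => T s u) 0 t
    ltac:(lra) (convex_ball c rho) (closed_ball c rho)).
  cbv beta in Hm. rewrite csg_0, Rminus_0_r in Hm.
  assert (Hq : norm (minus (scal (/ t) (minus (T t u) u)) c) <= rho).
  { apply Hm. clear Hm. intros x eps Hx Heps.
    destruct (gen_derive u z eps H Heps) as [d [Hd D]].
    exists d, (T x z). split; auto. split; [now apply Hr|].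
    intros a b Ha Hb Hab.
    assert (D1 := D x b ltac:(lra) ltac:(lra) ltac:(rewrite Rabs_right; lra)).
    assert (D2 := D x a ltac:(lra) ltac:(lra) ltac:(rewrite Rabs_left1; lra)).
    rewrite Rabs_right in D1 by lra. rewrite Rabs_left1 in D2 by lra.
    apply Rle_trans with (eps * (b - x) + eps * - (a - x)); [|right; ring].
    eapply Rle_trans; [|apply Rplus_le_compat; [exact D1|exact D2]].
    rewrite <- (norm_opp (minus (minus (T a u) (T x u)) (scal (a - x) (T x z)))).
    apply norm_le2. vec. }
  vrep (minus (minus (T t u) u) (scal t c)) with (scal t (minus (scal (/ t) (minus (T t u) u)) c)).
  canon. rewrite norm_scal_eq, Rabs_right by lra. canon. apply Rmult_le_compat_l; auto.
Qed.

Lemma gen_lipschitz u z t : K u z -> 0 <= t -> norm (minus (T t u) u) <= t * norm z.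
Proof.
  intros H Ht. generalize (gen_taylor u z zero t (norm z) H Ht).
  vrep (minus (minus (T t u) u) (scal t zero)) with (minus (T t u) u). intros D. apply D.
  intros s Hs. vrep (minus (T s z) zero) with (T s z). apply csg_norm. lra.
Qed.

Lemma gen_taylor2 u z w t : K u z -> K z w -> 0 <= t ->
  norm (minus (minus (T t u) u) (scal t z)) <= t * (t * norm w).
Proof.
  intros H H' Ht. apply gen_taylor with z; auto. intros s Hs.
  apply Rle_trans with (s * norm w); [apply gen_lipschitz; auto; lra|].
  apply Rmult_le_compat_r; [apply norm_pos|lra].
Qed.

(** By [gen_taylor], the expansion error of the [n]-th orbit at time [t] is at most [t] times the
    distance of the derivatives from [z], uniformly in [n]. *)
Lemma gen_closed un zn u z :
  (forall n, K (un n) (zn n)) -> lim_to un u -> lim_to zn z -> K u z.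
Proof.
  intros H Hu Hz. apply HK. intros eps Heps.
  destruct (csg_cont0 z eps Heps) as [d [Hd D]]. exists d. split; auto. intros t Ht.
  apply (lim_to_norm_le (fun n => minus (minus (T t (un n)) (un n)) (scal t z))).
  { canon. apply lim_to_minus; [|apply lim_to_const]. apply lim_to_minus; auto.
    apply (bounded_lim (T t)); auto. apply contraction_bounded, csg_contr. lra. }
  intros e He. destruct (Hz (e / (t + 1))) as [N HN]; [apply Rdiv_lt_0_compat; lra|].
  exists N. intros n Hn. specialize (HN n Hn).
  assert (Hb : norm (minus (minus (T t (un n)) (un n)) (scal t z)) <= t * (e / (t + 1) + eps)).
  { apply gen_taylor with (zn n); auto; [lra|]. intros s Hs.
    apply Rle_trans with (norm (T s (minus (zn n) z)) + norm (minus (T s z) z)).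
    { apply norm_le2. canon. rewrite csg_sub by lra. vec. }
    apply Rplus_le_compat.
    - apply Rle_trans with (1 := csg_norm s _ ltac:(lra)). now left.
    - left. apply D. lra. }
  apply Rle_trans with (1 := Hb).
  assert (t * (e / (t + 1)) <= e).
  { replace e with ((t + 1) * (e / (t + 1))) at 2 by (field; lra).
    apply Rmult_le_compat_r; [|lra]. left. apply Rdiv_lt_0_compat; lra. }
  lra.
Qed.

(** * Averages of orbits *)

(** [Rabs] extends the orbit to a continuous function on the whole line. *)
Definition avg (e : R) (u : V) : V := scal (/ e) (RInt (fun s => T (Rabs s) u) 0 e).

Lemma orbit_RInt a b u : is_RInt (fun s => T (Rabs s) u) a b (RInt (fun s => T (Rabs s) u) a b).
Proof. apply (RInt_correct (V := V)), ex_RInt_continuous. intros z _. apply csg_continuous. Qed.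

Lemma avg_near e u c r : 0 < e -> (forall s, 0 <= s <= e -> norm (minus (T s u) c) <= r) ->
  norm (minus (avg e u) c) <= r.
Proof.
  intros He H. unfold avg.
  generalize (riemann_mean1 (fun x : V => norm (minus x c) <= r) (fun s => T (Rabs s) u)
    (RInt (fun s => T (Rabs s) u) 0 e) 0 e He (convex_ball c r) (closed_ball c r)).
  rewrite Rminus_0_r. intros Hm. apply Hm; [|apply orbit_RInt].
  intros x Hx. rewrite Rabs_right by lra. now apply H.
Qed.

Lemma avg_commute A e u :
  bounded A -> (forall t x, 0 <= t -> A (T t x) = T t (A x)) -> A (avg e u) = avg e (A u).
Proof.
  intros HA HC. unfold avg. canon. rewrite (lin_scal A) by apply HA. f_equal. symmetry.
  apply (is_RInt_unique (V := V)).
  apply (is_RInt_ext (fun s => A (T (Rabs s) u))).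
  { intros x _. apply HC, Rabs_pos. }
  apply is_RInt_bounded; auto. apply orbit_RInt.
Qed.

Lemma avg_contraction e : 0 < e -> contraction (avg e).
Proof.
  intros He. repeat split.
  - intros u v. unfold avg.
    transitivity (scal (/ e) (plus (RInt (fun s => T (Rabs s) u) 0 e) (RInt (fun s => T (Rabs s) v) 0 e))); [|vec].
    f_equal. apply (is_RInt_unique (V := V)).
    apply (is_RInt_ext (fun s => plus (T (Rabs s) u) (T (Rabs s) v))).
    { intros x _. symmetry. apply csg_add, Rabs_pos. }
    apply (is_RInt_plus (V := V)); apply orbit_RInt.
  - intros r u. unfold avg.
    transitivity (scal (/ e) (scal r (RInt (fun s => T (Rabs s) u) 0 e))); [|vec].
    f_equal. apply (is_RInt_unique (V := V)).
    apply (is_RInt_ext (fun s => scal r (T (Rabs s) u))).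
    { intros x _. symmetry. apply csg_scal, Rabs_pos. }
    apply (is_RInt_scal (V := V)); apply orbit_RInt.
  - intros u. generalize (avg_near e u zero (norm u) He).
    vrep (minus (avg e u) zero) with (avg e u). intros H. apply H. intros s Hs.
    vrep (minus (T s u) zero) with (T s u). apply csg_norm. lra.
Qed.

Lemma orbit_RInt_shift t a b u : 0 <= t -> 0 <= a <= b ->
  T t (RInt (fun s => T (Rabs s) u) a b) = RInt (fun s => T (Rabs s) u) (t + a) (t + b).
Proof.
  intros Ht Hab.
  assert (E1 : is_RInt (fun s => T t (T (Rabs s) u)) a b (T t (RInt (fun s => T (Rabs s) u) a b))).
  { apply is_RInt_bounded; [apply contraction_bounded, csg_contr; auto|]. apply orbit_RInt. }
  assert (E2 := orbit_RInt (t + a) (t + b) u).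
  replace (t + a) with (1 * a + t) in E2 at 1 by ring.
  replace (t + b) with (1 * b + t) in E2 at 1 by ring.
  apply is_RInt_comp_lin in E2.
  rewrite <- (is_RInt_unique (V := V) _ _ _ _ E1). apply (is_RInt_unique (V := V)).
  apply is_RInt_ext with (2 := E2). rewrite Rmin_left, Rmax_right by lra. intros x Hx.
  rewrite !Rabs_right by lra. replace (1 * x + t) with (t + x) by ring.
  rewrite csg_plus by lra. vec.
Qed.

(** The integrals over [[0, e]] and [[t, t + e]] differ only near the two end points, where the orbit
    is almost constant. *)
Lemma orbit_RInt_gen e u : 0 < e -> K (RInt (fun s => T (Rabs s) u) 0 e) (minus (T e u) u).
Proof.
  intros He. apply HK. intros eps Heps.
  destruct (csg_cont0 u (eps / 2)) as [d [Hd D]]; [lra|].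
  exists (Rmin d e). split; [now apply Rmin_pos|]. intros t Ht.
  assert (Ht1 : t < d) by (generalize (Rmin_l d e); lra).
  assert (Ht2 : t < e) by (generalize (Rmin_r d e); lra). destruct Ht as [Ht _].
  destruct (Req_dec t 0) as [->|Hn].
  { rewrite csg_0. rewrite norm_0 by vec. lra. }
  rewrite orbit_RInt_shift by lra. rewrite Rplus_0_r.
  assert (E : plus (RInt (fun s => T (Rabs s) u) 0 t) (RInt (fun s => T (Rabs s) u) t (t + e))
    = plus (RInt (fun s => T (Rabs s) u) 0 e) (RInt (fun s => T (Rabs s) u) e (e + t))).
  { rewrite !(RInt_Chasles (V := V)); try (eexists; apply orbit_RInt). f_equal. ring. }
  replace e with (e + 0) in E at 3 by ring. rewrite <- orbit_RInt_shift in E by lra.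
  assert (Hn' := avg_near t u u (eps / 2) ltac:(lra) (fun s Hs => Rlt_le _ _ (D s ltac:(lra)))).
  unfold avg in Hn'.
  set (Y := RInt (fun s => T (Rabs s) u) 0 t) in *.
  set (I := RInt (fun s => T (Rabs s) u) 0 e) in *.
  set (I' := RInt (fun s => T (Rabs s) u) t (t + e)) in *.
  assert (HY : norm (minus Y (scal t u)) <= eps / 2 * t).
  { vrep (minus Y (scal t u)) with (scal t (minus (scal (/ t) Y) u)).
    canon. rewrite norm_scal_eq, Rabs_right by lra. rewrite Rmult_comm.
    apply Rmult_le_compat_r; [lra|exact Hn']. }
  assert (E' : I' = minus (plus I (T e Y)) Y).
  { rewrite <- E. vec. }
  apply Rle_trans with (norm (T e (minus Y (scal t u))) + norm (minus Y (scal t u))).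
  - rewrite <- (norm_opp (minus Y (scal t u))). apply norm_le2.
    canon. rewrite csg_sub, csg_scal by lra. rewrite E'. vec.
  - generalize (csg_norm e (minus Y (scal t u)) ltac:(lra)). canon. canon in HY. lra.
Qed.

(** * Resolvents *)

(** Up to [o(t)], the vector [(1 + l t) u] is [T t u + t (l u - z)], and [T t] does not increase norms. *)
Lemma gen_dissipative l u z : K u z -> l * norm u <= norm (minus (scal l u) z).
Proof.
  intros H. apply le_eps. intros eps Heps.
  destruct (gen_approx u z eps H Heps) as [d [Hd D]].
  set (t := d / 2). specialize (D t ltac:(unfold t; lra)).
  assert (Ht : 0 < t) by (unfold t; lra).
  assert (H1 : (1 + l * t) * norm u <=
    norm (T t u) + t * norm (minus (scal l u) z) + eps * t).
  { apply Rle_trans with (norm (scal (1 + l * t) u)).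
    - canon. rewrite norm_scal_eq. apply Rmult_le_compat_r; [apply norm_pos|apply Rle_abs].
    - apply Rle_trans with (norm (T t u) + norm (scal t (minus (scal l u) z))
        + norm (minus (minus (T t u) u) (scal t z))).
      + rewrite <- (norm_opp (minus (minus (T t u) u) (scal t z))). apply norm_le3. vec.
      + canon. rewrite norm_scal_eq, Rabs_right by lra. canon in D. lra. }
  assert (H2 := csg_norm t u ltac:(lra)).
  apply Rmult_le_reg_l with t; auto. canon. canon in H1. lra.
Qed.
End Semigroup.

Lemma exp_le x y : x <= y -> exp x <= exp y.
Proof.
  intros H. destruct (Rle_lt_or_eq x y H) as [H'| ->]; [|lra]. left. now apply exp_increasing.
Qed.

Lemma exp_small (l e : R) : 0 < e -> exists delta, 0 < delta /\ forall t, 0 <= t < delta ->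
  Rabs (exp (l * t) - 1 - l * t) <= e * t.
Proof.
  intros He. assert (Hl : 0 < Rabs l + 1) by (generalize (Rabs_pos l); lra).
  destruct (derivable_pt_lim_exp_0 (e / (Rabs l + 1))) as [d Hd].
  { now apply Rdiv_lt_0_compat. }
  exists (d / (Rabs l + 1)). split; [apply Rdiv_lt_0_compat; [apply cond_pos|auto]|].
  intros t Ht. destruct (Req_dec (l * t) 0) as [E|E].
  - rewrite E, exp_0. replace (1 - 1 - 0) with 0 by ring. rewrite Rabs_R0.
    apply Rmult_le_pos; lra.
  - assert (Hlt : Rabs (l * t) <= (Rabs l + 1) * t).
    { rewrite Rabs_mult, (Rabs_right t) by lra. apply Rmult_le_compat_r; lra. }
    assert (Hs : Rabs (l * t) < d).
    { apply Rle_lt_trans with (1 := Hlt). destruct Ht as [_ Ht].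
      apply (Rmult_lt_compat_l (Rabs l + 1)) in Ht; auto.
      replace ((Rabs l + 1) * (d / (Rabs l + 1))) with (pos d) in Ht by (field; lra). exact Ht. }
    specialize (Hd (l * t) E Hs). rewrite Rplus_0_l, exp_0 in Hd.
    replace (exp (l * t) - 1 - l * t) with (((exp (l * t) - 1) / (l * t) - 1) * (l * t))
      by (field; split; intros Z; apply E; rewrite Z; ring).
    rewrite Rabs_mult.
    apply Rle_trans with (e / (Rabs l + 1) * ((Rabs l + 1) * t)); [|right; field; lra].
    apply Rmult_le_compat; try apply Rabs_pos; auto. now left.
Qed.

Section Resolvent.
Context {V : CompleteNormedModule R_AbsRing} {T : R -> V -> V} {K : op V}.
Context (HT : csg T) (HK : gen K T).

(** A semigroup with the generator [K - l]. *)
Definition rescaled (l : R) (t : R) (u : V) : V := scal (exp (- l * t)) (T t u).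

Lemma rescaled_csg l : 0 < l -> csg (rescaled l).
Proof.
  intros Hl. unfold rescaled. split; [|split; [|split]].
  - intros t Ht. repeat split.
    + intros u v. rewrite (csg_add HT) by auto. vec.
    + intros r u. rewrite (csg_scal HT) by auto. vec.
    + intros u. canon. rewrite norm_scal_eq, Rabs_right by (left; apply exp_pos).
      apply Rle_trans with (1 * norm u); [|lra].
      apply Rmult_le_compat; [left; apply exp_pos|apply norm_pos| |now apply (csg_norm HT)].
      rewrite <- exp_0. apply exp_le. nra.
  - intros u. rewrite Rmult_0_r, exp_0, (csg_0 HT). vec.
  - intros s t u Hs Ht. rewrite (csg_plus HT), (csg_scal HT) by auto.
    replace (- l * (s + t)) with (- l * s + - l * t) by ring. rewrite exp_plus. vec.
  - intros u eps Heps. assert (Hn := norm_pos u).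
    destruct (exp_small (- l) 1 Rlt_0_1) as [d [Hd D]].
    destruct (csg_cont0 HT u (eps / 2)) as [d' [Hd' D']]; [lra|].
    set (d'' := eps / 2 / ((l + 1) * (norm u + 1))).
    assert (Hd'' : 0 < d'') by (apply Rdiv_lt_0_compat; [lra|nra]).
    exists (Rmin d (Rmin d' d'')). split; [repeat apply Rmin_pos; auto|].
    intros t Ht. assert (Ht1 : t < d) by (generalize (Rmin_l d (Rmin d' d'')); lra).
    assert (Hr := Rmin_r d (Rmin d' d'')).
    assert (Ht2 : t < d') by (generalize (Rmin_l d' d''); lra).
    assert (Ht3 : t < d'') by (generalize (Rmin_r d' d''); lra).
    specialize (D t ltac:(lra)). specialize (D' t ltac:(lra)).
    assert (Hexp : Rabs (exp (- l * t) - 1) <= (l + 1) * t).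
    { replace (exp (- l * t) - 1) with ((exp (- l * t) - 1 - - l * t) + - l * t) by ring.
      apply Rle_trans with (1 := Rabs_triang _ _).
      rewrite (Rabs_left1 (- l * t)) by nra. lra. }
    apply Rle_lt_trans with (norm (scal (exp (- l * t)) (minus (T t u) u))
      + norm (scal (exp (- l * t) - 1) u)).
    { apply norm_le2. vec. }
    canon. rewrite !norm_scal_eq, (Rabs_right (exp (- l * t))) by (left; apply exp_pos).
    assert (He1 : exp (- l * t) <= 1) by (rewrite <- exp_0; apply exp_le; nra).
    assert (H1 : exp (- l * t) * norm (minus (T t u) u) <= norm (minus (T t u) u)).
    { rewrite <- (Rmult_1_l (norm (minus (T t u) u))) at 2.
      apply Rmult_le_compat_r; auto. apply norm_pos. }
    assert (H2 : Rabs (exp (- l * t) - 1) * norm u <= (l + 1) * d'' * (norm u + 1)).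
    { apply Rmult_le_compat; auto; try apply Rabs_pos; try lra.
      apply Rle_trans with (1 := Hexp). apply Rmult_le_compat_l; lra. }
    replace ((l + 1) * d'' * (norm u + 1)) with (eps / 2) in H2
      by (unfold d''; field; split; lra).
    canon. canon in H1. canon in D'. lra.
Qed.

Lemma rescaled_gen l (y z : V) :
  (forall eps, 0 < eps -> exists delta, 0 < delta /\
     forall t, 0 <= t < delta ->
       norm (minus (minus (rescaled l t y) y) (scal t z)) <= eps * t) ->
  K y (plus (scal l y) z).
Proof.
  intros H. apply HK. intros eps Heps.
  assert (Hy := norm_pos y). assert (Hz := norm_pos z).
  destruct (H (eps / 6)) as [d [Hd D]]; [lra|].
  set (e1 := Rmin 1 (eps / 3 / (norm y + 1))).
  assert (He1 : 0 < e1) by (apply Rmin_pos; [lra|apply Rdiv_lt_0_compat; lra]).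
  destruct (exp_small l e1 He1) as [d1 [Hd1 D1]].
  set (c := Rabs l + 1). assert (Hc : 0 < c) by (unfold c; generalize (Rabs_pos l); lra).
  set (d2 := / c). assert (Hd2 : 0 < d2) by now apply Rinv_0_lt_compat.
  set (d3 := eps / 3 / (c * (norm z + 1))).
  assert (Hd3 : 0 < d3) by (apply Rdiv_lt_0_compat; [lra|apply Rmult_lt_0_compat; lra]).
  exists (Rmin (Rmin d d1) (Rmin d2 d3)). split; [repeat apply Rmin_pos; auto|].
  intros t Ht.
  assert (Ht' : t < d /\ t < d1 /\ t < d2 /\ t < d3).
  { generalize (Rmin_l (Rmin d d1) (Rmin d2 d3)) (Rmin_r (Rmin d d1) (Rmin d2 d3))
      (Rmin_l d d1) (Rmin_r d d1) (Rmin_l d2 d3) (Rmin_r d2 d3). lra. }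
  destruct Ht' as [Ht1 [Ht2 [Ht3 Ht4]]].
  specialize (D t ltac:(lra)). specialize (D1 t ltac:(lra)).
  assert (Hexp : Rabs (exp (l * t) - 1) <= c * t).
  { replace (exp (l * t) - 1) with ((exp (l * t) - 1 - l * t) + l * t) by ring.
    apply Rle_trans with (1 := Rabs_triang _ _). rewrite Rabs_mult, (Rabs_right t) by lra.
    assert (e1 * t <= 1 * t) by (apply Rmult_le_compat_r; [lra|apply Rmin_l]).
    unfold c. lra. }
  assert (Hct : c * t <= 1).
  { replace 1 with (c * d2) by (unfold d2; field; lra). apply Rmult_le_compat_l; lra. }
  assert (Hexp2 : Rabs (exp (l * t)) <= 2).
  { replace (exp (l * t)) with (exp (l * t) - 1 + 1) by ring.
    apply Rle_trans with (1 := Rabs_triang _ _). rewrite Rabs_R1. lra. }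
  apply Rle_trans with (norm (scal (exp (l * t)) (minus (minus (rescaled l t y) y) (scal t z)))
    + norm (scal (exp (l * t) - 1 - l * t) y) + norm (scal ((exp (l * t) - 1) * t) z)).
  - apply norm_le3. unfold rescaled.
    assert (E : exp (l * t) * exp (- l * t) = 1).
    { rewrite <- exp_plus, <- exp_0. f_equal. ring. }
    assert (E' : T t y = scal (exp (l * t) * exp (- l * t)) (T t y)) by (rewrite E; vec).
    rewrite E' at 1. vec.
  - canon. rewrite !norm_scal_eq.
    replace (eps * t) with (2 * (eps / 6 * t) + eps / 3 * t + eps / 3 * t) by field.
    apply Rplus_le_compat; [apply Rplus_le_compat|].
    + apply Rmult_le_compat; auto; [apply Rabs_pos|apply norm_pos].
    + apply Rle_trans with (e1 * t * norm y).
      { apply Rmult_le_compat_r; auto. }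
      assert (He : e1 <= eps / 3 / (norm y + 1)) by apply Rmin_r.
      apply (Rmult_le_compat_r (norm y + 1)) in He; [|lra].
      replace (eps / 3 / (norm y + 1) * (norm y + 1)) with (eps / 3) in He by (field; lra).
      assert (e1 * norm y <= eps / 3) by nra.
      replace (e1 * t * norm y) with (e1 * norm y * t) by ring.
      apply Rmult_le_compat_r; lra.
    + rewrite Rabs_mult, (Rabs_right t) by lra.
      apply Rle_trans with (c * t * t * norm z).
      { apply Rmult_le_compat_r; auto. apply Rmult_le_compat_r; lra. }
      assert (Hz3 : c * t * norm z <= eps / 3).
      { apply Rle_trans with (c * d3 * (norm z + 1)).
        - apply Rmult_le_compat; try lra; [apply Rmult_le_pos; lra|].
          apply Rmult_le_compat_l; lra.
        - right. unfold d3. field. lra. }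
      replace (c * t * t * norm z) with (c * t * norm z * t) by ring.
      apply Rmult_le_compat_r; lra.
Qed.

(** The integrals of the rescaled orbit over [[0, n]] solve the equation up to an error that tends to
    [0], and they are a Cauchy sequence because [l - K] is bounded below. *)
Lemma resolvent_exists l (x : V) : 0 < l -> exists y, K y (minus (scal l y) x).
Proof.
  intros Hl. assert (HTl := rescaled_csg l Hl).
  set (Kl := fun y z => forall eps, 0 < eps -> exists delta, 0 < delta /\
     forall t, 0 <= t < delta ->
       norm (minus (minus (rescaled l t y) y) (scal t z)) <= eps * t).
  assert (HKl : gen Kl (rescaled l)) by (intros y z; reflexivity).
  set (y := fun n : nat => RInt (fun s => rescaled l (Rabs s) x) 0 (INR n + 1)).
  assert (Hy : forall n, K (y n) (plus (scal l (y n)) (minus (rescaled l (INR n + 1) x) x))).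
  { intros n. apply rescaled_gen. apply (orbit_RInt_gen HTl HKl).
    generalize (pos_INR n); lra. }
  assert (Hsmall : forall eps, 0 < eps -> exists N, forall n, (N <= n)%nat ->
    norm (rescaled l (INR n + 1) x) < eps).
  { intros eps Heps. assert (Hx := norm_pos x).
    destruct (inv_INR_small (eps * l / (norm x + 1))) as [N HN].
    { apply Rdiv_lt_0_compat; [|lra]. now apply Rmult_lt_0_compat. }
    exists N. intros n Hn. specialize (HN n Hn). unfold rescaled.
    canon. rewrite norm_scal_eq, Rabs_right by (left; apply exp_pos).
    assert (Hp := pos_INR n). set (r := INR n + 1) in *.
    assert (Hr : 1 <= r) by (unfold r; lra).
    assert (Hlr : 0 < l * r) by (apply Rmult_lt_0_compat; lra).
    assert (He : exp (- l * r) <= / (l * r)).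
    { replace (- l * r) with (- (l * r)) by ring. rewrite exp_Ropp.
      apply Rinv_le_contravar; auto. left. generalize (exp_ineq1 (l * r)). lra. }
    apply Rle_lt_trans with (/ (l * r) * (norm x)).
    { apply Rmult_le_compat; [left; apply exp_pos|apply norm_pos|auto|].
      apply (csg_norm HT). lra. }
    rewrite Rinv_mult.
    apply Rle_lt_trans with (/ l * / r * (norm x + 1)).
    { apply Rmult_le_compat_l; [|lra]. left.
      apply Rmult_lt_0_compat; apply Rinv_0_lt_compat; lra. }
    apply (Rmult_lt_compat_l (/ l * (norm x + 1))) in HN.
    - replace (/ l * (norm x + 1) * (eps * l / (norm x + 1))) with eps in HN by (field; split; lra).
      lra.
    - apply Rmult_lt_0_compat; [now apply Rinv_0_lt_compat|lra]. }
  destruct (cauchy_lim y) as [y0 Hy0].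
  - intros eps Heps. destruct (Hsmall (l * eps / 2)) as [N HN].
    { apply Rdiv_lt_0_compat; [|lra]. now apply Rmult_lt_0_compat. }
    exists N. intros n m Hn Hm.
    assert (Hd := gen_dissipative HT HK l _ _ (gen_minus HT HK _ _ _ _ (Hy n) (Hy m))).
    assert (Hb : norm (minus (scal l (minus (y n) (y m)))
        (minus (plus (scal l (y n)) (minus (rescaled l (INR n + 1) x) x))
               (plus (scal l (y m)) (minus (rescaled l (INR m + 1) x) x))))
      <= norm (rescaled l (INR m + 1) x) + norm (rescaled l (INR n + 1) x)).
    { rewrite <- (norm_opp (rescaled l (INR n + 1) x)). apply norm_le2. vec. }
    assert (H1 := HN n Hn). assert (H2 := HN m Hm).
    apply Rmult_lt_reg_l with l; auto. canon. canon in Hd. canon in Hb. lra.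
  - exists y0. apply (gen_closed HT HK y (fun n => plus (scal l (y n)) (minus (rescaled l (INR n + 1) x) x))); auto.
    apply lim_to_ext with (fun n => minus (scal l (y n)) (minus x (rescaled l (INR n + 1) x))).
    { intros n. vec. }
    canon. apply lim_to_minus; [now apply lim_to_scal|].
    intros eps Heps. destruct (Hsmall eps Heps) as [N HN]. exists N. intros n Hn.
    rewrite <- norm_opp. specialize (HN n Hn).
    vrep (opp (minus (minus x (rescaled l (INR n + 1) x)) x)) with (rescaled l (INR n + 1) x).
    exact HN.
Qed.
End Resolvent.

(** [res K l x] is [(l - K)^{-1} x]. *)
Definition res {V : NormedModule R_AbsRing} (K : op V) (l : R) (x : V) : V :=
  epsilon (inhabits zero) (fun y => K y (minus (scal l y) x)).

Section ResolventFacts.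
Context {V : CompleteNormedModule R_AbsRing} {T : R -> V -> V} {K : op V}.
Context (HT : csg T) (HK : gen K T).

Lemma res_spec l (x : V) : 0 < l -> K (res K l x) (minus (scal l (res K l x)) x).
Proof. intros Hl. unfold res. apply epsilon_spec. now apply (resolvent_exists HT HK). Qed.

Lemma res_unique l (x y : V) : 0 < l -> K y (minus (scal l y) x) -> res K l x = y.
Proof.
  intros Hl H. apply minus_eq. apply Rmult_le_reg_l with l; auto. rewrite Rmult_0_r.
  assert (Hd := gen_dissipative HT HK l _ _ (gen_minus HT HK _ _ _ _ (res_spec l x Hl) H)).
  apply Rle_trans with (1 := Hd). right. apply norm_0. vec.
Qed.

Lemma res_norm l (x : V) : 0 < l -> l * norm (res K l x) <= norm x.
Proof.
  intros Hl. apply Rle_trans with (1 := gen_dissipative HT HK l _ _ (res_spec l x Hl)).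
  right. f_equal. vec.
Qed.

Lemma res_linear l : 0 < l -> linear (res K l).
Proof.
  intros Hl. split.
  - intros u v. apply res_unique; auto.
    generalize (gen_plus HT HK _ _ _ _ (res_spec l u Hl) (res_spec l v Hl)).
    match goal with |- K _ ?a -> K _ ?b => replace a with b by vec end. auto.
  - intros r u. apply res_unique; auto.
    generalize (gen_scal HT HK _ _ r (res_spec l u Hl)).
    match goal with |- K _ ?a -> K _ ?b => replace a with b by vec end. auto.
Qed.

Lemma res_bounded l : 0 < l -> bounded (res K l).
Proof.
  intros Hl. split; [now apply res_linear|]. exists (/ l). intros u.
  apply Rmult_le_reg_l with l; auto. rewrite <- Rmult_assoc, Rinv_r, Rmult_1_l by lra.
  now apply res_norm.
Qed.

Lemma res_commute A l (x : V) :
  0 < l -> bounded A -> (forall t x, 0 <= t -> A (T t x) = T t (A x)) ->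
  A (res K l x) = res K l (A x).
Proof.
  intros Hl HA HC. symmetry. apply res_unique; auto.
  generalize (gen_commute HK A _ _ HA HC (res_spec l x Hl)).
  destruct HA as [HA _]. canon. rewrite (lin_minus A), (lin_scal A) by auto. auto.
Qed.

Lemma res_csg l t (x : V) : 0 < l -> 0 <= t -> T t (res K l x) = res K l (T t x).
Proof.
  intros Hl Ht. apply (res_commute (T t)); auto.
  - now apply contraction_bounded, (csg_contr HT).
  - intros s y Hs. now apply (csg_comm HT).
Qed.

Lemma res_gen l (u z : V) : 0 < l -> K u z -> res K l z = minus (scal l (res K l u)) u.
Proof.
  intros Hl H. symmetry. apply (gen_unique HK (res K l u)).
  - now apply res_spec.
  - apply (gen_commute HK (res K l)); auto; [now apply res_bounded|].
    intros t x Ht. symmetry. now apply res_csg.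
Qed.

Lemma res_identity l m (x : V) : 0 < l -> 0 < m ->
  minus (res K l x) (res K m x) = scal (m - l) (res K l (res K m x)).
Proof.
  intros Hl Hm. assert (H := res_gen l _ _ Hl (res_spec m x Hm)).
  assert (L := res_linear l Hl). canon in H. rewrite (lin_minus (res K l)), (lin_scal (res K l)) in H by auto.
  apply (vec_from (-1) _ _ _ _ H). vec.
Qed.
End ResolventFacts.

(** * Improper integrals of powers *)

Lemma RInt_gen_iff {V : NormedModule R_AbsRing} (f : R -> V) (I : V) :
  is_RInt_gen f (at_right 0) (Rbar_locally p_infty) I <->
  forall eps, 0 < eps -> exists a0 b0, 0 < a0 /\ 0 < b0 /\ forall a b, 0 < a < a0 -> b0 < b ->
    exists J, is_RInt f a b J /\ norm (minus J I) < eps.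
Proof.
  split.
  - intros H eps Heps.
    assert (HP : locally I (fun J => norm (minus J I) < eps)).
    { apply (locally_le_locally_norm I). exists (mkposreal eps Heps). intros y Hy. exact Hy. }
    destruct (H _ HP) as [Q S HQ HS HQS].
    destruct HQ as [d Hd]. destruct HS as [M HM].
    exists d, (Rmax M 1). split; [apply cond_pos|]. split.
    { apply Rlt_le_trans with 1; [lra|apply Rmax_r]. }
    intros a b Ha Hb. apply (HQS a b).
    + apply Hd; [|lra]. change (Rabs (a - 0) < d). rewrite Rabs_right; lra.
    + apply HM. apply Rle_lt_trans with (2 := Hb). apply Rmax_l.
  - intros H P HP. apply (locally_norm_le_locally I) in HP. destruct HP as [eps HP].
    destruct (H eps (cond_pos eps)) as [a0 [b0 [Ha0 [Hb0 H']]]].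
    exists (fun a => 0 < a < a0) (fun b => b0 < b).
    + exists (mkposreal a0 Ha0). intros y Hy Hy0. change (Rabs (y - 0) < a0) in Hy.
      rewrite Rabs_right in Hy; lra.
    + exists b0. auto.
    + intros a b Ha Hb. destruct (H' a b Ha Hb) as [J [HJ HI]]. exists J. split; auto.
Qed.

Lemma Rpower_pos x y : 0 < Rpower x y.
Proof. apply exp_pos. Qed.

Lemma is_RInt_power p a b : p <> 0 -> 0 < a -> a <= b ->
  is_RInt (fun l => Rpower l (p - 1)) a b (Rpower b p / p - Rpower a p / p).
Proof.
  intros Hp Ha Hab.
  apply (is_RInt_derive (V := R_CompleteNormedModule) (fun l => Rpower l p / p)).
  - rewrite Rmin_left, Rmax_right by lra. intros x Hx. unfold Rpower. auto_derive; [lra|].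
    replace ((p - 1) * ln x) with (p * ln x + - ln x) by ring. rewrite exp_plus, exp_Ropp, exp_ln by lra.
    field. lra.
  - rewrite Rmin_left, Rmax_right by lra. intros x Hx.
    apply (ex_derive_continuous (V := R_NormedModule)). unfold Rpower. auto_derive. lra.
Qed.

Lemma power_small p eps : 0 < p -> 0 < eps ->
  exists a0, 0 < a0 /\ forall a, 0 < a < a0 -> Rpower a p < eps.
Proof.
  intros Hp Heps. exists (Rpower eps (/ p)). split; [apply Rpower_pos|]. intros a Ha.
  replace eps with (Rpower (Rpower eps (/ p)) p).
  - apply Rlt_Rpower_l; auto.
  - rewrite Rpower_mult, Rinv_l by lra. now apply Rpower_1.
Qed.

Lemma power_small_inf q eps : 0 < q -> 0 < eps ->
  exists b0, 0 < b0 /\ forall b, b0 < b -> Rpower b (- q) < eps.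
Proof.
  intros Hq Heps. destruct (power_small q eps Hq Heps) as [a0 [Ha0 H]].
  exists (/ a0). split; [now apply Rinv_0_lt_compat|]. intros b Hb.
  assert (Hb0 : 0 < b) by (apply Rlt_trans with (2 := Hb); now apply Rinv_0_lt_compat).
  replace (Rpower b (- q)) with (Rpower (/ b) q).
  - apply H. split; [now apply Rinv_0_lt_compat|]. rewrite <- (Rinv_inv a0).
    apply Rinv_lt_contravar; auto. apply Rmult_lt_0_compat; auto. now apply Rinv_0_lt_compat.
  - unfold Rpower. rewrite ln_Rinv by auto. f_equal. ring.
Qed.

Section Improper.
Context {V : CompleteNormedModule R_AbsRing}.

Lemma RInt_power_le (f : R -> V) (A p a b : R) I : p <> 0 -> 0 < a <= b ->
  (forall l, a <= l <= b -> norm (f l) <= A * Rpower l (p - 1)) ->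
  is_RInt f a b I -> norm I <= A * (Rpower b p / p - Rpower a p / p).
Proof.
  intros Hp Hab Hf HI.
  apply (norm_RInt_le f (fun l => A * Rpower l (p - 1)) a b I); try tauto.
  apply (is_RInt_scal (V := R_NormedModule) (fun l => Rpower l (p - 1)) a b A).
  apply is_RInt_power; tauto.
Qed.

(** Both tails are dominated by convergent integrals of powers, so the integrals over growing
    intervals are a Cauchy family.  The cut [N] stays free: choosing it is how an integral is later
    estimated by two norms of different strength. *)
Lemma improper_power (f : R -> V) A B p q N :
  0 < p -> 0 < q -> 0 < N ->
  (forall l, 0 < l -> continuous f l) ->
  (forall l, 0 < l <= N -> norm (f l) <= A * Rpower l (p - 1)) ->
  (forall l, N <= l -> norm (f l) <= B * Rpower l (- q - 1)) ->
  exists I, is_RInt_gen f (at_right 0) (Rbar_locally p_infty) I /\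
    norm I <= A * Rpower N p / p + B * Rpower N (- q) / q.
Proof.
  intros Hp Hq HN Hc HA HB.
  assert (HA0 : 0 <= A).
  { apply Rmult_le_reg_r with (Rpower N (p - 1)); [apply Rpower_pos|]. rewrite Rmult_0_l.
    apply Rle_trans with (norm (f N)); [apply norm_pos|apply HA; lra]. }
  assert (HB0 : 0 <= B).
  { apply Rmult_le_reg_r with (Rpower N (- q - 1)); [apply Rpower_pos|]. rewrite Rmult_0_l.
    apply Rle_trans with (norm (f N)); [apply norm_pos|apply HB; lra]. }
  assert (HI : forall a b, 0 < a -> 0 < b -> is_RInt f a b (RInt f a b)).
  { intros a b Ha Hb. apply (RInt_correct (V := V)), ex_RInt_continuous. intros z Hz. apply Hc.
    apply Rlt_le_trans with (2 := proj1 Hz). now apply Rmin_pos. }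
  assert (HL : forall a b, 0 < a <= b -> b <= N -> norm (RInt f a b) <= A * Rpower b p / p).
  { intros a b Ha Hb. apply Rle_trans with (A * (Rpower b p / p - Rpower a p / p)).
    - apply (RInt_power_le f A p a b); try lra; [|apply HI; lra]. intros l Hl. apply HA; lra.
    - assert (0 < Rpower a p / p) by (apply Rdiv_lt_0_compat; auto; apply Rpower_pos).
      unfold Rdiv at 3. rewrite Rmult_assoc. apply Rmult_le_compat_l; auto. unfold Rdiv in *. lra. }
  assert (HU : forall a b, N <= a <= b -> norm (RInt f a b) <= B * Rpower a (- q) / q).
  { intros a b Ha. apply Rle_trans with (B * (Rpower b (- q) / (- q) - Rpower a (- q) / (- q))).
    - apply (RInt_power_le f B (- q) a b); try lra; [|apply HI; lra]. intros l Hl. apply HB; lra.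
    - assert (0 < Rpower b (- q) / q) by (apply Rdiv_lt_0_compat; auto; apply Rpower_pos).
      replace (B * (Rpower b (- q) / - q - Rpower a (- q) / - q))
        with (B * Rpower a (- q) / q - B * (Rpower b (- q) / q)) by (field; lra).
      assert (0 <= B * (Rpower b (- q) / q)) by (apply Rmult_le_pos; lra). lra. }
  assert (Hsplit : forall a b a' b', 0 < a -> 0 < b -> 0 < a' -> 0 < b' ->
    RInt f a b = plus (RInt f a a') (plus (RInt f a' b') (RInt f b' b))).
  { intros a b a' b' H1 H2 H3 H4. apply (is_RInt_unique (V := V)).
    apply (is_RInt_Chasles f a a' b); [now apply HI|].
    apply (is_RInt_Chasles f a' b' b); now apply HI. }
  assert (Hlow : forall eps, 0 < eps -> exists a0, 0 < a0 <= N /\ forall a a', 0 < a -> a <= a' < a0 ->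
     norm (RInt f a a') < eps).
  { intros eps Heps. destruct (power_small p (eps * p / (A + 1)) Hp) as [a0 [Ha0 H]].
    { apply Rdiv_lt_0_compat; [now apply Rmult_lt_0_compat|lra]. }
    exists (Rmin a0 N). split; [split; [now apply Rmin_pos|apply Rmin_r]|].
    intros a a' Ha [Haa Ha'].
    assert (Ha1 := Rlt_le_trans _ _ _ Ha' (Rmin_l a0 N)).
    assert (Ha2 := Rlt_le_trans _ _ _ Ha' (Rmin_r a0 N)).
    apply Rle_lt_trans with (1 := HL a a' ltac:(lra) ltac:(lra)).
    apply Rle_lt_trans with ((A + 1) * Rpower a' p / p).
    { unfold Rdiv. apply Rmult_le_compat_r; [left; now apply Rinv_0_lt_compat|].
      apply Rmult_le_compat_r; [left; apply Rpower_pos|lra]. }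
    specialize (H a' ltac:(lra)).
    apply (Rmult_lt_compat_l ((A + 1) / p)) in H; [|apply Rdiv_lt_0_compat; lra].
    replace ((A + 1) / p * (eps * p / (A + 1))) with eps in H by (field; split; lra).
    apply Rle_lt_trans with (2 := H). right. field. lra. }
  assert (Hup : forall eps, 0 < eps -> exists b0, N <= b0 /\ forall b b', b0 < b -> b <= b' ->
     norm (RInt f b b') < eps).
  { intros eps Heps. destruct (power_small_inf q (eps * q / (B + 1)) Hq) as [b0 [Hb0 H]].
    { apply Rdiv_lt_0_compat; [now apply Rmult_lt_0_compat|lra]. }
    exists (Rmax b0 N). split; [apply Rmax_r|]. intros b b' Hb Hbb.
    assert (Hb1 := Rle_lt_trans _ _ _ (Rmax_l b0 N) Hb).
    assert (Hb2 := Rle_lt_trans _ _ _ (Rmax_r b0 N) Hb).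
    apply Rle_lt_trans with (1 := HU b b' ltac:(lra)).
    apply Rle_lt_trans with ((B + 1) * Rpower b (- q) / q).
    { unfold Rdiv. apply Rmult_le_compat_r; [left; now apply Rinv_0_lt_compat|].
      apply Rmult_le_compat_r; [left; apply Rpower_pos|lra]. }
    specialize (H b Hb1).
    apply (Rmult_lt_compat_l ((B + 1) / q)) in H; [|apply Rdiv_lt_0_compat; lra].
    replace ((B + 1) / q * (eps * q / (B + 1))) with eps in H by (field; split; lra).
    apply Rle_lt_trans with (2 := H). right. field. lra. }
  (* all integrals over large intervals are close to each other *)
  assert (Hclose : forall eps, 0 < eps -> exists a0 b0, 0 < a0 <= N /\ N <= b0 /\
    forall a b a' b', 0 < a < a0 -> b0 < b -> 0 < a' < a0 -> b0 < b' ->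
      norm (minus (RInt f a b) (RInt f a' b')) < eps).
  { intros eps Heps. destruct (Hlow (eps / 2)) as [a0 [Ha0 H1]]; [lra|].
    destruct (Hup (eps / 2)) as [b0 [Hb0 H2]]; [lra|].
    exists a0, b0. split; [auto|]. split; [auto|]. intros a b a' b' Ha Hb Ha' Hb'.
    assert (Hswap : forall x y, 0 < x -> 0 < y -> RInt f x y = opp (RInt f y x)).
    { intros x y Hx Hy. apply (is_RInt_unique (V := V)). apply (is_RInt_swap f). now apply HI. }
    assert (E1 : norm (RInt f a a') < eps / 2).
    { destruct (Rle_dec a a'); [apply H1; lra|]. rewrite Hswap by lra. canon. rewrite norm_opp. apply H1; lra. }
    assert (E2 : norm (RInt f b' b) < eps / 2).
    { destruct (Rle_dec b' b); [apply H2; lra|]. rewrite Hswap by lra. canon. rewrite norm_opp. apply H2; lra. }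
    rewrite (Hsplit a b a' b') by lra.
    apply Rle_lt_trans with (norm (RInt f a a') + norm (RInt f b' b)); [|lra].
    apply norm_le2. vec. }
  set (I := fun n : nat => RInt f (N / (INR n + 2)) (N * (INR n + 2))).
  assert (Hin : forall a0 b0, 0 < a0 -> 0 < b0 -> exists n0, forall n, (n0 <= n)%nat ->
    0 < N / (INR n + 2) < a0 /\ b0 < N * (INR n + 2)).
  { intros a0 b0 Ha0 Hb0. destruct (INR_archimed a0 N Ha0) as [n1 Hn1].
    destruct (INR_archimed N b0 HN) as [n2 Hn2].
    exists (max n1 n2). intros n Hn.
    assert (L1 : INR n1 <= INR n) by (apply le_INR; lia).
    assert (L2 : INR n2 <= INR n) by (apply le_INR; lia).
    assert (P := pos_INR n). repeat split.
    - apply Rdiv_lt_0_compat; lra.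
    - apply Rlt_div_l; nra.
    - nra. }
  destruct (cauchy_lim I) as [I0 HI0].
  { intros eps Heps. destruct (Hclose eps Heps) as [a0 [b0 [Ha0 [Hb0 H]]]].
    destruct (Hin a0 b0) as [n0 Hn0]; try lra. exists n0. intros n m Hn Hm.
    apply H; apply Hn0; auto. }
  exists I0. split.
  - apply RInt_gen_iff. intros eps Heps. destruct (Hclose (eps / 2)) as [a0 [b0 [Ha0 [Hb0 H]]]]; [lra|].
    exists a0, b0. split; [lra|]. split; [lra|]. intros a b Ha Hb. exists (RInt f a b).
    split; [apply HI; lra|].
    destruct (HI0 (eps / 2)) as [n1 Hn1]; [lra|]. destruct (Hin a0 b0) as [n2 Hn2]; try lra.
    set (n := max n1 n2). specialize (Hn1 n ltac:(lia)). specialize (Hn2 n ltac:(lia)).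
    assert (E := H a b _ _ Ha Hb (proj1 Hn2) (proj2 Hn2)).
    apply Rle_lt_trans with (norm (minus (RInt f a b) (I n)) + norm (minus (I n) I0)).
    + apply norm_le2. vec.
    + fold (I n) in E. canon. canon in E. canon in Hn1. lra.
  - apply (lim_to_norm_le I); auto. intros eps Heps. exists O. intros n _.
    assert (P := pos_INR n).
    assert (H1 : 0 < N / (INR n + 2) <= N).
    { split; [apply Rdiv_lt_0_compat; lra|]. apply Rle_div_l; nra. }
    assert (H2 : N <= N * (INR n + 2)) by nra.
    apply Rle_trans with (norm (RInt f (N / (INR n + 2)) N) + norm (RInt f N (N * (INR n + 2)))).
    + unfold I. rewrite (Hsplit _ _ N N) by lra.
      apply norm_le2. rewrite (RInt_point (V := V)). vec.
    + assert (E1 := HL (N / (INR n + 2)) N ltac:(lra) ltac:(lra)).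
      assert (E2 := HU N (N * (INR n + 2)) ltac:(lra)). lra.
Qed.
End Improper.

(** * Fractional powers *)

(** The integral of [l^{b-1} / (1 + l)] over the positive half line, which normalises Balakrishnan's
    formula. *)
Definition kappa (b : R) : R := PI / sin (PI * b).

Lemma kappa_pos b : 0 < b < 1 -> 0 < kappa b.
Proof.
  intros Hb. assert (P := PI_RGT_0). apply Rdiv_lt_0_compat; auto.
  apply sin_gt_0; nra.
Qed.

Lemma Rpower_1_base y : Rpower 1 y = 1.
Proof. unfold Rpower. now rewrite ln_1, Rmult_0_r, exp_0. Qed.

Lemma Rpower_nonneg x y : 0 <= Rpower x y.
Proof. left. apply Rpower_pos. Qed.

Section Frac.
Context {V : CompleteNormedModule R_AbsRing} {ip : V -> V -> R}.
Context (Hip : real_inner V ip).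
Context {T : R -> V -> V} {K : op V} (HT : csg T) (HK : gen K T).
Implicit Types u v w x y z : V.

(** ** Accretivity *)

(** The derivative of [|T t u|^2] at [0] is [2 <z, u>]. *)
Lemma gen_accretive u z : K u z -> ip z u <= 0.
Proof.
  intros H. assert (Hu := norm_pos u). apply le_eps. intros eps Heps.
  destruct (gen_approx HK u z (eps / (norm u + 1)) H) as [d [Hd D]].
  { apply Rdiv_lt_0_compat; lra. }
  set (t := d / 2). specialize (D t ltac:(unfold t; lra)). assert (Ht : 0 < t) by (unfold t; lra).
  set (r := minus (minus (T t u) u) (scal t z)) in *.
  assert (E : ip (T t u) u = ip u u + t * ip z u + ip r u).
  { rewrite <- (ip_scal_l Hip), <- !(ip_plus_l Hip). f_equal. unfold r. vec. }
  assert (C1 := cauchy_schwarz Hip (T t u) u). assert (C2 := cauchy_schwarz_abs Hip r u).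
  assert (N := csg_norm HT t u ltac:(lra)).
  rewrite (ip_norm Hip) in E. apply Rabs_le_between in C2.
  assert (C3 : norm r * norm u <= eps * t).
  { apply Rle_trans with (eps / (norm u + 1) * t * (norm u + 1)).
    - apply Rmult_le_compat; auto; [apply norm_pos|lra].
    - right. field. lra. }
  assert (C4 : norm (T t u) * norm u <= norm u ^ 2).
  { simpl. rewrite Rmult_1_r. apply Rmult_le_compat_r; auto. }
  apply Rmult_le_reg_l with t; auto. lra.
Qed.

Lemma res_accretive l x : 0 < l -> 0 <= ip (res K l x) x.
Proof.
  intros Hl. assert (H := res_spec HT HK l x Hl). apply gen_accretive in H.
  rewrite (ip_sym Hip) in H. rewrite (ip_minus_r Hip), (ip_scal_r Hip), (ip_norm Hip) in H.
  assert (0 <= l * norm (res K l x) ^ 2) by (apply Rmult_le_pos; [lra|apply pow2_ge_0]). lra.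
Qed.

Lemma res_ip_le l x : 0 < l -> l * ip (res K l x) x <= norm x ^ 2.
Proof.
  intros Hl. assert (H := res_norm HT HK l x Hl). assert (C := cauchy_schwarz Hip (res K l x) x).
  apply Rle_trans with (l * (norm (res K l x) * norm x)).
  - apply Rmult_le_compat_l; lra.
  - simpl. rewrite Rmult_1_r, <- Rmult_assoc. apply Rmult_le_compat_r; auto. apply norm_pos.
Qed.

(** With [x = (nu - K)^{-1} a], the vectors [(l - K)^{-1} a = x + (nu - l) (l - K)^{-1} x] form an angle
    of at most a right one with [x], and for [l] below [nu] their component along [x] is at least [|x|]. *)
Lemma res_angle_below a l nu : 0 < l <= nu ->
  norm (res K nu a) ^ 2 <= ip (res K l a) (res K nu a).
Proof.
  intros Hl. assert (E := res_identity HT HK l nu a ltac:(lra) ltac:(lra)).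
  set (x := res K nu a) in *.
  assert (E' : res K l a = plus x (scal (nu - l) (res K l x))).
  { rewrite <- E. vec. }
  rewrite E', (ip_plus_l Hip), (ip_scal_l Hip), (ip_norm Hip).
  assert (0 <= (nu - l) * ip (res K l x) x).
  { apply Rmult_le_pos; [lra|]. apply res_accretive. lra. }
  lra.
Qed.

Lemma res_angle_above a l nu : 0 < nu <= l -> 0 <= ip (res K l a) (res K nu a).
Proof.
  intros Hl. assert (E := res_identity HT HK l nu a ltac:(lra) ltac:(lra)).
  set (x := res K nu a) in *.
  assert (E' : res K l a = plus x (scal (nu - l) (res K l x))).
  { rewrite <- E. vec. }
  rewrite E', (ip_plus_l Hip), (ip_scal_l Hip), (ip_norm Hip).
  assert (H := res_ip_le l x ltac:(lra)). assert (H' := res_accretive l x ltac:(lra)).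
  assert (0 <= nu * ip (res K l x) x) by (apply Rmult_le_pos; lra). lra.
Qed.

Lemma ip_RInt_ge (f : R -> V) x a b I m : a <= b ->
  (forall l, a < l < b -> m <= ip (f l) x) -> is_RInt f a b I -> (b - a) * m <= ip I x.
Proof.
  intros Hab Hf HI.
  assert (Hl : bounded (V := V) (W := R_NormedModule) (fun u => ip u x)).
  { split; [split|].
    - intros u v. apply (ip_plus_l Hip).
    - intros r u. apply (ip_scal_l Hip).
    - exists (norm x). intros u. change (Rabs (ip u x) <= norm x * norm u).
      rewrite Rmult_comm. apply (cauchy_schwarz_abs Hip). }
  assert (H1 := is_RInt_bounded (W := R_NormedModule) (fun u => ip u x) f a b I Hl HI).
  apply (is_RInt_le (fun _ => m) (fun l => ip (f l) x) a b _ _ Hab (is_RInt_const a b m) H1 Hf).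
Qed.

Lemma balak_spec b u w : balakrishnan K b u w <->
  exists z, K u z /\
    is_RInt_gen (fun l => scal (Rpower l (b - 1)) (res K l (opp z)))
      (at_right 0) (Rbar_locally p_infty) (scal (kappa b) w).
Proof.
  split.
  - intros [z [g [Hz [Hg HI]]]]. exists z. split; auto.
    apply (proj2 (RInt_gen_iff (V := V) _ _)). generalize (proj1 (RInt_gen_iff (V := V) _ _) HI). clear HI. intros HI eps Heps.
    destruct (HI eps Heps) as [a0 [b0 [Ha0 [Hb0 H]]]]. exists a0, b0. repeat split; auto.
    intros a c Ha Hc. destruct (H a c Ha Hc) as [J [HJ HJ']]. exists J. split; auto.
    apply is_RInt_ext with (2 := HJ). intros l Hl. f_equal. symmetry.
    assert (Hl0 : 0 < l). { apply Rlt_trans with (2 := proj1 Hl). apply Rmin_pos; lra. }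
    destruct (Hg l Hl0) as [y [Hy1 Hy2]]. apply (res_unique HT HK); auto.
    match goal with |- K _ ?c => replace c with y; auto end.
    apply (vec_from (-1) _ _ _ _ Hy2). vec.
  - intros [z [Hz HI]]. exists z, (fun l => res K l (opp z)). split; [auto|split; [|auto]].
    intros l Hl. exists (minus (scal l (res K l (opp z))) (opp z)). split.
    + now apply (res_spec HT HK).
    + vec.
Qed.

Lemma RInt_gen_uniq (f : R -> V) I J :
  is_RInt_gen f (at_right 0) (Rbar_locally p_infty) I ->
  is_RInt_gen f (at_right 0) (Rbar_locally p_infty) J -> I = J.
Proof.
  intros H1 H2. rewrite <- (is_RInt_gen_unique f I H1). now apply is_RInt_gen_unique.
Qed.

(** Balakrishnan's integral is paired with [x = (nu - K)^{-1} (-K) u]: all of it contributes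
    nonnegatively, and the part over [[nu/2, nu]] contributes enough.  So the decay of the resolvents,
    usually read off from composition rules for powers, needs only the Hilbert space structure. *)
Lemma balak_key b u w z nu : 0 < b < 1 -> balakrishnan K b u w -> K u z -> 0 < nu ->
  norm (res K nu (opp z)) <= 2 * kappa b * Rpower nu (- b) * norm w.
Proof.
  intros Hb Hw Hz Hnu. apply balak_spec in Hw. destruct Hw as [z' [Hz' HI]].
  assert (E := gen_unique HK u z' z Hz' Hz). subst z'. clear Hz'.
  set (f := fun l => scal (Rpower l (b - 1)) (res K l (opp z))) in *.
  set (x := res K nu (opp z)). assert (Hx := norm_pos x). assert (Hk := kappa_pos b Hb).
  assert (Hmain : nu / 2 * (Rpower nu (b - 1) * norm x ^ 2) <= kappa b * ip w x).
  { apply le_eps. intros eps Heps.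
    destruct (proj1 (RInt_gen_iff (V := V) f _) HI (eps / (norm x + 1))) as [a0 [b0 [Ha0 [Hb0 H]]]].
    { apply Rdiv_lt_0_compat; lra. }
    (* the finite interval [[a, c]] is split at [nu / 2] and at [nu] *)
    set (a := Rmin a0 nu / 4). set (c := b0 + nu + 1).
    assert (Ha : 0 < a < a0 /\ a < nu / 2).
    { unfold a. generalize (Rmin_l a0 nu) (Rmin_r a0 nu) (Rmin_pos a0 nu Ha0 Hnu). lra. }
    destruct (H a c ltac:(lra) ltac:(unfold c; lra)) as [J [HJ HJ']].
    assert (Hex : ex_RInt f a c) by now exists J.
    assert (Hex1 : ex_RInt f a nu).
    { apply (ex_RInt_Chasles_1 (V := V)) with c; auto. unfold c; lra. }
    assert (Hex2 : ex_RInt f nu c).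
    { apply (ex_RInt_Chasles_2 (V := V)) with a; auto. unfold c; lra. }
    assert (Hex3 : ex_RInt f a (nu / 2)).
    { apply (ex_RInt_Chasles_1 (V := V)) with nu; auto. lra. }
    assert (Hex4 : ex_RInt f (nu / 2) nu).
    { apply (ex_RInt_Chasles_2 (V := V)) with a; auto. lra. }
    destruct Hex2 as [J3 HJ3]. destruct Hex3 as [J1 HJ1]. destruct Hex4 as [J2 HJ2].
    assert (EJ : J = plus J1 (plus J2 J3)).
    { rewrite <- (is_RInt_unique (V := V) f a c J HJ). apply (is_RInt_unique (V := V)).
      apply is_RInt_Chasles with (nu / 2); auto. apply is_RInt_Chasles with nu; auto. }
    assert (P1 : 0 <= ip J1 x).
    { apply Rle_trans with ((nu / 2 - a) * 0); [lra|].
      apply (ip_RInt_ge f x a (nu / 2)); auto; [lra|]. intros l Hl. unfold f.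
      rewrite (ip_scal_l Hip). apply Rmult_le_pos; [apply Rpower_nonneg|].
      apply Rle_trans with (norm x ^ 2); [apply pow2_ge_0|]. apply res_angle_below. lra. }
    assert (P3 : 0 <= ip J3 x).
    { apply Rle_trans with ((c - nu) * 0); [lra|].
      apply (ip_RInt_ge f x nu c); auto; [unfold c; lra|]. intros l Hl. unfold f.
      rewrite (ip_scal_l Hip). apply Rmult_le_pos; [apply Rpower_nonneg|].
      apply res_angle_above. lra. }
    assert (P2 : nu / 2 * (Rpower nu (b - 1) * norm x ^ 2) <= ip J2 x).
    { replace (nu / 2) with (nu - nu / 2) at 1 by field.
      apply (ip_RInt_ge f x (nu / 2) nu); auto; [lra|]. intros l Hl. unfold f.
      rewrite (ip_scal_l Hip). apply Rmult_le_compat; [apply Rpower_nonneg|apply pow2_ge_0| |].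
      - unfold Rpower. assert (Hln : ln l < ln nu) by (apply ln_increasing; lra).
        destruct (Req_dec ((b - 1) * ln nu) ((b - 1) * ln l)) as [->|Hne]; [lra|].
        left. apply exp_increasing. nra.
      - apply res_angle_below. lra. }
    assert (P4 : ip J x <= kappa b * ip w x + eps).
    { assert (C := cauchy_schwarz Hip (minus J (scal (kappa b) w)) x).
      rewrite (ip_minus_l Hip), (ip_scal_l Hip) in C.
      assert (norm (minus J (scal (kappa b) w)) * norm x <= eps).
      { apply Rle_trans with (eps / (norm x + 1) * (norm x + 1)).
        - apply Rmult_le_compat; auto; [apply norm_pos|now left|lra].
        - right. field. lra. }
      lra. }
    rewrite EJ, !(ip_plus_l Hip) in P4. lra. }
  destruct (Req_dec (norm x) 0) as [E|E].
  { fold x. rewrite E. apply Rmult_le_pos; [|apply norm_pos].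
    apply Rmult_le_pos; [lra|apply Rpower_nonneg]. }
  assert (C := cauchy_schwarz Hip w x).
  assert (Hn : nu / 2 * Rpower nu (b - 1) * norm x <= kappa b * norm w).
  { apply Rmult_le_reg_r with (norm x); [lra|].
    apply Rle_trans with (kappa b * ip w x); [simpl in Hmain; lra|].
    rewrite Rmult_assoc. apply Rmult_le_compat_l; lra. }
  assert (Ep : nu * Rpower nu (b - 1) = Rpower nu b).
  { rewrite <- (Rpower_1 nu) at 1 by auto. rewrite <- Rpower_plus. f_equal. ring. }
  assert (Ep' : Rpower nu (- b) * Rpower nu b = 1).
  { rewrite <- Rpower_plus, Rplus_opp_l. now apply Rpower_O. }
  assert (Hp := Rpower_pos nu (- b)).
  apply (Rmult_le_compat_l (2 * Rpower nu (- b))) in Hn; [|lra].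
  replace (2 * Rpower nu (- b) * (nu / 2 * Rpower nu (b - 1) * norm x))
    with (Rpower nu (- b) * (nu * Rpower nu (b - 1)) * norm x) in Hn by field.
  rewrite Ep, Ep' in Hn. fold x. lra.
Qed.

Lemma res_opp_eq l u z : 0 < l -> K u z -> res K l (opp z) = minus u (scal l (res K l u)).
Proof.
  intros Hl Hz. canon. rewrite (lin_opp (res K l)) by now apply (res_linear HT HK).
  rewrite (res_gen HT HK l u z) by auto. vec.
Qed.

Lemma res_opp_le l u z : 0 < l -> K u z -> norm (res K l (opp z)) <= 2 * norm u.
Proof.
  intros Hl Hz. rewrite (res_opp_eq l u z) by auto.
  assert (H := res_norm HT HK l u Hl).
  apply Rle_trans with (norm u + norm (scal l (res K l u))).
  - rewrite <- (norm_opp (scal l (res K l u))). apply norm_le2. vec.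
  - canon. rewrite norm_scal_eq, Rabs_right by lra. canon in H. lra.
Qed.

(** By the resolvent identity. *)
Lemma res_continuous x l : 0 < l -> continuous (fun l => res K l x) l.
Proof.
  intros Hl. apply (proj2 (continuous_iff (V := V) (fun l => res K l x) l)).
  intros eps Heps. assert (Hx := norm_pos x).
  set (d := eps * l * l / 2 / (norm x + 1)).
  assert (Hd : 0 < d).
  { apply Rdiv_lt_0_compat; [|lra]. apply Rdiv_lt_0_compat; [|lra].
    repeat apply Rmult_lt_0_compat; auto. }
  exists (Rmin (l / 2) d). split; [apply Rmin_pos; lra|]. intros t Ht.
  assert (Ht1 := Rlt_le_trans _ _ _ Ht (Rmin_l _ _)).
  assert (Ht2 := Rlt_le_trans _ _ _ Ht (Rmin_r _ _)).
  apply Rabs_def2 in Ht1. assert (Ht0 : l / 2 < t) by lra.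
  rewrite (res_identity HT HK) by lra. canon. rewrite norm_scal_eq.
  assert (N1 := res_norm HT HK t (res K l x) ltac:(lra)).
  assert (N2 := res_norm HT HK l x Hl).
  rewrite Rabs_minus_sym in Ht2.
  assert (N3 : norm (res K t (res K l x)) <= 2 / (l * l) * norm x).
  { apply Rmult_le_reg_l with t; [lra|]. apply Rle_trans with (1 := N1).
    apply Rmult_le_reg_l with l; auto. apply Rle_trans with (1 := N2).
    replace (l * (t * (2 / (l * l) * norm x))) with (t * 2 / l * norm x) by (field; lra).
    rewrite <- (Rmult_1_l (norm x)) at 1. apply Rmult_le_compat_r; auto.
    apply Rle_div_r; lra. }
  apply Rle_lt_trans with (Rabs (l - t) * (2 / (l * l) * norm x)).
  { apply Rmult_le_compat_l; [apply Rabs_pos|exact N3]. }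
  assert (N4 : 2 / (l * l) * norm x < 2 / (l * l) * (norm x + 1)).
  { apply Rmult_lt_compat_l; [|lra]. apply Rdiv_lt_0_compat; [lra|now apply Rmult_lt_0_compat]. }
  apply Rle_lt_trans with (Rabs (l - t) * (2 / (l * l) * (norm x + 1))).
  { apply Rmult_le_compat_l; [apply Rabs_pos|lra]. }
  apply Rlt_le_trans with (d * (2 / (l * l) * (norm x + 1))).
  { apply Rmult_lt_compat_r; auto. apply Rmult_lt_0_compat; [|lra].
    apply Rdiv_lt_0_compat; [lra|now apply Rmult_lt_0_compat]. }
  right. unfold d. field. lra.
Qed.

Lemma Rpower_continuous p l : 0 < l -> continuous (fun l => Rpower l p) l.
Proof.
  intros Hl. apply (ex_derive_continuous (V := R_NormedModule)). unfold Rpower. auto_derive. lra.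
Qed.

(** The integrand is at most [2 |u| l^{b-1}] and at most [M l^{b-g-1}]; the first bound is integrable at
    [0], the second at infinity, and [N] is where they are exchanged. *)
Lemma balak_exists b g u z M N : 0 < b < 1 -> b < g -> 0 < N -> K u z ->
  (forall l, 0 < l -> norm (res K l (opp z)) <= M * Rpower l (- g)) ->
  exists w, balakrishnan K b u w /\
    kappa b * norm w <= 2 * norm u * Rpower N b / b + M * Rpower N (- (g - b)) / (g - b).
Proof.
  intros Hb Hg HN Hz HM. assert (Hk := kappa_pos b Hb).
  destruct (improper_power (fun l => scal (Rpower l (b - 1)) (res K l (opp z)))
    (2 * norm u) M b (g - b) N) as [I [HI HI']]; try lra.
  - intros l Hl. apply (continuous_scal (V := V)).
    + now apply Rpower_continuous.
    + now apply res_continuous.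
  - intros l Hl. canon. rewrite norm_scal_eq, Rabs_right by (apply Rle_ge, Rpower_nonneg).
    rewrite Rmult_comm. apply Rmult_le_compat_r; [apply Rpower_nonneg|].
    apply res_opp_le; auto. lra.
  - intros l Hl. canon. rewrite norm_scal_eq, Rabs_right by (apply Rle_ge, Rpower_nonneg).
    apply Rle_trans with (Rpower l (b - 1) * (M * Rpower l (- g))).
    + apply Rmult_le_compat_l; [apply Rpower_nonneg|]. apply HM. lra.
    + right. replace (- (g - b) - 1) with ((b - 1) + - g) by ring. rewrite Rpower_plus. ring.
  - exists (scal (/ kappa b) I). split.
    + apply balak_spec. exists z. split; auto.
      match goal with |- is_RInt_gen _ _ _ ?c => replace c with I by vec end. exact HI.
    + canon. rewrite norm_scal_eq, Rabs_right by (apply Rle_ge, Rlt_le, Rinv_0_lt_compat; auto).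
      rewrite <- Rmult_assoc, Rinv_r, Rmult_1_l by lra. exact HI'.
Qed.

Lemma balak_unique b u w w' : 0 < b < 1 -> balakrishnan K b u w -> balakrishnan K b u w' -> w = w'.
Proof.
  intros Hb H H'. assert (Hk := kappa_pos b Hb).
  apply balak_spec in H. apply balak_spec in H'.
  destruct H as [z [Hz H]]. destruct H' as [z' [Hz' H']].
  assert (E := gen_unique HK u z' z Hz' Hz). subst z'.
  assert (E := RInt_gen_uniq _ _ _ H H').
  transitivity (scal (/ kappa b) (scal (kappa b) w)); [vec|]. rewrite E. vec.
Qed.

Lemma balak_lin b u w u' w' (r r' : R) : balakrishnan K b u w -> balakrishnan K b u' w' ->
  balakrishnan K b (plus (scal r u) (scal r' u')) (plus (scal r w) (scal r' w')).
Proof.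
  rewrite !balak_spec. intros [z [Hz H]] [z' [Hz' H']].
  exists (plus (scal r z) (scal r' z')). split; [now apply (gen_linear HT HK)|].
  apply (proj2 (RInt_gen_iff (V := V) _ _)). intros eps Heps.
  assert (Hc : 0 < Rabs r + Rabs r' + 1) by (generalize (Rabs_pos r) (Rabs_pos r'); lra).
  assert (He : 0 < eps / (Rabs r + Rabs r' + 1)) by now apply Rdiv_lt_0_compat.
  destruct (proj1 (RInt_gen_iff (V := V) _ _) H _ He) as [a0 [b0 [Ha0 [Hb0 D]]]].
  destruct (proj1 (RInt_gen_iff (V := V) _ _) H' _ He) as [a1 [b1 [Ha1 [Hb1 D']]]].
  exists (Rmin a0 a1), (Rmax b0 b1). split; [now apply Rmin_pos|].
  split; [apply Rlt_le_trans with (1 := Hb0), Rmax_l|]. intros a c Ha Hc'.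
  destruct (D a c) as [J [HJ NJ]].
  { generalize (Rmin_l a0 a1); lra. } { generalize (Rmax_l b0 b1); lra. }
  destruct (D' a c) as [J' [HJ' NJ']].
  { generalize (Rmin_r a0 a1); lra. } { generalize (Rmax_r b0 b1); lra. }
  exists (plus (scal r J) (scal r' J')). split.
  - apply (is_RInt_ext (fun l => plus (scal r (scal (Rpower l (b - 1)) (res K l (opp z))))
      (scal r' (scal (Rpower l (b - 1)) (res K l (opp z')))))).
    + intros l Hl. assert (Hl0 : 0 < l).
      { apply Rlt_trans with (2 := proj1 Hl). apply Rmin_pos; try lra.
        generalize (Rmax_l b0 b1); lra. }
      assert (L := res_linear HT HK l Hl0).
      canon. rewrite !(lin_opp (res K l)), (lin_plus (res K l)), !(lin_scal (res K l)) by auto. vec.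
    + apply (is_RInt_plus (V := V)); now apply (is_RInt_scal (V := V)).
  - apply Rle_lt_trans with (norm (scal r (minus J (scal (kappa b) w)))
      + norm (scal r' (minus J' (scal (kappa b) w')))).
    { apply norm_le2. vec. }
    canon. rewrite !norm_scal_eq. canon in NJ. canon in NJ'.
    apply Rle_lt_trans with (Rabs r * (eps / (Rabs r + Rabs r' + 1)) + Rabs r' * (eps / (Rabs r + Rabs r' + 1))).
    + apply Rplus_le_compat; apply Rmult_le_compat_l; try apply Rabs_pos; now left.
    + apply Rlt_le_trans with ((Rabs r + Rabs r' + 1) * (eps / (Rabs r + Rabs r' + 1))).
      * lra.
      * right. field. lra.
Qed.

Definition commuting (A : V -> V) : Prop :=
  bounded A /\ forall t x, 0 <= t -> A (T t x) = T t (A x).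

Lemma commuting_gen A u z : commuting A -> K u z -> K (A u) (A z).
Proof. intros [H1 H2]. now apply (gen_commute HK). Qed.

Lemma commuting_res_self l : 0 < l -> commuting (res K l).
Proof.
  intros Hl. split; [now apply (res_bounded HT HK)|].
  intros t x Ht. symmetry. now apply (res_csg HT HK).
Qed.

Lemma commuting_T t : 0 <= t -> commuting (T t).
Proof.
  intros Ht. split; [now apply contraction_bounded, (csg_contr HT)|].
  intros s x Hs. now apply (csg_comm HT).
Qed.

Lemma balak_commute A b u w : commuting A -> balakrishnan K b u w -> balakrishnan K b (A u) (A w).
Proof.
  intros HA. rewrite !balak_spec. intros [z [Hz H]]. exists (A z).
  split; [now apply commuting_gen|]. destruct HA as [HA HC].
  destruct (bounded_pos A HA) as [k [Hk Hb]].
  apply (proj2 (RInt_gen_iff (V := V) _ _)). intros eps Heps.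
  destruct (proj1 (RInt_gen_iff (V := V) _ _) H (eps / k)) as [a0 [b0 [Ha0 [Hb0 D]]]].
  { now apply Rdiv_lt_0_compat. }
  exists a0, b0. repeat split; auto. intros a c Ha Hc. destruct (D a c Ha Hc) as [J [HJ NJ]].
  exists (A J). split.
  - apply (is_RInt_ext (fun l => A (scal (Rpower l (b - 1)) (res K l (opp z))))).
    + intros l Hl. assert (Hl0 : 0 < l).
      { apply Rlt_trans with (2 := proj1 Hl). apply Rmin_pos; lra. }
      canon. rewrite (lin_scal A) by apply HA. f_equal.
      rewrite (res_commute HT HK A) by auto. canon. now rewrite (lin_opp A) by apply HA.
    + now apply is_RInt_bounded.
  - canon. rewrite <- (lin_scal A), <- (lin_minus A) by apply HA.
    apply Rle_lt_trans with (1 := Hb _). canon in NJ.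
    apply (Rmult_lt_compat_l k) in NJ; auto.
    replace (k * (eps / k)) with eps in NJ by (field; lra). exact NJ.
Qed.

(** ** The closure of Balakrishnan's operator *)

Definition cbal (b : R) : op V := closure_op (balakrishnan K b).

Lemma cbal_spec b u w : cbal b u w <->
  exists un wn, (forall n, balakrishnan K b (un n) (wn n)) /\ lim_to un u /\ lim_to wn w.
Proof.
  unfold cbal, closure_op. split; intros [un [wn [H1 [H2 H3]]]]; exists un, wn.
  - now rewrite !lim_to_filterlim.
  - now rewrite <- !lim_to_filterlim.
Qed.

Lemma cbal_balak b u w : balakrishnan K b u w -> cbal b u w.
Proof.
  intros H. apply cbal_spec. exists (fun _ => u), (fun _ => w).
  repeat split; auto; apply lim_to_const.
Qed.

Lemma cbal_lin b u w u' w' (r r' : R) : cbal b u w -> cbal b u' w' ->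
  cbal b (plus (scal r u) (scal r' u')) (plus (scal r w) (scal r' w')).
Proof.
  rewrite !cbal_spec. intros [un [wn [H1 [H2 H3]]]] [un' [wn' [H1' [H2' H3']]]].
  exists (fun n => plus (scal r (un n)) (scal r' (un' n))),
         (fun n => plus (scal r (wn n)) (scal r' (wn' n))). split; [|split].
  - intros n. now apply balak_lin.
  - canon. apply lim_to_plus; now apply lim_to_scal.
  - canon. apply lim_to_plus; now apply lim_to_scal.
Qed.

Lemma cbal_minus b u w u' w' : cbal b u w -> cbal b u' w' -> cbal b (minus u u') (minus w w').
Proof.
  intros H H'. generalize (cbal_lin b u w u' w' 1 (-1) H H').
  replace (plus (scal 1 u) (scal (-1) u')) with (minus u u') by vec.
  now replace (plus (scal 1 w) (scal (-1) w')) with (minus w w') by vec.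
Qed.

Lemma cbal_scal b u w (r : R) : cbal b u w -> cbal b (scal r u) (scal r w).
Proof.
  intros H. generalize (cbal_lin b u w u w r 0 H H).
  replace (plus (scal r u) (scal 0 u)) with (scal r u) by vec.
  now replace (plus (scal r w) (scal 0 w)) with (scal r w) by vec.
Qed.

Lemma cbal_commute A b u w : commuting A -> cbal b u w -> cbal b (A u) (A w).
Proof.
  intros HA. rewrite !cbal_spec. intros [un [wn [H1 [H2 H3]]]].
  exists (fun n => A (un n)), (fun n => A (wn n)). split; [|split].
  - intros n. now apply balak_commute.
  - apply bounded_lim; auto. apply HA.
  - apply bounded_lim; auto. apply HA.
Qed.

Lemma cbal_closed b un wn u w :
  (forall n, cbal b (un n) (wn n)) -> lim_to un u -> lim_to wn w -> cbal b u w.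
Proof.
  intros H Hu Hw. apply cbal_spec.
  assert (Hc : forall n, exists p : V * V, balakrishnan K b (fst p) (snd p) /\
    norm (minus (fst p) (un n)) < / (INR n + 1) /\ norm (minus (snd p) (wn n)) < / (INR n + 1)).
  { intros n. generalize (H n). rewrite cbal_spec. intros [u' [w' [H1 [H2 H3]]]].
    destruct (H2 _ (inv_INR_pos n)) as [N1 D1]. destruct (H3 _ (inv_INR_pos n)) as [N2 D2].
    exists (u' (max N1 N2), w' (max N1 N2)). simpl. repeat split; auto; [apply D1|apply D2]; lia. }
  destruct (choice _ Hc) as [p Hp]. clear Hc.
  exists (fun n => fst (p n)), (fun n => snd (p n)). split; [intros n; apply Hp|].
  assert (G : forall (f g : nat -> V) c, (forall n, norm (minus (f n) (g n)) < / (INR n + 1)) ->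
    lim_to g c -> lim_to f c).
  { intros f g c Hfg Hg eps Heps.
    destruct (Hg (eps / 2)) as [N1 D1]; [lra|].
    destruct (inv_INR_small (eps / 2)) as [N2 D2]; [lra|].
    exists (max N1 N2). intros n Hn. specialize (D1 n ltac:(lia)). specialize (D2 n ltac:(lia)).
    specialize (Hfg n).
    apply Rle_lt_trans with (norm (minus (f n) (g n)) + norm (minus (g n) c)); [|clra].
    apply norm_le2. vec. }
  split; [apply (G _ un)|apply (G _ wn)]; auto; intros n; apply Hp.
Qed.

(** One application of the resolvent makes Balakrishnan's operator bounded, hence it is closable. *)
Lemma cbal_res_bound b : 0 < b < 1 -> exists C, 0 <= C /\
  forall u w, cbal b u w -> norm (res K 1 w) <= C * norm u.
Proof.
  intros Hb. assert (Hk := kappa_pos b Hb).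
  set (C := (2 / b + 2 / (1 - b)) / kappa b).
  assert (HC : 0 <= C).
  { apply Rle_div_r; auto. rewrite Rmult_0_l.
    apply Rplus_le_le_0_compat; apply Rlt_le, Rdiv_lt_0_compat; lra. }
  assert (H0 : forall u w, balakrishnan K b u w -> norm (res K 1 w) <= C * norm u).
  { intros u w H. assert (H1 := balak_commute (res K 1) b u w (commuting_res_self 1 Rlt_0_1) H).
    assert (Hz := res_spec HT HK 1 u Rlt_0_1). set (z := minus (scal 1 (res K 1 u)) u) in *.
    assert (Nr := res_norm HT HK 1 u Rlt_0_1). rewrite Rmult_1_l in Nr.
    assert (Nz : norm z <= 2 * norm u).
    { apply Rle_trans with (norm (res K 1 u) + norm u); [|lra].
      apply norm_le2m. unfold z. vec. }
    destruct (balak_exists b 1 (res K 1 u) z (2 * norm u) 1) as [w' [Hw' Nw']]; auto; try lra.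
    { intros l Hl. rewrite Rpower_Ropp, Rpower_1 by auto.
      apply Rmult_le_reg_l with l; auto. replace (l * (2 * norm u * / l)) with (2 * norm u) by (field; lra).
      apply Rle_trans with (1 := res_norm HT HK l (opp z) Hl). canon. now rewrite norm_opp. }
    rewrite (balak_unique b _ _ _ Hb H1 Hw').
    apply Rmult_le_reg_l with (kappa b); auto. apply Rle_trans with (1 := Nw').
    rewrite !Rpower_1_base. unfold C.
    replace (kappa b * ((2 / b + 2 / (1 - b)) / kappa b * norm u))
      with (2 * norm u * 1 / b + 2 * norm u * 1 / (1 - b)) by (field; lra).
    apply Rplus_le_compat_r. unfold Rdiv. apply Rmult_le_compat_r.
    - left. apply Rinv_0_lt_compat. lra.
    - canon. canon in Nr. lra. }
  exists C. split; auto. intros u w H. apply cbal_spec in H.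
  destruct H as [un [wn [H1 [H2 H3]]]].
  apply (lim_to_norm_le (fun n => res K 1 (wn n))).
  - apply (bounded_lim (res K 1)); auto. now apply (res_bounded HT HK), Rlt_0_1.
  - intros eps Heps. destruct (H2 (eps / (C + 1))) as [N HN]; [apply Rdiv_lt_0_compat; lra|].
    exists N. intros n Hn. specialize (HN n Hn). apply Rle_trans with (1 := H0 _ _ (H1 n)).
    assert (Hle : norm (un n) <= norm u + eps / (C + 1)).
    { apply Rle_trans with (norm u + norm (minus (un n) u)); [|canon in HN; canon; lra].
      apply norm_le2. vec. }
    apply Rle_trans with (C * (norm u + eps / (C + 1))); [now apply Rmult_le_compat_l|].
    rewrite Rmult_plus_distr_l. apply Rplus_le_compat_l.
    replace eps with ((C + 1) * (eps / (C + 1))) at 2 by (field; lra).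
    apply Rmult_le_compat_r; [|lra]. left. apply Rdiv_lt_0_compat; lra.
Qed.

Lemma cbal_unique b u w w' : 0 < b < 1 -> cbal b u w -> cbal b u w' -> w = w'.
Proof.
  intros Hb H H'. destruct (cbal_res_bound b Hb) as [C [HC HC']].
  assert (Hd := HC' _ _ (cbal_minus b _ _ _ _ H H')).
  rewrite (norm_0 (minus u u)), Rmult_0_r in Hd by vec.
  assert (Hs := res_spec HT HK 1 (minus w w') Rlt_0_1).
  assert (E0 : res K 1 (minus w w') = zero).
  { apply norm_eq_zero. apply Rle_antisym; auto. apply norm_pos. }
  rewrite E0 in Hs. assert (Hz := gen_zero HT HK).
  assert (E1 := gen_unique HK _ _ _ Hz Hs).
  apply (vec_from 1 _ _ _ _ E1). vec.
Qed.
End Frac.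

Lemma lim_norm_le {V : NormedModule R_AbsRing} (un : nat -> V) u eps :
  lim_to un u -> 0 < eps -> exists N, forall n, (N <= n)%nat -> norm (un n) <= norm u + eps.
Proof.
  intros Hu Heps. destruct (Hu eps Heps) as [N HN]. exists N. intros n Hn. specialize (HN n Hn).
  apply Rle_trans with (norm u + norm (minus (un n) u)); [|lra]. apply norm_le2. vec.
Qed.

Lemma lim_norm_affine {V W Z : NormedModule R_AbsRing} (vn : nat -> V) (xn : nat -> W) (wn : nat -> Z)
    v x w A B : 0 <= A -> 0 <= B ->
  lim_to vn v -> lim_to xn x -> lim_to wn w ->
  (forall n, norm (vn n) <= A * norm (xn n) + B * norm (wn n)) ->
  norm v <= A * norm x + B * norm w.
Proof.
  intros HA HB Hv Hx Hw H. apply (lim_to_norm_le vn); auto. intros eps Heps.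
  destruct (lim_norm_le xn x (eps / 2 / (A + 1)) Hx) as [N1 D1].
  { apply Rdiv_lt_0_compat; lra. }
  destruct (lim_norm_le wn w (eps / 2 / (B + 1)) Hw) as [N2 D2].
  { apply Rdiv_lt_0_compat; lra. }
  exists (max N1 N2). intros n Hn. specialize (D1 n ltac:(lia)). specialize (D2 n ltac:(lia)).
  apply Rle_trans with (1 := H n).
  assert (E : forall c, 0 <= c -> c * (eps / 2 / (c + 1)) <= eps / 2).
  { intros c Hc. assert (0 < eps / 2 / (c + 1)) by (apply Rdiv_lt_0_compat; lra).
    replace (eps / 2) with ((c + 1) * (eps / 2 / (c + 1))) at 2 by (field; lra).
    apply Rmult_le_compat_r; lra. }
  assert (E1 := E A HA). assert (E2 := E B HB).
  apply (Rmult_le_compat_l A) in D1; auto. apply (Rmult_le_compat_l B) in D2; auto. lra.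
Qed.

Lemma cauchy_affine {V : CompleteNormedModule R_AbsRing} {W Z : NormedModule R_AbsRing}
    (vn : nat -> V) (xn : nat -> W) (wn : nat -> Z) x w A B : 0 <= A -> 0 <= B ->
  lim_to xn x -> lim_to wn w ->
  (forall n m, norm (minus (vn n) (vn m)) <=
     A * norm (minus (xn n) (xn m)) + B * norm (minus (wn n) (wn m))) ->
  exists v, lim_to vn v.
Proof.
  intros HA HB Hx Hw H. apply cauchy_lim. intros eps Heps.
  destruct (Hx (eps / 8 / (A + 1))) as [N1 D1]; [apply Rdiv_lt_0_compat; lra|].
  destruct (Hw (eps / 8 / (B + 1))) as [N2 D2]; [apply Rdiv_lt_0_compat; lra|].
  exists (max N1 N2). intros n m Hn Hm.
  assert (E1 : norm (minus (xn n) (xn m)) <= 2 * (eps / 8 / (A + 1))).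
  { apply Rle_trans with (norm (minus (xn n) x) + norm (minus (xn m) x)).
    - apply norm_le2m. vec.
    - assert (a := D1 n ltac:(lia)). assert (b := D1 m ltac:(lia)). lra. }
  assert (E2 : norm (minus (wn n) (wn m)) <= 2 * (eps / 8 / (B + 1))).
  { apply Rle_trans with (norm (minus (wn n) w) + norm (minus (wn m) w)).
    - apply norm_le2m. vec.
    - assert (a := D2 n ltac:(lia)). assert (b := D2 m ltac:(lia)). lra. }
  apply Rle_lt_trans with (1 := H n m).
  assert (E : forall c, 0 <= c -> c * (2 * (eps / 8 / (c + 1))) <= eps / 4).
  { intros c Hc. assert (0 < eps / 8 / (c + 1)) by (apply Rdiv_lt_0_compat; lra).
    replace (eps / 4) with ((c + 1) * (2 * (eps / 8 / (c + 1)))) by (field; lra).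
    apply Rmult_le_compat_r; lra. }
  assert (E3 := E A HA). assert (E4 := E B HB).
  apply (Rmult_le_compat_l A) in E1; auto. apply (Rmult_le_compat_l B) in E2; auto. lra.
Qed.

Section Powers.
Context {V : CompleteNormedModule R_AbsRing} {ip : V -> V -> R}.
Context (Hip : real_inner V ip).
Context {T : R -> V -> V} {K : op V} (HT : csg T) (HK : gen K T).
Implicit Types u v w x y z : V.

(** Orders are taken from [(0, 1]] instead of [[0, 1)] because the estimates below gain on orders that
    are strictly smaller: at an integer there has to be room below. *)
Definition order_pow (g : R) : op V := fun x w =>
  (g < 1 /\ cbal (K := K) g x w) \/ (g = 1 /\ K x (opp w)).

Lemma gen_lin_neg x w x' w' (r r' : R) : K x (opp w) -> K x' (opp w') ->
  K (plus (scal r x) (scal r' x')) (opp (plus (scal r w) (scal r' w'))).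
Proof.
  intros H H'. generalize (gen_linear HT HK _ _ _ _ r r' H H').
  match goal with |- K _ ?a -> K _ ?b => replace a with b by vec end. auto.
Qed.

Lemma order_pow_lin g x w x' w' (r r' : R) : order_pow g x w -> order_pow g x' w' ->
  order_pow g (plus (scal r x) (scal r' x')) (plus (scal r w) (scal r' w')).
Proof.
  intros [[Hg H]|[Hg H]] [[Hg' H']|[Hg' H']]; try lra; [left|right]; split; auto.
  - now apply (cbal_lin HT HK).
  - now apply gen_lin_neg.
Qed.

Lemma commuting_gen_neg A x w : commuting (T := T) A -> K x (opp w) -> K (A x) (opp (A w)).
Proof.
  intros HA H. rewrite <- (lin_opp A) by apply HA. now apply (commuting_gen HK).
Qed.

Lemma order_pow_commute g A x w : commuting (T := T) A -> order_pow g x w -> order_pow g (A x) (A w).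
Proof.
  intros HA [[Hg H]|[Hg H]]; [left|right]; split; auto.
  - now apply (cbal_commute HT HK).
  - now apply commuting_gen_neg.
Qed.

Lemma order_pow_closed g xn wn x w :
  (forall n, order_pow g (xn n) (wn n)) -> lim_to xn x -> lim_to wn w -> order_pow g x w.
Proof.
  intros H Hx Hw. destruct (H O) as [[Hg _]|[Hg _]]; [left|right]; split; auto.
  - apply (cbal_closed g xn wn); auto. intros n. destruct (H n) as [[_ Hn]|[Hn _]]; [auto|lra].
  - apply (gen_closed HT HK xn (fun n => opp (wn n))); auto; [|canon; now apply lim_to_opp].
    intros n. destruct (H n) as [[Hn _]|[_ Hn]]; [lra|auto].
Qed.

(** This is [balak_key], since [x - nu (nu - K)^{-1} x = (nu - K)^{-1} (-K) x]: the high-frequency part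
    of [x] is small if a power of [-K] is defined at [x]. *)
Lemma order_pow_decay g : 0 < g <= 1 -> exists C, 0 <= C /\ forall x w nu,
  order_pow g x w -> 0 < nu ->
  norm (minus x (scal nu (res K nu x))) <= C * Rpower nu (- g) * norm w.
Proof.
  intros Hg. destruct (Req_dec g 1) as [->|Hg1].
  - exists 1. split; [lra|]. intros x w nu [[Hlt _]|[_ H]] Hnu; [lra|].
    rewrite Rmult_1_l, Rpower_Ropp, Rpower_1 by auto.
    assert (E := res_opp_eq HT HK nu x (opp w) Hnu H). canon in E. canon. rewrite <- E.
    apply Rmult_le_reg_l with nu; auto. rewrite <- Rmult_assoc, Rinv_r, Rmult_1_l by lra.
    apply Rle_trans with (1 := res_norm HT HK nu _ Hnu). canon. rewrite !norm_opp. lra.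
  - assert (Hg' : 0 < g < 1) by lra. assert (Hk := kappa_pos g Hg').
    exists (2 * kappa g). split; [lra|]. intros x w nu [[_ H]|[E _]] Hnu; [|lra].
    apply cbal_spec in H. destruct H as [xn [wn [H [Hx Hw]]]].
    assert (Hc : 0 <= 2 * kappa g * Rpower nu (- g)).
    { apply Rmult_le_pos; [lra|apply Rpower_nonneg]. }
    apply Rle_trans with (0 * norm w + 2 * kappa g * Rpower nu (- g) * norm w); [|lra].
    apply (lim_norm_affine (fun n => minus (xn n) (scal nu (res K nu (xn n)))) wn wn); auto; [lra| |].
    + canon. apply lim_to_minus; auto. apply lim_to_scal.
      apply (bounded_lim (res K nu)); auto. now apply (res_bounded HT HK).
    + intros n. rewrite Rmult_0_l, Rplus_0_l.
      generalize (H n). rewrite (balak_spec HT HK). intros [z [Hz HI]].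
      assert (E := res_opp_eq HT HK nu (xn n) z Hnu Hz). canon in E. canon. rewrite <- E.
      now apply (balak_key Hip HT HK g (xn n)).
Qed.

(** By [order_pow_decay], Balakrishnan's integral of a smaller order converges.  The estimate is linear,
    so it turns graph-convergent sequences into Cauchy sequences and passes to the closure. *)
Lemma order_pow_embed b g : 0 < b < 1 -> b < g <= 1 -> exists C1 C2, 0 <= C1 /\ 0 <= C2 /\
  forall N x w, 0 < N -> order_pow g x w -> exists v, cbal (K := K) b x v /\
    norm v <= C1 * Rpower N b * norm x + C2 * Rpower N (- (g - b)) * norm w.
Proof.
  intros Hb Hg. assert (Hk := kappa_pos b Hb).
  destruct (order_pow_decay g ltac:(lra)) as [C [HC Hdec]].
  set (C1 := 2 / b / kappa b). set (C2 := C / (g - b) / kappa b).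
  assert (HC1 : 0 <= C1) by (repeat apply Rdiv_le_0_compat; lra).
  assert (HC2 : 0 <= C2) by (repeat apply Rdiv_le_0_compat; lra).
  exists C1, C2. split; [auto|split; [auto|]].
  assert (H0 : forall N x w z, 0 < N -> order_pow g x w -> K x z ->
    exists v, balakrishnan K b x v /\
      norm v <= C1 * Rpower N b * norm x + C2 * Rpower N (- (g - b)) * norm w).
  { intros N x w z HN Hxw Hz.
    destruct (balak_exists HT HK b g x z (C * norm w) N) as [v [Hv Nv]]; auto; try lra.
    { intros l Hl. rewrite (res_opp_eq HT HK l x z) by auto. canon.
      apply Rle_trans with (1 := Hdec x w l Hxw Hl). right. ring. }
    exists v. split; auto. apply Rmult_le_reg_l with (kappa b); auto.
    apply Rle_trans with (1 := Nv). right. unfold C1, C2. field. lra. }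
  intros N x w HN [[Hg1 H]|[Hg1 H]].
  - apply cbal_spec in H. destruct H as [xn [wn [H [Hx Hw]]]].
    assert (Hex : forall n, exists v, balakrishnan K b (xn n) v /\
      norm v <= C1 * Rpower N b * norm (xn n) + C2 * Rpower N (- (g - b)) * norm (wn n)).
    { intros n. generalize (H n). rewrite (balak_spec HT HK). intros [z [Hz _]].
      apply H0 with z; auto. left. split; auto. now apply cbal_balak. }
    destruct (choice _ Hex) as [vn Hvn].
    assert (P1 : 0 <= C1 * Rpower N b) by (apply Rmult_le_pos; auto; apply Rpower_nonneg).
    assert (P2 : 0 <= C2 * Rpower N (- (g - b))) by (apply Rmult_le_pos; auto; apply Rpower_nonneg).
    destruct (cauchy_affine vn xn wn x w (C1 * Rpower N b) (C2 * Rpower N (- (g - b)))) as [v Hv]; auto.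
    + intros n m.
      assert (Hd : balakrishnan K g (minus (xn n) (xn m)) (minus (wn n) (wn m))).
      { generalize (balak_lin HT HK g _ _ _ _ 1 (-1) (H n) (H m)).
        match goal with |- balakrishnan K g ?a ?c -> balakrishnan K g ?a' ?c' =>
          replace a with a' by vec; replace c with c' by vec end. auto. }
      generalize Hd. rewrite (balak_spec HT HK). intros [z [Hz _]].
      destruct (H0 N _ _ z HN (or_introl (conj Hg1 (cbal_balak _ _ _ Hd))) Hz) as [v' [Hv' Nv']].
      replace (minus (vn n) (vn m)) with v'; [exact Nv'|].
      apply (balak_unique HT HK b (minus (xn n) (xn m))); auto.
      generalize (balak_lin HT HK b _ _ _ _ 1 (-1) (proj1 (Hvn n)) (proj1 (Hvn m))).
      match goal with |- balakrishnan K b ?a ?c -> balakrishnan K b ?a' ?c' =>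
        replace a with a' by vec; replace c with c' by vec end. auto.
    + exists v. split.
      * apply cbal_spec. exists xn, vn. repeat split; auto. intros n. apply Hvn.
      * apply (lim_norm_affine vn xn wn); auto. intros n. apply Hvn.
  - destruct (H0 N x w (opp w)) as [v [Hv Nv]]; auto; [now right|].
    exists v. split; auto. now apply cbal_balak.
Qed.

(** ** Interaction with the generator *)

Lemma gen_quotient_lim u z : K u z ->
  lim_to (fun n => scal (INR n + 1) (minus (T (/ (INR n + 1)) u) u)) z.
Proof.
  intros H eps Heps. destruct (gen_approx HK u z (eps / 2) H) as [d [Hd D]]; [lra|].
  destruct (inv_INR_small d Hd) as [N HN]. exists N. intros n Hn. specialize (HN n Hn).
  assert (P := pos_INR n). assert (P' := inv_INR_pos n).
  specialize (D _ (conj (Rlt_le _ _ P') HN)).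
  vrep (minus (scal (INR n + 1) (minus (T (/ (INR n + 1)) u) u)) z) with
    (scal (INR n + 1) (minus (minus (T (/ (INR n + 1)) u) u) (scal (/ (INR n + 1)) z))).
  rewrite norm_scal_eq, Rabs_right by lra.
  apply (Rmult_le_compat_l (INR n + 1)) in D; [|lra].
  replace ((INR n + 1) * (eps / 2 * / (INR n + 1))) with (eps / 2) in D by (field; lra). clra.
Qed.

(** The power commutes with the difference quotients of the semigroup, and it is closed. *)
Lemma cbal_gen g u u' y y' : K u u' -> K y y' -> cbal (K := K) g u y -> cbal (K := K) g u' y'.
Proof.
  intros Hu Hy H.
  apply (cbal_closed g _ _ _ _ (fun n =>
    cbal_scal HT HK g _ _ (INR n + 1) (cbal_minus HT HK g _ _ _ _
      (cbal_commute HT HK (T (/ (INR n + 1))) g u y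
         (commuting_T HT _ (Rlt_le _ _ (inv_INR_pos n))) H) H))).
  - now apply gen_quotient_lim.
  - now apply gen_quotient_lim.
Qed.

Definition smooth (n : nat) (u : V) : V := avg (T := T) (/ (INR n + 1)) u.

Lemma smooth_commuting n : commuting (T := T) (smooth n).
Proof.
  split.
  - apply contraction_bounded, (avg_contraction HT), inv_INR_pos.
  - intros t x Ht. symmetry. apply (avg_commute HT (T t)).
    + now apply contraction_bounded, (csg_contr HT).
    + intros s y Hs. now apply (csg_comm HT).
Qed.

Lemma avg_gen e u : 0 < e -> K (avg (T := T) e u) (scal (/ e) (minus (T e u) u)).
Proof. intros He. apply (gen_scal HT HK). now apply (orbit_RInt_gen HT HK). Qed.

Lemma avg_lim (en : nat -> R) u : (forall n, 0 < en n <= / (INR n + 1)) ->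
  lim_to (fun n => avg (T := T) (en n) u) u.
Proof.
  intros Hen eps Heps. destruct (csg_cont0 HT u (eps / 2)) as [d [Hd D]]; [lra|].
  destruct (inv_INR_small d Hd) as [N HN]. exists N. intros n Hn. specialize (HN n Hn).
  specialize (Hen n).
  apply Rle_lt_trans with (eps / 2); [|lra]. apply (avg_near HT); [apply Hen|].
  intros s Hs. left. apply D. lra.
Qed.

Lemma smooth_lim u : lim_to (fun n => smooth n u) u.
Proof. apply avg_lim. intros n. split; [apply inv_INR_pos|lra]. Qed.

(** High frequencies of [K u] are controlled by its power of order [g], that is by [K y], and low ones by
    [u] itself.  So the images of the smoothed vectors [smooth n u] under [K] converge. *)
Lemma cbal_shift g u y y' : 0 < g < 1 -> cbal (K := K) g u y -> K y y' ->
  exists u', K u u' /\ cbal (K := K) g u' y'.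
Proof.
  intros Hg H Hy. destruct (order_pow_decay g ltac:(lra)) as [C [HC Hdec]].
  set (un' := fun n => scal (/ / (INR n + 1)) (minus (T (/ (INR n + 1)) u) u)).
  assert (Hun : forall n, K (smooth n u) (un' n)).
  { intros n. apply avg_gen, inv_INR_pos. }
  assert (Hc : forall n, cbal (K := K) g (un' n) (smooth n y')).
  { intros n. apply (cbal_gen g (smooth n u) (un' n) (smooth n y) (smooth n y')); auto.
    - apply (commuting_gen HK); auto. apply smooth_commuting.
    - apply (cbal_commute HT HK); auto. apply smooth_commuting. }
  destruct (cauchy_affine un' (fun n => smooth n y') (fun n => smooth n u) y' u C 2) as [u' Hu']; auto; [lra| | | |].
  - apply smooth_lim.
  - apply smooth_lim.
  - intros n m.
    assert (Hd := cbal_minus HT HK g _ _ _ _ (Hc n) (Hc m)).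
    assert (HKd := gen_minus HT HK _ _ _ _ (Hun n) (Hun m)).
    set (x := minus (un' n) (un' m)) in *.
    assert (D1 := Hdec x _ 1 (or_introl (conj (proj2 Hg) Hd)) Rlt_0_1).
    rewrite Rpower_1_base, Rmult_1_r in D1.
    assert (D2 := res_opp_le HT HK 1 _ _ Rlt_0_1 HKd).
    canon in D2. rewrite (lin_opp (res K 1)), norm_opp in D2 by (apply (res_linear HT HK); lra).
    apply Rle_trans with (norm (minus x (scal 1 (res K 1 x))) + norm (res K 1 x)).
    + apply norm_le2. unfold x. vec.
    + change (minus (un' n) (un' m)) with x in D2. clra.
  - exists u'. split.
    + apply (gen_closed HT HK (fun n => smooth n u) un'); auto. apply smooth_lim.
    + apply (cbal_closed g un' (fun n => smooth n y')); auto. apply smooth_lim.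
Qed.

(** The relation passes through [(1 - K)^{-1}], which commutes with the power. *)
Lemma cbal_gen_image b u u' v v' : 0 < b < 1 -> K u u' ->
  cbal (K := K) b u v -> cbal (K := K) b u' v' -> K v v'.
Proof.
  intros Hb Hu Hv Hv'.
  assert (E : res K 1 (minus u u') = u).
  { apply (res_unique HT HK); [lra|].
    match goal with |- K _ ?a => replace a with u' by vec end. auto. }
  assert (Hc := cbal_commute HT HK (res K 1) b _ _ (commuting_res_self HT HK 1 Rlt_0_1)
    (cbal_minus HT HK b _ _ _ _ Hv Hv')).
  rewrite E in Hc. assert (E' := cbal_unique HT HK b u _ _ Hb Hv Hc).
  assert (Hs := res_spec HT HK 1 (minus v v') Rlt_0_1). rewrite <- E' in Hs.
  match goal with H : K _ ?a |- _ => replace a with v' in H by vec end. auto.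
Qed.

(** ** Integer powers *)

Lemma neg_pow_lin n u x u' x' (r r' : R) : neg_pow K n u x -> neg_pow K n u' x' ->
  neg_pow K n (plus (scal r u) (scal r' u')) (plus (scal r x) (scal r' x')).
Proof.
  revert x x'. induction n as [|n IH]; intros x x'.
  - simpl. now intros -> ->.
  - intros [y [H1 H2]] [y' [H1' H2']]. exists (plus (scal r y) (scal r' y')).
    split; auto. now apply gen_lin_neg.
Qed.

Lemma neg_pow_commute n A u x : commuting (T := T) A -> neg_pow K n u x -> neg_pow K n (A u) (A x).
Proof.
  intros HA. revert x. induction n as [|n IH]; intros x.
  - simpl. now intros ->.
  - intros [y [H1 H2]]. exists (A y). split; auto. now apply commuting_gen_neg.
Qed.

(** Together with [neg_pow_unshift]: integer powers and a fractional one may be interchanged. *)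
Lemma neg_pow_shift g n u y w : 0 < g < 1 -> cbal (K := K) g u y -> neg_pow K n y w ->
  exists x, neg_pow K n u x /\ cbal (K := K) g x w.
Proof.
  intros Hg Hu. revert w. induction n as [|n IH]; intros w.
  - simpl. intros ->. now exists u.
  - intros [y1 [H1 H2]]. destruct (IH y1 H1) as [x1 [H3 H4]].
    destruct (cbal_shift g x1 y1 (opp w) Hg H4 H2) as [x [H5 H6]].
    exists (opp x). split.
    + exists x1. split; auto. match goal with |- K _ ?a => replace a with x by vec end. auto.
    + match goal with |- cbal _ ?a ?c =>
        replace a with (scal (-1) x) by vec; replace c with (scal (-1) (opp w)) by vec end.
      now apply (cbal_scal HT HK).
Qed.

Lemma neg_pow_unshift b n u x v : 0 < b < 1 -> neg_pow K n u x -> cbal (K := K) b x v ->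
  exists v0, cbal (K := K) b u v0 /\ neg_pow K n v0 v.
Proof.
  intros Hb. revert x v. induction n as [|n IH]; intros x v.
  - simpl. intros -> H. now exists v.
  - intros [x1 [H1 H2]] H. destruct (order_pow_embed b 1) as [C1 [C2 [_ [_ He]]]]; [lra|lra|].
    destruct (He 1 x1 x Rlt_0_1) as [v1 [Hv1 _]]; [now right|].
    destruct (IH x1 v1 H1 Hv1) as [v0 [H3 H4]].
    exists v0. split; auto. exists v1. split; auto.
    apply (cbal_gen_image b x1 (opp x) v1 (opp v)); auto.
    match goal with |- cbal _ ?a ?c =>
      replace a with (scal (-1) x) by vec; replace c with (scal (-1) v) by vec end.
    now apply (cbal_scal HT HK).
Qed.

(** The part of [x] above the frequency [nu] is small by [order_pow_decay], the part below is at most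
    [2 nu] times the norm of the preceding power, to which the induction applies with a coefficient that
    lets its [x]-term be absorbed. *)
Lemma neg_pow_interp n : forall g eps, 0 < g <= 1 -> 0 < eps -> exists C, 0 <= C /\
  forall u x w, neg_pow K n u x -> order_pow g x w -> norm x <= eps * norm w + C * norm u.
Proof.
  induction n as [|n IH]; intros g eps Hg Heps.
  - exists 1. split; [lra|]. intros u x w. simpl. intros -> _.
    generalize (norm_pos w). intros. assert (0 <= eps * norm w) by (apply Rmult_le_pos; lra). lra.
  - destruct (order_pow_decay g Hg) as [C [HC Hdec]].
    destruct (power_small_inf g (eps / 2 / (C + 1))) as [b0 [Hb0 Hb]]; [lra|apply Rdiv_lt_0_compat; lra|].
    set (nu := b0 + 1). specialize (Hb nu ltac:(unfold nu; lra)). assert (Hnu : 0 < nu) by (unfold nu; lra).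
    (* with this coefficient, [2 nu] times the [x]-term is half of [|x|] *)
    destruct (IH 1 (/ (4 * nu))) as [C' [HC' H']]; [lra|apply Rinv_0_lt_compat; lra|].
    exists (4 * nu * C'). split; [apply Rmult_le_pos; lra|].
    intros u x w [y [H1 H2]] Hxw.
    assert (D := Hdec x w nu Hxw Hnu).
    assert (D1 := res_opp_le HT HK nu y (opp x) Hnu H2).
    assert (D2 := H' u y x H1 (or_intror (conj eq_refl H2))).
    replace (opp (opp x)) with x in D1 by vec.
    assert (D3 : norm x <= C * Rpower nu (- g) * norm w + nu * (2 * norm y)).
    { apply Rle_trans with (norm (minus x (scal nu (res K nu x))) + norm (scal nu (res K nu x))).
      - apply norm_le2. vec.
      - apply Rplus_le_compat; auto. canon. rewrite norm_scal_eq, Rabs_right by lra.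
        apply Rmult_le_compat_l; lra. }
    assert (D4 : C * Rpower nu (- g) * norm w <= eps / 2 * norm w).
    { apply Rmult_le_compat_r; [apply norm_pos|].
      apply Rle_trans with ((C + 1) * (eps / 2 / (C + 1))); [|right; field; lra].
      apply Rmult_le_compat; try lra. apply Rpower_nonneg. }
    apply (Rmult_le_compat_l (nu * 2)) in D2; [|lra].
    replace (nu * 2 * (/ (4 * nu) * norm x + C' * norm u))
      with (norm x / 2 + 2 * nu * C' * norm u) in D2 by (field; lra).
    lra.
Qed.

Lemma minus_as_lin x y : minus x y = plus (scal 1 x) (scal (-1) y).
Proof. vec. Qed.

Lemma neg_pow_closed n un xn u x :
  (forall k, neg_pow K n (un k) (xn k)) -> lim_to un u -> lim_to xn x -> neg_pow K n u x.
Proof.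
  revert xn x. induction n as [|n IH]; intros xn x H Hu Hx.
  - simpl in *. apply (lim_to_unique xn); auto. apply lim_to_ext with un; auto.
  - destruct (choice _ H) as [yn Hyn].
    destruct (neg_pow_interp n 1 1) as [C [HC Hint]]; [lra|lra|].
    destruct (cauchy_affine yn xn un x u 1 C) as [y Hy]; auto; [lra| |].
    + intros k l. apply Hint.
      * rewrite !minus_as_lin. apply neg_pow_lin; apply Hyn.
      * right. split; auto. rewrite !minus_as_lin. apply gen_lin_neg; apply Hyn.
    + exists y. split.
      * apply (IH yn); auto. intros k. apply Hyn.
      * apply (gen_closed HT HK yn (fun k => opp (xn k))); auto; [|canon; now apply lim_to_opp].
        intros k. apply Hyn.
Qed.

(** ** Fractional powers of any order *)

Lemma INR_frac_unique n b m c : INR n + b = INR m + c -> 0 <= b < 1 -> 0 <= c < 1 -> n = m /\ b = c.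
Proof.
  intros E Hb Hc. assert (n = m).
  { destruct (Nat.lt_trichotomy n m) as [H|[H|H]]; auto; exfalso.
    - apply le_INR in H. rewrite S_INR in H. lra.
    - apply le_INR in H. rewrite S_INR in H. lra. }
  subst m. split; auto. lra.
Qed.

Lemma frac_pow_0 u w : frac_pow K 0 u w <-> w = u.
Proof.
  split.
  - intros [n [b [v [E [Hb [Hv Hw]]]]]].
    destruct (INR_frac_unique 0 0 n b) as [<- <-]; [simpl; lra|lra|lra|].
    destruct Hv as [[_ ->]|[Hv _]]; [exact Hw|lra].
  - intros ->. exists O, 0, u. simpl. repeat split; auto; try lra.
Qed.

Lemma frac_pow_INR n u w : frac_pow K (INR n + 0) u w <-> neg_pow K n u w.
Proof.
  split.
  - intros [m [b [v [E [Hb [Hv Hw]]]]]].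
    destruct (INR_frac_unique n 0 m b) as [<- <-]; [auto|lra|lra|].
    destruct Hv as [[_ ->]|[Hv _]]; [exact Hw|lra].
  - intros H. exists n, 0, u. repeat split; auto; try lra.
Qed.

(** [frac_pow] applies the fractional part first.  Estimates gain on the part that is applied last, so
    here the integer power comes first. *)
Lemma frac_pow_char n g u w : 0 < g <= 1 ->
  (frac_pow K (INR n + g) u w <-> exists x, neg_pow K n u x /\ order_pow g x w).
Proof.
  intros Hg. destruct (Req_dec g 1) as [->|Hg1].
  - replace (INR n + 1) with (INR (S n) + 0) by (rewrite S_INR; ring). rewrite frac_pow_INR. split.
    + intros [y [H1 H2]]. exists y. split; auto. now right.
    + intros [y [H1 [[H2 _]|[_ H2]]]]; [lra|]. now exists y.
  - split.
    + intros [m [b [v [E [Hb [Hv Hw]]]]]].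
      destruct (INR_frac_unique n g m b) as [<- <-]; [auto|lra|lra|].
      destruct Hv as [[Hv _]|[_ Hv]]; [lra|].
      destruct (neg_pow_shift g n u v w) as [x [H1 H2]]; auto; [lra|].
      exists x. split; auto. left. split; auto. lra.
    + intros [x [H1 [[_ H2]|[H2 _]]]]; [|lra].
      destruct (neg_pow_unshift g n u x w) as [v [H3 H4]]; auto; [lra|].
      exists n, g, v. repeat split; auto; try lra. right. split; [lra|exact H3].
Qed.

Lemma order_split a : 0 < a -> exists n g, a = INR n + g /\ 0 < g <= 1.
Proof.
  intros Ha. destruct (nfloor_ex a) as [n Hn]; [lra|].
  destruct (Req_dec a (INR n)) as [E|E].
  - destruct n as [|n]; [simpl in E; lra|]. exists n, 1. rewrite S_INR in E. lra.
  - exists n, (a - INR n). lra.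
Qed.

Lemma frac_pow_lin a u w u' w' (r r' : R) : 0 <= a -> frac_pow K a u w -> frac_pow K a u' w' ->
  frac_pow K a (plus (scal r u) (scal r' u')) (plus (scal r w) (scal r' w')).
Proof.
  intros [Ha|<-].
  - destruct (order_split a Ha) as [n [g [-> Hg]]]. rewrite !frac_pow_char by auto.
    intros [x [H1 H2]] [x' [H1' H2']]. exists (plus (scal r x) (scal r' x')).
    split; [now apply neg_pow_lin|now apply order_pow_lin].
  - rewrite !frac_pow_0. now intros -> ->.
Qed.

Lemma frac_pow_commute a A u w : 0 <= a -> commuting (T := T) A ->
  frac_pow K a u w -> frac_pow K a (A u) (A w).
Proof.
  intros [Ha|<-] HA.
  - destruct (order_split a Ha) as [n [g [-> Hg]]]. rewrite !frac_pow_char by auto.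
    intros [x [H1 H2]]. exists (A x).
    split; [now apply neg_pow_commute|now apply order_pow_commute].
  - rewrite !frac_pow_0. now intros ->.
Qed.

(** The intermediate vectors converge by interpolation. *)
Lemma frac_pow_closed a un wn u w : 0 <= a ->
  (forall n, frac_pow K a (un n) (wn n)) -> lim_to un u -> lim_to wn w -> frac_pow K a u w.
Proof.
  intros [Ha|<-] H Hu Hw.
  - destruct (order_split a Ha) as [n [g [-> Hg]]]. rewrite frac_pow_char by auto.
    assert (Hc : forall k, exists x, neg_pow K n (un k) x /\ order_pow g x (wn k)).
    { intros k. apply frac_pow_char; auto. }
    destruct (choice _ Hc) as [xn Hxn].
    destruct (neg_pow_interp n g 1) as [C [HC Hint]]; [lra|lra|].
    destruct (cauchy_affine xn wn un w u 1 C) as [x Hx]; auto; [lra| |].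
    + intros k l. apply Hint.
      * rewrite !minus_as_lin. apply neg_pow_lin; apply Hxn.
      * rewrite !minus_as_lin. apply order_pow_lin; apply Hxn.
    + exists x. split.
      * apply (neg_pow_closed n un xn); auto. intros k. apply Hxn.
      * apply (order_pow_closed g xn wn); auto. intros k. apply Hxn.
  - apply frac_pow_0. apply (lim_to_unique wn); auto. apply lim_to_ext with un; auto.
    intros n. symmetry. now apply frac_pow_0.
Qed.

Lemma frac_embed_step n g b eps : 0 <= b < g -> g <= 1 -> 0 < eps -> exists C, 0 <= C /\
  forall u w, frac_pow K (INR n + g) u w -> exists v, frac_pow K (INR n + b) u v /\
    norm v <= eps * norm w + C * norm u.
Proof.
  intros Hb Hg Heps. destruct (Req_dec b 0) as [->|Hb0].
  - destruct (neg_pow_interp n g eps) as [C [HC H]]; [lra|auto|].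
    exists C. split; auto. intros u w Hw. apply frac_pow_char in Hw; [|lra].
    destruct Hw as [x [H1 H2]]. exists x. split; [now apply frac_pow_INR|]. now apply H.
  - destruct (order_pow_embed b g) as [C1 [C2 [HC1 [HC2 He]]]]; [lra|lra|].
    destruct (power_small_inf (g - b) (eps / 2 / (C2 + 1))) as [b0 [Hb1 HN]]; [lra|apply Rdiv_lt_0_compat; lra|].
    set (N := b0 + 1). specialize (HN N ltac:(unfold N; lra)).
    set (c := C1 * Rpower N b).
    assert (Hc : 0 <= c) by (apply Rmult_le_pos; auto; apply Rpower_nonneg).
    destruct (neg_pow_interp n g (eps / 2 / (c + 1))) as [C [HC H]]; [lra|apply Rdiv_lt_0_compat; lra|].
    exists (c * C). split; [apply Rmult_le_pos; auto|]. intros u w Hw.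
    apply frac_pow_char in Hw; [|lra]. destruct Hw as [x [H1 H2]].
    destruct (He N x w) as [v [Hv Nv]]; auto; [unfold N; lra|].
    exists v. split.
    + apply frac_pow_char; [lra|]. exists x. split; auto. left. split; auto. lra.
    + assert (D := H u x w H1 H2). fold c in Nv.
      assert (D1 : C2 * Rpower N (- (g - b)) * norm w <= eps / 2 * norm w).
      { apply Rmult_le_compat_r; [apply norm_pos|].
        apply Rle_trans with ((C2 + 1) * (eps / 2 / (C2 + 1))); [|right; field; lra].
        apply Rmult_le_compat; try lra. apply Rpower_nonneg. }
      assert (D2 : c * norm x <= eps / 2 * norm w + c * C * norm u).
      { apply Rle_trans with (c * (eps / 2 / (c + 1) * norm w + C * norm u)).
        - now apply Rmult_le_compat_l.
        - rewrite Rmult_plus_distr_l, <- !Rmult_assoc. apply Rplus_le_compat_r.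
          apply Rmult_le_compat_r; [apply norm_pos|].
          replace (eps / 2) with ((c + 1) * (eps / 2 / (c + 1))) at 2 by (field; lra).
          assert (0 < eps / 2 / (c + 1)) by (apply Rdiv_lt_0_compat; lra).
          apply Rmult_le_compat_r; lra. }
      lra.
Qed.

(** An Ehrling inequality, composed from steps of order at most one. *)
Lemma frac_embed a c eps : 0 <= a < c -> 0 < eps -> exists C, 0 <= C /\
  forall u w, frac_pow K c u w -> exists v, frac_pow K a u v /\
    norm v <= eps * norm w + C * norm u.
Proof.
  intros Hac Heps. destruct (order_split c) as [n [g [-> Hg]]]; [lra|].
  destruct (nfloor_ex a) as [m Hm]; [lra|].
  set (b := a - INR m). assert (Ea : a = INR m + b) by (unfold b; ring). assert (Hb : 0 <= b < 1) by (unfold b; lra).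
  rewrite Ea in *. clearbody b. clear Ea Hm a. revert g Hg Hac eps Heps.
  induction n as [|n IH]; intros g Hg Hac eps Heps.
  - assert (m = O) as ->.
    { destruct m; auto. rewrite S_INR in Hac. simpl in Hac. generalize (pos_INR m). lra. }
    apply frac_embed_step; auto; simpl in Hac; lra.
  - destruct (Nat.eq_dec m (S n)) as [->|Hne].
    { apply frac_embed_step; auto; lra. }
    assert (Hlt : (m < S n)%nat).
    { destruct (Nat.lt_trichotomy m (S n)) as [?|[?|Hgt]]; auto; [lia|].
      apply le_INR in Hgt. rewrite S_INR in Hgt. lra. }
    destruct (IH 1 ltac:(lra)) with (eps := eps) as [C1 [HC1 H1]]; auto.
    { assert (Hl : INR m <= INR n) by (apply le_INR; lia). generalize (pos_INR m). lra. }
    (* down to the integer order [S n], to be read as [n + 1] with fractional part [1] *)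
    destruct (frac_embed_step (S n) g 0 1) as [C2 [HC2 H2]]; try lra.
    exists (C1 + eps * C2). split; [apply Rplus_le_le_0_compat; auto; apply Rmult_le_pos; lra|].
    intros u w Hw. destruct (H2 u w Hw) as [v [Hv Nv]].
    replace (INR (S n) + 0) with (INR n + 1) in Hv by (rewrite S_INR; ring).
    destruct (H1 u v Hv) as [v' [Hv' Nv']]. exists v'. split; auto.
    apply Rle_trans with (1 := Nv'). apply (Rmult_le_compat_l eps) in Nv; lra.
Qed.

(** * Balls of the interpolation spaces *)

(** Balls for the norm of [X^a].  Statements about them avoid naming the image under the power. *)
Definition xball (a r : R) (u : V) : Prop :=
  exists w, frac_pow K a u w /\ norm u + norm w <= r.

Lemma xball_mono a r r' u : r <= r' -> xball a r u -> xball a r' u.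
Proof. intros Hr [w [H1 H2]]. exists w. split; auto. lra. Qed.

Lemma xball_norm a r u : xball a r u -> norm u <= r.
Proof. intros [w [_ H]]. generalize (norm_pos w). lra. Qed.

Lemma xball_nonneg a r u : xball a r u -> 0 <= r.
Proof. intros H. apply Rle_trans with (norm u); [apply norm_pos|now apply xball_norm with a]. Qed.

Lemma xball_lin a r r' u u' (c c' : R) : 0 <= a -> xball a r u -> xball a r' u' ->
  xball a (Rabs c * r + Rabs c' * r') (plus (scal c u) (scal c' u')).
Proof.
  intros Ha [w [H1 H2]] [w' [H1' H2']]. exists (plus (scal c w) (scal c' w')).
  split; [now apply frac_pow_lin|].
  apply Rle_trans with ((norm (scal c u) + norm (scal c' u')) + (norm (scal c w) + norm (scal c' w'))).
  - apply Rplus_le_compat; apply norm_le2; reflexivity.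
  - canon. rewrite !norm_scal_eq.
    assert (P := Rabs_pos c). assert (P' := Rabs_pos c').
    apply (Rmult_le_compat_l _ _ _ P) in H2. apply (Rmult_le_compat_l _ _ _ P') in H2'. clra.
Qed.

Lemma xball_plus a r r' u u' : 0 <= a -> xball a r u -> xball a r' u' -> xball a (r + r') (plus u u').
Proof.
  intros Ha H H'. generalize (xball_lin a r r' u u' 1 1 Ha H H').
  rewrite Rabs_R1, !Rmult_1_l. now replace (plus (scal 1 u) (scal 1 u')) with (plus u u') by vec.
Qed.

Lemma xball_minus a r r' u u' : 0 <= a -> xball a r u -> xball a r' u' -> xball a (r + r') (minus u u').
Proof.
  intros Ha H H'. generalize (xball_lin a r r' u u' 1 (-1) Ha H H').
  rewrite Rabs_R1, Rabs_m1, !Rmult_1_l. now replace (plus (scal 1 u) (scal (-1) u')) with (minus u u') by vec.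
Qed.

Lemma xball_scal a r u (c : R) : 0 <= a -> xball a r u -> xball a (Rabs c * r) (scal c u).
Proof.
  intros Ha H. generalize (xball_lin a r r u u c 0 Ha H H).
  rewrite Rabs_R0, Rmult_0_l, Rplus_0_r. now replace (plus (scal c u) (scal 0 u)) with (scal c u) by vec.
Qed.

Lemma xball_zero a : 0 <= a -> (exists r u, xball a r u) -> xball a 0 zero.
Proof.
  intros Ha [r [u H]]. generalize (xball_scal a r u 0 Ha H).
  rewrite Rabs_R0, Rmult_0_l. now replace (scal 0 u) with (@zero V) by vec.
Qed.

Lemma xball_convex a r : 0 <= a -> convex (xball a r).
Proof.
  intros Ha x y t Ht Hx Hy. generalize (xball_lin a r r x y t (1 - t) Ha Hx Hy).
  apply xball_mono. rewrite !Rabs_right by lra. lra.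
Qed.

Lemma xball_contraction a r u A : 0 <= a -> commuting (T := T) A -> contraction A ->
  xball a r u -> xball a r (A u).
Proof.
  intros Ha HA [_ HA'] [w [H1 H2]]. exists (A w). split; [now apply frac_pow_commute|].
  generalize (HA' u) (HA' w). lra.
Qed.

Lemma xball_S a r t u : 0 <= a -> 0 <= t -> xball a r u -> xball a r (T t u).
Proof. intros Ha Ht. apply xball_contraction; auto; [now apply (commuting_T HT)|apply (csg_contr HT t Ht)]. Qed.

(** Bounded sequences of graph points have convex combinations that converge, so balls stay closed in
    the weaker norm. *)
Lemma xball_closed a r : 0 <= a -> closed_set (xball a r).
Proof.
  intros Ha xn x Hxn Hx.
  (* images of points close to [x], with almost the right norm *)
  set (P := fun n w => exists z, frac_pow K a z w /\ norm (minus z x) <= / (INR n + 1) /\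
    norm w <= r - norm x + / (INR n + 1)).
  destruct (nested_convex_limit Hip P (Rabs r + 1)) as [wn [w [Hwn Hw]]].
  - intros n w1 w2 t Ht [z1 [A1 [B1 D1]]] [z2 [A2 [B2 D2]]].
    exists (plus (scal t z1) (scal (1 - t) z2)). split; [now apply frac_pow_lin|]. split.
    + now apply (convex_ball x (/ (INR n + 1))).
    + generalize (convex_ball (V := V) zero (r - norm x + / (INR n + 1)) w1 w2 t Ht). cbv beta.
      assert (E : forall w : V, norm (minus w zero) = norm w).
      { intros w. f_equal. vec. }
      canon. rewrite !E. auto.
  - intros n w [z [A1 [B1 D1]]]. exists z.
    assert (Hle : / (INR (S n) + 1) <= / (INR n + 1)).
    { apply Rinv_le_contravar; generalize (pos_INR n); rewrite ?S_INR; lra. }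
    repeat split; auto; lra.
  - intros n. destruct (Hx _ (inv_INR_pos n)) as [N HN]. specialize (HN N (le_n N)).
    destruct (Hxn N) as [w [Hw1 Hw2]].
    assert (Hd : norm x <= norm (xn N) + norm (minus (xn N) x)) by (apply norm_le2m; vec).
    exists w. split.
    + exists (xn N). repeat split; auto; clra.
    + assert (P1 := norm_pos (xn N)). generalize (Rle_abs r). lra.
  - destruct (choice _ Hwn) as [zn Hzn].
    exists w. split.
    + apply (frac_pow_closed a zn wn); auto.
      * intros n. apply Hzn.
      * apply lim_to_inv. intros n. apply Hzn.
    + assert (norm w <= r - norm x); [|lra].
      apply (lim_to_norm_le wn); auto. intros eps Heps.
      destruct (inv_INR_small eps Heps) as [N HN]. exists N. intros n Hn. specialize (HN n Hn).
      destruct (Hzn n) as [_ [_ H]]. lra.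
Qed.

Lemma xball_embed a c eps : 0 <= a < c -> 0 < eps -> exists C, 0 <= C /\
  forall r u, xball c r u -> xball a (eps * r + C * norm u) u.
Proof.
  intros Hac Heps. destruct (frac_embed a c eps Hac Heps) as [C [HC H]].
  exists (C + 1). split; [lra|]. intros r u [w [H1 H2]].
  destruct (H u w H1) as [v [Hv Nv]]. exists v. split; auto.
  assert (P := norm_pos u). assert (eps * norm w <= eps * r).
  { apply Rmult_le_compat_l; lra. }
  lra.
Qed.
End Powers.

(** * Function spaces *)

Section FunctionSpace.
Context {d : nat} {Omega : Rd d -> Prop} {X : fun_hilbert Omega}.
Implicit Types u v w : X.

Lemma eqae_refl phi : eqae X phi phi.
Proof.
  apply (hs_negl_sub (f := X)) with (fun _ => False); [|apply hs_negl_empty].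
  intros x H. now apply H.
Qed.

Lemma eqae_sym phi psi : eqae X phi psi -> eqae X psi phi.
Proof. apply hs_negl_sub. intros x H E. now apply H. Qed.

Lemma eqae_trans phi psi chi : eqae X phi psi -> eqae X psi chi -> eqae X phi chi.
Proof.
  intros H1 H2. apply hs_negl_sub with (2 := hs_negl_union H1 H2).
  intros x H. destruct (classic (phi x = psi x)) as [E|E]; [right|left]; auto.
  now rewrite <- E.
Qed.

Lemma eqae_map2 (op : C -> C -> C) phi phi' psi psi' : eqae X phi phi' -> eqae X psi psi' ->
  eqae X (fun x => op (phi x) (psi x)) (fun x => op (phi' x) (psi' x)).
Proof.
  intros H1 H2. apply hs_negl_sub with (2 := hs_negl_union H1 H2).
  intros x H. destruct (classic (phi x = phi' x)) as [E|E]; [right|left]; auto.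
  intros E'. apply H. now rewrite E, E'.
Qed.

Lemma eqae_map1 (op : C -> C) phi phi' : eqae X phi phi' ->
  eqae X (fun x => op (phi x)) (fun x => op (phi' x)).
Proof. intros H. apply (eqae_map2 (fun a _ => op a) phi phi' phi phi'); auto. Qed.

(** The same as [hs_cscal_real], along the inheritance path on which rewriting meets [scal]. *)
Lemma cscal_real (r : R) u :
  hs_cscal (RtoC r) u = @scal R_Ring (NormedModule.ModuleSpace R_AbsRing X) r u.
Proof. apply hs_cscal_real. Qed.

Lemma hs_fun_ext u v : eqae X (hs_fun u) (hs_fun v) -> u = v.
Proof.
  intros H.
  assert (E : minus u v = zero).
  { apply (hs_fun_inj (f := X)). change (eqae X (hs_fun (minus u v)) (fun _ => RtoC 0)).
    apply eqae_trans with (fun x => Cplus (hs_fun u x) (Cmult (RtoC (-1)) (hs_fun v x))).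
    - apply eqae_trans with (fun x => Cplus (hs_fun u x) (hs_fun (opp v) x)); [apply hs_fun_plus|].
      apply eqae_map2; [apply eqae_refl|].
      replace (opp v) with (hs_cscal (RtoC (-1)) v); [apply hs_fun_cscal|].
      rewrite cscal_real. vec.
    - apply eqae_trans with (fun x => Cplus (hs_fun v x) (Cmult (RtoC (-1)) (hs_fun v x))).
      + apply eqae_map2; auto. apply eqae_refl.
      + apply hs_negl_sub with (2 := hs_negl_empty X). intros x Hx. apply Hx.
        unfold Cplus, Cmult, RtoC. simpl. f_equal; ring. }
  apply (vec_from 1 _ _ _ _ E). vec.
Qed.

Lemma conj_plus u v : hs_conj (plus u v) = plus (hs_conj u) (hs_conj v).
Proof.
  apply hs_fun_ext. apply eqae_trans with (1 := hs_fun_conj _).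
  apply eqae_trans with (fun x => Cconj (Cplus (hs_fun u x) (hs_fun v x))).
  { apply eqae_map1. apply hs_fun_plus. }
  apply eqae_trans with (fun x => Cplus (hs_fun (hs_conj u) x) (hs_fun (hs_conj v) x)).
  - apply eqae_trans with (fun x => Cplus (Cconj (hs_fun u x)) (Cconj (hs_fun v x))).
    + replace (fun x => Cconj (Cplus (hs_fun u x) (hs_fun v x)))
        with (fun x => Cplus (Cconj (hs_fun u x)) (Cconj (hs_fun v x))); [apply eqae_refl|].
      apply functional_extensionality. intros x. unfold Cplus, Cconj. simpl. f_equal. ring.
    + apply eqae_sym, eqae_map2; apply hs_fun_conj.
  - apply eqae_sym, hs_fun_plus.
Qed.

Lemma conj_cscal c u : hs_conj (hs_cscal c u) = hs_cscal (Cconj c) (hs_conj u).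
Proof.
  apply hs_fun_ext. apply eqae_trans with (1 := hs_fun_conj _).
  apply eqae_trans with (fun x => Cconj (Cmult c (hs_fun u x))).
  { apply eqae_map1. apply hs_fun_cscal. }
  apply eqae_trans with (fun x => Cmult (Cconj c) (hs_fun (hs_conj u) x)).
  - apply eqae_trans with (fun x => Cmult (Cconj c) (Cconj (hs_fun u x))).
    + replace (fun x => Cconj (Cmult c (hs_fun u x)))
        with (fun x => Cmult (Cconj c) (Cconj (hs_fun u x))); [apply eqae_refl|].
      apply functional_extensionality. intros x. unfold Cmult, Cconj. simpl. f_equal; ring.
    + apply (eqae_map1 (Cmult (Cconj c))). apply eqae_sym, hs_fun_conj.
  - apply eqae_sym, hs_fun_cscal.
Qed.

Lemma conj_conj u : hs_conj (hs_conj u) = u.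
Proof.
  apply hs_fun_ext. apply eqae_trans with (1 := hs_fun_conj _).
  apply eqae_trans with (fun x => Cconj (Cconj (hs_fun u x))).
  { apply eqae_map1. apply hs_fun_conj. }
  replace (fun x => Cconj (Cconj (hs_fun u x))) with (hs_fun u); [apply eqae_refl|].
  apply functional_extensionality. intros x. unfold Cconj. destruct (hs_fun u x). simpl.
  f_equal. ring.
Qed.

Lemma conj_linear : linear (V := X) (W := X) (@hs_conj _ _ X).
Proof.
  split; [apply conj_plus|]. intros r u. rewrite <- !cscal_real.
  etransitivity; [apply conj_cscal|].
  replace (Cconj (RtoC r)) with (RtoC r); [reflexivity|].
  unfold Cconj, RtoC. simpl. f_equal. ring.
Qed.

Lemma conj_minus u v : hs_conj (minus u v) = minus (hs_conj u) (hs_conj v).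
Proof. apply (lin_minus (V := X) (W := X) (@hs_conj _ _ X)). apply conj_linear. Qed.

Lemma conj_scal (r : R) u : hs_conj (scal r u) = scal r (hs_conj u).
Proof. apply conj_linear. Qed.

Lemma conj_contraction : contraction (V := X) (@hs_conj _ _ X).
Proof. split; [apply conj_linear|]. intros u. rewrite hs_conj_isometry. apply Rle_refl. Qed.

Definition rip (u v : X) : R := fst (hs_inner u v).

Lemma rip_inner : real_inner X rip.
Proof.
  unfold rip. split; [|split; [|split]].
  - intros u v. now rewrite (hs_inner_sym v u).
  - intros u v w. now rewrite hs_inner_plus.
  - intros r u v. rewrite <- cscal_real, hs_inner_cscal. simpl. ring.
  - intros u. now rewrite hs_inner_norm.
Qed.

Lemma clinear_linear (A : X -> X) : clinear A -> linear (V := X) (W := X) A.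
Proof.
  intros [H1 H2]. split; auto. intros r u. rewrite <- !cscal_real. apply H2.
Qed.
End FunctionSpace.

(** * The semigroups of [L], its conjugate and their difference *)

Lemma gen_of_right_limits {V : NormedModule R_AbsRing} (K : op V) (T : R -> V -> V) :
  (forall u, T 0 u = u) ->
  (forall u z, K u z <->
    filterlim (fun t => scal (/ t) (minus (T t u) u)) (at_right 0) (locally z)) ->
  gen K T.
Proof.
  intros H0 H u z.
  assert (HR := right_lim_iff (fun t => scal (/ t) (minus (T t u) u)) z).
  assert (E : forall t, 0 < t -> norm (minus (minus (T t u) u) (scal t z))
    = t * norm (minus (scal (/ t) (minus (T t u) u)) z)).
  { intros t Ht. vrep (minus (minus (T t u) u) (scal t z))
      with (scal t (minus (scal (/ t) (minus (T t u) u)) z)).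
    rewrite norm_scal_eq, Rabs_right; auto; lra. }
  split; intros D.
  - apply H in D. generalize (proj1 HR D). clear D. intros D eps Heps.
    destruct (D eps Heps) as [d [Hd D']]. exists d. split; auto. intros t Ht.
    destruct (Req_dec t 0) as [->|Hn].
    + rewrite H0. rewrite norm_0 by vec. lra.
    + rewrite E by lra. rewrite Rmult_comm. apply Rmult_le_compat_r; [lra|].
      left. apply D'. lra.
  - apply H, (proj2 HR). intros eps Heps.
    destruct (D (eps / 2)) as [d [Hd D']]; [lra|]. exists d. split; auto. intros t Ht.
    specialize (D' t ltac:(lra)). rewrite E in D' by lra.
    apply Rle_lt_trans with (eps / 2); [|lra]. apply Rmult_le_reg_l with t; clra.
Qed.

Lemma csg_of_semigroup {d} {Omega : Rd d -> Prop} {X : fun_hilbert Omega} (S : R -> X -> X) :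
  contraction_semigroup S -> csg (V := X) S.
Proof.
  intros [H1 [H2 [H3 [H4 H5]]]]. split; [|split; [|split]]; auto.
  - intros t Ht. split; auto. now apply clinear_linear, H1.
  - intros u. apply (proj1 (right_lim_iff _ _) (H5 u)).
Qed.

Lemma gen_of_semigroup {d} {Omega : Rd d -> Prop} {X : fun_hilbert Omega} (L : op X) (S : R -> X -> X) :
  contraction_semigroup S -> generates_semigroup L S -> gen (V := X) L S.
Proof. intros HS HL. apply gen_of_right_limits; auto. apply HS. Qed.

Section Group.
Context {d : nat} {Omega : Rd d -> Prop} {X : fun_hilbert Omega} {U : R -> X -> X}.
Context (HU : unitary_group U).
Implicit Types u v w : X.

Lemma group_linear t : linear (V := X) (W := X) (U t).
Proof. apply clinear_linear, HU. Qed.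

Lemma group_norm t u : norm (U t u) = norm u.
Proof.
  destruct HU as [_ [_ [_ [H _]]]]. assert (E := H t u u). rewrite !hs_inner_norm in E.
  apply (f_equal fst) in E. simpl in E.
  assert (P1 := norm_pos (V := X) (U t u)). assert (P2 := norm_pos (V := X) u).
  apply Rsqr_inj; auto. unfold Rsqr. lra.
Qed.

Lemma group_contraction t : contraction (V := X) (U t).
Proof. split; [apply group_linear|]. intros u. rewrite group_norm. apply Rle_refl. Qed.

Lemma csg_of_group : csg (V := X) U.
Proof.
  destruct HU as [H1 [H2 [H3 [H4 H5]]]]. split; [|split; [|split]]; auto.
  - intros t _. apply group_contraction.
  - intros u eps Heps.
    destruct (proj1 (filterlim_locally_ball_norm (F := locally 0) (U := X) _ _) (H5 u)
      (mkposreal eps Heps)) as [d0 Hd0].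
    exists d0. split; [apply cond_pos|]. intros t Ht. apply (Hd0 t).
    change (Rabs (t - 0) < d0). rewrite Rabs_right; lra.
Qed.

(** For negative [t], the difference quotient is [U t] applied to the one for [- t]. *)
Lemma gen_of_group (A : op X) : generates_group A U -> gen (V := X) A U.
Proof.
  intros HA. apply gen_of_right_limits; [apply HU|]. intros u z. rewrite (HA u z).
  assert (HR := right_lim_iff (V := X) (fun t => scal (/ t) (minus (U t u) u)) z).
  assert (HP := punctured_lim_iff (V := X) (fun t => scal (/ t) (minus (U t u) u)) z).
  split; intros H0; [apply HR; generalize (proj1 HP H0)|apply HP; generalize (proj1 HR H0)];
    clear H0; intros H eps Heps.
  - destruct (H eps Heps) as [d0 [Hd0 D]]. exists d0. split; auto. intros t Ht.
    apply D; [lra|]. rewrite Rabs_right; lra.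
  - destruct (H (eps / 2)) as [d0 [Hd0 D]]; [lra|].
    destruct (csg_cont0 csg_of_group z (eps / 2)) as [d1 [Hd1 D1]]; [lra|].
    exists (Rmin d0 d1). split; [now apply Rmin_pos|]. intros t Ht0 Ht.
    assert (Ht1 := Rlt_le_trans _ _ _ Ht (Rmin_l d0 d1)).
    assert (Ht2 := Rlt_le_trans _ _ _ Ht (Rmin_r d0 d1)).
    destruct (Rlt_dec 0 t) as [Hp|Hp].
    + rewrite Rabs_right in Ht1 by lra. specialize (D t ltac:(lra)). lra.
    + rewrite Rabs_left in Ht1, Ht2 by lra.
      specialize (D (- t) ltac:(lra)). specialize (D1 (- t) ltac:(lra)).
      destruct HU as [H1 [H2 [H3 _]]]. assert (L := group_linear t).
      assert (E1 : U t (U (- t) u) = u) by (rewrite <- H3, Rplus_opp_r; apply H2).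
      assert (E2 : U t (U (- t) z) = z) by (rewrite <- H3, Rplus_opp_r; apply H2).
      assert (E : minus (scal (/ t) (minus (U t u) u)) z =
        plus (U t (minus (scal (/ - t) (minus (U (- t) u) u)) z)) (opp (U t (minus (U (- t) z) z)))).
      { canon. rewrite (lin_minus (U t)), (lin_scal (U t)), !(lin_minus (U t)) by auto.
        rewrite E1, E2. vec. }
      apply Rle_lt_trans with (norm (minus (scal (/ - t) (minus (U (- t) u) u)) z) + norm (minus (U (- t) z) z)).
      * apply Rle_trans with (1 := norm_le2 _ _ _ E). canon. rewrite norm_opp.
        right. f_equal; apply group_norm.
      * clra.
Qed.
End Group.

Section Bar.
Context {d : nat} {Omega : Rd d -> Prop} {X : fun_hilbert Omega} {L : op X} {S : R -> X -> X}.
Context (HS : csg (V := X) S) (HL : gen (V := X) L S).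
Implicit Types u v w : X.

(** The semigroup of the conjugate operator. *)
Definition bar_sg (t : R) (u : X) : X := hs_conj (S t (hs_conj u)).

Lemma bar_csg : csg (V := X) bar_sg.
Proof.
  unfold bar_sg. split; [|split; [|split]].
  - intros t Ht. assert (C := csg_contr HS t Ht).
    apply (contraction_comp (V := X) (@hs_conj _ _ X) (fun u => S t (hs_conj u)));
      [apply conj_contraction|].
    apply (contraction_comp (V := X)); auto. apply conj_contraction.
  - intros u. rewrite (csg_0 HS). apply conj_conj.
  - intros s t u Hs Ht. now rewrite (csg_plus HS), conj_conj by auto.
  - intros u eps Heps. destruct (csg_cont0 HS (hs_conj u) eps Heps) as [d0 [Hd0 D]].
    exists d0. split; auto. intros t Ht. specialize (D t ltac:(lra)).
    apply Rle_lt_trans with (2 := D). right.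
    transitivity (norm (hs_conj (minus (S t (hs_conj u)) (hs_conj u)))); [|apply hs_conj_isometry].
    f_equal. rewrite conj_minus, conj_conj. reflexivity.
Qed.

Lemma bar_gen : gen (V := X) (bar_op L) bar_sg.
Proof.
  intros u z. unfold bar_op. rewrite (HL (hs_conj u) (hs_conj z)). unfold bar_sg.
  assert (E : forall t, norm (minus (minus (S t (hs_conj u)) (hs_conj u)) (scal t (hs_conj z)))
    = norm (minus (minus (hs_conj (S t (hs_conj u))) u) (scal t z))).
  { intros t.
    transitivity (norm (hs_conj (minus (minus (S t (hs_conj u)) (hs_conj u)) (scal t (hs_conj z)))));
      [symmetry; apply hs_conj_isometry|].
    f_equal. rewrite !conj_minus, conj_scal, !conj_conj. reflexivity. }
  split; intros H eps Heps; destruct (H eps Heps) as [d0 [Hd0 D]]; exists d0; split; auto;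
    intros t Ht; specialize (D t Ht); rewrite E in *; auto; now rewrite <- E in D.
Qed.
End Bar.

(** * Commuting semigroups *)

Lemma quadratic_const {V : NormedModule R_AbsRing} (h : R -> V) a b C : a <= b -> 0 <= C ->
  (forall s t, a <= s <= t -> t <= b -> norm (minus (h t) (h s)) <= C * (t - s) ^ 2) -> h b = h a.
Proof.
  intros Hab HC H. apply small_const; auto. intros eps Heps. exists (eps / (C + 1)).
  split; [apply Rdiv_lt_0_compat; lra|]. intros s t Hs Ht Hst.
  apply Rle_trans with (1 := H s t Hs Ht).
  assert (D : (C + 1) * (t - s) <= eps).
  { replace eps with ((C + 1) * (eps / (C + 1))) by (field; lra). apply Rmult_le_compat_l; lra. }
  simpl. nra.
Qed.

Section Commute.
Context {V : CompleteNormedModule R_AbsRing} {T : R -> V -> V} {K : op V}.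
Context (HT : csg T) (HK : gen K T).
Implicit Types u v w x y z : V.

Lemma gen_square_dense u eps : 0 < eps ->
  exists v z w, K v z /\ K z w /\ norm (minus v u) < eps.
Proof.
  intros Heps.
  destruct (avg_lim HT (fun n => / (INR n + 1)) u (fun n => conj (inv_INR_pos n) (Rle_refl _)) (eps / 2))
    as [N HN]; [lra|]. specialize (HN N (le_n N)). set (e := / (INR N + 1)) in *.
  assert (He : 0 < e) by apply inv_INR_pos.
  set (v := avg (T := T) e u) in *. assert (Hv := avg_gen HT HK e u He). fold v in Hv.
  destruct (avg_lim HT (fun n => / (INR n + 1)) v (fun n => conj (inv_INR_pos n) (Rle_refl _)) (eps / 2))
    as [N' HN']; [lra|]. specialize (HN' N' (le_n N')). set (e' := / (INR N' + 1)) in *.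
  assert (He' : 0 < e') by apply inv_INR_pos.
  exists (avg (T := T) e' v), (scal (/ e') (minus (T e' v) v)),
    (scal (/ e') (minus (T e' (scal (/ e) (minus (T e u) u))) (scal (/ e) (minus (T e u) u)))).
  split; [now apply avg_gen|]. split.
  - apply (gen_scal HT HK). apply (gen_minus HT HK); auto. apply (gen_orbit HT HK); auto. lra.
  - apply Rle_lt_trans with (norm (minus (avg (T := T) e' v) v) + norm (minus v u)).
    + apply norm_le2. vec.
    + clra.
Qed.

(** [T(t-r) A T(r) u] is constant in [r]: on the domain of [K^2] its increments are quadratically small. *)
Lemma commute_of_gen A : bounded A -> (forall u z, K u z -> K (A u) (A z)) ->
  forall t u, 0 <= t -> A (T t u) = T t (A u).
Proof.
  intros HA HC t u Ht. destruct (bounded_pos A HA) as [k [Hk Hb]]. destruct HA as [HA _].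
  assert (H0 : forall v z w, K v z -> K z w -> A (T t v) = T t (A v)).
  { intros v z w Hv Hz.
    assert (Pw : 0 <= 2 * (k * norm w)) by (generalize (Rmult_le_pos k _ (Rlt_le _ _ Hk) (norm_pos w)); lra).
    assert (E := quadratic_const (fun r => T (t - r) (A (T r v))) 0 t (2 * (k * norm w)) Ht Pw).
    cbv beta in E. rewrite Rminus_diag, Rminus_0_r, !(csg_0 HT) in E. apply E. clear E.
    intros s r Hs Hr. replace (t - s) with ((t - r) + (r - s)) by ring.
    rewrite (csg_plus HT (t - r)) by lra. canon. rewrite <- (csg_sub HT) by lra.
    apply Rle_trans with (1 := csg_norm HT (t - r) _ ltac:(lra)).
    set (e := r - s). assert (He : 0 <= e) by (unfold e; lra).
    replace r with (e + s) by (unfold e; ring). rewrite (csg_plus HT e) by lra.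
    set (y := T s v). assert (Hy : K y (T s z)) by (apply (gen_orbit HT HK); auto; lra).
    assert (Hy' : K (T s z) (T s w)) by (apply (gen_orbit HT HK); auto; lra).
    assert (D1 := gen_taylor2 HT HK y (T s z) (T s w) e Hy Hy' He).
    assert (D2 := gen_taylor2 HT HK (A y) (A (T s z)) (A (T s w)) e (HC _ _ Hy) (HC _ _ Hy') He).
    assert (N1 := csg_norm HT s w ltac:(lra)).
    assert (N2 := Hb (T s w)). assert (N3 := Hb (minus (minus (T e y) y) (scal e (T s z)))).
    apply Rle_trans with (norm (A (minus (minus (T e y) y) (scal e (T s z))))
      + norm (minus (minus (T e (A y)) (A y)) (scal e (A (T s z))))).
    - apply norm_le2m. canon. rewrite !(lin_minus A), (lin_scal A) by auto. vec.
    - apply Rle_trans with (k * (e * (e * norm w)) + e * (e * (k * norm w))); [|right; ring].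
      apply Rplus_le_compat.
      + apply Rle_trans with (1 := N3). apply Rmult_le_compat_l; [lra|].
        apply Rle_trans with (1 := D1). apply Rmult_le_compat_l; auto. apply Rmult_le_compat_l; auto.
      + apply Rle_trans with (1 := D2). apply Rmult_le_compat_l; auto. apply Rmult_le_compat_l; auto.
        apply Rle_trans with (1 := N2). apply Rmult_le_compat_l; lra. }
  apply minus_eq, le_eps. intros eps Heps.
  destruct (gen_square_dense u (eps / (2 * k))) as [v [z [w [Hv [Hz Hd]]]]].
  { apply Rdiv_lt_0_compat; lra. }
  apply Rle_trans with (norm (A (T t (minus v u))) + norm (T t (A (minus v u)))).
  - rewrite Rplus_comm. apply norm_le2m. canon.
    rewrite !(csg_sub HT), !(lin_minus A), (csg_sub HT) by auto. rewrite (H0 v z w) by auto. vec.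
  - assert (N1 := csg_norm HT t (A (minus v u)) Ht). assert (N2 := Hb (minus v u)).
    assert (N3 := csg_norm HT t (minus v u) Ht). assert (N4 := Hb (T t (minus v u))).
    apply (Rmult_le_compat_l k) in N3; [|lra]. apply (Rmult_lt_compat_l k) in Hd; auto.
    replace (k * (eps / (2 * k))) with (eps / 2) in Hd by (field; lra). clra.
Qed.
End Commute.

(** [K] commutes with the difference quotients of [T'], and it is closed. *)
Lemma gen_gen {V : CompleteNormedModule R_AbsRing} {T T' : R -> V -> V} {K K' : op V}
    (HT : csg T) (HK : gen K T) (HT' : csg T') (HK' : gen K' T')
    (HC : forall s t u, 0 <= s -> 0 <= t -> T s (T' t u) = T' t (T s u)) u a z z' :
  K u a -> K' u z -> K' a z' -> K z z'.
Proof.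
  intros Ha Hz Hz'.
  apply (gen_closed HT HK (fun n => scal (INR n + 1) (minus (T' (/ (INR n + 1)) u) u))
    (fun n => scal (INR n + 1) (minus (T' (/ (INR n + 1)) a) a))).
  - intros n. assert (P := inv_INR_pos n). apply (gen_scal HT HK), (gen_minus HT HK); auto.
    apply (gen_commute HK (T' (/ (INR n + 1)))); auto.
    + apply contraction_bounded, (csg_contr HT'). lra.
    + intros t x Ht. symmetry. apply HC; lra.
  - now apply (gen_quotient_lim HK').
  - now apply (gen_quotient_lim HK').
Qed.

(** * Regular vectors *)

Lemma bounded_comp {V W Z : NormedModule R_AbsRing} (B : W -> Z) (A : V -> W) :
  bounded B -> bounded A -> bounded (fun u => B (A u)).
Proof.
  intros HB HA. destruct (bounded_pos B HB) as [k [Hk Hkb]]. destruct (bounded_pos A HA) as [l [Hl Hlb]].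
  destruct HB as [[B1 B2] _]. destruct HA as [[A1 A2] _]. split; [split|].
  - intros u v. now rewrite A1, B1.
  - intros r u. now rewrite A2, B2.
  - exists (k * l). intros u. apply Rle_trans with (1 := Hkb _). rewrite Rmult_assoc.
    apply Rmult_le_compat_l; auto. lra.
Qed.

Lemma avg_gen_near {V : CompleteNormedModule R_AbsRing} {T : R -> V -> V} {K : op V}
  (HT : csg T) (HK : gen K T) e u (z : V) : 0 < e -> K u z -> norm (minus (avg (T := T) e u) u) <= e * norm z.
Proof.
  intros He Hz. apply (avg_near HT); auto. intros s Hs.
  apply Rle_trans with (1 := gen_lipschitz HT HK u z s Hz (proj1 Hs)).
  apply Rmult_le_compat_r; [apply norm_pos|lra].
Qed.

Section Regular.
Context {d : nat} {Omega : Rd d -> Prop} {X : fun_hilbert Omega} {L : op X} {S : R -> X -> X}.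
Context (HS : csg (V := X) S) (HL : gen (V := X) L S) (HC : commutes_with_bar S).
Implicit Types u v w x y z a b : X.

Notation Sb := (bar_sg (S := S)).
Notation Lb := (bar_op L).
Notation HSb := (bar_csg HS).
Notation HLb := (bar_gen HL).

Lemma S_Sb s t u : 0 <= s -> 0 <= t -> S s (Sb t u) = Sb t (S s u).
Proof. intros Hs Ht. now apply HC. Qed.

(** Such operators commute with [L], its conjugate, [A] and the fractional powers, and they keep
    vectors regular. *)
Definition bicomm (A : X -> X) : Prop :=
  bounded (V := X) (W := X) A /\
  (forall t u, 0 <= t -> A (S t u) = S t (A u)) /\
  (forall t u, 0 <= t -> A (Sb t u) = Sb t (A u)).

Lemma bicomm_commuting A : bicomm A -> commuting (V := X) (T := S) A.
Proof. intros [H1 [H2 _]]. now split. Qed.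

Lemma bicomm_L A u a : bicomm A -> L u a -> L (A u) (A a).
Proof. intros [H1 [H2 _]]. now apply (gen_commute (V := X) HL). Qed.

Lemma bicomm_Lb A u a : bicomm A -> Lb u a -> Lb (A u) (A a).
Proof. intros [H1 [_ H2]]. now apply (gen_commute (V := X) HLb). Qed.

Lemma bicomm_S t : 0 <= t -> bicomm (S t).
Proof.
  intros Ht. split; [|split].
  - apply contraction_bounded, (csg_contr HS t Ht).
  - intros s u Hs. now apply (csg_comm HS).
  - intros s u Hs. now apply S_Sb.
Qed.

Lemma bicomm_Sb t : 0 <= t -> bicomm (Sb t).
Proof.
  intros Ht. split; [|split].
  - apply contraction_bounded, (csg_contr HSb t Ht).
  - intros s u Hs. symmetry. now apply S_Sb.
  - intros s u Hs. now apply (csg_comm HSb).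
Qed.

Lemma bicomm_comp A B : bicomm A -> bicomm B -> bicomm (fun u => A (B u)).
Proof.
  intros [A1 [A2 A3]] [B1 [B2 B3]]. split; [|split].
  - now apply (bounded_comp (V := X) (W := X) (Z := X)).
  - intros t u Ht. now rewrite B2, A2.
  - intros t u Ht. now rewrite B3, A3.
Qed.

Lemma bicomm_quotient A e : 0 < e -> bicomm A -> bicomm (fun u => scal (/ e) (minus (A u) u)).
Proof.
  intros He [A1 [A2 A3]]. destruct (bounded_pos (V := X) (W := X) A A1) as [k [Hk Hkb]].
  destruct A1 as [A1 _]. split; [split; [split|]|split].
  - intros u v. canon. rewrite (lin_plus A) by auto. vec.
  - intros r u. canon. rewrite (lin_scal A) by auto. vec.
  - exists (/ e * (k + 1)). intros u. canon. rewrite norm_scal_eq, Rabs_right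
      by (apply Rle_ge, Rlt_le, Rinv_0_lt_compat; auto).
    rewrite Rmult_assoc. apply Rmult_le_compat_l; [left; now apply Rinv_0_lt_compat|].
    apply Rle_trans with (norm (A u) + norm u); [apply norm_le2m; vec|].
    generalize (Hkb u). clra.
  - intros t u Ht. rewrite A2 by auto. canon. rewrite (csg_scal HS), (csg_sub HS) by auto. vec.
  - intros t u Ht. rewrite A3 by auto. canon. rewrite (csg_scal HSb), (csg_sub HSb) by auto. vec.
Qed.

Lemma bicomm_avg_S e : 0 < e -> bicomm (avg (V := X) (T := S) e).
Proof.
  intros He. split; [|split].
  - apply contraction_bounded, (avg_contraction HS e He).
  - intros t u Ht. symmetry. apply (avg_commute HS (S t)); apply (bicomm_S t Ht).
  - intros t u Ht. symmetry. apply (avg_commute HS (Sb t)); apply (bicomm_Sb t Ht).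
Qed.

Lemma bicomm_avg_Sb e : 0 < e -> bicomm (avg (V := X) (T := Sb) e).
Proof.
  intros He. split; [|split].
  - apply contraction_bounded, (avg_contraction HSb e He).
  - intros t u Ht. symmetry. apply (avg_commute HSb (S t)); apply (bicomm_S t Ht).
  - intros t u Ht. symmetry. apply (avg_commute HSb (Sb t)); apply (bicomm_Sb t Ht).
Qed.

(** ** Smoothing *)

Definition twice_avg (e : R) (u : X) : X := avg (V := X) (T := S) e (avg (V := X) (T := Sb) e u).

Lemma twice_avg_bicomm e : 0 < e -> bicomm (twice_avg e).
Proof.
  intros He. apply (bicomm_comp (avg (V := X) (T := S) e) (avg (V := X) (T := Sb) e));
    [now apply bicomm_avg_S|now apply bicomm_avg_Sb].
Qed.

Lemma twice_avg_contraction e : 0 < e -> contraction (V := X) (twice_avg e).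
Proof.
  intros He.
  apply (contraction_comp (V := X) (avg (V := X) (T := S) e) (avg (V := X) (T := Sb) e)); [apply (avg_contraction HS e He)|apply (avg_contraction HSb e He)].
Qed.

Lemma bicomm_twice_avg A e u : 0 < e -> bicomm A -> A (twice_avg e u) = twice_avg e (A u).
Proof.
  intros He [A1 [A2 A3]]. unfold twice_avg.
  rewrite (avg_commute HS A), (avg_commute HSb A); auto.
Qed.

Lemma twice_avg_near e u a b : 0 < e -> L u a -> Lb u b ->
  norm (minus (twice_avg e u) u) <= e * (norm a + norm b).
Proof.
  intros He Ha Hb. unfold twice_avg. assert (C := avg_contraction HS e He).
  apply Rle_trans with (norm (avg (V := X) (T := S) e (minus (avg (V := X) (T := Sb) e u) u))
    + norm (minus (avg (V := X) (T := S) e u) u)).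
  - apply norm_le2. canon. rewrite (lin_minus (avg (V := X) (T := S) e)) by apply C. vec.
  - rewrite Rmult_plus_distr_l, Rplus_comm. apply Rplus_le_compat.
    + now apply (avg_gen_near HS HL).
    + apply Rle_trans with (1 := proj2 C _). now apply (avg_gen_near HSb HLb).
Qed.

Definition half (k : nat) : R := (/ 2) ^ k.

Lemma half_pos k : 0 < half k.
Proof. apply pow_lt. lra. Qed.

(** The infinite product of the averages over [[0, 2^-k]], [k >= j], converges strongly, and it has
    infinitely many smoothing factors. *)
Fixpoint prod_avg (j m : nat) (u : X) : X :=
  match m with
  | O => u
  | Datatypes.S m => twice_avg (half (j + m)) (prod_avg j m u)
  end.

Lemma prod_avg_bicomm j m : bicomm (prod_avg j m).
Proof.
  induction m as [|m IH]; simpl.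
  - split; [|split]; auto. split; [split; auto|]. exists 1. intros u. rewrite Rmult_1_l. apply Rle_refl.
  - apply (bicomm_comp (twice_avg (half (j + m))) (prod_avg j m)); auto. apply twice_avg_bicomm, half_pos.
Qed.

Lemma prod_avg_contraction j m : contraction (V := X) (prod_avg j m).
Proof.
  induction m as [|m IH]; simpl.
  - split; [split; auto|]. intros u. apply Rle_refl.
  - apply (contraction_comp (V := X) (twice_avg (half (j + m))) (prod_avg j m)); auto.
    apply twice_avg_contraction, half_pos.
Qed.

Lemma bicomm_prod_avg A j m u : bicomm A -> A (prod_avg j m u) = prod_avg j m (A u).
Proof.
  intros HA. induction m as [|m IH]; simpl; auto.
  now rewrite bicomm_twice_avg, IH by (auto; apply half_pos).
Qed.

Lemma prod_avg_first j m u :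
  prod_avg j (Datatypes.S m) u = twice_avg (half j) (prod_avg (Datatypes.S j) m u).
Proof.
  induction m as [|m IH].
  - simpl. now rewrite Nat.add_0_r.
  - change (prod_avg j (Datatypes.S (Datatypes.S m)) u)
      with (twice_avg (half (j + Datatypes.S m)) (prod_avg j (Datatypes.S m) u)).
    rewrite IH. rewrite (bicomm_twice_avg (twice_avg (half (j + Datatypes.S m))))
      by (try apply twice_avg_bicomm; apply half_pos).
    simpl. now rewrite Nat.add_succ_r.
Qed.

(** Telescoping: the factor with index [k] moves a vector by at most [2^-k] times the norms of its images. *)
Lemma prod_avg_step j m u a b : L u a -> Lb u b ->
  norm (minus (prod_avg j m u) u) <= 2 * (half j - half (j + m)) * (norm a + norm b).
Proof.
  intros Ha Hb. induction m as [|m IH]; simpl.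
  - rewrite norm_0 by vec. rewrite Nat.add_0_r. lra.
  - assert (HB := prod_avg_bicomm j m).
    assert (H := twice_avg_near (half (j + m)) _ _ _ (half_pos _) (bicomm_L _ _ _ HB Ha) (bicomm_Lb _ _ _ HB Hb)).
    assert (N1 := proj2 (prod_avg_contraction j m) a). assert (N2 := proj2 (prod_avg_contraction j m) b).
    assert (P := half_pos (j + m)).
    assert (E : half (j + Datatypes.S m) = half (j + m) / 2).
    { rewrite Nat.add_succ_r. unfold half. simpl. field. }
    rewrite E.
    apply Rle_trans with (norm (minus (twice_avg (half (j + m)) (prod_avg j m u)) (prod_avg j m u))
      + norm (minus (prod_avg j m u) u)); [apply norm_le2; vec|].
    assert (H' : half (j + m) * (norm (prod_avg j m a) + norm (prod_avg j m b))
      <= half (j + m) * (norm a + norm b)) by (apply Rmult_le_compat_l; lra).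
    canon. canon in H. canon in IH. canon in H'. lra.
Qed.

Lemma regular_dense_pair u eps : 0 < eps ->
  exists v a b, L v a /\ Lb v b /\ norm (minus v u) < eps.
Proof.
  intros Heps.
  assert (Hl := fun (T : R -> X -> X) (HT : csg (V := X) T) u => avg_lim HT (fun n => / (INR n + 1)) u
    (fun n => conj (inv_INR_pos n) (Rle_refl _)) (eps / 2) ltac:(lra)).
  destruct (Hl Sb HSb u) as [N HN]. specialize (HN N (le_n N)). set (e := / (INR N + 1)) in *.
  assert (He : 0 < e) by apply inv_INR_pos. set (v := avg (V := X) (T := Sb) e u) in *.
  destruct (Hl S HS v) as [N' HN']. specialize (HN' N' (le_n N')). set (e' := / (INR N' + 1)) in *.
  assert (He' : 0 < e') by apply inv_INR_pos.
  exists (avg (V := X) (T := S) e' v), (scal (/ e') (minus (S e' v) v)),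
    (avg (V := X) (T := S) e' (scal (/ e) (minus (Sb e u) u))).
  split; [now apply (avg_gen HS HL)|]. split.
  - apply (bicomm_Lb (avg (V := X) (T := S) e')); [now apply bicomm_avg_S|].
    now apply (avg_gen HSb HLb).
  - apply Rle_lt_trans with (norm (minus (avg (V := X) (T := S) e' v) v) + norm (minus v u)).
    + apply norm_le2. vec.
    + clra.
Qed.

Lemma half_small eps : 0 < eps -> exists j, forall k, (j <= k)%nat -> half k < eps.
Proof.
  intros Heps. destruct (pow_lt_1_zero (/ 2)) with (y := eps) as [N HN]; auto.
  { rewrite Rabs_right; lra. }
  exists N. intros k Hk. specialize (HN k Hk). unfold half.
  rewrite Rabs_right in HN; auto. left. apply half_pos.
Qed.

(** First on the common domain of [L] and its conjugate; contractivity gives the rest. *)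
Lemma prod_avg_near u eps : 0 < eps -> exists j, forall k m, (j <= k)%nat ->
  norm (minus (prod_avg k m u) u) < eps.
Proof.
  intros Heps. destruct (regular_dense_pair u (eps / 4)) as [v [a [b [Ha [Hb Hv]]]]]; [lra|].
  assert (Pa := norm_pos (V := X) a). assert (Pb := norm_pos (V := X) b).
  destruct (half_small (eps / 4 / (norm a + norm b + 1))) as [j Hj]; [apply Rdiv_lt_0_compat; lra|].
  exists j. intros k m Hk. specialize (Hj k Hk).
  assert (H := prod_avg_step k m v a b Ha Hb). assert (C := prod_avg_contraction k m).
  assert (N := proj2 C (minus v u)). assert (P := half_pos (k + m)). assert (P' := half_pos k).
  apply Rle_lt_trans with (norm (prod_avg k m (minus v u)) + norm (minus (prod_avg k m v) v) + norm (minus v u)).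
  - apply Rle_trans with (norm (minus (minus (prod_avg k m v) v) (prod_avg k m (minus v u))) + norm (minus v u)).
    + apply norm_le2. canon. rewrite (lin_minus (prod_avg k m)) by apply C. vec.
    + apply Rplus_le_compat_r. rewrite Rplus_comm. apply norm_le2m. reflexivity.
  - assert (H' : half k * (norm a + norm b) <= eps / 4).
    { apply Rle_trans with (eps / 4 / (norm a + norm b + 1) * (norm a + norm b + 1)).
      - apply Rmult_le_compat; lra.
      - right. field. lra. }
    assert (H'' : 2 * (half k - half (k + m)) * (norm a + norm b) <= 2 * (half k * (norm a + norm b))).
    { assert (0 <= half (k + m) * (norm a + norm b)) by (apply Rmult_le_pos; lra). lra. }
    clra.
Qed.

Lemma prod_avg_split j m n u : prod_avg j (m + n) u = prod_avg (j + m) n (prod_avg j m u).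
Proof.
  induction n as [|n IH].
  - now rewrite Nat.add_0_r.
  - rewrite Nat.add_succ_r. simpl. now rewrite IH, Nat.add_assoc.
Qed.

Lemma prod_avg_cauchy j u : exists v, lim_to (V := X) (fun m => prod_avg j m u) v.
Proof.
  apply (cauchy_lim (V := X)). intros eps Heps.
  destruct (prod_avg_near u (eps / 2)) as [k Hk]; [lra|].
  assert (H : forall m, (k <= m)%nat -> norm (minus (prod_avg j m u) (prod_avg j k u)) < eps / 2).
  { intros m Hm. replace m with (k + (m - k))%nat by lia. rewrite prod_avg_split.
    rewrite <- (bicomm_prod_avg (prod_avg j k)) by apply prod_avg_bicomm.
    assert (C := prod_avg_contraction j k). canon. rewrite <- (lin_minus (prod_avg j k)) by apply C.
    apply Rle_lt_trans with (1 := proj2 C _). apply Hk. lia. }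
  exists k. intros n m Hn Hm. assert (H1 := H n Hn). assert (H2 := H m Hm).
  apply Rle_lt_trans with (norm (minus (prod_avg j n u) (prod_avg j k u))
    + norm (minus (prod_avg j m u) (prod_avg j k u))); [apply norm_le2m; vec|]. lra.
Qed.

Definition mollify (j : nat) (u : X) : X :=
  epsilon (inhabits zero) (fun v => lim_to (V := X) (fun m => prod_avg j m u) v).

Lemma mollify_spec j u : lim_to (V := X) (fun m => prod_avg j m u) (mollify j u).
Proof. unfold mollify. apply epsilon_spec. apply prod_avg_cauchy. Qed.

Lemma mollify_commute A j u : bicomm A -> A (mollify j u) = mollify j (A u).
Proof.
  intros HA. apply (lim_to_unique (V := X) (fun m => A (prod_avg j m u))).
  - apply (bounded_lim (V := X) (W := X) A); [apply HA|apply mollify_spec].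
  - apply lim_to_ext with (fun m => prod_avg j m (A u)); [|apply mollify_spec].
    intros m. symmetry. now apply bicomm_prod_avg.
Qed.

Lemma mollify_contraction j : contraction (V := X) (mollify j).
Proof.
  assert (C := fun m => prod_avg_contraction j m). split; [split|].
  - intros u v. apply (lim_to_unique (V := X) (fun m => prod_avg j m (plus u v))); [apply mollify_spec|].
    apply lim_to_ext with (fun m => plus (prod_avg j m u) (prod_avg j m v)).
    + intros m. symmetry. apply (C m).
    + apply (lim_to_plus (V := X)); apply mollify_spec.
  - intros r u. apply (lim_to_unique (V := X) (fun m => prod_avg j m (scal r u))); [apply mollify_spec|].
    apply lim_to_ext with (fun m => scal r (prod_avg j m u)).
    + intros m. symmetry. apply (C m).
    + apply (lim_to_scal (V := X)). apply mollify_spec.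
  - intros u. apply (lim_to_norm_le (V := X) (fun m => prod_avg j m u)); [apply mollify_spec|].
    intros eps Heps. exists O. intros m _. generalize (proj2 (C m) u). lra.
Qed.

Lemma mollify_bicomm j : bicomm (mollify j).
Proof.
  split; [|split].
  - apply contraction_bounded, mollify_contraction.
  - intros t u Ht. symmetry. apply mollify_commute. now apply bicomm_S.
  - intros t u Ht. symmetry. apply mollify_commute. now apply bicomm_Sb.
Qed.

Lemma mollify_lim u : lim_to (V := X) (fun j => mollify j u) u.
Proof.
  intros eps Heps. destruct (prod_avg_near u (eps / 2)) as [j Hj]; [lra|].
  exists j. intros k Hk. apply Rle_lt_trans with (eps / 2); [|lra].
  apply (lim_to_norm_le (V := X) (fun m => minus (prod_avg k m u) u)).
  - canon. apply (lim_to_minus (V := X)); [apply mollify_spec|apply lim_to_const].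
  - intros e He. exists O. intros m _. specialize (Hj k m Hk). clra.
Qed.

Lemma mollify_first j u : mollify j u = twice_avg (half j) (mollify (Datatypes.S j) u).
Proof.
  apply (lim_to_unique (V := X) (fun m => prod_avg j (Datatypes.S m) u)).
  - intros eps Heps. destruct (mollify_spec j u eps Heps) as [N HN]. exists N.
    intros n Hn. apply (HN (Datatypes.S n)). lia.
  - apply lim_to_ext with (fun m => twice_avg (half j) (prod_avg (Datatypes.S j) m u)).
    + intros m. symmetry. apply prod_avg_first.
    + apply (bounded_lim (V := X) (W := X) (twice_avg (half j))); [|apply mollify_spec].
      apply (twice_avg_bicomm (half j) (half_pos j)).
Qed.

(** Each application of [L] or its conjugate uses up one factor of the product. *)
Lemma mollify_regular j u : regular L (mollify j u).
Proof.
  intros N. revert j u. induction N as [|N IH]; intros j u.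
  - simpl. now exists (norm (mollify j u)).
  - assert (P := half_pos j).
    (* composed with the first factor, [L] and its conjugate become the bounded [D1] and [D2] *)
    set (D1 := fun y => scal (/ half j) (minus (S (half j) (avg (V := X) (T := Sb) (half j) y))
      (avg (V := X) (T := Sb) (half j) y))).
    set (D2 := fun y => scal (/ half j) (minus (Sb (half j) (avg (V := X) (T := S) (half j) y))
      (avg (V := X) (T := S) (half j) y))).
    assert (B1 : bicomm D1).
    { apply (bicomm_comp (fun u => scal (/ half j) (minus (S (half j) u) u))).
      - apply bicomm_quotient; auto. apply bicomm_S. lra.
      - now apply bicomm_avg_Sb. }
    assert (B2 : bicomm D2).
    { apply (bicomm_comp (fun u => scal (/ half j) (minus (Sb (half j) u) u))).
      - apply bicomm_quotient; auto. apply bicomm_Sb. lra.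
      - now apply bicomm_avg_S. }
    set (y := mollify (Datatypes.S j) u).
    assert (H1 : L (mollify j u) (D1 y)).
    { rewrite mollify_first. apply (avg_gen HS HL (half j)); auto. }
    assert (H2 : Lb (mollify j u) (D2 y)).
    { rewrite mollify_first. unfold twice_avg.
      rewrite (avg_commute HSb (avg (V := X) (T := S) (half j))) by apply (bicomm_avg_S _ P).
      apply (avg_gen HSb HLb (half j)); auto. }
    unfold y in H1, H2. rewrite mollify_commute in H1 by auto. rewrite mollify_commute in H2 by auto.
    destruct (IH j u) as [r0 R0]. destruct (IH (Datatypes.S j) (D1 u)) as [r1 R1].
    destruct (IH (Datatypes.S j) (D2 u)) as [r2 R2].
    exists (r0 + r1 + r2). simpl. exists (mollify (Datatypes.S j) (D1 u)), (mollify (Datatypes.S j) (D2 u)), r0, r1, r2.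
    repeat split; auto.
Qed.

(** ** Operations that keep regularity *)

Lemma regular_L u : regular L u -> exists a, L u a /\ regular L a.
Proof.
  intros H. destruct (H 1%nat) as [r [a [b [r0 [r1 [r2 [Ha _]]]]]]]. exists a. split; auto.
  intros N. destruct (H (Datatypes.S N)) as [r' [a' [b' [r0' [r1' [r2' [Ha' [_ [_ [Hr _]]]]]]]]]].
  exists r1'. now rewrite (gen_unique HL u a a' Ha Ha').
Qed.

Lemma regular_Lb u : regular L u -> exists b, Lb u b /\ regular L b.
Proof.
  intros H. destruct (H 1%nat) as [r [a [b [r0 [r1 [r2 [_ [Hb _]]]]]]]]. exists b. split; auto.
  intros N. destruct (H (Datatypes.S N)) as [r' [a' [b' [r0' [r1' [r2' [_ [Hb' [_ [_ [Hr _]]]]]]]]]]].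
  exists r2'. now rewrite (gen_unique HLb u b b' Hb Hb').
Qed.

Lemma regular_conj u : regular L u -> regular L (hs_conj u).
Proof.
  intros H N. destruct (H N) as [r Hr]. exists r. clear H. revert u r Hr.
  induction N as [|N IH]; simpl; intros u r.
  - intros ->. now rewrite hs_conj_isometry.
  - intros [a [b [r0 [r1 [r2 [Ha [Hb [H0 [H1 [H2 ->]]]]]]]]]].
    exists (hs_conj b), (hs_conj a), r0, r2, r1. split; [exact Hb|]. split.
    + unfold bar_op. now rewrite !conj_conj.
    + repeat split; auto. ring.
Qed.

(** Words in [L] and its conjugate pass through [f], so only the bound of [f] in norm is lost. *)
Lemma graph_norm_map (f : X -> X) (m : nat) (k : R) :
  (forall u a, regular L u -> L u a -> L (f u) (f a)) ->
  (forall u b, regular L u -> Lb u b -> Lb (f u) (f b)) ->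
  (forall u r, regular L u -> graph_norm L m u r -> norm (f u) <= k * r) ->
  forall N u r, regular L u -> graph_norm L (N + m) u r ->
    exists r', graph_norm L N (f u) r' /\ r' <= k * r.
Proof.
  intros H1 H2 H3 N. induction N as [|N IH]; intros u r Hu Hr.
  - exists (norm (f u)). split; [reflexivity|]. now apply H3.
  - destruct Hr as [a [b [r0 [r1 [r2 [Ha [Hb [R0 [R1 [R2 ->]]]]]]]]]].
    destruct (regular_L u Hu) as [a' [Ha' Ra]]. rewrite (gen_unique HL u a' a Ha' Ha) in Ra.
    destruct (regular_Lb u Hu) as [b' [Hb' Rb]]. rewrite (gen_unique HLb u b' b Hb' Hb) in Rb.
    destruct (IH u r0 Hu R0) as [s0 [S0 T0]]. destruct (IH a r1 Ra R1) as [s1 [S1 T1]].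
    destruct (IH b r2 Rb R2) as [s2 [S2 T2]].
    exists (s0 + s1 + s2). split; [|lra].
    exists (f a), (f b), s0, s1, s2. repeat split; auto.
Qed.

Lemma regular_map (f : X -> X) :
  (forall u a, regular L u -> L u a -> L (f u) (f a)) ->
  (forall u b, regular L u -> Lb u b -> Lb (f u) (f b)) ->
  forall u, regular L u -> regular L (f u).
Proof.
  intros H1 H2 u Hu N. revert u Hu. induction N as [|N IH]; intros u Hu.
  - now exists (norm (f u)).
  - destruct (regular_L u Hu) as [a [Ha Ra]]. destruct (regular_Lb u Hu) as [b [Hb Rb]].
    destruct (IH u Hu) as [r0 R0]. destruct (IH a Ra) as [r1 R1]. destruct (IH b Rb) as [r2 R2].
    exists (r0 + r1 + r2), (f a), (f b), r0, r1, r2. repeat split; auto.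
Qed.

Lemma regular_bicomm A u : bicomm A -> regular L u -> regular L (A u).
Proof.
  intros HA. apply regular_map; intros v a _; [now apply bicomm_L|now apply bicomm_Lb].
Qed.

Lemma regular_lin u v (r s : R) : regular L u -> regular L v -> regular L (plus (scal r u) (scal s v)).
Proof.
  intros Hu Hv N. revert u v Hu Hv. induction N as [|N IH]; intros u v Hu Hv.
  - now exists (norm (plus (scal r u) (scal s v))).
  - destruct (regular_L u Hu) as [a [Ha Ra]]. destruct (regular_Lb u Hu) as [b [Hb Rb]].
    destruct (regular_L v Hv) as [a' [Ha' Ra']]. destruct (regular_Lb v Hv) as [b' [Hb' Rb']].
    destruct (IH u v Hu Hv) as [r0 R0]. destruct (IH a a' Ra Ra') as [r1 R1].
    destruct (IH b b' Rb Rb') as [r2 R2].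
    exists (r0 + r1 + r2), (plus (scal r a) (scal s a')), (plus (scal r b) (scal s b')), r0, r1, r2.
    split; [now apply (gen_linear HS HL)|]. split; [now apply (gen_linear HSb HLb)|]. auto.
Qed.

Lemma regular_minus u v : regular L u -> regular L v -> regular L (minus u v).
Proof.
  intros Hu Hv. replace (minus u v) with (plus (scal 1 u) (scal (-1) v)) by vec. now apply regular_lin.
Qed.

Lemma graph_norm_ge N u r : graph_norm L N u r -> norm u <= r.
Proof.
  revert u r. induction N as [|N IH]; intros u r.
  - simpl. intros ->. apply Rle_refl.
  - intros [a [b [r0 [r1 [r2 [_ [_ [R0 [R1 [R2 ->]]]]]]]]]].
    assert (H0 := IH _ _ R0). assert (H1 := IH _ _ R1). assert (H2 := IH _ _ R2).
    assert (P1 := norm_pos (V := X) a). assert (P2 := norm_pos (V := X) b). lra.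
Qed.

Lemma regular_dense u eps : 0 < eps -> exists v, regular L v /\ norm (minus v u) < eps.
Proof.
  intros Heps. destruct (mollify_lim u eps Heps) as [N HN].
  exists (mollify N u). split; [apply mollify_regular|]. now apply HN.
Qed.
End Regular.

(** * Flows on regular vectors *)

Section Flows.
Context {d : nat} {Omega : Rd d -> Prop} {X : fun_hilbert Omega} {L : op X} {S : R -> X -> X}.
Context (HS : csg (V := X) S) (HL : gen (V := X) L S) (HC : commutes_with_bar S).
Context {U : R -> X -> X} (HU : unitary_group U) (HA : generates_group (A_op L) U).
Implicit Types u v w z a b : X.

Notation Sb := (bar_sg (S := S)).
Notation Lb := (bar_op L).
Notation HSb := (bar_csg HS).
Notation HLb := (bar_gen HL).
Notation HUs := (csg_of_group HU).
Notation HUg := (gen_of_group HU (A_op L) HA).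
Notation bic := (bicomm (S := S)).

Lemma A_op_spec u z : A_op L u z <->
  exists un zn, (forall n : nat, exists a b, L (un n) a /\ Lb (un n) b /\ zn n = plus (opp a) b) /\
    lim_to (V := X) un u /\ lim_to (V := X) zn z.
Proof.
  unfold A_op, closure_op. split; intros [un [zn [H1 [H2 H3]]]]; exists un, zn; split; auto;
    now split; apply (lim_to_filterlim (V := X)).
Qed.

Lemma A_op_of_L u a b : L u a -> Lb u b -> A_op L u (plus (opp a) b).
Proof.
  intros Ha Hb. apply A_op_spec. exists (fun _ => u), (fun _ => plus (opp a) b).
  split; [|split; apply lim_to_const]. intros _. now exists a, b.
Qed.

Lemma bicomm_A (B : X -> X) u z : bic B -> A_op L u z -> A_op L (B u) (B z).
Proof.
  intros HB. rewrite !A_op_spec. intros [un [zn [H1 [H2 H3]]]].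
  exists (fun n => B (un n)), (fun n => B (zn n)). split; [|split].
  - intros n. destruct (H1 n) as [a [b [Ha [Hb E]]]]. exists (B a), (B b).
    split; [now apply (bicomm_L HL)|]. split; [now apply (bicomm_Lb HL)|].
    rewrite E. destruct HB as [[HB _] _]. canon. now rewrite (lin_plus B), (lin_opp B).
  - apply (bounded_lim (V := X) (W := X)); auto. apply HB.
  - apply (bounded_lim (V := X) (W := X)); auto. apply HB.
Qed.

(** Both semigroups commute with [A] because they commute with [L] and its conjugate. *)
Lemma bicomm_U t : 0 <= t -> bic (U t).
Proof.
  intros Ht. split; [|split].
  - apply contraction_bounded, (group_contraction HU t).
  - intros s u Hs. symmetry. apply (commute_of_gen HUs HUg (S s)); auto.
    + apply (bicomm_S HS HC s Hs).
    + intros x z. apply bicomm_A. now apply bicomm_S.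
  - intros s u Hs. symmetry. apply (commute_of_gen HUs HUg (Sb s)); auto.
    + apply (bicomm_Sb HS HC s Hs).
    + intros x z. apply bicomm_A. now apply bicomm_Sb.
Qed.

(** What [e^{tL}] and [e^{tA}] have in common.  The generator of the latter is a closure, and only on
    regular vectors it is visibly a difference of [L] and its conjugate. *)
Definition regular_flow (T : R -> X -> X) (K : op X) : Prop :=
  csg (V := X) T /\ gen (V := X) K T /\ (forall t, 0 <= t -> bic (T t)) /\
  (forall u, regular L u -> exists z, K u z /\ regular L z /\
     forall r, graph_norm L 1 u r -> norm z <= r).

Lemma graph_norm_1 u r : graph_norm L 1 u r -> exists a b, L u a /\ Lb u b /\
  r = norm u + norm a + norm b.
Proof.
  intros [a [b [r0 [r1 [r2 [Ha [Hb [H0 [H1 [H2 ->]]]]]]]]]]. simpl in *. subst. now exists a, b.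
Qed.

Lemma flow_S : regular_flow S L.
Proof.
  split; [auto|split; [auto|split]].
  - intros t Ht. now apply bicomm_S.
  - intros u Hu. destruct (regular_L HL u Hu) as [a [Ha Ra]]. exists a. repeat split; auto.
    intros r Hr. destruct (graph_norm_1 u r Hr) as [a' [b' [Ha' [_ ->]]]].
    rewrite (gen_unique HL u a a' Ha Ha').
    generalize (norm_pos (V := X) u) (norm_pos (V := X) b'). lra.
Qed.

Lemma flow_U : regular_flow U (A_op L).
Proof.
  split; [apply HUs|split; [apply HUg|split]].
  - intros t Ht. now apply bicomm_U.
  - intros u Hu. destruct (regular_L HL u Hu) as [a [Ha Ra]].
    destruct (regular_Lb HL u Hu) as [b [Hb Rb]]. exists (plus (opp a) b).
    split; [now apply A_op_of_L|]. split.
    + replace (plus (opp a) b) with (plus (scal (-1) a) (scal 1 b)) by vec. now apply (regular_lin HS HL).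
    + intros r Hr. destruct (graph_norm_1 u r Hr) as [a' [b' [Ha' [Hb' ->]]]].
      rewrite (gen_unique HL u a a' Ha Ha'), (gen_unique HLb u b b' Hb Hb').
      apply Rle_trans with (norm (opp a') + norm b'); [apply norm_le2; reflexivity|].
      canon. rewrite norm_opp. generalize (norm_pos (V := X) u). lra.
Qed.

(** By density it suffices to show [e^{tA} e^{tL} v = e^{t conj L} v] for regular [v].  The path
    [r |-> e^{(t-r)A} e^{(t-r)L} e^{r conj L} v] from one side to the other is stationary, because
    [A = - L + conj L] there; its increments are quadratically small. *)
Lemma S_U_Sb t u : 0 <= t -> S t (U t u) = Sb t u.
Proof.
  intros Ht.
  assert (H0 : forall v, regular L v -> Sb t v = U t (S t v)).
  { intros v Hv.
    destruct (regular_L HL v Hv) as [a [Ha Ra]]. destruct (regular_Lb HL v Hv) as [b [Hb Rb]].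
    destruct (regular_L HL a Ra) as [aa [Haa _]]. destruct (regular_Lb HL b Rb) as [bb [Hbb _]].
    set (z := plus (opp a) b). assert (Hz : A_op L v z) by now apply A_op_of_L.
    assert (Rz : regular L z).
    { unfold z. replace (plus (opp a) b) with (plus (scal (-1) a) (scal 1 b)) by vec.
      now apply (regular_lin HS HL). }
    destruct (proj2 (proj2 (proj2 flow_U)) z Rz) as [zz [Hzz _]].
    destruct (proj2 (proj2 (proj2 flow_U)) a Ra) as [za [Hza _]].
    set (C := norm bb + norm aa + norm zz + norm za).
    assert (PC : 0 <= C) by (repeat apply Rplus_le_le_0_compat; apply norm_pos).
    assert (E := quadratic_const (V := X) (fun r => U (t - r) (S (t - r) (Sb r v))) 0 t C Ht PC).
    cbv beta in E. rewrite Rminus_diag, Rminus_0_r, (csg_0 HUs), (csg_0 HS), (csg_0 HSb) in E.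
    apply E. clear E. intros s r Hs Hr. set (e := r - s). assert (He : 0 <= e) by (unfold e; lra).
    set (y := Sb s v).
    assert (E1 : U (t - s) (S (t - s) y) = U (t - r) (S (t - r) (U e (S e y)))).
    { replace (t - s) with ((t - r) + e) by (unfold e; ring).
      rewrite (csg_plus HUs), (csg_plus HS) by lra.
      f_equal. apply (proj1 (proj2 (bicomm_U e He))). lra. }
    assert (E2 : Sb r v = Sb e y).
    { unfold y. rewrite <- (csg_plus HSb) by lra. f_equal. unfold e. ring. }
    rewrite E1, E2. canon. rewrite <- (csg_sub HUs), <- (csg_sub HS) by lra.
    apply Rle_trans with (1 := csg_norm HUs (t - r) _ ltac:(lra)).
    apply Rle_trans with (1 := csg_norm HS (t - r) _ ltac:(lra)).
    assert (Bs := bicomm_Sb HS HC s (proj1 Hs)).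
    assert (Ya := bicomm_L HL _ _ _ Bs Ha). assert (Yaa := bicomm_L HL _ _ _ Bs Haa).
    assert (Yb := bicomm_Lb HL _ _ _ Bs Hb). assert (Ybb := bicomm_Lb HL _ _ _ Bs Hbb).
    assert (Yz := bicomm_A _ _ _ Bs Hz). assert (Yzz := bicomm_A _ _ _ Bs Hzz).
    assert (Yza := bicomm_A _ _ _ Bs Hza). fold y in Ya, Yb, Yz.
    assert (D1 := gen_taylor2 HSb HLb _ _ _ e Yb Ybb He).
    assert (D2 := gen_taylor2 HS HL _ _ _ e Ya Yaa He).
    assert (D3 := gen_taylor2 HUs HUg _ _ _ e Yz Yzz He).
    assert (D4 := gen_lipschitz HUs HUg _ _ e Yza He).
    assert (N1 := csg_norm HSb s bb (proj1 Hs)). assert (N2 := csg_norm HSb s aa (proj1 Hs)).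
    assert (N3 := csg_norm HSb s zz (proj1 Hs)). assert (N4 := csg_norm HSb s za (proj1 Hs)).
    assert (EZ : Sb s z = plus (opp (Sb s a)) (Sb s b)).
    { unfold z. destruct (csg_lin HSb s (proj1 Hs)) as [La Ls]. canon.
      rewrite (lin_plus (Sb s)), (lin_opp (Sb s)) by (split; auto). reflexivity. }
    set (p1 := minus (minus (Sb e y) y) (scal e (Sb s b))) in *.
    set (p2 := minus (minus (S e y) y) (scal e (Sb s a))) in *.
    set (p3 := minus (minus (U e y) y) (scal e (Sb s z))) in *.
    set (p4 := minus (U e (Sb s a)) (Sb s a)) in *.
    assert (EP : minus (Sb e y) (U e (S e y)) = minus p1 (plus (U e p2) (plus p3 (scal e p4)))).
    { unfold p1, p2, p3, p4. canon. rewrite !(csg_sub HUs), (csg_scal HUs), EZ by lra. vec. }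
    assert (Q : norm (minus (Sb e y) (U e (S e y))) <= norm p1 + (norm (U e p2) + (norm p3 + norm (scal e p4)))).
    { apply Rle_trans with (1 := norm_le2m _ _ _ EP). apply Rplus_le_compat_l.
      apply Rle_trans with (norm (U e p2) + norm (plus p3 (scal e p4))); [now apply norm_le2|].
      apply Rplus_le_compat_l. now apply norm_le2. }
    apply Rle_trans with (1 := Q).
    assert (Q2 := csg_norm HUs e p2 He).
    assert (Q4 : norm (scal e p4) <= e * (e * norm za)).
    { canon. rewrite norm_scal_eq, Rabs_right by lra. apply Rmult_le_compat_l; auto.
      apply Rle_trans with (1 := D4). now apply Rmult_le_compat_l. }
    assert (M : forall p q : X, norm (Sb s q) <= norm q -> norm p <= e * (e * norm (Sb s q)) -> norm p <= e * (e * norm q)).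
    { intros p q Hq Hp. apply Rle_trans with (1 := Hp). apply Rmult_le_compat_l; auto. now apply Rmult_le_compat_l. }
    assert (M1 := M _ _ N1 D1). assert (M2 := M _ _ N2 D2). assert (M3 := M _ _ N3 D3).
    fold e. replace (C * e ^ 2) with (e * (e * norm bb) + (e * (e * norm aa) + (e * (e * norm zz) + e * (e * norm za))))
      by (unfold C; ring).
    repeat apply Rplus_le_compat; auto. now apply Rle_trans with (1 := Q2). }
  rewrite <- (proj1 (proj2 (bicomm_U t Ht)) t u Ht).
  apply (minus_eq (V := X)), le_eps. intros eps Heps.
  destruct (regular_dense HS HL HC u (eps / 2)) as [v [Hv Hd]]; [lra|].
  apply Rle_trans with (norm (Sb t (minus v u)) + norm (U t (S t (minus v u)))).
  - apply norm_le2m. canon. rewrite (csg_sub HSb), (csg_sub HS), (csg_sub HUs) by auto.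
    rewrite (H0 v Hv). vec.
  - assert (N1 := csg_norm HSb t (minus v u) Ht). assert (N2 := csg_norm HS t (minus v u) Ht).
    assert (N3 := csg_norm HUs t (S t (minus v u)) Ht). clra.
Qed.

(** ** Second order Taylor bounds in graph norms *)

Definition gen_value (K : op X) (u : X) : X := epsilon (inhabits zero) (fun z => K u z).

Lemma gen_value_spec T K u : regular_flow T K -> regular L u ->
  K u (gen_value K u) /\ regular L (gen_value K u).
Proof.
  intros [HT [HK [_ H]]] Hu. destruct (H u Hu) as [z [Hz [Rz _]]].
  assert (E : K u (gen_value K u)) by (unfold gen_value; apply epsilon_spec; now exists z).
  split; auto. now rewrite (gen_unique HK u _ z E Hz).
Qed.

Lemma gen_value_norm T K u r : regular_flow T K -> regular L u -> graph_norm L 1 u r ->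
  norm (gen_value K u) <= r.
Proof.
  intros HT Hu Hr. destruct (gen_value_spec T K u HT Hu) as [E _].
  destruct HT as [_ [HK [_ H]]]. destruct (H u Hu) as [z [Hz [_ D]]].
  rewrite (gen_unique HK u _ z E Hz). auto.
Qed.

(** [gen_gen]: the generators of commuting semigroups commute. *)
Lemma gen_value_L T K u a : regular_flow T K -> regular L u -> L u a ->
  L (gen_value K u) (gen_value K a).
Proof.
  intros HT Hu Ha. destruct (regular_L HL u Hu) as [a' [Ha' Ra]].
  rewrite (gen_unique HL u a' a Ha' Ha) in Ra.
  assert (E1 := proj1 (gen_value_spec T K u HT Hu)). assert (E2 := proj1 (gen_value_spec T K a HT Ra)).
  destruct HT as [HT [HK [HB _]]].
  apply (gen_gen HS HL HT HK) with (u := u) (a := a); auto.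
  intros s t x Hs Ht. symmetry. now apply (HB t Ht).
Qed.

Lemma gen_value_Lb T K u b : regular_flow T K -> regular L u -> Lb u b ->
  Lb (gen_value K u) (gen_value K b).
Proof.
  intros HT Hu Hb. destruct (regular_Lb HL u Hu) as [b' [Hb' Rb]].
  rewrite (gen_unique HLb u b' b Hb' Hb) in Rb.
  assert (E1 := proj1 (gen_value_spec T K u HT Hu)). assert (E2 := proj1 (gen_value_spec T K b HT Rb)).
  destruct HT as [HT [HK [HB _]]].
  apply (gen_gen HSb HLb HT HK) with (u := u) (a := b); auto.
  intros s t x Hs Ht. symmetry. now apply (HB t Ht).
Qed.

Lemma gen_value_graph_norm T K N u r : regular_flow T K -> regular L u ->
  graph_norm L (N + 1) u r -> exists r', graph_norm L N (gen_value K u) r' /\ r' <= r.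
Proof.
  intros HT Hu Hr.
  destruct (graph_norm_map HL (gen_value K) 1 1) with (N := N) (u := u) (r := r) as [r' [H1 H2]]; auto.
  - intros v a Hv. now apply (gen_value_L T).
  - intros v b Hv. now apply (gen_value_Lb T).
  - intros v s Hv Hs. rewrite Rmult_1_l. now apply (gen_value_norm T).
  - exists r'. split; auto. lra.
Qed.

Definition flow_rem (T : R -> X -> X) (K : op X) (x y : R) (u : X) : X :=
  minus (minus (T y u) (T x u)) (scal (y - x) (T x (gen_value K u))).

Lemma flow_rem_norm T K x y u r : regular_flow T K -> 0 <= x -> 0 <= y -> regular L u ->
  graph_norm L 2 u r -> norm (flow_rem T K x y u) <= 2 * (y - x) ^ 2 * r.
Proof.
  intros HF Hx Hy Hu Hr. unfold flow_rem. set (z := gen_value K u).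
  destruct (gen_value_spec T K u HF Hu) as [Hz Rz]. fold z in Hz, Rz.
  destruct (gen_value_spec T K z HF Rz) as [Hw _]. set (w := gen_value K z) in *.
  destruct (gen_value_graph_norm T K 1 u r HF Hu Hr) as [r' [Hr' Hle]].
  assert (Nw := gen_value_norm T K z r' HF Rz Hr'). fold w in Nw.
  destruct HF as [HT [HK [HB _]]].
  assert (Pw := norm_pos (V := X) w).
  destruct (Rle_dec x y) as [Hxy|Hxy].
  - set (e := y - x). assert (He : 0 <= e) by (unfold e; lra).
    replace y with (x + e) by (unfold e; ring). rewrite (csg_plus HT) by lra.
    rewrite <- (csg_scal HT) by lra. canon. rewrite <- !(csg_sub HT) by lra.
    apply Rle_trans with (1 := csg_norm HT x _ Hx).
    apply Rle_trans with (1 := gen_taylor2 HT HK u z w e Hz Hw He).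
    replace (2 * e ^ 2 * r) with (e * (e * (2 * r))) by ring.
    apply Rmult_le_compat_l; auto. apply Rmult_le_compat_l; auto. lra.
  - set (e := x - y). assert (He : 0 <= e) by (unfold e; lra).
    replace (y - x) with (- e) by (unfold e; ring). replace x with (y + e) by (unfold e; ring).
    rewrite !(csg_plus HT) by lra.
    assert (D1 := gen_taylor2 HT HK u z w e Hz Hw He). assert (D2 := gen_lipschitz HT HK z w e Hw He).
    apply Rle_trans with (norm (T y (scal e (minus (T e z) z))) + norm (T y (minus (minus (T e u) u) (scal e z)))).
    + apply norm_le2m. canon. rewrite !(csg_sub HT), !(csg_scal HT), !(csg_sub HT) by lra. vec.
    + assert (N1 := csg_norm HT y (minus (minus (T e u) u) (scal e z)) Hy).
      assert (N2 := csg_norm HT y (scal e (minus (T e z) z)) Hy).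
      canon in N2. rewrite norm_scal_eq, Rabs_right in N2 by lra.
      apply (Rmult_le_compat_l e) in D2; auto.
      replace (2 * (- e) ^ 2 * r) with (e * (e * r) + e * (e * r)) by ring.
      assert (M : e * (e * norm w) <= e * (e * r)).
      { apply Rmult_le_compat_l; auto. apply Rmult_le_compat_l; auto. lra. }
      clra.
Qed.

Lemma flow_rem_graph_norm T K x y N u r : regular_flow T K -> 0 <= x -> 0 <= y -> regular L u ->
  graph_norm L (N + 2) u r ->
  exists r', graph_norm L N (flow_rem T K x y u) r' /\ r' <= 2 * (y - x) ^ 2 * r.
Proof.
  intros HF Hx Hy Hu Hr.
  apply (graph_norm_map HL (flow_rem T K x y) 2 (2 * (y - x) ^ 2)) with (u := u); auto.
  - intros v a Hv Ha. assert (HB := proj1 (proj2 (proj2 HF))). unfold flow_rem.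
    apply (gen_minus HS HL); [apply (gen_minus HS HL)|apply (gen_scal HS HL)].
    + now apply (bicomm_L HL _ _ _ (HB y Hy)).
    + now apply (bicomm_L HL _ _ _ (HB x Hx)).
    + apply (bicomm_L HL _ _ _ (HB x Hx)). now apply (gen_value_L T).
  - intros v b Hv Hb. assert (HB := proj1 (proj2 (proj2 HF))). unfold flow_rem.
    apply (gen_minus HSb HLb); [apply (gen_minus HSb HLb)|apply (gen_scal HSb HLb)].
    + now apply (bicomm_Lb HL _ _ _ (HB y Hy)).
    + now apply (bicomm_Lb HL _ _ _ (HB x Hx)).
    + apply (bicomm_Lb HL _ _ _ (HB x Hx)). now apply (gen_value_Lb T).
  - intros v s Hv Hs. now apply flow_rem_norm.
Qed.

(** The differential below refers to some graph norm of unknown order, so tangency is asked for in all of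
    them. *)
Definition regular_curve (c : R -> X) (c' : X) (x : R) : Prop :=
  (forall y, 0 <= y -> regular L (c y)) /\ regular L c' /\
  forall N, exists k, 0 <= k /\ forall y, 0 <= y ->
    exists r, graph_norm L N (minus (minus (c y) (c x)) (scal (y - x) c')) r /\ r <= k * (y - x) ^ 2.

Lemma flow_curve T K u x : regular_flow T K -> regular L u -> 0 <= x ->
  regular_curve (fun y => T y u) (T x (gen_value K u)) x.
Proof.
  intros HF Hu Hx. assert (HB := proj1 (proj2 (proj2 HF))).
  split; [|split].
  - intros y Hy. apply (regular_bicomm HL _ _ (HB y Hy)); auto.
  - apply (regular_bicomm HL _ _ (HB x Hx)). apply (gen_value_spec T K u HF Hu).
  - intros N. destruct (Hu (N + 2)%nat) as [r Hr]. exists (2 * r). split.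
    + assert (P := graph_norm_ge _ _ _ Hr). assert (P' := norm_pos (V := X) u). lra.
    + intros y Hy. destruct (flow_rem_graph_norm T K x y N u r HF Hx Hy Hu Hr) as [r' [H1 H2]].
      exists r'. split; [exact H1|]. lra.
Qed.

Lemma const_curve u x : regular L u -> regular_curve (fun _ => u) zero x.
Proof.
  intros Hu.
  assert (Hz : forall v, regular L v -> forall N, graph_norm L N (minus v v) 0).
  { intros v Hv N. revert v Hv. induction N as [|N IH]; intros v Hv.
    - simpl. symmetry. apply norm_0. vec.
    - destruct (regular_L HL v Hv) as [a [Ha Ra]]. destruct (regular_Lb HL v Hv) as [b [Hb Rb]].
      exists (minus a a), (minus b b), 0, 0, 0. split; [now apply (gen_minus HS HL)|].
      split; [now apply (gen_minus HSb HLb)|]. repeat split; auto. ring. }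
  split; [auto|split].
  - intros N. exists 0.
    match goal with |- graph_norm L N ?z 0 => replace z with (minus u u) by vec end. auto.
  - intros N. exists 0. split; [lra|]. intros y _. exists 0. split; [|lra].
    match goal with |- graph_norm L N ?z 0 => replace z with (minus u u) by vec end. auto.
Qed.

Lemma graph_norm_lin N u v r s (c e : R) : graph_norm L N u r -> graph_norm L N v s ->
  exists q, graph_norm L N (plus (scal c u) (scal e v)) q /\ q <= Rabs c * r + Rabs e * s.
Proof.
  revert u v r s. induction N as [|N IH]; intros u v r s.
  - simpl. intros -> ->. exists (norm (plus (scal c u) (scal e v))). split; auto.
    rewrite <- !(norm_scal_eq (V := X)). now apply norm_le2.
  - intros [a [b [r0 [r1 [r2 [Ha [Hb [R0 [R1 [R2 ->]]]]]]]]]] [a' [b' [s0 [s1 [s2 [Ha' [Hb' [S0 [S1 [S2 ->]]]]]]]]]].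
    destruct (IH _ _ _ _ R0 S0) as [q0 [Q0 T0]]. destruct (IH _ _ _ _ R1 S1) as [q1 [Q1 T1]].
    destruct (IH _ _ _ _ R2 S2) as [q2 [Q2 T2]].
    exists (q0 + q1 + q2). split; [|lra].
    exists (plus (scal c a) (scal e a')), (plus (scal c b) (scal e b')), q0, q1, q2.
    split; [now apply (gen_linear HS HL)|]. split; [now apply (gen_linear HSb HLb)|]. auto.
Qed.

Lemma sum_n_bound (r : nat -> R) M n : (forall i, (i <= n)%nat -> r i <= M) ->
  sum_n r n <= (INR n + 1) * M.
Proof.
  intros H. induction n as [|n IH].
  - rewrite sum_O. simpl. specialize (H O (le_n O)). lra.
  - rewrite sum_Sn. change (sum_n r n + r (Datatypes.S n) <= (INR (Datatypes.S n) + 1) * M).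
    rewrite S_INR. assert (H1 := H (Datatypes.S n) (le_n _)).
    assert (H2 := IH (fun i Hi => H i (Nat.le_le_succ_r _ _ Hi))). lra.
Qed.

Lemma sum_n_diff_bound (f g : nat -> X) (t M : R) n :
  (forall i, (i <= n)%nat -> norm (minus (f i) (scal t (g i))) <= M) ->
  norm (minus (sum_n f n) (scal t (sum_n g n))) <= (INR n + 1) * M.
Proof.
  intros H. induction n as [|n IH].
  - rewrite !sum_O. simpl. specialize (H O (le_n O)). lra.
  - rewrite !sum_Sn, S_INR. assert (H1 := H (Datatypes.S n) (le_n _)).
    assert (H2 := IH (fun i Hi => H i (Nat.le_le_succ_r _ _ Hi))).
    apply Rle_trans with (norm (minus (sum_n f n) (scal t (sum_n g n)))
      + norm (minus (f (Datatypes.S n)) (scal t (g (Datatypes.S n))))).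
    + apply norm_le2. vec.
    + clra.
Qed.

(** The chain rule.  Regular curves stay tangent in the graph norm that the differential uses. *)
Lemma differential_curve n H (v : nat -> X) (D : nat -> X -> X) (c : nat -> R -> X) (c' : nat -> X) x :
  Defs.differential L n H v D -> 0 <= x ->
  (forall i, (i <= n)%nat -> regular_curve (c i) (c' i) x) ->
  exists z0, H v z0 /\ forall eps, 0 < eps -> exists delta, 0 < delta /\
    forall y, 0 <= y -> Rabs (y - x) < delta ->
      exists z, H (fun i => plus (v i) (minus (c i y) (c i x))) z /\
        norm (minus (minus z z0) (scal (y - x) (sum_n (fun i => D i (c' i)) n))) <= eps * Rabs (y - x).
Proof.
  intros [Dadd [Dscal [N [[KD HD] [z0 [Hz0 Hdiff]]]]]] Hx Hc. exists z0. split; auto.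
  (* common constants for the finitely many curves *)
  assert (Hk : exists k, 0 <= k /\ forall i, (i <= n)%nat -> forall y, 0 <= y ->
    exists r, graph_norm L N (minus (minus (c i y) (c i x)) (scal (y - x) (c' i))) r /\ r <= k * (y - x) ^ 2).
  { assert (Hk : forall m, (m <= n)%nat -> exists k, 0 <= k /\ forall i, (i <= m)%nat -> forall y, 0 <= y ->
      exists r, graph_norm L N (minus (minus (c i y) (c i x)) (scal (y - x) (c' i))) r /\ r <= k * (y - x) ^ 2);
      [|now apply Hk].
    induction m as [|m IH]; intros Hm.
    - destruct (Hc O Hm) as [_ [_ H0]]. destruct (H0 N) as [k [Hk0 Hk]]. exists k. split; auto.
      intros i Hi. replace i with O by lia. auto.
    - destruct (IH ltac:(lia)) as [k [Hk0 Hk]].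
      destruct (Hc (Datatypes.S m) Hm) as [_ [_ H0]]. destruct (H0 N) as [k' [Hk0' Hk']].
      exists (k + k'). split; [lra|]. intros i Hi y Hy. assert (P := pow2_ge_0 (y - x)).
      assert (P1 : 0 <= k * (y - x) ^ 2) by now apply Rmult_le_pos.
      assert (P2 : 0 <= k' * (y - x) ^ 2) by now apply Rmult_le_pos.
      destruct (Nat.eq_dec i (Datatypes.S m)) as [->|Hne].
      + destruct (Hk' y Hy) as [r [R1 R2]]. exists r. split; auto. lra.
      + destruct (Hk i ltac:(lia) y Hy) as [r [R1 R2]]. exists r. split; auto. lra. }
  destruct Hk as [k [Hk0 Hk]].
  assert (Hr : exists r, 0 <= r /\ forall i, (i <= n)%nat -> exists s, graph_norm L N (c' i) s /\ s <= r).
  { assert (Hr : forall m, (m <= n)%nat -> exists r, 0 <= r /\ forall i, (i <= m)%nat ->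
      exists s, graph_norm L N (c' i) s /\ s <= r); [|now apply Hr].
    induction m as [|m IH]; intros Hm.
    - destruct (Hc O Hm) as [_ [H0 _]]. destruct (H0 N) as [s Hs]. exists (Rabs s). split; [apply Rabs_pos|].
      intros i Hi. replace i with O by lia. exists s. split; auto. apply Rle_abs.
    - destruct (IH ltac:(lia)) as [r [Hr0 Hr]].
      destruct (Hc (Datatypes.S m) Hm) as [_ [H0 _]]. destruct (H0 N) as [s Hs].
      exists (r + Rabs s). assert (P := Rabs_pos s). split; [lra|]. intros i Hi.
      destruct (Nat.eq_dec i (Datatypes.S m)) as [->|Hne].
      + exists s. split; auto. generalize (Rle_abs s). lra.
      + destruct (Hr i ltac:(lia)) as [s' [S1 S2]]. exists s'. split; auto. lra. }
  destruct Hr as [r [Hr0 Hr]].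
  intros eps Heps.
  assert (Pn : 0 < INR n + 1) by (generalize (pos_INR n); lra).
  set (M := (INR n + 1) * (k + r + 1)). assert (HM : 0 < M) by (apply Rmult_lt_0_compat; lra).
  destruct (Hdiff (eps / 2 / M)) as [delta [Hd Hdelta]].
  { apply Rdiv_lt_0_compat; lra. }
  set (Q := (INR n + 1) * (Rabs KD + 1) * (k + 1)).
  assert (PK := Rabs_pos KD).
  assert (HQ : 0 < Q) by (repeat apply Rmult_lt_0_compat; lra).
  set (delta' := Rmin 1 (Rmin (delta / M) (eps / 2 / Q))).
  exists delta'. split.
  { repeat apply Rmin_pos; try lra; apply Rdiv_lt_0_compat; lra. }
  intros y Hy Hyx. set (h := y - x) in *.
  assert (B1 : Rabs h < 1) by (apply Rlt_le_trans with (1 := Hyx), Rmin_l).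
  assert (B2 : Rabs h < delta / M).
  { apply Rlt_le_trans with (1 := Hyx). apply Rle_trans with (1 := Rmin_r _ _). apply Rmin_l. }
  assert (B3 : Rabs h < eps / 2 / Q).
  { apply Rlt_le_trans with (1 := Hyx). apply Rle_trans with (1 := Rmin_r _ _). apply Rmin_r. }
  assert (PH := Rabs_pos h).
  assert (Hh2 : h ^ 2 = Rabs h * Rabs h) by (rewrite <- Rabs_mult, Rabs_right; [ring|nra]).
  (* graph norms of the increments are at most of order |h| *)
  assert (Hinc : forall i, exists s, (i <= n)%nat ->
    regular L (minus (c i y) (c i x)) /\ graph_norm L N (minus (c i y) (c i x)) s /\ s <= (k + r) * Rabs h).
  { intros i. destruct (Compare_dec.le_dec i n) as [Hi|Hi]; [|exists 0; lia].
    destruct (Hk i Hi y Hy) as [s1 [S1 T1]]. destruct (Hr i Hi) as [s2 [S2 T2]]. fold h in S1, T1.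
    destruct (graph_norm_lin N _ _ s1 s2 1 h S1 S2) as [s [S3 T3]].
    exists s. intros _. destruct (Hc i Hi) as [Rc [Rc' _]].
    split; [apply (regular_minus HS HL); apply Rc; auto|]. split.
    - match goal with H : graph_norm L N ?a s |- graph_norm L N ?b s => replace b with a by vec end. exact S3.
    - rewrite Rabs_R1 in T3. rewrite Hh2 in T1.
      assert (k * (Rabs h * Rabs h) <= k * (1 * Rabs h)).
      { apply Rmult_le_compat_l; auto. apply Rmult_le_compat_r; lra. }
      assert (Rabs h * s2 <= Rabs h * r) by (apply Rmult_le_compat_l; auto). lra. }
  destruct (choice _ Hinc) as [s Hs].
  assert (Hsum : sum_n s n <= M * Rabs h).
  { unfold M. apply Rle_trans with ((INR n + 1) * ((k + r) * Rabs h)).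
    - apply sum_n_bound. intros i Hi. now apply Hs.
    - rewrite Rmult_assoc. apply Rmult_le_compat_l; [lra|]. apply Rmult_le_compat_r; lra. }
  assert (Hsmall : sum_n s n < delta).
  { apply Rle_lt_trans with (1 := Hsum). apply (Rmult_lt_compat_l M) in B2; auto.
    replace (M * (delta / M)) with delta in B2 by (field; lra). exact B2. }
  destruct (Hdelta (fun i => minus (c i y) (c i x)) s) as [z [Hz Nz]]; auto.
  { intros i Hi. destruct (Hs i Hi) as [? [? _]]. auto. }
  exists z. split; auto.
  assert (HDi : norm (minus (sum_n (fun i => D i (minus (c i y) (c i x))) n)
    (scal h (sum_n (fun i => D i (c' i)) n))) <= (INR n + 1) * ((Rabs KD + 1) * (k * h ^ 2))).
  { apply sum_n_diff_bound. intros i Hi. destruct (Hc i Hi) as [Rc [Rc' _]].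
    destruct (Hk i Hi y Hy) as [s1 [S1 T1]]. fold h in S1, T1.
    assert (R1 : regular L (minus (minus (c i y) (c i x)) (scal h (c' i)))).
    { replace (minus (minus (c i y) (c i x)) (scal h (c' i)))
        with (plus (scal 1 (minus (c i y) (c i x))) (scal (- h) (c' i))) by vec.
      apply (regular_lin HS HL); auto. now apply (Hs i Hi). }
    assert (R2 : regular L (scal h (c' i))).
    { replace (scal h (c' i)) with (plus (scal h (c' i)) (scal 0 (c' i))) by vec.
      now apply (regular_lin HS HL). }
    assert (E : D i (minus (c i y) (c i x)) =
      plus (D i (minus (minus (c i y) (c i x)) (scal h (c' i)))) (scal h (D i (c' i)))).
    { rewrite <- (Dscal i h (c' i) Hi Rc'). rewrite <- (Dadd i _ _ Hi R1 R2). f_equal. vec. }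
    rewrite E.
    apply Rle_trans with (norm (D i (minus (minus (c i y) (c i x)) (scal h (c' i))))).
    { right. f_equal. vec. }
    apply Rle_trans with (1 := HD i _ s1 Hi R1 S1).
    assert (P0 : 0 <= s1).
    { apply Rle_trans with (2 := graph_norm_ge _ _ _ S1). apply norm_pos. }
    apply Rle_trans with ((Rabs KD + 1) * s1).
    - apply Rmult_le_compat_r; auto. generalize (Rle_abs KD). lra.
    - apply Rmult_le_compat_l; auto. lra. }
  apply Rle_trans with (norm (minus (minus z z0) (sum_n (fun i => D i (minus (c i y) (c i x))) n))
    + norm (minus (sum_n (fun i => D i (minus (c i y) (c i x))) n) (scal h (sum_n (fun i => D i (c' i)) n)))).
  - apply norm_le2. vec.
  - replace (eps * Rabs h) with (eps / 2 * Rabs h + eps / 2 * Rabs h) by field.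
    apply Rplus_le_compat.
    + apply Rle_trans with (1 := Nz). apply Rle_trans with (eps / 2 / M * (M * Rabs h)).
      * apply Rmult_le_compat_l; auto. left. apply Rdiv_lt_0_compat; lra.
      * right. field. lra.
    + apply Rle_trans with (1 := HDi). rewrite Hh2.
      apply Rle_trans with (Q * Rabs h * Rabs h).
      * unfold Q. replace ((INR n + 1) * ((Rabs KD + 1) * (k * (Rabs h * Rabs h))))
          with ((INR n + 1) * (Rabs KD + 1) * k * (Rabs h * Rabs h)) by ring.
        rewrite (Rmult_assoc _ (Rabs h)). apply Rmult_le_compat_r; [now apply Rmult_le_pos|].
        apply Rmult_le_compat_l; [apply Rmult_le_pos|]; lra.
      * apply Rmult_le_compat_r; auto. apply (Rmult_lt_compat_l Q) in B3; auto.
        replace (Q * (eps / 2 / Q)) with (eps / 2) in B3 by (field; lra). lra.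
Qed.
End Flows.

(** * Functional calculus *)

Definition sinc (x : R) : R := if Req_EM_T x 0 then 1 else sin x / x.
Definition cosc (x : R) : R := if Req_EM_T x 0 then 0 else (1 - cos x) / x.

Lemma phi1_imag x : phi1 (0, x) = (sinc x, cosc x).
Proof.
  unfold phi1, sinc, cosc. destruct (Req_EM_T x 0) as [->|Hx].
  - destruct (Ceq_dec (0, 0) (RtoC 0)) as [_|H]; [reflexivity|]. now exfalso; apply H.
  - destruct (Ceq_dec (0, x) (RtoC 0)) as [H|_].
    + exfalso. apply Hx. now apply (f_equal snd) in H.
    + unfold cexp, Cdiv, Cminus, Cinv, Cmult, Cplus, Copp, RtoC. simpl. rewrite exp_0.
      f_equal; field; auto.
Qed.

Lemma sin_abs_le x : Rabs (sin x) <= Rabs x.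
Proof.
  destruct (MVT_gen sin 0 x cos) as [c [_ Hc]].
  - intros y _. auto_derive; auto. ring.
  - intros y _. apply (continuity_sin y).
  - rewrite sin_0, !Rminus_0_r in Hc. rewrite Hc, Rabs_mult.
    rewrite <- (Rmult_1_l (Rabs x)) at 2. apply Rmult_le_compat_r; [apply Rabs_pos|].
    apply Rabs_le. generalize (COS_bound c). lra.
Qed.

Lemma one_minus_cos_abs_le x : Rabs (1 - cos x) <= Rabs x.
Proof.
  destruct (MVT_gen (fun y => 1 - cos y) 0 x sin) as [c [_ Hc]].
  - intros y _. auto_derive; auto. ring.
  - intros y _. apply continuity_pt_minus; [now apply continuity_pt_const|]. apply (continuity_cos y).
  - rewrite cos_0, Rminus_0_r in Hc. replace (1 - cos x - (1 - 1)) with (1 - cos x) in Hc by ring.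
    rewrite Hc, Rabs_mult. rewrite <- (Rmult_1_l (Rabs x)) at 2.
    apply Rmult_le_compat_r; [apply Rabs_pos|]. apply Rabs_le. generalize (SIN_bound c). lra.
Qed.

Lemma sinc_bound x : Rabs (sinc x) <= 1.
Proof.
  unfold sinc. destruct (Req_EM_T x 0) as [_|Hx]; [rewrite Rabs_R1; lra|].
  unfold Rdiv. rewrite Rabs_mult, Rabs_inv. assert (P := Rabs_pos_lt x Hx).
  apply Rle_div_l; auto. rewrite Rmult_1_l. apply sin_abs_le.
Qed.

Lemma cosc_bound x : Rabs (cosc x) <= 1.
Proof.
  unfold cosc. destruct (Req_EM_T x 0) as [_|Hx]; [rewrite Rabs_R0; lra|].
  unfold Rdiv. rewrite Rabs_mult, Rabs_inv. assert (P := Rabs_pos_lt x Hx).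
  apply Rle_div_l; auto. rewrite Rmult_1_l. apply one_minus_cos_abs_le.
Qed.

(** Both [sinc] and [cosc] are of this form. *)
Lemma quotient_continuous (f : R -> R) (d0 : R) (x : R) :
  f 0 = 0 -> derivable_pt_lim f 0 d0 -> continuity f ->
  continuous (fun y => if Req_EM_T y 0 then d0 else f y / y) x.
Proof.
  intros H0 Hd Hc. destruct (Req_dec x 0) as [->|Hx].
  - apply (proj2 (continuous_iff (V := R_NormedModule) _ _)). intros eps Heps.
    destruct (Hd eps Heps) as [delta H]. exists delta. split; [apply cond_pos|]. intros t Ht.
    rewrite Rminus_0_r in Ht. destruct (Req_EM_T 0 0) as [_|Hn]; [|lra].
    change (Rabs ((if Req_EM_T t 0 then d0 else f t / t) - d0) < eps).
    destruct (Req_EM_T t 0) as [->|Ht0].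
    + rewrite Rminus_diag, Rabs_R0. auto.
    + specialize (H t Ht0 Ht). now rewrite Rplus_0_l, H0, Rminus_0_r in H.
  - apply (continuous_ext_loc (T := R_UniformSpace) (U := R_UniformSpace) (fun y => if Req_EM_T y 0 then d0 else f y / y) (fun y => f y / y)).
    + assert (P : 0 < Rabs x) by now apply Rabs_pos_lt.
      exists (mkposreal _ P). intros y Hy. change (Rabs (y - x) < Rabs x) in Hy.
      destruct (Req_EM_T y 0) as [->|_]; auto. rewrite Rminus_0_l, Rabs_Ropp in Hy. lra.
    + apply continuity_pt_filterlim. apply continuity_pt_div; auto.
      apply derivable_continuous_pt, derivable_pt_id.
Qed.

Lemma sinc_continuous x : continuous sinc x.
Proof.
  apply (quotient_continuous sin 1 x sin_0); [|apply continuity_sin].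
  replace 1 with (cos 0) by apply cos_0. apply derivable_pt_lim_sin.
Qed.

Lemma cosc_continuous x : continuous cosc x.
Proof.
  apply (quotient_continuous (fun y => 1 - cos y) 0 x).
  - rewrite cos_0. ring.
  - apply is_derive_Reals. auto_derive; auto. rewrite sin_0. ring.
  - intros y. apply continuity_pt_minus; [now apply continuity_pt_const|]. apply continuity_cos.
Qed.

Lemma continuous_C (f g : R -> R) x :
  continuous f x -> continuous g x -> continuous (fun y => ((f y, g y) : C)) x.
Proof.
  intros Hf Hg P [eps HP].
  assert (H1 : locally x (fun y => ball (f x) eps (f y))) by exact (Hf _ (locally_ball (f x) eps)).
  assert (H2 : locally x (fun y => ball (g x) eps (g y))) by exact (Hg _ (locally_ball (g x) eps)).
  generalize (filter_and _ _ H1 H2). unfold filtermap. apply filter_imp. intros y [Y1 Y2]. apply HP.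
  split; [exact Y1|exact Y2].
Qed.

Lemma bounded_cont_C (f g : R -> R) : (forall x, continuous f x) -> (forall x, continuous g x) ->
  (forall x, Rabs (f x) <= 1) -> (forall x, Rabs (g x) <= 1) ->
  bounded_cont (fun y => ((f y, g y) : C)) /\ forall x, Cmod (f x, g x) <= 2.
Proof.
  intros Hf Hg Bf Bg.
  assert (B : forall x, Cmod (f x, g x) <= 2).
  { intros x. apply Rle_trans with (1 := Cmod_2Rmax _). simpl.
    assert (M : Rmax (Rabs (f x)) (Rabs (g x)) <= 1) by (apply Rmax_lub; auto).
    assert (Q : sqrt 2 <= 2).
    { rewrite <- (sqrt_square 2) at 2 by lra. apply sqrt_le_1; lra. }
    assert (P := sqrt_pos 2). assert (P' : 0 <= Rmax (Rabs (f x)) (Rabs (g x))).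
    { apply Rle_trans with (1 := Rabs_pos (f x)). apply Rmax_l. }
    nra. }
  split; auto. split; [|now exists 2]. intros x. now apply continuous_C.
Qed.

Lemma bounded_cont_mult (g h : R -> C) : bounded_cont g -> bounded_cont h ->
  bounded_cont (fun l => Cmult (g l) (h l)).
Proof.
  intros [G1 [K1 G2]] [H1 [K2 H2]]. split.
  - assert (Hc : forall f : R -> C, (forall x, continuous f x) ->
      (forall x, continuous (fun l => fst (f l)) x) /\ (forall x, continuous (fun l => snd (f l)) x)).
    { intros f Hf. split; intros x.
      - apply (continuous_comp f fst); [apply Hf|apply continuous_fst].
      - apply (continuous_comp f snd); [apply Hf|apply continuous_snd]. }
    destruct (Hc g G1) as [Gf Gs]. destruct (Hc h H1) as [Hf Hs]. intros x.
    apply (continuous_C (fun l => fst (g l) * fst (h l) - snd (g l) * snd (h l))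
      (fun l => fst (g l) * snd (h l) + snd (g l) * fst (h l))).
    + apply (continuous_minus (V := R_NormedModule)); now apply (continuous_mult (K := R_AbsRing)).
    + apply (continuous_plus (V := R_NormedModule)); now apply (continuous_mult (K := R_AbsRing)).
  - exists (K1 * K2). intros x. rewrite Cmod_mult. apply Rmult_le_compat; auto; apply Cmod_ge_0.
Qed.

Definition exp_fun (t : R) (l : R) : C := cexp (0, t * l).
Definition phi_fun (t : R) (l : R) : C := phi1 (0, t * l).

Lemma scaled_continuous (f : R -> R) t : (forall x, continuous f x) -> forall x, continuous (fun l => f (t * l)) x.
Proof.
  intros Hf x. apply (continuous_comp (fun l => t * l) f); auto.
  apply (continuous_scal_r (V := R_NormedModule) t (fun l => l)). apply continuous_id.
Qed.

Lemma exp_fun_bc t : bounded_cont (exp_fun t).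
Proof.
  unfold exp_fun, cexp. simpl. rewrite exp_0.
  replace (fun l => (1 * cos (t * l), 1 * sin (t * l))) with (fun l => ((cos (t * l), sin (t * l)) : C)).
  - apply bounded_cont_C.
    + apply scaled_continuous. intros x. apply continuity_pt_filterlim, continuity_cos.
    + apply scaled_continuous. intros x. apply continuity_pt_filterlim, continuity_sin.
    + intros x. apply Rabs_le. generalize (COS_bound (t * x)). lra.
    + intros x. apply Rabs_le. generalize (SIN_bound (t * x)). lra.
  - apply functional_extensionality. intros l. now rewrite !Rmult_1_l.
Qed.

Lemma phi_fun_bc t : bounded_cont (phi_fun t) /\ forall l, Cmod (phi_fun t l) <= 2.
Proof.
  unfold phi_fun.
  replace (fun l => phi1 (0, t * l)) with (fun l => ((sinc (t * l), cosc (t * l)) : C)).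
  - destruct (bounded_cont_C (fun l => sinc (t * l)) (fun l => cosc (t * l))) as [H1 H2].
    + apply scaled_continuous, sinc_continuous.
    + apply scaled_continuous, cosc_continuous.
    + intros x. apply sinc_bound.
    + intros x. apply cosc_bound.
    + split; auto. intros l. rewrite phi1_imag. apply H2.
  - apply functional_extensionality. intros l. now rewrite phi1_imag.
Qed.

(** Cocycle identity behind [int_0^(t+h) = int_0^t + e^(tA) int_0^h]. *)
Lemma phi_fun_add t h l :
  Cmult (RtoC (t + h)) (phi_fun (t + h) l) =
  Cplus (Cmult (RtoC t) (phi_fun t l)) (Cmult (exp_fun t l) (Cmult (RtoC h) (phi_fun h l))).
Proof.
  unfold phi_fun, exp_fun. rewrite !phi1_imag. unfold cexp, sinc, cosc. simpl. rewrite exp_0.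
  assert (G : forall s, s * (if Req_EM_T (s * l) 0 then 1 else sin (s * l) / (s * l))
     = if Req_EM_T l 0 then s else sin (s * l) / l).
  { intros s. destruct (Req_EM_T l 0) as [->|Hl].
    - destruct (Req_EM_T (s * 0) 0) as [_|H]; [ring|]. exfalso. apply H. ring.
    - destruct (Req_EM_T (s * l) 0) as [H|H].
      + apply Rmult_integral in H. destruct H as [->|H]; [|lra].
        rewrite !Rmult_0_l, sin_0. field. auto.
      + field. split; auto. intros ->. apply H. ring. }
  assert (G' : forall s, s * (if Req_EM_T (s * l) 0 then 0 else (1 - cos (s * l)) / (s * l))
     = if Req_EM_T l 0 then 0 else (1 - cos (s * l)) / l).
  { intros s. destruct (Req_EM_T l 0) as [->|Hl].
    - destruct (Req_EM_T (s * 0) 0) as [_|H]; [ring|]. exfalso. apply H. ring.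
    - destruct (Req_EM_T (s * l) 0) as [H|H].
      + apply Rmult_integral in H. destruct H as [->|H]; [|lra].
        rewrite !Rmult_0_l, cos_0. field. auto.
      + field. split; auto. intros ->. apply H. ring. }
  assert (M : forall (s a b : R), Cmult (RtoC s) (a, b) = (s * a, s * b)).
  { intros s a b. unfold Cmult, RtoC. simpl. f_equal; ring. }
  rewrite !M, !G, !G'. unfold Cmult, Cplus. simpl.
  destruct (Req_EM_T l 0) as [->|Hl].
  - rewrite !Rmult_0_r, cos_0, sin_0. f_equal; ring.
  - replace ((t + h) * l) with (t * l + h * l) by ring. rewrite sin_plus, cos_plus.
    f_equal; field; auto.
Qed.

Section Calculus.
Context {d : nat} {Omega : Rd d -> Prop} {X : fun_hilbert Omega}.
Context {U : R -> X -> X} (HU : unitary_group U).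
Context {Phi : (R -> C) -> X -> X} (HPhi : functional_calculus U Phi).
Implicit Types u v y : X.

Notation HUs := (csg_of_group HU).

Lemma Phi_phi_add t h y :
  scal (t + h) (Phi (phi_fun (t + h)) y) = plus (scal t (Phi (phi_fun t) y)) (U t (scal h (Phi (phi_fun h) y))).
Proof.
  destruct HPhi as [P1 [P2 [P3 [P4 [P5 _]]]]].
  assert (Pc : forall c g, bounded_cont g -> bounded_cont (fun l => Cmult (RtoC c) (g l))).
  { intros c g Hg. apply (bounded_cont_mult (fun _ => RtoC c) g); auto. split.
    - intros x. apply continuous_const.
    - exists (Cmod (RtoC c)). intros x. apply Rle_refl. }
  assert (B := fun t => proj1 (phi_fun_bc t)).
  canon. rewrite <- !cscal_real. rewrite <- !P4 by auto. rewrite <- P1.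
  replace (fun l => Cmult (RtoC (t + h)) (phi_fun (t + h) l)) with
    (fun l => Cplus (Cmult (RtoC t) (phi_fun t l)) (Cmult (exp_fun t l) (Cmult (RtoC h) (phi_fun h l))))
    by (apply functional_extensionality; intros l; symmetry; apply phi_fun_add).
  rewrite P3; [|now apply Pc|].
  - f_equal. apply (P5 (exp_fun t)); [apply exp_fun_bc|now apply Pc].
  - apply (bounded_cont_mult (exp_fun t)); [apply exp_fun_bc|now apply Pc].
Qed.

(** The functional calculus is continuous for bounded pointwise convergence, and [phi_1(h .)] tends to [1]. *)
Lemma Phi_phi_0 y eps : 0 < eps -> exists delta, 0 < delta /\
  forall h, 0 < h < delta -> norm (minus (Phi (phi_fun h) y) y) < eps.
Proof.
  intros Heps. apply NNPP. intros Hn.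
  assert (Hc : forall n : nat, exists h, 0 < h < / (INR n + 1) /\ eps <= norm (minus (Phi (phi_fun h) y) y)).
  { intros n. apply NNPP. intros Hn'. apply Hn. exists (/ (INR n + 1)). split; [apply inv_INR_pos|].
    intros h Hh. apply Rnot_le_lt. intros Hle. apply Hn'. now exists h. }
  destruct (choice _ Hc) as [h Hh].
  destruct HPhi as [P1 [_ [_ [_ [_ [_ [_ P8]]]]]]].
  assert (Hl : filterlim (fun n => Phi (phi_fun (h n)) y) eventually (locally (Phi (exp_fun 0) y))).
  { apply (P8 (fun n => phi_fun (h n)) (exp_fun 0) 2 y).
    - intros n. apply phi_fun_bc.
    - apply exp_fun_bc.
    - intros n l. apply phi_fun_bc.
    - intros l.
      apply (filterlim_ext (fun n => ((sinc (h n * l), cosc (h n * l)) : C))).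
      { intros n. unfold phi_fun. now rewrite phi1_imag. }
      replace (exp_fun 0 l) with ((sinc 0, cosc 0) : C).
      + assert (Hlim : filterlim (fun n => h n * l) eventually (locally 0)).
        { apply (filterlim_locally_ball_norm (F := eventually) (U := R_NormedModule)). intros e.
          assert (He : 0 < e / (Rabs l + 1)).
          { apply Rdiv_lt_0_compat; [apply cond_pos|]. generalize (Rabs_pos l). lra. }
          destruct (inv_INR_small _ He) as [N HN]. exists N. intros n Hn2. specialize (HN n Hn2).
          change (Rabs (h n * l - 0) < e). rewrite Rminus_0_r, Rabs_mult.
          destruct (Hh n) as [[H1 H2] _]. rewrite (Rabs_right (h n)) by lra.
          assert (Pl := Rabs_pos l).
          apply Rle_lt_trans with (h n * (Rabs l + 1)); [apply Rmult_le_compat_l; lra|].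
          assert (H3 : h n < e / (Rabs l + 1)) by lra.
          apply (Rmult_lt_compat_r (Rabs l + 1)) in H3; [|lra].
          replace (e / (Rabs l + 1) * (Rabs l + 1)) with (pos e) in H3 by (field; lra). exact H3. }
        apply (filterlim_comp _ _ _ (fun n => h n * l) (fun x => ((sinc x, cosc x) : C)) _ _ _ Hlim).
        apply (continuous_C sinc cosc 0); [apply sinc_continuous|apply cosc_continuous].
      + unfold exp_fun, cexp, sinc, cosc. simpl. rewrite Rmult_0_l, exp_0, cos_0, sin_0.
        destruct (Req_EM_T 0 0); [|lra]. f_equal; ring. }
  unfold exp_fun in Hl. rewrite P1 in Hl.
  assert (E0 : U 0 y = y) by apply HU. rewrite E0 in Hl.
  apply (lim_to_filterlim (V := X)) in Hl. destruct (Hl eps Heps) as [N HN].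
  specialize (HN N (le_n N)). destruct (Hh N) as [_ H]. clra.
Qed.

(** Both sides satisfy the same cocycle identity and have the derivative [y] at [0]. *)
Lemma orbit_RInt_phi t y : 0 < t ->
  is_RInt (V := X) (fun s => U (Rabs s) y) 0 t (scal t (Phi (phi_fun t) y)).
Proof.
  intros Ht.
  set (q := fun s => scal s (Phi (phi_fun s) y)).
  set (I := fun s => RInt (V := X) (fun r => U (Rabs r) y) 0 s).
  assert (E : minus (I t) (q t) = minus (I 0) (q 0)).
  { apply (small_const (V := X) (fun s => minus (I s) (q s)) 0 t); [lra|]. intros eps Heps.
    destruct (Phi_phi_0 y (eps / 2)) as [d1 [Hd1 D1]]; [lra|].
    destruct (csg_cont0 HUs y (eps / 2)) as [d2 [Hd2 D2]]; [lra|].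
    exists (Rmin d1 d2). split; [now apply Rmin_pos|]. intros s r Hs Hr Hd.
    assert (Hd3 := Rlt_le_trans _ _ _ Hd (Rmin_l d1 d2)).
    assert (Hd4 := Rlt_le_trans _ _ _ Hd (Rmin_r d1 d2)).
    destruct (Req_dec s r) as [->|Hne]; [rewrite norm_0 by vec; lra|].
    set (e := r - s) in *. assert (He : 0 < e) by (unfold e; lra).
    assert (Eq : q r = plus (q s) (U s (q e))).
    { unfold q. replace r with (s + e) by (unfold e; ring). apply Phi_phi_add. }
    assert (EI : I r = plus (I s) (U s (I e))).
    { unfold I. rewrite (orbit_RInt_shift HUs s 0 e) by lra. rewrite Rplus_0_r.
      replace (s + e) with r by (unfold e; ring). symmetry.
      apply (RInt_Chasles (V := X)); eexists; apply (orbit_RInt HUs). }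
    assert (D3 := avg_near HUs e y y (eps / 2) He (fun p Hp => Rlt_le _ _ (D2 p ltac:(lra)))).
    assert (D4 := D1 e ltac:(lra)).
    apply Rle_trans with (norm (U s (scal e (minus (scal (/ e) (I e)) (Phi (phi_fun e) y))))).
    - right. f_equal. rewrite EI, Eq.
      assert (E1 : scal e (minus (scal (/ e) (I e)) (Phi (phi_fun e) y)) = minus (I e) (q e)) by (unfold q; vec).
      rewrite E1. canon. rewrite (csg_sub HUs) by lra. vec.
    - apply Rle_trans with (1 := csg_norm HUs s _ ltac:(lra)). canon.
      rewrite norm_scal_eq, Rabs_right, Rmult_comm by lra. apply Rmult_le_compat_r; [lra|].
      unfold avg in D3. fold (I e) in D3.
      apply Rle_trans with (norm (minus (scal (/ e) (I e)) y) + norm (minus (Phi (phi_fun e) y) y)).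
      + apply norm_le2m. vec.
      + clra. }
  assert (E0 : I 0 = zero) by apply (RInt_point (V := X)).
  assert (Et : q t = I t).
  { apply (vec_from (-1) _ _ _ _ E). rewrite E0. unfold q. vec. }
  unfold q in Et. rewrite Et. apply (orbit_RInt HUs).
Qed.
End Calculus.

(** * Derivatives of composed orbits *)

Definition deriv_within {V : NormedModule R_AbsRing} (b : R) (h : R -> V) (x : R) (d : V) : Prop :=
  forall eps, 0 < eps -> exists delta, 0 < delta /\ forall y, 0 <= y <= b -> Rabs (y - x) < delta ->
    norm (minus (minus (h y) (h x)) (scal (y - x) d)) <= eps * Rabs (y - x).

Lemma deriv_within_unique {V : NormedModule R_AbsRing} b (h : R -> V) x d d' :
  0 < b -> 0 <= x <= b -> deriv_within b h x d -> deriv_within b h x d' -> d = d'.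
Proof.
  intros Hb Hx H H'. apply minus_eq, le_eps. intros eps Heps.
  destruct (H (eps / 2)) as [e1 [He1 D1]]; [lra|]. destruct (H' (eps / 2)) as [e2 [He2 D2]]; [lra|].
  assert (Hy : exists y, 0 <= y <= b /\ y <> x /\ Rabs (y - x) < e1 /\ Rabs (y - x) < e2).
  { set (m := Rmin (Rmin e1 e2) b / 2).
    assert (Hm : 0 < m < e1 /\ m < e2 /\ m < b / 2 + b / 4).
    { unfold m. generalize (Rmin_l (Rmin e1 e2) b) (Rmin_r (Rmin e1 e2) b) (Rmin_l e1 e2) (Rmin_r e1 e2)
        (Rmin_pos _ _ (Rmin_pos _ _ He1 He2) Hb). lra. }
    assert (Hm' : m <= b / 2). { unfold m. generalize (Rmin_r (Rmin e1 e2) b). lra. }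
    destruct (Rle_dec x (b / 2)).
    - exists (x + m). replace (x + m - x) with m by ring. rewrite Rabs_right by lra. lra.
    - exists (x - m). replace (x - m - x) with (- m) by ring. rewrite Rabs_Ropp, Rabs_right by lra. lra. }
  destruct Hy as [y [Hyb [Hne [Hy1 Hy2]]]]. specialize (D1 y Hyb Hy1). specialize (D2 y Hyb Hy2).
  assert (P : 0 < Rabs (y - x)) by (apply Rabs_pos_lt; lra).
  assert (E : norm (scal (y - x) (minus d d')) <= eps * Rabs (y - x)).
  { apply Rle_trans with (norm (minus (minus (h y) (h x)) (scal (y - x) d'))
      + norm (minus (minus (h y) (h x)) (scal (y - x) d))); [|lra].
    apply norm_le2m. vec. }
  rewrite norm_scal_eq in E. apply Rmult_le_reg_r with (Rabs (y - x)); auto. lra.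
Qed.

(** A mean value theorem: the derivatives need to be in [K] only up to arbitrarily small errors, since
    [K] is closed. *)
Lemma convex_mean_deriv {V : NormedModule R_AbsRing} J (K : (nat -> V) -> Prop) (h : R -> nat -> V) b :
  0 < b -> fam_convex K -> fam_closed J K ->
  (forall x eps, 0 <= x <= b -> 0 < eps -> exists d c, K d /\
     forall k, (k <= J)%nat -> deriv_within b (fun y => h y k) x (c k) /\ norm (minus (c k) (d k)) <= eps) ->
  K (fun k => scal (/ b) (minus (h b k) (h 0 k))).
Proof.
  intros Hb Hcv Hcl H.
  assert (Hm := convex_mean_value J K h 0 b Hb Hcv Hcl). rewrite Rminus_0_r in Hm. apply Hm. clear Hm.
  intros x eps Hx Heps. destruct (H x (eps / 2) Hx) as [d [c [Kd Hc]]]; [lra|].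
  assert (Hdel : exists delta, 0 < delta /\ forall k, (k <= J)%nat -> forall y, 0 <= y <= b ->
    Rabs (y - x) < delta ->
    norm (minus (minus (h y k) (h x k)) (scal (y - x) (c k))) <= eps / 2 * Rabs (y - x)).
  { assert (Hdel : forall m, (m <= J)%nat -> exists delta, 0 < delta /\ forall k, (k <= m)%nat ->
      forall y, 0 <= y <= b -> Rabs (y - x) < delta ->
      norm (minus (minus (h y k) (h x k)) (scal (y - x) (c k))) <= eps / 2 * Rabs (y - x)); [|now apply Hdel].
    induction m as [|m IH]; intros Hm.
    - destruct (proj1 (Hc O Hm) (eps / 2)) as [e [He D]]; [lra|]. exists e. split; auto.
      intros k Hk. replace k with O by lia. exact D.
    - destruct (IH ltac:(lia)) as [e1 [He1 D1]].
      destruct (proj1 (Hc (S m) Hm) (eps / 2)) as [e2 [He2 D2]]; [lra|].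
      exists (Rmin e1 e2). split; [now apply Rmin_pos|]. intros k Hk y Hy Hyx.
      destruct (Nat.eq_dec k (S m)) as [->|Hne].
      + apply D2; auto. apply Rlt_le_trans with (1 := Hyx), Rmin_r.
      + apply D1; auto; [lia|]. apply Rlt_le_trans with (1 := Hyx), Rmin_l. }
  destruct Hdel as [delta [Hd D]]. exists delta, d. split; [auto|split; [auto|]].
  intros s t k Hs Ht Hst Hk.
  assert (D1 := D k Hk t ltac:(lra) ltac:(rewrite Rabs_right; lra)).
  assert (D2 := D k Hk s ltac:(lra) ltac:(rewrite Rabs_left1; lra)).
  rewrite Rabs_right in D1 by lra. rewrite Rabs_left1 in D2 by lra.
  assert (D3 := proj2 (Hc k Hk)).
  apply Rle_trans with (norm (minus (minus (h t k) (h x k)) (scal (t - x) (c k)))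
    + norm (minus (minus (h s k) (h x k)) (scal (s - x) (c k))) + norm (scal (t - s) (minus (c k) (d k)))).
  - apply Rle_trans with (norm (minus (minus (minus (h t k) (h x k)) (scal (t - x) (c k)))
      (minus (minus (h s k) (h x k)) (scal (s - x) (c k)))) + norm (scal (t - s) (minus (c k) (d k)))).
    + apply norm_le2. vec.
    + apply Rplus_le_compat_r. now apply norm_le2m.
  - rewrite norm_scal_eq, Rabs_right by lra.
    assert ((t - s) * norm (minus (c k) (d k)) <= (t - s) * (eps / 2)) by (apply Rmult_le_compat_l; lra).
    lra.
Qed.

(** The remaining time [b - y] decreases, hence the sign of [z]. *)
Lemma product_rule {V : CompleteNormedModule R_AbsRing} {T : R -> V -> V} {K : op V}
    (HT : csg T) (HK : gen K T) b (phi : R -> V) x (d z : V) :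
  0 <= x <= b -> deriv_within b phi x d -> K (phi x) z ->
  deriv_within b (fun y => T (b - y) (phi y)) x (T (b - x) (minus d z)).
Proof.
  intros Hx Hd Hz eps Heps.
  destruct (Hd (eps / 4)) as [d1 [Hd1 D1]]; [lra|].
  destruct (gen_approx HK (phi x) z (eps / 4) Hz) as [d2 [Hd2 D2]]; [lra|].
  destruct (csg_cont0 HT (minus d z) (eps / 4)) as [d3 [Hd3 D3]]; [lra|].
  destruct (csg_cont0 HT d (eps / 4)) as [d4 [Hd4 D4]]; [lra|].
  exists (Rmin (Rmin d1 d2) (Rmin d3 d4)). split; [repeat apply Rmin_pos; auto|].
  intros y Hy Hyx.
  assert (B : Rabs (y - x) < d1 /\ Rabs (y - x) < d2 /\ Rabs (y - x) < d3 /\ Rabs (y - x) < d4).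
  { generalize (Rmin_l (Rmin d1 d2) (Rmin d3 d4)) (Rmin_r (Rmin d1 d2) (Rmin d3 d4))
      (Rmin_l d1 d2) (Rmin_r d1 d2) (Rmin_l d3 d4) (Rmin_r d3 d4). lra. }
  destruct B as [B1 [B2 [B3 B4]]]. specialize (D1 y Hy B1). clear Hyx.
  assert (Hr : exists r, phi y = plus (plus (phi x) (scal (y - x) d)) r /\ norm r <= eps / 4 * Rabs (y - x)).
  { exists (minus (minus (phi y) (phi x)) (scal (y - x) d)). split; [vec|exact D1]. }
  clear D1. destruct Hr as [r [Er D1]]. rewrite Er. clear Er.
  destruct (Rle_dec x y) as [Hxy|Hxy].
  - rewrite Rabs_right in * by lra. set (e := y - x) in *. assert (He : 0 <= e) by (unfold e; lra).
    assert (Hpe : 0 <= eps * e) by (apply Rmult_le_pos; lra).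
    specialize (D2 e ltac:(lra)). specialize (D3 e ltac:(lra)).
    replace (b - x) with ((b - y) + e) by (unfold e; ring). rewrite !(csg_plus HT) by lra.
    set (q := minus (minus (T e (phi x)) (phi x)) (scal e z)) in *.
    set (p := minus (T e (minus d z)) (minus d z)) in *.
    apply Rle_trans with (norm (T (b - y) (minus (minus r q) (scal e p)))).
    + right. f_equal. unfold q, p. canon.
      repeat (rewrite ?(csg_sub HT), ?(csg_add HT), ?(csg_scal HT) by lra). vec.
    + apply Rle_trans with (1 := csg_norm HT (b - y) _ ltac:(lra)).
      apply Rle_trans with (norm (minus r q) + norm (scal e p)); [now apply norm_le2m|].
      assert (Q1 : norm (minus r q) <= norm r + norm q) by now apply norm_le2m.
      assert (Q2 : norm (scal e p) <= e * (eps / 4)).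
      { canon. rewrite norm_scal_eq, Rabs_right by lra. apply Rmult_le_compat_l; auto. clra. }
      clra.
  - rewrite Rabs_left in * by lra. set (e := x - y) in *. assert (He : 0 <= e) by (unfold e; lra).
    assert (Hpe : 0 <= eps * e) by (apply Rmult_le_pos; lra).
    replace (- (y - x)) with e in * by (unfold e; ring). replace (y - x) with (- e) in * by (unfold e; ring).
    specialize (D2 e ltac:(lra)). specialize (D4 e ltac:(lra)).
    replace (b - y) with ((b - x) + e) by (unfold e; ring). rewrite !(csg_plus HT) by lra.
    set (q := minus (minus (T e (phi x)) (phi x)) (scal e z)) in *.
    set (p := minus (T e d) d) in *.
    apply Rle_trans with (norm (T (b - x) (minus (plus q (T e r)) (scal e p)))).
    + right. f_equal.
      unfold q, p. canon.
      repeat (rewrite ?(csg_sub HT), ?(csg_add HT), ?(csg_scal HT) by lra). vec.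
    + apply Rle_trans with (1 := csg_norm HT (b - x) _ ltac:(lra)).
      apply Rle_trans with (norm (plus q (T e r)) + norm (scal e p)); [now apply norm_le2m|].
      assert (Q1 : norm (plus q (T e r)) <= norm q + norm (T e r)) by now apply norm_le2.
      assert (Q2 : norm (scal e p) <= e * (eps / 4)).
      { canon. rewrite norm_scal_eq, Rabs_right by lra. apply Rmult_le_compat_l; auto. clra. }
      assert (Q3 := csg_norm HT e r He).
      clra.
Qed.

(** * The nonlinearity *)

Section Nonlinearity.
Context {d : nat} {Omega : Rd d -> Prop} {X : fun_hilbert Omega}.
Context {B : cfun Omega -> X -> Prop} (hB : linear_fun_op B) {F G : C -> nat -> C} {J : nat}.
Implicit Types u v w z : X.

Lemma cdot_ext (Y Z Z' : nat -> C) : (forall k, (1 <= k <= J)%nat -> Z k = Z' k) ->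
  cdot J Y Z = cdot J Y Z'.
Proof. intros H. apply sum_n_m_ext_loc. intros k Hk. now rewrite H. Qed.

Lemma cdot_lin (Y Z Z' : nat -> C) (a b : C) :
  cdot J Y (fun k => Cplus (Cmult a (Z k)) (Cmult b (Z' k))) =
  Cplus (Cmult a (cdot J Y Z)) (Cmult b (cdot J Y Z')).
Proof.
  unfold cdot.
  assert (E1 : Cmult a (sum_n_m (fun k => Cmult (Y k) (Z k)) 1 J)
    = sum_n_m (fun k => Cmult a (Cmult (Y k) (Z k))) 1 J).
  { symmetry. apply (sum_n_m_mult_l (K := C_Ring) a). }
  assert (E2 : Cmult b (sum_n_m (fun k => Cmult (Y k) (Z' k)) 1 J)
    = sum_n_m (fun k => Cmult b (Cmult (Y k) (Z' k))) 1 J).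
  { symmetry. apply (sum_n_m_mult_l (K := C_Ring) b). }
  rewrite E1, E2.
  transitivity (sum_n_m (fun k => plus (G := C_AbelianMonoid) (Cmult a (Cmult (Y k) (Z k)))
    (Cmult b (Cmult (Y k) (Z' k)))) 1 J).
  - apply sum_n_m_ext. intros k.
    change (Cmult (Y k) (Cplus (Cmult a (Z k)) (Cmult b (Z' k))) =
      Cplus (Cmult a (Cmult (Y k) (Z k))) (Cmult b (Cmult (Y k) (Z' k)))). ring.
  - apply (sum_n_m_plus (G := C_AbelianMonoid)).
Qed.

Lemma negl_finite (P : nat -> pt Omega -> Prop) m : (forall k, (1 <= k <= m)%nat -> hs_negl X (P k)) ->
  hs_negl X (fun x => exists k, (1 <= k <= m)%nat /\ P k x).
Proof.
  induction m as [|m IH]; intros H.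
  - apply hs_negl_sub with (2 := hs_negl_empty X). intros x [k [Hk _]]. lia.
  - assert (H1 := H (S m) ltac:(lia)). assert (H2 := IH (fun k Hk => H k ltac:(lia))).
    apply hs_negl_sub with (2 := hs_negl_union H1 H2).
    intros x [k [Hk Hx]]. destruct (Nat.eq_dec k (S m)) as [->|Hne]; [now left|].
    right. exists k. split; auto. lia.
Qed.

Lemma eqae_cdot v (Z Z' : nat -> cfun Omega) :
  (forall k, (1 <= k <= J)%nat -> eqae X (Z k) (Z' k)) ->
  eqae X (fun x => cdot J (F (hs_fun v x)) (fun k => Z k x)) (fun x => cdot J (F (hs_fun v x)) (fun k => Z' k x)).
Proof.
  intros H. apply hs_negl_sub with (2 := negl_finite _ J H).
  intros x Hx. apply NNPP. intros Hn. apply Hx. apply cdot_ext. intros k Hk.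
  apply NNPP. intros Hk'. apply Hn. now exists k.
Qed.

Lemma B_unique phi z z' : B phi z -> B phi z' -> z = z'.
Proof. apply hB. Qed.

Lemma B_eqae phi psi z : eqae X phi psi -> B phi z -> B psi z.
Proof. apply hB. Qed.

Lemma B_eqfun phi psi z : (forall x, phi x = psi x) -> B phi z -> B psi z.
Proof.
  intros H. apply B_eqae. apply hs_negl_sub with (2 := hs_negl_empty X). intros x Hx. now apply Hx.
Qed.

Lemma BF_unique v Y z z' : BF B F J v Y z -> BF B F J v Y z' -> z = z'.
Proof. apply B_unique. Qed.

Lemma BF_ext v (Y Y' : nat -> X) z : (forall k, (1 <= k <= J)%nat -> Y k = Y' k) ->
  BF B F J v Y z -> BF B F J v Y' z.
Proof.
  intros H. apply B_eqfun. intros x. apply cdot_ext. intros k Hk. now rewrite H.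
Qed.

Lemma BF_lin v (Y Y' : nat -> X) z z' (a b : R) : BF B F J v Y z -> BF B F J v Y' z' ->
  BF B F J v (fun k => plus (scal a (Y k)) (scal b (Y' k))) (plus (scal a z) (scal b z')).
Proof.
  intros H H'. destruct hB as [_ [_ [Hadd Hscal]]].
  assert (Ha := Hscal (RtoC a) _ _ H). assert (Hb := Hscal (RtoC b) _ _ H').
  rewrite cscal_real in Ha, Hb. assert (Hs := Hadd _ _ _ _ Ha Hb).
  unfold BF. revert Hs. apply B_eqae.
  apply eqae_trans with (fun x => cdot J (F (hs_fun v x))
    (fun k => Cplus (Cmult (RtoC a) (hs_fun (Y k) x)) (Cmult (RtoC b) (hs_fun (Y' k) x)))).
  - apply hs_negl_sub with (2 := hs_negl_empty X). intros x Hx. apply Hx. symmetry. apply cdot_lin.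
  - apply (eqae_cdot v (fun k x => Cplus (Cmult (RtoC a) (hs_fun (Y k) x)) (Cmult (RtoC b) (hs_fun (Y' k) x)))
      (fun k x => hs_fun (plus (scal a (Y k)) (scal b (Y' k))) x)).
    intros k _. apply eqae_sym. apply eqae_trans with (1 := hs_fun_plus _ _).
    apply (eqae_map2 Cplus).
    + canon. rewrite <- cscal_real. apply hs_fun_cscal.
    + canon. rewrite <- cscal_real. apply hs_fun_cscal.
Qed.

Lemma nonlin_unique v w z z' : nonlin B F G J v w z -> nonlin B F G J v w z' -> z = z'.
Proof. apply B_unique. Qed.

Lemma comp_fun_unique k w y y' : comp_fun G k w y -> comp_fun G k w y' -> y = y'.
Proof. intros H H'. apply hs_fun_ext. apply eqae_trans with (1 := H). now apply eqae_sym. Qed.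

Lemma nonlin_BF v w (Y : nat -> X) z : (forall k, (1 <= k <= J)%nat -> comp_fun G k w (Y k)) ->
  (nonlin B F G J v w z <-> BF B F J v Y z).
Proof.
  intros H.
  assert (E : eqae X (fun x => cdot J (F (hs_fun v x)) (fun k => hs_fun (Y k) x))
    (fun x => cdot J (F (hs_fun v x)) (G (hs_fun w x)))).
  { apply (eqae_cdot v (fun k => hs_fun (Y k)) (fun k x => G (hs_fun w x) k)). exact H. }
  split; intros Hz; revert Hz; apply B_eqae; auto. now apply eqae_sym.
Qed.

Lemma Psi_num_unique (Phi : (R -> C) -> X -> X) tau v z z' :
  Psi_num Phi B F G J tau v z -> Psi_num Phi B F G J tau v z' -> z = z'.
Proof.
  intros [y [Hy Hz]] [y' [Hy' Hz']]. apply (BF_unique v (fun k => Phi (fun l => phi1 (0, tau * l)) (y k))); auto.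
  revert Hz'. apply BF_ext. intros k Hk. f_equal. now apply (comp_fun_unique k (hs_conj v)); auto.
Qed.
End Nonlinearity.

Lemma bounded_in_iff {d} {Omega : Rd d -> Prop} {X : fun_hilbert Omega} (L : op X) a (E : X -> Prop) r :
  bounded_in L a E r <-> exists z, E z /\ xball (V := X) (K := L) a r z.
Proof.
  split.
  - intros [z [q [Hz [[w [Hw ->]] Hq]]]]. exists z. split; auto. now exists w.
  - intros [z [Hz [w [Hw Hr]]]]. exists z, (norm z + norm w). repeat split; auto. now exists w.
Qed.

Lemma xball_has_norm {d} {Omega : Rd d -> Prop} {X : fun_hilbert Omega} (L : op X) a r u :
  xball (V := X) (K := L) a r u -> exists p, has_norm L a u p /\ p <= r.
Proof. intros [w [Hw Hr]]. exists (norm u + norm w). split; auto. now exists w. Qed.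

Lemma has_norm_xball {d} {Omega : Rd d -> Prop} {X : fun_hilbert Omega} (L : op X) a p u :
  has_norm L a u p -> xball (V := X) (K := L) a p u.
Proof. intros [w [Hw ->]]. exists w. split; auto. apply Rle_refl. Qed.

(** * The local error for regular data *)

Section LocalError.
Context {d : nat} {Omega : Rd d -> Prop} {X : fun_hilbert Omega}.
Context {L : op X} {S : R -> X -> X} {U : R -> X -> X} {Phi : (R -> C) -> X -> X}.
Context {J : nat} {F G : C -> nat -> C} {B : cfun Omega -> X -> Prop}.
Context (hS : contraction_semigroup S) (hL : generates_semigroup L S).
Context (hU : unitary_group U) (hA : generates_group (A_op L) U).
Context (hcomm : commutes_with_bar S) (hPhi : functional_calculus U Phi).
Context (hB : linear_fun_op B) (hBcl : closed_fun_op L B F J).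
Context {alpha0 alpha1 : R} (Ha0 : 0 <= alpha0) (Ha1 : 0 <= alpha1).
Context {cf : R -> R -> R} (Hcf : const2 cf) (h3f : forall v w p q,
  has_norm L alpha1 v p -> has_norm L alpha1 w q ->
  bounded_in L alpha0 (cont_ext L alpha1 (comm_f L B F G J) v w) (cf p q)).
Context {cg : R -> R -> R} (Hcg : const2 cg) (h3G : forall s v w p q,
  has_norm L alpha1 v p -> has_norm L alpha1 w q ->
  bounded_in L alpha0 (cont_ext L alpha1 (B_comm_G L U B F G J s) v w) (cg p q)).
Context {kc : R} (hconj : forall u p, has_norm L alpha1 u p ->
  bounded_in L alpha1 (fun z => z = hs_conj u) (kc * p)).
Implicit Types u v w z : X.

Notation HS := (csg_of_semigroup S hS).
Notation HL := (gen_of_semigroup L S hS hL).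
Notation HUs := (csg_of_group hU).
Notation HUg := (gen_of_group hU (A_op L) hA).
Notation Hip := (rip_inner (X := X)).
Notation ball := (xball (V := X) (K := L)).
Notation ball_S := (xball_S Hip HS HL).
Notation FS := (flow_S HS HL hcomm).
Notation FU := (flow_U HS HL hcomm hU hA).
Notation BU := (fun t Ht => bicomm_U HS HL hcomm hU hA t Ht).

Lemma ball_bicomm a r u A : 0 <= a -> bicomm (S := S) A -> contraction (V := X) A -> ball a r u -> ball a r (A u).
Proof.
  intros Ha HA HA'. apply (xball_contraction Hip HS HL); auto. now apply bicomm_commuting.
Qed.

Lemma ball_U a r t u : 0 <= a -> 0 <= t -> ball a r u -> ball a r (U t u).
Proof. intros Ha Ht. apply ball_bicomm; auto; [now apply BU|apply (csg_contr HUs t Ht)]. Qed.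

Lemma const_seq_cvg a r u : 0 <= a -> ball a r u -> cvg_X L a (fun _ => u) u.
Proof.
  intros Ha [w [Hw _]]. exists (fun _ => 0). split; [|apply is_lim_seq_const].
  intros _. exists (minus w w). split.
  - generalize (frac_pow_lin Hip HS HL a u w u w 1 (-1) Ha Hw Hw).
    match goal with |- frac_pow L a ?x ?y -> frac_pow L a ?x' ?y' =>
      replace x with x' by vec; replace y with y' by vec end. auto.
  - rewrite !norm_0 by vec. ring.
Qed.

(** The constant sequences are admissible approximations of regular arguments. *)
Lemma comm_f_at v w p q : regular L v -> regular L w -> ball alpha1 p v -> ball alpha1 q w ->
  exists c, ball alpha0 (cf p q) c /\
    forall eps, 0 < eps -> exists c', comm_f L B F G J v w c' /\ norm (minus c' c) < eps.
Proof.
  intros Rv Rw Bv Bw.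
  destruct (xball_has_norm L alpha1 p v Bv) as [p' [Hp Hpp]].
  destruct (xball_has_norm L alpha1 q w Bw) as [q' [Hq Hqq]].
  destruct (proj1 (bounded_in_iff _ _ _ _) (h3f v w p' q' Hp Hq)) as [c [Hc Bc]].
  exists c. split; [apply xball_mono with (2 := Bc); now apply Hcf|].
  destruct (Hc (fun _ => v) (fun _ => w)) as [zn [Hzn Hlim]]; auto.
  - now apply const_seq_cvg with p.
  - now apply const_seq_cvg with q.
  - apply (lim_to_filterlim (V := X)) in Hlim. intros eps Heps. destruct (Hlim eps Heps) as [N HN].
    exists (zn N). split; [apply Hzn|apply HN; lia].
Qed.

Definition fval (v w : X) : X := epsilon (inhabits zero) (fun z => nonlin B F G J v w z).

Lemma fval_spec v w z : nonlin B F G J v w z -> nonlin B F G J v w (fval v w).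
Proof. intros H. unfold fval. apply epsilon_spec. now exists z. Qed.

Lemma fval_eq v w z : nonlin B F G J v w z -> fval v w = z.
Proof. intros H. apply (nonlin_unique hB (F := F) (G := G) (J := J) v w); auto. now apply fval_spec with z. Qed.

Lemma deriv_within_le b b' (h : R -> X) x (c : X) : b <= b' -> deriv_within (V := X) b' h x c -> deriv_within (V := X) b h x c.
Proof.
  intros Hb H eps Heps. destruct (H eps Heps) as [e [He D]]. exists e. split; auto.
  intros y Hy. apply D. lra.
Qed.

Lemma nonlin_curve (c0 c1 : R -> X) c0' c1' x (D : nat -> X -> X) :
  0 <= x -> regular_curve (L := L) c0 c0' x -> regular_curve (L := L) c1 c1' x ->
  Defs.differential L 1 (fun p => nonlin B F G J (p O) (p 1%nat))
    (fun i => match i with O => c0 x | _ => c1 x end) D ->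
  forall b, deriv_within (V := X) b (fun y => fval (c0 y) (c1 y)) x (plus (D O c0') (D 1%nat c1')).
Proof.
  intros Hx H0 H1 HD b.
  destruct (differential_curve HS HL 1 _ _ D (fun i => match i with O => c0 | _ => c1 end)
    (fun i => match i with O => c0' | _ => c1' end) x HD Hx) as [z0 [Hz0 Hd]].
  { intros i Hi. destruct i; auto. }
  simpl in Hz0. intros eps Heps. destruct (Hd eps Heps) as [e [He Hd']]. exists e. split; auto.
  intros y Hy Hyx. destruct (Hd' y (proj1 Hy) Hyx) as [z [Hz Nz]].
  assert (E : forall a c : X, plus a (minus c a) = c) by (intros; vec).
  simpl in Hz. rewrite !E in Hz.
  rewrite (fval_eq _ _ _ Hz), (fval_eq _ _ _ Hz0).
  rewrite sum_Sn, sum_O in Nz. exact Nz.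
Qed.

(** The curve [s |-> e^{(tau-s)L} f(e^{sL} v, e^{sL} w)] has the derivative
    [e^{(tau-s)L} C[f,L](e^{sL} v, e^{sL} w)], which stays in a ball of [X^alpha0]. *)
Lemma step_nonlin tau xi v w p q : 0 < xi <= tau -> regular L v -> regular L w ->
  ball alpha1 p v -> ball alpha1 q w ->
  ball alpha0 (xi * cf p q) (minus (S (tau - xi) (fval (S xi v) (S xi w))) (S tau (fval v w))).
Proof.
  intros Hxi Rv Rw Bv Bw.
  assert (Hm : ball alpha0 (cf p q) (scal (/ xi)
    (minus (S (tau - xi) (fval (S xi v) (S xi w))) (S (tau - 0) (fval (S 0 v) (S 0 w)))))).
  { apply (convex_mean_deriv (V := X) 0 (fun Y => ball alpha0 (cf p q) (Y O))
      (fun y _ => S (tau - y) (fval (S y v) (S y w))) xi); [lra| | |].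
    - intros Y Z t Ht HY HZ. now apply (xball_convex Hip HS HL).
    - intros Yn Y HY Hlim. apply (xball_closed Hip HS HL alpha0 (cf p q) Ha0 (fun n => Yn n O)); auto.
    - intros x eps Hx Heps.
      assert (Hbx := bicomm_S HS hcomm x (proj1 Hx)).
      destruct (comm_f_at (S x v) (S x w) p q) as [c [Bc Hc]].
      { now apply (regular_bicomm HL (S x)). } { now apply (regular_bicomm HL (S x)). }
      { apply ball_S; auto. lra. } { apply ball_S; auto. lra. }
      destruct (Hc eps Heps) as [c' [[z [y [Kv [D [_ [Hz [Hy [HKv [HD Hc']]]]]]]]] Nc]].
      exists (fun _ => S (tau - x) c), (fun _ => S (tau - x) c'). split.
      + apply ball_S; auto. lra.
      + intros k _. split.
        * apply deriv_within_le with tau; [lra|].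
          assert (Cv := flow_curve HS HL S L v x FS Rv (proj1 Hx)).
          assert (Cw := flow_curve HS HL S L w x FS Rw (proj1 Hx)).
          assert (E0 : Kv O = S x (gen_value L v)).
          { apply (gen_unique HL (S x v)); [now apply (HKv O); lia|].
            apply (gen_orbit HS HL); [lra|]. apply (gen_value_spec S L v FS Rv). }
          assert (E1 : Kv 1%nat = S x (gen_value L w)).
          { apply (gen_unique HL (S x w)); [now apply (HKv 1%nat); lia|].
            apply (gen_orbit HS HL); [lra|]. apply (gen_value_spec S L w FS Rw). }
          assert (Hd := nonlin_curve (fun y => S y v) (fun y => S y w) _ _ x D (proj1 Hx) Cv Cw HD tau).
          replace c' with (minus (plus (D O (S x (gen_value L v))) (D 1%nat (S x (gen_value L w)))) y).
          -- apply (product_rule HS HL tau (fun y => fval (S y v) (S y w))); auto; [lra|].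
             now rewrite (fval_eq _ _ _ Hz).
          -- rewrite Hc', sum_Sn, sum_O, E0, E1. vec.
        * canon. rewrite <- (csg_sub HS) by lra.
          apply Rle_trans with (1 := csg_norm HS (tau - x) _ ltac:(lra)). clra. }
  rewrite Rminus_0_r, !(csg_0 HS) in Hm.
  generalize (xball_scal Hip HS HL alpha0 _ _ xi Ha0 Hm). rewrite Rabs_right by lra.
  match goal with |- ?f ?a -> ?g ?b => replace a with b by vec end. auto.
Qed.

(** ** Second step: the commutator of [G] and [A] *)

Definition Gval (k : nat) (w : X) : X := epsilon (inhabits zero) (fun y => comp_fun G k w y).

Lemma Gval_spec k w y : comp_fun G k w y -> comp_fun G k w (Gval k w).
Proof. intros H. unfold Gval. apply epsilon_spec. now exists y. Qed.

Lemma Gval_eq k w y : comp_fun G k w y -> Gval k w = y.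
Proof. intros H. apply (comp_fun_unique (G := G) k w); auto. now apply Gval_spec with y. Qed.

(** [B(F(v) . Y)] is defined for some tuples [Y] only and need not be bounded in [Y].  Therefore the mean
    value theorem is applied to the tuples, for the convex set of those with value in a ball. *)
Definition BF_ball (v : X) (r : R) (Y : nat -> X) : Prop :=
  exists z, BF B F J v Y z /\ ball alpha0 r z.

Lemma BF_ball_convex v r : fam_convex (V := X) (BF_ball v r).
Proof.
  intros Y Z t Ht [y [Hy By]] [z [Hz Bz]]. exists (plus (scal t y) (scal (1 - t) z)). split.
  - now apply (BF_lin hB).
  - now apply (xball_convex Hip HS HL).
Qed.

(** Values in a ball have convex combinations that converge strongly; the same combinations of the tuples
    still converge to [Y], and [B] is closed. *)
Lemma BF_ball_closed v r : regular L v -> fam_closed (V := X) J (BF_ball v r).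
Proof.
  intros Rv Yn Y HYn HY.
  (* values at tuples that are close to [Y] *)
  set (P := fun n z => exists Z, (forall k, (1 <= k <= J)%nat -> norm (minus (Z k) (Y k)) <= / (INR n + 1)) /\
    BF B F J v Z z /\ ball alpha0 r z).
  destruct (nested_convex_limit (V := X) Hip P r) as [zn [z [Hzn Hz]]].
  - intros n z1 z2 t Ht [Z1 [A1 [B1 D1]]] [Z2 [A2 [B2 D2]]].
    exists (fun k => plus (scal t (Z1 k)) (scal (1 - t) (Z2 k))). split; [|split].
    + intros k Hk. apply (convex_ball (V := X) (Y k) (/ (INR n + 1))); auto.
    + now apply (BF_lin hB).
    + now apply (xball_convex Hip HS HL).
  - intros n z1 [Z [A1 [B1 D1]]]. exists Z. split; [|split]; auto. intros k Hk.
    apply Rle_trans with (1 := A1 k Hk). apply Rinv_le_contravar; rewrite ?S_INR; generalize (pos_INR n); lra.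
  - intros n.
    assert (HN : exists N, forall k, (k <= J)%nat -> norm (minus (Yn N k) (Y k)) <= / (INR n + 1)).
    { assert (HN : forall m, (m <= J)%nat -> exists N, forall i k, (N <= i)%nat -> (k <= m)%nat ->
        norm (minus (Yn i k) (Y k)) <= / (INR n + 1)).
      { induction m as [|m IH]; intros Hm.
        - destruct (HY O Hm _ (inv_INR_pos n)) as [N HN]. exists N. intros i k Hi Hk.
          replace k with O by lia. left. now apply HN.
        - destruct (IH ltac:(lia)) as [N1 D1]. destruct (HY (Datatypes.S m) Hm _ (inv_INR_pos n)) as [N2 D2].
          exists (max N1 N2). intros i k Hi Hk. destruct (Nat.eq_dec k (Datatypes.S m)) as [->|Hne].
          + left. apply D2. lia.
          + apply D1; lia. }
      destruct (HN J (le_n J)) as [N D]. exists N. intros k Hk. now apply D. }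
    destruct HN as [N HN]. destruct (HYn N) as [z [Hz Bz]]. exists z. split.
    + exists (Yn N). split; [|now split]. intros k Hk. apply HN. lia.
    + apply (xball_norm alpha0 r z Bz).
  - destruct (choice _ Hzn) as [Zn HZn]. exists z. split.
    + apply (hBcl v Zn Y zn z Rv).
      * intros n. apply HZn.
      * intros k Hk. apply (lim_to_filterlim (V := X)). apply lim_to_inv. intros n. now apply HZn.
      * now apply (lim_to_filterlim (V := X)).
    + apply (xball_closed Hip HS HL alpha0 r Ha0 zn); auto. intros n. apply HZn.
Qed.

Lemma BF_ball_ext v r (Y Z : nat -> X) : (forall k, (1 <= k <= J)%nat -> Y k = Z k) ->
  BF_ball v r Y -> BF_ball v r Z.
Proof. intros E [z [Hz Bz]]. exists z. split; auto. now apply (BF_ext hB v Y). Qed.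

(** The commutator of [G_k] and [A] is the derivative of [s |-> e^{(b-s)A} G_k(e^{sA} w)], up to the group. *)
Lemma Gval_curve b k w x c : 0 <= x <= b -> regular L w ->
  commutator L 0 (fun p => comp_fun G k (p O)) (A_op L) (fun _ => U x w) c ->
  comp_fun G k (U x w) (Gval k (U x w)) /\
  exists g', deriv_within (V := X) b (fun y => Gval k (U y w)) x g' /\
    deriv_within (V := X) b (fun y => U (b - y) (Gval k (U y w))) x (U (b - x) c).
Proof.
  intros Hx Rw [z [y [Kv [D [_ [Hz [Hy [HKv [HD Hc]]]]]]]]].
  split; [now apply Gval_spec with z|].
  assert (Cw := flow_curve HS HL U (A_op L) w x FU Rw (proj1 Hx)).
  assert (E0 : Kv O = U x (gen_value (A_op L) w)).
  { apply (gen_unique HUg (U x w)); [now apply (HKv O); lia|].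
    apply (gen_orbit HUs HUg); [lra|]. apply (gen_value_spec U (A_op L) w FU Rw). }
  destruct (differential_curve HS HL 0 _ _ D (fun _ y => U y w) (fun _ => U x (gen_value (A_op L) w)) x HD (proj1 Hx))
    as [z0 [Hz0 Hd]]; [intros i Hi; exact Cw|].
  assert (Hg : deriv_within (V := X) b (fun y => Gval k (U y w)) x (D O (U x (gen_value (A_op L) w)))).
  { intros eps Heps. destruct (Hd eps Heps) as [e [He Hd']]. exists e. split; auto.
    intros s Hs Hsx. destruct (Hd' s (proj1 Hs) Hsx) as [z1 [Hz1 Nz]].
    assert (E : forall a c : X, plus a (minus c a) = c) by (intros; vec). rewrite E in Hz1.
    rewrite (Gval_eq _ _ _ Hz1), (Gval_eq _ _ _ Hz0). rewrite sum_O in Nz. exact Nz. }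
  exists (D O (U x (gen_value (A_op L) w))). split; auto.
  replace c with (minus (D O (U x (gen_value (A_op L) w))) y).
  - apply (product_rule HUs HUg b (fun y => Gval k (U y w))); auto.
    now rewrite (Gval_eq _ _ _ Hz).
  - rewrite Hc, sum_O, E0. vec.
Qed.

Lemma comm_G_at s v w p q : regular L v -> regular L w -> ball alpha1 p v -> ball alpha1 q w ->
  exists (cn : nat -> nat -> X) (zn : nat -> X) z, ball alpha0 (cg p q) z /\ lim_to (V := X) zn z /\
    forall n, (forall k, (1 <= k <= J)%nat ->
        commutator L 0 (fun p => comp_fun G k (p O)) (A_op L) (fun _ => w) (cn n k)) /\
      BF B F J v (fun k => U s (cn n k)) (zn n).
Proof.
  intros Rv Rw Bv Bw.
  destruct (xball_has_norm L alpha1 p v Bv) as [p' [Hp Hpp]].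
  destruct (xball_has_norm L alpha1 q w Bw) as [q' [Hq Hqq]].
  destruct (proj1 (bounded_in_iff _ _ _ _) (h3G s v w p' q' Hp Hq)) as [z [Hz Bz]].
  destruct (Hz (fun _ => v) (fun _ => w)) as [zn [Hzn Hlim]]; auto.
  - now apply const_seq_cvg with p.
  - now apply const_seq_cvg with q.
  - apply (lim_to_filterlim (V := X)) in Hlim. destruct (choice _ Hzn) as [cn Hcn].
    exists cn, zn, z. split; [apply xball_mono with (2 := Bz); now apply Hcg|]. split; auto.
Qed.

(** Mean value theorem along [s |-> e^{(xi-s)A} G_k(e^{sA} w)], all components [k] at once. *)
Lemma step_G xi v w p q : 0 < xi -> regular L v -> regular L w -> ball alpha1 p v -> ball alpha1 q w ->
  BF_ball v (cg p q) (fun k => scal (/ xi) (minus (Gval k (U xi w)) (U xi (Gval k w)))).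
Proof.
  intros Hxi Rv Rw Bv Bw.
  set (h := fun y k => match k with O => zero | _ => U (xi - y) (Gval k (U y w)) end).
  assert (Hm : BF_ball v (cg p q) (fun k => scal (/ xi) (minus (h xi k) (h 0 k)))).
  { apply (convex_mean_deriv (V := X) J (BF_ball v (cg p q)) h xi Hxi).
    - apply BF_ball_convex.
    - now apply BF_ball_closed.
    - intros x eps Hx Heps.
      assert (Rx : regular L (U x w)) by (apply (regular_bicomm HL (U x)); auto; apply BU; lra).
      destruct (comm_G_at (xi - x) v (U x w) p q) as [cn [zn [z [Bz [Hlim Hcn]]]]]; auto.
      { apply ball_U; auto. lra. }
      (* the value of the commutator is unique, being a derivative *)
      assert (Eq : forall n k, (1 <= k <= J)%nat -> U (xi - x) (cn n k) = U (xi - x) (cn O k)).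
      { intros n k Hk.
        destruct (proj2 (Gval_curve xi k w x _ Hx Rw (proj1 (Hcn n) k Hk))) as [_ [_ D1]].
        destruct (proj2 (Gval_curve xi k w x _ Hx Rw (proj1 (Hcn O) k Hk))) as [_ [_ D2]].
        apply (deriv_within_unique (V := X) xi _ x _ _ Hxi Hx D1 D2). }
      assert (Ez : z = zn O).
      { apply (lim_to_unique (V := X) zn); auto. apply lim_to_ext with (fun _ => zn O); [|apply lim_to_const].
        intros n. apply (BF_unique hB (F := F) (J := J) v (fun k => U (xi - x) (cn O k))); [apply Hcn|].
        generalize (proj2 (Hcn n)). apply (BF_ext hB). now apply Eq. }
      exists (fun k => match k with O => zero | _ => U (xi - x) (cn O k) end),
             (fun k => match k with O => zero | _ => U (xi - x) (cn O k) end).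
      split.
      + apply BF_ball_ext with (fun k => U (xi - x) (cn O k)).
        { intros k Hk. destruct k; [lia|auto]. }
        exists z. split; auto. rewrite Ez. apply Hcn.
      + intros k Hk. split; [|rewrite norm_0 by vec; lra]. destruct k as [|k].
        * intros e He. exists 1. split; [lra|]. intros y _ _. unfold h. rewrite norm_0 by vec.
          apply Rmult_le_pos; [lra|apply Rabs_pos].
        * destruct (proj2 (Gval_curve xi (Datatypes.S k) w x _ Hx Rw (proj1 (Hcn O) (Datatypes.S k) ltac:(lia))))
            as [_ [_ D1]]. exact D1. }
  revert Hm. apply BF_ball_ext. intros k Hk. unfold h. destruct k as [|k]; [lia|].
  rewrite Rminus_diag, Rminus_0_r, !(csg_0 HUs). reflexivity.
Qed.

Lemma deriv_within_cont b (h : R -> X) x c : 0 <= x -> 0 < b ->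
  (forall b, deriv_within (V := X) b h x c) -> forall eps, 0 < eps -> exists delta, 0 < delta /\
    forall y, 0 <= y <= b -> Rabs (y - x) < delta -> norm (minus (h y) (h x)) < eps.
Proof.
  intros Hx Hb H eps Heps. destruct (H b 1 Rlt_0_1) as [e [He D]].
  assert (P := norm_pos (V := X) c).
  exists (Rmin e (eps / (norm c + 2))). split; [apply Rmin_pos; auto; apply Rdiv_lt_0_compat; lra|].
  intros y Hy Hyx. assert (H1 := Rlt_le_trans _ _ _ Hyx (Rmin_l _ _)).
  assert (H2 := Rlt_le_trans _ _ _ Hyx (Rmin_r _ _)). specialize (D y Hy H1).
  apply Rle_lt_trans with (norm (minus (minus (h y) (h x)) (scal (y - x) c)) + norm (scal (y - x) c)).
  - apply norm_le2. vec.
  - canon. rewrite norm_scal_eq. apply Rle_lt_trans with (Rabs (y - x) * (norm c + 1)); [clra|].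
    apply Rle_lt_trans with (Rabs (y - x) * (norm c + 2)).
    + apply Rmult_le_compat_l; [apply Rabs_pos|lra].
    + apply (Rmult_lt_compat_r (norm c + 2)) in H2; [|lra].
      replace (eps / (norm c + 2) * (norm c + 2)) with eps in H2 by (field; lra). exact H2.
Qed.

Lemma abs_continuous (h : R -> X) :
  (forall x, 0 <= x -> exists c, forall b, deriv_within (V := X) b h x c) ->
  forall x, continuous (U := X) (fun s => h (Rabs s)) x.
Proof.
  intros H x. apply (proj2 (continuous_iff (V := X) (fun s => h (Rabs s)) x)). intros eps Heps.
  assert (P := Rabs_pos x). destruct (H (Rabs x) P) as [c Hc].
  destruct (deriv_within_cont (Rabs x + 1) h (Rabs x) c P ltac:(lra) Hc eps Heps) as [e [He D]].
  exists (Rmin e 1). split; [apply Rmin_pos; lra|]. intros t Ht.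
  assert (H1 := Rlt_le_trans _ _ _ Ht (Rmin_l _ _)). assert (H2 := Rlt_le_trans _ _ _ Ht (Rmin_r _ _)).
  assert (H3 := Rabs_triang_inv2 t x). apply D.
  - split; [apply Rabs_pos|]. assert (H4 := Rabs_triang_inv t x). lra.
  - lra.
Qed.

(** The integral of [f(v, e^{sA} w) = B(F(v) . G(e^{sA} w))] over [[0, tau]] is compared with that of
    [B(F(v) . e^{sA} G(w))], which is [tau B(F(v) . phi_1(tau A) G(w))].  Integration and [B] are
    interchanged because [B] is closed. *)
Lemma average_G tau v w y p q psi : 0 < tau -> regular L v -> regular L w ->
  ball alpha1 p v -> ball alpha1 q w ->
  (forall k, (1 <= k <= J)%nat -> comp_fun G k w (y k)) ->
  BF B F J v (fun k => Phi (fun l => phi1 (0, tau * l)) (y k)) psi ->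
  exists I, is_RInt (V := X) (fun s => fval v (U (Rabs s) w)) 0 tau I /\
    ball alpha0 (tau * cg p q) (minus (scal (/ tau) I) psi) /\
    forall s, 0 <= s -> nonlin B F G J v (U s w) (fval v (U s w)).
Proof.
  intros Htau Rv Rw Bv Bw Hy Hpsi.
  assert (RU : forall s, 0 <= s -> regular L (U s w)).
  { intros s Hs. apply (regular_bicomm HL (U s)); auto. now apply BU. }
  assert (HF : forall s, 0 <= s -> exists D, Defs.differential L 1 (fun p => nonlin B F G J (p O) (p 1%nat))
    (fun i => match i with O => v | _ => U s w end) D /\ nonlin B F G J v (U s w) (fval v (U s w))).
  { intros s Hs. destruct (comm_f_at v (U s w) p q) as [c [_ Hc]]; auto.
    { apply ball_U; auto. }
    destruct (Hc 1 Rlt_0_1) as [c' [[z [b [Kv [D [_ [Hz [_ [_ [HD _]]]]]]]]] _]].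
    exists D. split; auto. now apply fval_spec with z. }
  assert (CF : forall x, continuous (U := X) (fun s => fval v (U (Rabs s) w)) x).
  { apply (abs_continuous (fun s => fval v (U s w))). intros x Hx. destruct (HF x Hx) as [D [HD _]].
    eexists. apply (nonlin_curve (fun _ => v) (fun s => U s w) zero (U x (gen_value (A_op L) w)) x D Hx); auto.
    - now apply (const_curve HS HL).
    - now apply (flow_curve HS HL U (A_op L) w x FU). }
  assert (HG : forall k s, (1 <= k <= J)%nat -> 0 <= s -> exists c,
    commutator L 0 (fun p => comp_fun G k (p O)) (A_op L) (fun _ => U s w) c).
  { intros k s Hk Hs. destruct (comm_G_at 0 v (U s w) p q) as [cn [zn [z [_ [_ H]]]]]; auto.
    { apply ball_U; auto. }
    exists (cn O k). now apply H. }
  assert (CG : forall k, (1 <= k <= J)%nat -> forall x, continuous (U := X) (fun s => Gval k (U (Rabs s) w)) x).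
  { intros k Hk. apply (abs_continuous (fun s => Gval k (U s w))). intros x Hx. destruct (HG k x Hk Hx) as [c Hc].
    assert (Hex : forall b, x <= b -> exists g', deriv_within (V := X) b (fun y => Gval k (U y w)) x g').
    { intros b Hb. destruct (proj2 (Gval_curve b k w x c ltac:(lra) Rw Hc)) as [g' [Hg' _]]. now exists g'. }
    destruct (Hex (x + 1) ltac:(lra)) as [g1 Hg1]. exists g1. intros b.
    destruct (Rle_dec b (x + 1)) as [Hb|Hb]; [now apply deriv_within_le with (x + 1)|].
    destruct (Hex b ltac:(lra)) as [g2 Hg2].
    rewrite (deriv_within_unique (V := X) (x + 1) _ x g1 g2 ltac:(lra) ltac:(lra) Hg1
      (deriv_within_le (x + 1) b _ _ _ ltac:(lra) Hg2)). exact Hg2. }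
  set (I := RInt (V := X) (fun s => fval v (U (Rabs s) w)) 0 tau).
  assert (HI : is_RInt (V := X) (fun s => fval v (U (Rabs s) w)) 0 tau I).
  { apply (RInt_correct (V := X)), (ex_RInt_continuous (V := X)). intros z _. apply CF. }
  set (IG := fun k => RInt (V := X) (fun s => Gval k (U (Rabs s) w)) 0 tau).
  assert (HIG : forall k, (1 <= k <= J)%nat -> is_RInt (V := X) (fun s => Gval k (U (Rabs s) w)) 0 tau (IG k)).
  { intros k Hk. apply (RInt_correct (V := X)), (ex_RInt_continuous (V := X)). intros z _. now apply CG. }
  assert (Ey : forall k, (1 <= k <= J)%nat -> Gval k w = y k).
  { intros k Hk. apply Gval_eq. now apply Hy. }
  (* component [0] carries the value of [B] at the tuple of the other components *)
  assert (A1 : BF B F J v (fun k => scal (/ tau) (IG k)) (scal (/ tau) I)).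
  { assert (Hr := riemann_mean (V := X) J (fun Y => BF B F J v Y (Y O))
      (fun s k => match k with O => fval v (U (Rabs s) w) | _ => Gval k (U (Rabs s) w) end)
      (fun k => match k with O => I | _ => IG k end) 0 tau Htau). rewrite Rminus_0_r in Hr.
    apply (BF_ext hB v (fun k => scal (/ tau) (match k with O => I | _ => IG k end)));
      [intros k Hk; destruct k; [lia|auto]|].
    apply Hr.
    - intros Y Z t Ht HY HZ. now apply (BF_lin hB).
    - intros Yn Y HYn Hlim. apply (hBcl v Yn Y (fun n => Yn n O) (Y O) Rv HYn).
      + intros k Hk. apply (lim_to_filterlim (V := X)), Hlim. lia.
      + apply (lim_to_filterlim (V := X)), (Hlim O). lia.
    - intros s Hs. rewrite Rabs_right by lra. destruct (HF s (proj1 Hs)) as [_ [_ Hn]].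
      apply (BF_ext hB v (fun k => Gval k (U s w))); [intros k Hk; destruct k; [lia|auto]|].
      apply (nonlin_BF hB (G := G) v (U s w)); auto. intros k Hk. destruct (HG k s Hk (proj1 Hs)) as [c Hc].
      apply (Gval_curve s k w s c); auto. lra.
    - intros k Hk. destruct k as [|k]; [exact HI|]. apply HIG. lia. }
  assert (A2 : BF_ball v (tau * cg p q) (fun k => minus (scal (/ tau) (IG k)) (Phi (phi_fun tau) (y k)))).
  { set (f := fun s k => match k with O => zero | _ => minus (Gval k (U (Rabs s) w)) (U (Rabs s) (y k)) end).
    set (If := fun k => match k with O => zero | _ => minus (IG k) (scal tau (Phi (phi_fun tau) (y k))) end).
    assert (Hr := riemann_mean (V := X) J (BF_ball v (tau * cg p q)) f If 0 tau Htau). rewrite Rminus_0_r in Hr.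
    apply BF_ball_ext with (fun k => scal (/ tau) (If k)).
    { intros k Hk. unfold If. destruct k; [lia|]. vec. }
    apply Hr; clear Hr.
    - apply BF_ball_convex.
    - now apply BF_ball_closed.
    - intros s Hs. assert (Hcg0 : 0 <= cg p q).
      { destruct (comm_G_at 0 v w p q) as [_ [_ [z [Bz _]]]]; auto. now apply xball_nonneg with (1 := Bz). }
      destruct (step_G tau v w p q Htau Rv Rw Bv Bw) as [z0 [Hz0 Bz0]].
      destruct (Req_dec s 0) as [->|Hs0].
      (* the tuples at [s] are written as combinations of tuples at which [B] is known to be defined *)
      + apply BF_ball_ext with (fun k => plus (scal 0 (scal (/ tau) (minus (Gval k (U tau w)) (U tau (Gval k w)))))
          (scal 0 (scal (/ tau) (minus (Gval k (U tau w)) (U tau (Gval k w)))))).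
        { intros k Hk. unfold f. destruct k; [lia|]. rewrite Rabs_R0, !(csg_0 HUs), Ey by lia. vec. }
        exists (plus (scal 0 z0) (scal 0 z0)). split; [now apply (BF_lin hB)|].
        generalize (xball_lin Hip HS HL alpha0 _ _ z0 z0 0 0 Ha0 Bz0 Bz0). apply xball_mono.
        rewrite Rabs_R0. assert (0 <= tau * cg p q) by (apply Rmult_le_pos; lra). lra.
      + destruct (step_G s v w p q ltac:(lra) Rv Rw Bv Bw) as [z [Hz Bz]].
        apply BF_ball_ext with (fun k => plus (scal s (scal (/ s) (minus (Gval k (U s w)) (U s (Gval k w)))))
          (scal 0 (scal (/ s) (minus (Gval k (U s w)) (U s (Gval k w)))))).
        { intros k Hk. unfold f. destruct k; [lia|]. rewrite Rabs_right, Ey by (lia || lra). vec. }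
        exists (plus (scal s z) (scal 0 z)). split; [now apply (BF_lin hB)|].
        generalize (xball_lin Hip HS HL alpha0 _ _ z z s 0 Ha0 Bz Bz). apply xball_mono.
        rewrite Rabs_R0, Rabs_right by lra. rewrite Rmult_0_l, Rplus_0_r.
        apply Rmult_le_compat_r; lra.
    - intros k Hk. unfold f, If. destruct k as [|k].
      + generalize (is_RInt_const (V := X) 0 tau zero). match goal with |- is_RInt _ _ _ ?a -> _ => replace a with (@zero X) by vec end. intros H0. exact H0.
      + apply (is_RInt_minus (V := X)); [apply HIG; lia|]. apply (orbit_RInt_phi hU hPhi); auto. }
  exists I. split; [exact HI|]. split.
  - destruct A2 as [z [Hz Bz]].
    assert (E : z = minus (scal (/ tau) I) psi); [|rewrite E in Bz; exact Bz].
    apply (BF_unique hB (F := F) (J := J) v (fun k => minus (scal (/ tau) (IG k)) (Phi (phi_fun tau) (y k)))); auto.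
    generalize (BF_lin hB v _ _ _ _ 1 (-1) A1 Hpsi).
    match goal with |- ?f ?a -> ?g ?b => replace a with b by vec end.
    apply (BF_ext hB). intros k _. unfold phi_fun. vec.
  - intros s Hs. destruct (HF s Hs) as [_ [_ Hn]]. exact Hn.
Qed.

Lemma ball_conj p v : ball alpha1 p v -> ball alpha1 (Rabs kc * p) (hs_conj v).
Proof.
  intros Bv. destruct (xball_has_norm L alpha1 p v Bv) as [p' [Hp Hpp]].
  destruct (proj1 (bounded_in_iff _ _ _ _) (hconj v p' Hp)) as [z [-> Bz]].
  apply xball_mono with (2 := Bz). assert (P := xball_nonneg _ _ _ (has_norm_xball L alpha1 p' v Hp)).
  apply Rle_trans with (Rabs kc * p').
  - apply Rmult_le_compat_r; auto. apply Rle_abs.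
  - apply Rmult_le_compat_l; auto. apply Rabs_pos.
Qed.

(** With [w = conj v], the linear flow satisfies [conj(e^{sL} v) = e^{s conj L} w = e^{sL} e^{sA} w].  So
    [step_nonlin] replaces [e^{(tau-s)L} f(e^{sL} v, e^{sL} e^{sA} w)] by [e^{tau L} f(v, e^{sA} w)], and
    [average_G] replaces the average of the latter by the scheme. *)
Lemma local_error_regular tau v p psi I : 0 < tau -> regular L v -> ball alpha1 p v ->
  Psi_num Phi B F G J tau v psi ->
  is_RInt (V := X) (fun s => S (tau - s) (fval (S s v) (hs_conj (S s v)))) 0 tau I ->
  ball alpha0 (tau * (tau * (cf p (Rabs kc * p) + cg p (Rabs kc * p)))) (minus I (scal tau (S tau psi))).
Proof.
  intros Htau Rv Bv [y [Hy Hpsi]] HI. set (w := hs_conj v) in *. set (q := Rabs kc * p) in *.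
  assert (Rw : regular L w) by now apply regular_conj.
  assert (Bw : ball alpha1 q w) by now apply ball_conj.
  destruct (average_G tau v w y p q psi Htau Rv Rw Bv Bw Hy Hpsi) as [I1 [HI1 [B1 _]]].
  assert (Hcf0 : 0 <= cf p q /\ ball alpha0 0 (zero : X)).
  { destruct (comm_f_at v w p q Rv Rw Bv Bw) as [c [Bc _]]. split; [now apply xball_nonneg with (1 := Bc)|].
    apply (xball_zero Hip HS HL alpha0 Ha0). now exists (cf p q), c. }
  destruct Hcf0 as [Hcf0 Bz].
  assert (B2 : ball alpha0 (tau * cf p q) (scal (/ tau) (minus I (S tau I1)))).
  { assert (Hr := riemann_mean1 (V := X) (ball alpha0 (tau * cf p q))
      (fun s => minus (S (tau - s) (fval (S s v) (hs_conj (S s v)))) (S tau (fval v (U (Rabs s) w))))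
      (minus I (S tau I1)) 0 tau). rewrite Rminus_0_r in Hr. apply Hr; auto; clear Hr.
    - intros a b t Ht Ha Hb'. now apply (xball_convex Hip HS HL).
    - intros an a Han Hlim. now apply (xball_closed Hip HS HL alpha0 _ Ha0 an).
    - intros s Hs. rewrite Rabs_right by lra.
      assert (E : hs_conj (S s v) = S s (U s w)).
      { rewrite (S_U_Sb HS HL hcomm hU hA) by lra. unfold bar_sg, w. now rewrite conj_conj. }
      rewrite E. destruct (Req_dec s 0) as [->|Hs0].
      + rewrite Rminus_0_r, !(csg_0 HS), (csg_0 HUs).
        match goal with |- _ ?a => replace a with (zero : X) by vec end.
        apply xball_mono with (2 := Bz). apply Rmult_le_pos; lra.
      + apply xball_mono with (s * cf p q); [apply Rmult_le_compat_r; lra|].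
        apply step_nonlin; auto; [lra| |].
        * apply (regular_bicomm HL (U s)); auto. apply BU. lra.
        * apply ball_U; auto. lra.
    - apply (is_RInt_minus (V := X)); [exact HI|].
      apply (is_RInt_bounded (S tau)); auto. apply contraction_bounded. apply (csg_contr HS). lra. }
  assert (B3 := ball_S alpha0 _ tau _ Ha0 (Rlt_le _ _ Htau) B1).
  generalize (xball_scal Hip HS HL alpha0 _ _ tau Ha0 (xball_plus Hip HS HL alpha0 _ _ _ _ Ha0 B2 B3)).
  rewrite Rabs_right, (csg_sub HS), (csg_scal HS) by lra. rewrite <- Rmult_plus_distr_l.
  match goal with |- ?f ?a -> ?g ?b => replace a with b by vec end. auto.
Qed.
End LocalError.

(** * Global error of a Lie-type splitting *)

(** The discrete Gronwall lemma.  The recursion is required only below the level that the conclusion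
    reaches: this is how a bound is carried along the induction. *)
Lemma gronwall (E : nat -> R -> Prop) (T tau l delta : R) :
  0 < tau -> 0 <= l -> 0 <= delta ->
  (forall n r r', r <= r' -> E n r -> E n r') -> E O 0 ->
  (forall n r, INR (S n) * tau <= T -> 0 <= r <= T * delta * exp (T * l) -> E n r ->
     E (S n) ((1 + tau * l) * r + tau * delta)) ->
  forall n, INR n * tau <= T -> E n (T * delta * exp (T * l)).
Proof.
  intros Htau Hl Hd Hmono H0 Hstep.
  assert (Hle : forall n, INR n * tau <= T ->
    0 <= INR n * tau * delta * exp (INR n * tau * l) <= T * delta * exp (T * l)).
  { intros n Hn. assert (P : 0 <= INR n * tau) by (apply Rmult_le_pos; [apply pos_INR|lra]).
    assert (P1 := exp_pos (INR n * tau * l)).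
    split; [repeat apply Rmult_le_pos; try apply pos_INR; lra|].
    apply Rmult_le_compat; [now apply Rmult_le_pos|lra|apply Rmult_le_compat_r; lra|].
    apply exp_le, Rmult_le_compat_r; lra. }
  assert (Hind : forall n, INR n * tau <= T -> E n (INR n * tau * delta * exp (INR n * tau * l))).
  { induction n as [|n IH]; intros Hn.
    - apply Hmono with (2 := H0). simpl. lra.
    - rewrite S_INR in Hn. assert (Hn' : INR n * tau <= T) by lra.
      apply Hmono with (2 := Hstep n _ ltac:(rewrite S_INR; lra) (Hle n Hn') (IH Hn')).
      assert (P1 : 0 <= INR n * tau) by (apply Rmult_le_pos; [apply pos_INR|lra]).
      rewrite S_INR. replace ((INR n + 1) * tau) with (INR n * tau + tau) by ring.
      destruct (Hle n Hn') as [P6 _]. set (x := INR n * tau) in *.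
      assert (P7 : 0 <= tau * l) by (apply Rmult_le_pos; lra).
      assert (P8 : 0 <= x * l) by (apply Rmult_le_pos; lra).
      replace ((x + tau) * l) with (x * l + tau * l) by ring. rewrite exp_plus.
      assert (P9 := exp_ineq1_le (tau * l)). assert (P10 := exp_ineq1_le (x * l)).
      assert (P11 : 0 <= tau * delta) by (apply Rmult_le_pos; lra).
      replace ((x + tau) * delta * (exp (x * l) * exp (tau * l))) with
        (exp (tau * l) * (x * delta * exp (x * l)) + tau * delta * (exp (x * l) * exp (tau * l))) by ring.
      apply Rplus_le_compat.
      + apply Rmult_le_compat_r; lra.
      + rewrite <- (Rmult_1_r (tau * delta)) at 1. apply Rmult_le_compat_l; auto.
        rewrite <- (Rmult_1_r 1). apply Rmult_le_compat; lra. }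
  intros n Hn. apply Hmono with (2 := Hind n Hn). now apply Hle.
Qed.

Section Convergence.
Context {V : CompleteNormedModule R_AbsRing} {ip : V -> V -> R} (Hip : real_inner V ip).
Context {S : R -> V -> V} {L : op V} (HS : csg S) (HL : gen L S).
Implicit Types u v w : V.

Notation ball := (xball (V := V) (K := L)).

(** Contractions preserve the ball, and it is closed and convex. *)
Lemma duhamel_ball a r h I tau : 0 <= a -> 0 < tau -> (forall s, 0 <= s <= tau -> ball a r (h s)) ->
  is_RInt (fun s => S (tau - s) (h s)) 0 tau I -> ball a (tau * r) I.
Proof.
  intros Ha Htau Hh HI.
  assert (Hm : ball a r (scal (/ tau) I)).
  { assert (Hr := riemann_mean1 (ball a r) (fun s => S (tau - s) (h s)) I 0 tau).
    rewrite Rminus_0_r in Hr. apply Hr; auto.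
    - intros x y t Ht Hx Hy. now apply (xball_convex Hip HS HL).
    - intros xn x Hx Hlim. now apply (xball_closed Hip HS HL a r Ha xn).
    - intros s Hs. apply (xball_S Hip HS HL); auto. lra. }
  generalize (xball_scal Hip HS HL a _ _ tau Ha Hm). rewrite Rabs_right by lra.
  match goal with |- ?f ?a -> ?g ?b => replace a with b by vec end. auto.
Qed.

Lemma orbit_near a r u eps : 0 <= a -> ball a r u -> 0 < eps -> exists delta, 0 < delta /\
  forall s t, 0 <= s -> 0 <= t -> Rabs (t - s) < delta -> ball a eps (minus (S t u) (S s u)).
Proof.
  intros Ha [w [Hw _]] Heps.
  destruct (csg_cont HS u (eps / 2)) as [d1 [Hd1 D1]]; [lra|].
  destruct (csg_cont HS w (eps / 2)) as [d2 [Hd2 D2]]; [lra|].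
  exists (Rmin d1 d2). split; [now apply Rmin_pos|]. intros s t Hs Ht Hst.
  specialize (D1 s t Hs Ht (Rlt_le_trans _ _ _ Hst (Rmin_l _ _))).
  specialize (D2 s t Hs Ht (Rlt_le_trans _ _ _ Hst (Rmin_r _ _))).
  exists (minus (S t w) (S s w)). split; [|clra].
  assert (C : forall t, 0 <= t -> frac_pow L a (S t u) (S t w)).
  { intros x Hx. apply (frac_pow_commute Hip HS HL a (S x) u w); auto.
    split; [apply contraction_bounded, (csg_contr HS x Hx)|]. intros y z Hy.
    now rewrite <- !(csg_plus HS), Rplus_comm by auto. }
  generalize (frac_pow_lin Hip HS HL a _ _ _ _ 1 (-1) Ha (C t Ht) (C s Hs)).
  match goal with |- frac_pow L a ?x ?y -> frac_pow L a ?x' ?y' =>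
    replace x with x' by vec; replace y with y' by vec end. auto.
Qed.

Context {f : V -> V}.

Lemma duhamel_exists a M l tau u : 0 <= a -> 0 <= l -> 0 < tau -> ball a M u ->
  (forall v w r, ball a M v -> ball a M w -> ball a r (minus v w) -> ball a (l * r) (minus (f v) (f w))) ->
  exists I, is_RInt (fun s => S (tau - s) (f (S s u))) 0 tau I.
Proof.
  intros Ha Hl Htau Hu Hf.
  assert (Hc : forall x eps, 0 < eps -> exists delta, 0 < delta /\ forall t, Rabs (t - x) < delta ->
    norm (minus (f (S (Rabs t) u)) (f (S (Rabs x) u))) < eps).
  { intros x eps Heps. destruct (orbit_near a M u (eps / (l + 1)) Ha Hu) as [d [Hd D]].
    { apply Rdiv_lt_0_compat; lra. }
    exists d. split; auto. intros t Ht.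
    assert (B : ball a (l * (eps / (l + 1))) (minus (f (S (Rabs t) u)) (f (S (Rabs x) u)))).
    { apply Hf; try (apply (xball_S Hip HS HL); auto; apply Rabs_pos). apply D; try apply Rabs_pos.
      apply Rle_lt_trans with (2 := Ht). apply Rabs_triang_inv2. }
    apply Rle_lt_trans with (1 := xball_norm a _ _ B).
    apply Rmult_lt_reg_r with (l + 1); [lra|].
    replace (l * (eps / (l + 1)) * (l + 1)) with (l * eps) by (field; lra). lra. }
  assert (Hex : ex_RInt (fun s => S (Rabs (tau - s)) (f (S (Rabs s) u))) 0 tau).
  { apply (ex_RInt_continuous (V := V)). intros x _.
    apply (proj2 (continuous_iff (V := V) (fun s => S (Rabs (tau - s)) (f (S (Rabs s) u))) x)).
    intros eps Heps. destruct (Hc x (eps / 2)) as [d1 [Hd1 D1]]; [lra|].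
    destruct (csg_cont HS (f (S (Rabs x) u)) (eps / 2)) as [d2 [Hd2 D2]]; [lra|].
    exists (Rmin d1 d2). split; [now apply Rmin_pos|]. intros t Ht.
    specialize (D1 t (Rlt_le_trans _ _ _ Ht (Rmin_l _ _))).
    assert (Ht2 := Rlt_le_trans _ _ _ Ht (Rmin_r _ _)).
    specialize (D2 (Rabs (tau - x)) (Rabs (tau - t)) (Rabs_pos _) (Rabs_pos _)).
    apply Rle_lt_trans with (norm (S (Rabs (tau - t)) (minus (f (S (Rabs t) u)) (f (S (Rabs x) u))))
      + norm (minus (S (Rabs (tau - t)) (f (S (Rabs x) u))) (S (Rabs (tau - x)) (f (S (Rabs x) u))))).
    - apply norm_le2. rewrite (csg_sub HS) by apply Rabs_pos. vec.
    - assert (N := csg_norm HS (Rabs (tau - t)) (minus (f (S (Rabs t) u)) (f (S (Rabs x) u))) (Rabs_pos _)).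
      assert (N2 : norm (minus (S (Rabs (tau - t)) (f (S (Rabs x) u))) (S (Rabs (tau - x)) (f (S (Rabs x) u)))) < eps / 2).
      { apply D2. apply Rle_lt_trans with (1 := Rabs_triang_inv2 _ _).
        replace (tau - t - (tau - x)) with (- (t - x)) by ring. now rewrite Rabs_Ropp. }
      clra. }
  destruct Hex as [I HI]. exists I. revert HI. apply is_RInt_ext.
  intros s Hs. rewrite Rmin_left, Rmax_right in Hs by lra. rewrite !Rabs_right by lra. reflexivity.
Qed.

(** ** The exact solution *)

Context {T : R} {u0 : V} {u : R -> V}.
Context (Hu : forall t, 0 <= t <= T ->
  exists I, is_RInt (fun xi => S (t - xi) (f (u xi))) 0 t I /\ u t = plus (S t u0) I).

Lemma mild_initial : 0 <= T -> u 0 = u0.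
Proof.
  intros HT. destruct (Hu 0 ltac:(lra)) as [I [HI ->]].
  assert (E : I = zero).
  { rewrite <- (is_RInt_unique (V := V) _ _ _ _ HI). apply (RInt_point (V := V)). }
  rewrite E, (csg_0 HS). vec.
Qed.

Lemma mild_restart t tau : 0 <= t -> 0 < tau -> t + tau <= T ->
  exists I, is_RInt (fun s => S (tau - s) (f (u (t + s)))) 0 tau I /\ u (t + tau) = plus (S tau (u t)) I.
Proof.
  intros Ht Htau HT.
  destruct (Hu t ltac:(lra)) as [I1 [HI1 E1]]. destruct (Hu (t + tau) ltac:(lra)) as [I2 [HI2 E2]].
  destruct (ex_RInt_Chasles_2 (V := V) (fun xi => S (t + tau - xi) (f (u xi))) 0 t (t + tau) ltac:(lra)
    (ex_intro _ I2 HI2)) as [I3 HI3].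
  assert (HI4 : is_RInt (fun xi => S (t + tau - xi) (f (u xi))) 0 t (S tau I1)).
  { apply is_RInt_ext with (fun xi => S tau (S (t - xi) (f (u xi)))).
    - intros x Hx. rewrite Rmin_left, Rmax_right in Hx by lra. rewrite <- (csg_plus HS) by lra.
      f_equal. ring.
    - apply (is_RInt_bounded (S tau)); auto. apply contraction_bounded, (csg_contr HS). lra. }
  assert (E3 : I2 = plus (S tau I1) I3).
  { rewrite <- (is_RInt_unique (V := V) _ _ _ _ HI2). apply (is_RInt_unique (V := V)).
    apply (is_RInt_Chasles (V := V)) with t; auto. }
  exists I3. split.
  - assert (HI5 := is_RInt_comp_lin (V := V) (fun xi => S (t + tau - xi) (f (u xi))) 1 t 0 tau I3).
    replace (1 * 0 + t) with t in HI5 by ring. replace (1 * tau + t) with (t + tau) in HI5 by ring.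
    specialize (HI5 HI3). revert HI5. apply is_RInt_ext. intros x _.
    replace (1 * x + t) with (t + x) by ring. replace (t + tau - (t + x)) with (tau - x) by ring. vec.
  - rewrite E2, E1, E3, Rplus_comm, (csg_plus HS), (csg_add HS) by lra. vec.
Qed.

(** ** Consistency *)

Context {a0 a b : R} {psi : R -> V -> V} (Hab : 0 <= a0 < b) (Ha : 0 <= a).
Context (f_lip0 : forall M, exists l, 0 <= l /\ forall v w r,
  ball a0 M v -> ball a0 M w -> ball a0 r (minus v w) -> ball a0 (l * r) (minus (f v) (f w))).
Context (f_lip : forall M, exists l, 0 <= l /\ forall v w r,
  ball a0 M v -> ball a0 M w -> ball a r (minus v w) -> ball a (l * r) (minus (f v) (f w))).
Context (f_bound : forall M, exists k, 0 <= k /\ forall v, ball b M v -> ball a k (f v) /\ ball b k (f v)).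
Context (psi_bound : forall M, exists k, 0 <= k /\ forall tau v, 0 < tau <= 1 -> ball b M v -> ball b k (psi tau v)).
Context (psi_lip0 : forall M, exists l, 0 <= l /\ forall tau v w r, 0 < tau <= 1 ->
  ball a0 M v -> ball a0 M w -> ball a0 r (minus v w) -> ball a0 (l * r) (minus (psi tau v) (psi tau w))).
Context (psi_lip : forall M, exists l, 0 <= l /\ forall tau v w r, 0 < tau <= 1 ->
  ball a0 M v -> ball a0 M w -> ball a r (minus v w) -> ball a (l * r) (minus (psi tau v) (psi tau w))).
Context (linear_flow_error : forall M, exists k, 0 <= k /\ forall tau v I, 0 < tau <= 1 -> ball b M v ->
  is_RInt (fun s => S (tau - s) (f (S s v))) 0 tau I ->
  ball a (tau * (tau * k)) (minus I (scal tau (S tau (psi tau v))))).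

Lemma embed_ball : exists c, 1 <= c /\ forall r v, ball b r v -> ball a0 (c * r) v.
Proof.
  destruct (xball_embed Hip HS HL a0 b 1 Hab Rlt_0_1) as [C [HC H]].
  exists (1 + C). split; [lra|]. intros r v Hv. apply xball_mono with (2 := H r v Hv).
  assert (C * norm v <= C * r) by (apply Rmult_le_compat_l; auto; now apply xball_norm with (1 := Hv)). lra.
Qed.

(** What the scheme misses in one step from the exact solution. *)
Definition defect t tau : V := minus (u (t + tau)) (S tau (plus (u t) (scal tau (psi tau (u t))))).

(** In [X^a] the defect is quadratic: the solution and the linear flow are at distance [O(s)] after time
    [s], which costs [O(tau^2)] by the Lipschitz bound, and [linear_flow_error] is the rest.  In [X^b] it is
    only linear, but that suffices for interpolation. *)
Lemma defect_bound M : (forall t, 0 <= t <= T -> ball b M (u t)) ->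
  exists k, 0 <= k /\ forall t tau, 0 <= t -> 0 < tau <= 1 -> t + tau <= T ->
    ball a (tau * (tau * k)) (defect t tau) /\ ball b (tau * k) (defect t tau).
Proof.
  intros HM. destruct embed_ball as [c [Hc Hemb]].
  destruct (f_lip0 (c * M)) as [l0 [Hl0 L0]]. destruct (f_lip (c * M)) as [l [Hl Lf]].
  destruct (f_bound M) as [kf [Hkf Bf]]. destruct (psi_bound M) as [kp [Hkp Bp]].
  destruct (linear_flow_error M) as [kl [Hkl Bl]].
  assert (P : 0 <= l * kf) by now apply Rmult_le_pos.
  exists (l * kf + kl + (kf + kp)). split; [lra|]. intros t tau Ht Htau HtT.
  destruct (mild_restart t tau Ht (proj1 Htau) HtT) as [I [HI EI]].
  destruct (duhamel_exists a0 (c * M) l0 tau (u t)) as [I2 HI2]; try tauto.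
  { apply Hemb, HM. lra. }
  assert (B2 := Bl tau (u t) I2 Htau (HM t ltac:(lra)) HI2).
  assert (Bu : ball b M (u t)) by (apply HM; lra).
  assert (B1 : ball a (tau * (tau * (l * kf))) (minus I I2)).
  { apply duhamel_ball with (fun s => minus (f (u (t + s))) (f (S s (u t)))); [auto|lra| |].
    - intros s Hs. apply xball_mono with (l * (s * kf)).
      { replace (l * (s * kf)) with (s * (l * kf)) by ring. apply Rmult_le_compat_r; lra. }
      apply Lf.
      + apply Hemb, HM. lra.
      + apply Hemb. apply (xball_S Hip HS HL); [lra|lra|auto].
      + destruct (Req_dec s 0) as [->|Hs0].
        * rewrite Rplus_0_r, Rmult_0_l, (csg_0 HS).
          match goal with |- _ ?x => replace x with (zero : V) by vec end.
          apply (xball_zero Hip HS HL a Ha). exists kf, (f (u t)). now apply Bf.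
        * destruct (mild_restart t s Ht ltac:(lra) ltac:(lra)) as [Is [HIs ->]].
          match goal with |- _ ?x => replace x with Is by vec end.
          apply duhamel_ball with (fun x => f (u (t + x))); [auto|lra| |exact HIs].
          intros x Hx. apply Bf, HM. lra.
    - apply is_RInt_ext with (fun s => minus (S (tau - s) (f (u (t + s)))) (S (tau - s) (f (S s (u t))))).
      + intros s Hs. rewrite Rmin_left, Rmax_right in Hs by lra. now rewrite (csg_sub HS) by lra.
      + now apply (is_RInt_minus (V := V)). }
  unfold defect. rewrite EI, (csg_add HS), (csg_scal HS) by lra. split.
  - apply xball_mono with (tau * (tau * (l * kf)) + tau * (tau * kl)).
    { rewrite <- !Rmult_plus_distr_l. repeat (apply Rmult_le_compat_l; [lra|]). lra. }
    generalize (xball_plus Hip HS HL a _ _ _ _ Ha B1 B2).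
    match goal with |- ?f ?a -> ?g ?b => replace a with b by vec end. auto.
  - assert (B3 : ball b (tau * kf) I).
    { apply duhamel_ball with (fun x => f (u (t + x))); [lra|lra| |exact HI]. intros x Hx. apply Bf, HM. lra. }
    assert (B4 := xball_scal Hip HS HL b _ _ tau ltac:(lra) (xball_S Hip HS HL b _ tau _ ltac:(lra) ltac:(lra) (Bp tau (u t) Htau Bu))).
    rewrite Rabs_right in B4 by lra.
    apply xball_mono with (tau * kf + tau * kp).
    { rewrite <- !Rmult_plus_distr_l. apply Rmult_le_compat_l; lra. }
    generalize (xball_minus Hip HS HL b _ _ _ _ ltac:(lra) B3 B4).
    match goal with |- ?f ?a -> ?g ?b => replace a with b by vec end. auto.
Qed.

(** ** Stability and convergence *)

Definition iterates (tau : R) (v : nat -> V) : Prop :=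
  v O = u0 /\ forall n, v (Datatypes.S n) = S tau (plus (v n) (scal tau (psi tau (v n)))).

Lemma error_step c tau (v : nat -> V) n l r delta : 0 <= c -> 0 < tau <= 1 -> iterates tau v ->
  ball c r (minus (u (INR n * tau)) (v n)) ->
  ball c (l * r) (minus (psi tau (u (INR n * tau))) (psi tau (v n))) ->
  ball c (tau * delta) (defect (INR n * tau) tau) ->
  ball c ((1 + tau * l) * r + tau * delta) (minus (u (INR (Datatypes.S n) * tau)) (v (Datatypes.S n))).
Proof.
  intros Hc Htau [_ Hv] B1 B2 B3. set (t := INR n * tau) in *.
  replace (INR (Datatypes.S n) * tau) with (t + tau) by (rewrite S_INR; unfold t; ring). rewrite Hv.
  assert (B4 := xball_scal Hip HS HL c _ _ tau Hc B2). rewrite Rabs_right in B4 by lra.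
  assert (B5 := xball_S Hip HS HL c _ tau _ Hc ltac:(lra) (xball_plus Hip HS HL c _ _ _ _ Hc B1 B4)).
  replace ((1 + tau * l) * r + tau * delta) with (r + tau * (l * r) + tau * delta) by ring.
  generalize (xball_plus Hip HS HL c _ _ _ _ Hc B5 B3). unfold defect.
  rewrite (csg_add HS), (csg_scal HS), !(csg_sub HS), !(csg_add HS), !(csg_scal HS) by lra.
  match goal with |- ?f ?a -> ?g ?b => replace a with b by vec end. auto.
Qed.

(** For [X^a0] no quadratic defect is available.  Interpolation between [X^b] and [X] makes the defect there
    a small multiple of [tau] once [tau] is below a threshold, so that Gronwall's lemma keeps the iterates
    near the solution.  Above the threshold only boundedly many steps fit into [[0, T]]. *)
Lemma iterates_bounded M : 0 < T -> (forall t, 0 <= t <= T -> ball b M (u t)) ->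
  exists M', forall tau (v : nat -> V), 0 < tau <= 1 -> iterates tau v -> forall n, INR n * tau <= T ->
    ball a0 M' (v n) /\ ball a0 M' (u (INR n * tau)).
Proof.
  intros HT HM. destruct embed_ball as [c [Hc Hemb]]. destruct (defect_bound M HM) as [k [Hk Hdef]].
  assert (Hu0 := mild_initial (Rlt_le _ _ HT)).
  assert (HM0 : ball b M u0) by (rewrite <- Hu0; apply HM; lra).
  assert (PM := xball_nonneg _ _ _ HM0).
  destruct (psi_lip0 (c * M + 1)) as [l [Hl Lp]].
  assert (Pe := exp_pos (T * l)).
  (* the error stays below 1 if every step contributes at most [tau * delta] *)
  set (delta := / (T * exp (T * l))).
  assert (Pd : 0 < delta) by (apply Rinv_0_lt_compat, Rmult_lt_0_compat; lra).
  assert (Ed : T * delta * exp (T * l) = 1) by (unfold delta; field; split; lra).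
  destruct (xball_embed Hip HS HL a0 b (delta / (2 * (k + 1))) Hab) as [C [HC Hsmall]].
  { apply Rdiv_lt_0_compat; lra. }
  assert (PCk : 0 <= C * k) by now apply Rmult_le_pos.
  set (tau0 := delta / (2 * (C * k + 1))).
  assert (Pt : 0 < tau0) by (apply Rdiv_lt_0_compat; lra).
  assert (Hbu : forall tau n, 0 < tau -> INR n * tau <= T -> ball a0 (c * M) (u (INR n * tau))).
  { intros tau n Htau Hn. apply Hemb, HM. split; auto. apply Rmult_le_pos; [apply pos_INR|lra]. }
  assert (HcM : 0 <= c * M) by (apply Rmult_le_pos; lra).
  (* radii in [X^b] that depend on the number of steps *)
  assert (HR : forall N, exists R, c * M <= R /\ forall tau (v : nat -> V), 0 < tau <= 1 -> iterates tau v ->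
    forall n, (n <= N)%nat -> ball b R (v n)).
  { induction N as [|N [R [HR IH]]].
    - exists (c * M). split; [lra|]. intros tau v _ [Hv _] n Hn. replace n with O by lia. rewrite Hv.
      apply xball_mono with (2 := HM0). rewrite <- (Rmult_1_l M) at 1. apply Rmult_le_compat_r; lra.
    - destruct (psi_bound R) as [kp [Hkp Bp]]. exists (R + kp). split; [lra|].
      intros tau v Htau Hv n Hn. destruct (Nat.eq_dec n (Datatypes.S N)) as [->|Hne].
      + rewrite (proj2 Hv). apply (xball_S Hip HS HL); [lra|lra|].
        apply xball_mono with (R + tau * kp).
        { apply Rplus_le_compat_l. rewrite <- (Rmult_1_l kp) at 2. apply Rmult_le_compat_r; lra. }
        assert (B := IH tau v Htau Hv N (le_n N)).
        assert (B' := xball_scal Hip HS HL b _ _ tau ltac:(lra) (Bp tau (v N) Htau B)).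
        rewrite Rabs_right in B' by lra. apply (xball_plus Hip HS HL b); auto. lra.
      + apply xball_mono with R; [lra|]. apply (IH tau v Htau Hv). lia. }
  destruct (nfloor_ex (T / tau0)) as [N HN]; [apply Rlt_le, Rdiv_lt_0_compat; lra|].
  destruct (HR N) as [R [HR1 HR2]].
  exists (c * R + 1). intros tau v Htau Hv n Hn.
  assert (HcR : c * M <= c * R).
  { apply Rmult_le_compat_l; [lra|]. apply Rle_trans with (c * M); auto.
    rewrite <- (Rmult_1_l M) at 1. apply Rmult_le_compat_r; lra. }
  split; [|apply xball_mono with (c * M); [lra|apply Hbu; tauto]].
  destruct (Rle_dec tau tau0) as [Hs|Hs].
  - assert (Hclose : forall n r, INR n * tau <= T -> r <= 1 ->
      ball a0 r (minus (u (INR n * tau)) (v n)) -> ball a0 (c * M + 1) (v n)).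
    { intros m r Hm Hr B.
      generalize (xball_minus Hip HS HL a0 _ _ _ _ ltac:(lra) (Hbu tau m (proj1 Htau) Hm) B).
      match goal with |- _ ?a -> _ => replace a with (v m) by vec end. apply xball_mono. lra. }
    assert (Hg := gronwall (fun n r => ball a0 r (minus (u (INR n * tau)) (v n))) T tau l delta
      (proj1 Htau) Hl (Rlt_le _ _ Pd)). rewrite Ed in Hg.
    assert (Hg' : ball a0 1 (minus (u (INR n * tau)) (v n))).
    { apply Hg; auto; clear Hg.
      - intros m r r' Hr. now apply xball_mono.
      - simpl. rewrite Rmult_0_l, Hu0, (proj1 Hv).
        match goal with |- _ ?x => replace x with (zero : V) by vec end.
        apply (xball_zero Hip HS HL a0); [lra|]. exists (c * M), u0. now apply Hemb.
      - intros m r Hm Hr B. rewrite S_INR in Hm. assert (Hm' : INR m * tau <= T) by lra.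
        apply error_step; auto; [lra| |].
        + apply Lp; auto; [|now apply Hclose with r].
          apply xball_mono with (c * M); [lra|]. apply Hbu; tauto.
        + destruct (Hdef (INR m * tau) tau) as [D1 D2]; try lra.
          { apply Rmult_le_pos; [apply pos_INR|lra]. }
          apply xball_mono with (2 := Hsmall _ _ D2).
          assert (N1 := xball_norm a _ _ D1).
          assert (E1 : delta / (2 * (k + 1)) * (tau * k) <= tau * (delta / 2)).
          { replace (delta / (2 * (k + 1)) * (tau * k)) with (tau * (delta / 2) * (k / (k + 1))) by (field; lra).
            rewrite <- (Rmult_1_r (tau * (delta / 2))) at 2. apply Rmult_le_compat_l.
            - apply Rmult_le_pos; lra.
            - apply Rmult_le_reg_r with (k + 1); [lra|]. unfold Rdiv. rewrite Rmult_assoc, Rinv_l by lra. lra. }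
          assert (E2 : C * (tau * (tau * k)) <= tau * (delta / 2)).
          { replace (C * (tau * (tau * k))) with (tau * (tau * (C * k))) by ring.
            apply Rmult_le_compat_l; [lra|]. apply Rle_trans with (tau0 * (C * k + 1)).
            - apply Rmult_le_compat; lra.
            - right. unfold tau0. field. lra. }
          apply Rle_trans with (1 := Rplus_le_compat_l _ _ _ (Rmult_le_compat_l _ _ _ HC N1)). lra. }
    apply xball_mono with (c * M + 1); [lra|]. apply Hclose with (2 := Rle_refl 1); auto.
  - apply xball_mono with (c * R); [lra|]. apply Hemb. apply (HR2 tau v Htau Hv).
    apply PeanoNat.Nat.lt_succ_r, INR_lt. rewrite S_INR. apply Rle_lt_trans with (T / tau0); [|tauto].
    apply Rmult_le_reg_r with tau0; auto. unfold Rdiv. rewrite Rmult_assoc, Rinv_l, Rmult_1_r by lra.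
    apply Rle_trans with (2 := Hn). apply Rmult_le_compat_l; [apply pos_INR|lra].
Qed.

Theorem first_order_convergence M : 0 < T -> (forall t, 0 <= t <= T -> ball b M (u t)) ->
  exists k, 0 < k /\ forall tau (v : nat -> V), 0 < tau <= 1 -> iterates tau v -> forall n, INR n * tau <= T ->
    ball a (k * tau) (minus (u (INR n * tau)) (v n)).
Proof.
  intros HT HM. destruct (iterates_bounded M HT HM) as [M' HM'].
  destruct (psi_lip M') as [l [Hl Lp]]. destruct (defect_bound M HM) as [k [Hk Hdef]].
  assert (P := exp_pos (T * l)).
  assert (P1 : 0 <= T * k * exp (T * l)) by (repeat apply Rmult_le_pos; lra).
  exists (T * k * exp (T * l) + 1). split; [lra|].
  intros tau v Htau Hv n Hn.
  assert (Pk : 0 <= tau * k) by (apply Rmult_le_pos; lra).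
  assert (Hg := gronwall (fun n r => ball a r (minus (u (INR n * tau)) (v n))) T tau l (tau * k)
    (proj1 Htau) Hl Pk).
  apply xball_mono with (T * (tau * k) * exp (T * l)).
  - replace ((T * k * exp (T * l) + 1) * tau) with (T * (tau * k) * exp (T * l) + tau) by ring. lra.
  - apply Hg; auto; clear Hg.
    + intros m r r' Hr. now apply xball_mono.
    + simpl. rewrite Rmult_0_l, (mild_initial (Rlt_le _ _ HT)), (proj1 Hv).
      match goal with |- _ ?x => replace x with (zero : V) by vec end.
      apply (xball_zero Hip HS HL a Ha).
      destruct (f_bound M) as [kf [_ Bf]]. exists kf, (f (u 0)). apply Bf, HM. lra.
    + intros m r Hm Hr B. rewrite S_INR in Hm. assert (Hm' : INR m * tau <= T) by lra.
      destruct (HM' tau v Htau Hv m Hm') as [Bv Bu].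
      apply error_step; auto. apply Hdef; auto; [|lra]. apply Rmult_le_pos; [apply pos_INR|lra].
Qed.
End Convergence.

(** * The splitting scheme *)

Section Scheme.
Context {d : nat} {Omega : Rd d -> Prop} {X : fun_hilbert Omega} {L : op X}.
Implicit Types u v w : X.
Notation ball := (xball (V := X) (K := L)).

Lemma bound_ball b b' c (E : X -> X -> Prop) (val : X -> X) : const1 c -> (forall v z, E v z -> val v = z) ->
  (forall v p, has_norm L b v p -> bounded_in L b' (E v) (c p)) ->
  forall M v, ball b M v -> E v (val v) /\ ball b' (Rabs (c M)) (val v).
Proof.
  intros [_ Hc] HE H M v Hv. destruct (xball_has_norm L b M v Hv) as [p [Hp Hle]].
  destruct (proj1 (bounded_in_iff _ _ _ _) (H v p Hp)) as [z [Hz Bz]]. rewrite (HE v z Hz).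
  split; auto. apply xball_mono with (2 := Bz). apply Rle_trans with (c M); auto. apply Rle_abs.
Qed.

Lemma lip_ball a0 b c (E : X -> X -> Prop) (val : X -> X) : const2 c -> (forall v z, E v z -> val v = z) ->
  (forall v w p q r, has_norm L a0 v p -> has_norm L a0 w q -> has_norm L b (minus v w) r ->
     bounded_in L b (sub_expr (E v) (E w)) (c p q * r)) ->
  forall M v w r, ball a0 M v -> ball a0 M w -> ball b r (minus v w) ->
    ball b (Rabs (c M M) * r) (minus (val v) (val w)).
Proof.
  intros [_ Hc] HE H M v w r Hv Hw Hr.
  destruct (xball_has_norm L a0 M v Hv) as [p [Hp Hpl]]. destruct (xball_has_norm L a0 M w Hw) as [q [Hq Hql]].
  destruct (xball_has_norm L b r _ Hr) as [s [Hs Hsl]].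
  destruct (proj1 (bounded_in_iff _ _ _ _) (H v w p q s Hp Hq Hs)) as [z [[z1 [z2 [H1 [H2 ->]]]] Bz]].
  rewrite (HE v z1 H1), (HE w z2 H2). apply xball_mono with (2 := Bz).
  assert (Ps := xball_nonneg _ _ _ (has_norm_xball L b s _ Hs)).
  apply Rle_trans with (Rabs (c M M) * s).
  - apply Rmult_le_compat_r; auto. apply Rle_trans with (c M M); auto. apply Rle_abs.
  - apply Rmult_le_compat_l; auto. apply Rabs_pos.
Qed.

Context {S : R -> X -> X} {U : R -> X -> X} {Phi : (R -> C) -> X -> X}.
Context {J : nat} {F G : C -> nat -> C} {B : cfun Omega -> X -> Prop}.
Context (hS : contraction_semigroup S) (hL : generates_semigroup L S) (hcomm : commutes_with_bar S).
Context (hB : linear_fun_op B).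

Notation HS := (csg_of_semigroup S hS).
Notation HL := (gen_of_semigroup L S hS hL).
Notation Hip := (rip_inner (X := X)).

Definition fself (v : X) : X := fval (J := J) (F := F) (G := G) (B := B) v (hs_conj v).

Definition psi_val (tau : R) (v : X) : X := epsilon (inhabits zero) (Psi_num Phi B F G J tau v).

Lemma fself_eq v z : nonlin B F G J v (hs_conj v) z -> fself v = z.
Proof. apply (fval_eq hB). Qed.

Lemma psi_val_eq tau v z : Psi_num Phi B F G J tau v z -> psi_val tau v = z.
Proof.
  intros H. apply (Psi_num_unique hB (F := F) (G := G) (J := J) Phi tau v); auto.
  unfold psi_val. apply epsilon_spec. now exists z.
Qed.

Lemma mollify_ball a r j v : 0 <= a -> ball a r v -> ball a r (mollify (S := S) j v).
Proof.
  intros Ha. apply (ball_bicomm hS hL); auto.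
  - apply (mollify_bicomm HS HL hcomm).
  - apply (mollify_contraction HS HL hcomm).
Qed.

(** Smoothing commutes with the power. *)
Lemma mollify_near a r v eps : 0 <= a -> ball a r v -> 0 < eps ->
  exists N, forall j, (N <= j)%nat -> ball a eps (minus (mollify (S := S) j v) v).
Proof.
  intros Ha [w [Hw _]] Heps.
  destruct (mollify_lim HS HL hcomm v (eps / 2)) as [N1 D1]; [lra|].
  destruct (mollify_lim HS HL hcomm w (eps / 2)) as [N2 D2]; [lra|].
  exists (max N1 N2). intros j Hj. specialize (D1 j ltac:(lia)). specialize (D2 j ltac:(lia)).
  exists (minus (mollify (S := S) j w) w). split; [|clra].
  assert (Hc : frac_pow L a (mollify (S := S) j v) (mollify (S := S) j w)).
  { apply (frac_pow_commute Hip HS HL a (mollify (S := S) j) v w); auto.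
    apply bicomm_commuting. apply (mollify_bicomm HS HL hcomm). }
  generalize (frac_pow_lin Hip HS HL a _ _ _ _ 1 (-1) Ha Hc Hw).
  match goal with |- frac_pow L a ?x ?y -> frac_pow L a ?x' ?y' =>
    replace x with x' by vec; replace y with y' by vec end. auto.
Qed.

(** Smoothing keeps the ball of [X^b] and converges in [X^a0], where both terms depend continuously on the
    vector.  So the estimate passes from regular vectors to all of [X^b]. *)
Lemma local_error a0 a b M M0 lf lp k tau v I : 0 <= a0 -> 0 <= a -> 0 <= b -> 0 < tau -> 0 <= lf -> 0 <= lp ->
  ball b M v -> ball a0 M0 v ->
  (forall v w r, ball a0 M0 v -> ball a0 M0 w -> ball a0 r (minus v w) ->
     ball a0 (lf * r) (minus (fself v) (fself w))) ->
  (forall v w r, ball a0 M0 v -> ball a0 M0 w -> ball a0 r (minus v w) ->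
     ball a0 (lp * r) (minus (psi_val tau v) (psi_val tau w))) ->
  (forall v I, regular L v -> ball b M v ->
     is_RInt (V := X) (fun s => S (tau - s) (fself (S s v))) 0 tau I ->
     ball a k (minus I (scal tau (S tau (psi_val tau v))))) ->
  is_RInt (V := X) (fun s => S (tau - s) (fself (S s v))) 0 tau I ->
  ball a k (minus I (scal tau (S tau (psi_val tau v)))).
Proof.
  intros Ha0 Ha Hb Htau Hlf Hlp Bv Bv0 Hf Hp Hreg HI.
  set (vn := fun j => mollify (S := S) j v).
  assert (B0 : forall j, ball a0 M0 (vn j)) by (intros j; now apply mollify_ball).
  assert (HIn : forall j, exists In, is_RInt (V := X) (fun s => S (tau - s) (fself (S s (vn j)))) 0 tau In).
  { intros j. apply (duhamel_exists Hip HS HL a0 M0 lf tau (vn j)); auto. }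
  apply choice in HIn. destruct HIn as [In HIn].
  apply (xball_closed Hip HS HL a k Ha (fun j => minus (In j) (scal tau (S tau (psi_val tau (vn j)))))).
  - intros j. apply Hreg; auto; [apply (mollify_regular HS HL hcomm)|now apply mollify_ball].
  - intros eps Heps.
    assert (P : 0 < tau * (lf + lp + 1)) by (apply Rmult_lt_0_compat; lra).
    destruct (mollify_near a0 M0 v (eps / (tau * (lf + lp + 1))) Ha0 Bv0) as [N HN].
    { now apply Rdiv_lt_0_compat. }
    set (e := eps / (tau * (lf + lp + 1))) in *.
    assert (Ee : tau * (lf + lp + 1) * e = eps) by (unfold e; field; split; lra).
    exists N. intros j Hj. specialize (HN j Hj). fold (vn j) in HN.
    assert (D1 : ball a0 (tau * (lf * e)) (minus (In j) I)).
    { apply (duhamel_ball Hip HS HL a0 (lf * e) (fun s => minus (fself (S s (vn j))) (fself (S s v)))); auto.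
      - intros s Hs. apply Hf; try (apply (xball_S Hip HS HL); auto; lra).
        rewrite <- (csg_sub HS) by lra. apply (xball_S Hip HS HL); auto. lra.
      - apply is_RInt_ext with (fun s => minus (S (tau - s) (fself (S s (vn j)))) (S (tau - s) (fself (S s v)))).
        + intros s Hs. rewrite Rmin_left, Rmax_right in Hs by lra. now rewrite (csg_sub HS) by lra.
        + now apply (is_RInt_minus (V := X)). }
    assert (D2 := Hp (vn j) v e (B0 j) Bv0 HN).
    assert (D3 := xball_scal Hip HS HL a0 _ _ tau Ha0 (xball_S Hip HS HL a0 _ tau _ Ha0 ltac:(lra) D2)).
    rewrite (csg_sub HS), Rabs_right in D3 by lra.
    assert (D4 := xball_norm _ _ _ (xball_minus Hip HS HL a0 _ _ _ _ Ha0 D1 D3)).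
    apply Rle_lt_trans with (tau * (lf * e) + tau * (lp * e)).
    + apply Rle_trans with (2 := D4). right. f_equal. vec.
    + assert (0 < tau * e); [|lra].
      apply Rmult_lt_0_compat; auto. now apply Rdiv_lt_0_compat.
Qed.

Lemma curve_bounded b T (u : R -> X) : 0 <= b -> 0 <= T ->
  (forall t, 0 <= t <= T -> in_X L b (u t)) ->
  (forall t, 0 <= t <= T -> forall eps, 0 < eps -> exists delta, 0 < delta /\
     forall s, 0 <= s <= T -> Rabs (s - t) < delta ->
       exists r, has_norm L b (minus (u s) (u t)) r /\ r < eps) ->
  exists M, forall t, 0 <= t <= T -> ball b M (u t).
Proof.
  intros Hb HT Hin Hc.
  apply (interval_induction (fun s t => exists M, forall r, s <= r <= t -> ball b M (u r)) 0 T HT).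
  - intros s m t Hs Ht [M1 H1] [M2 H2]. exists (Rmax M1 M2). intros r Hr. destruct (Rle_dec r m).
    + apply xball_mono with (1 := Rmax_l M1 M2). apply H1. lra.
    + apply xball_mono with (1 := Rmax_r M1 M2). apply H2. lra.
  - intros x Hx. destruct (Hc x Hx 1 Rlt_0_1) as [delta [Hd D]]. destruct (Hin x Hx) as [p Hp].
    apply has_norm_xball in Hp. exists delta. split; auto. intros s t Hs Ht Hst. exists (1 + p).
    intros r Hr. destruct (D r) as [q [Hq Hq1]]; [lra|apply Rabs_def1; lra|].
    apply has_norm_xball in Hq. assert (Hq' := xball_mono _ _ 1 _ (Rlt_le _ _ Hq1) Hq).
    generalize (xball_plus Hip HS HL b _ _ _ _ Hb Hq' Hp).
    match goal with |- ?f ?a -> ?g ?b => replace a with b by vec end. auto.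
Qed.
End Scheme.


Theorem theorem2
  (d : nat) (Omega : Rd d -> Prop) (X : fun_hilbert Omega)
  (L : op X) (S : R -> X -> X) (U : R -> X -> X) (Phi : (R -> C) -> X -> X)
  (J : nat) (F G : C -> nat -> C) (B : cfun Omega -> X -> Prop)
  (a0 a1 alpha0 alpha1 : R)
  (* (1) *)
  (hS : contraction_semigroup S) (hL : generates_semigroup L S)
  (hU : unitary_group U) (hA : generates_group (A_op L) U)
  (hcomm : commutes_with_bar S)
  (hPhi : functional_calculus U Phi)
  (hB : linear_fun_op B) (hBcl : closed_fun_op L B F J)
  (* (2) *)
  (ha : 0 <= a0 < a1)
  (h2 : forall alpha, a0 <= alpha <= a1 ->
     exists c, const1 c /\ forall u p q,
       has_norm L a0 u p -> has_norm L alpha u q ->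
       bounded_in L alpha (nonlin B F G J u (hs_conj u)) (c p * q))
  (h2lip : exists c, const2 c /\ forall u v p q r,
     has_norm L a0 u p -> has_norm L a0 v q -> has_norm L a0 (minus u v) r ->
     bounded_in L a0
       (sub_expr (nonlin B F G J u (hs_conj u)) (nonlin B F G J v (hs_conj v)))
       (c p q * r))
  (halpha0 : 0 <= alpha0 <= a1) (halpha1 : a0 < alpha1 <= a1)
  (* complex conjugation is bounded on X^{alpha1} *)
  (hconj : exists K, forall u p, has_norm L alpha1 u p ->
     bounded_in L alpha1 (fun z => z = hs_conj u) (K * p))
  (* (3) *)
  (h3f : exists c, const2 c /\ forall v w p q,
     has_norm L alpha1 v p -> has_norm L alpha1 w q ->
     bounded_in L alpha0
       (cont_ext L alpha1 (comm_f L B F G J) v w) (c p q))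
  (h3G : exists c, const2 c /\ forall s v w p q,
     has_norm L alpha1 v p -> has_norm L alpha1 w q ->
     bounded_in L alpha0
       (cont_ext L alpha1 (B_comm_G L U B F G J s) v w) (c p q))
  (* (4) *)
  (h4lip : exists c, const2 c /\ forall u v p q r,
     has_norm L a0 u p -> has_norm L a0 v q -> has_norm L alpha0 (minus u v) r ->
     bounded_in L alpha0
       (sub_expr (nonlin B F G J u (hs_conj u)) (nonlin B F G J v (hs_conj v)))
       (c p q * r))
  (h4f : exists c, const1 c /\ forall u p, has_norm L alpha1 u p ->
     bounded_in L alpha0 (nonlin B F G J u (hs_conj u)) (c p))
  (h4Psi : exists c, const1 c /\ forall tau u p, 0 < tau <= 1 ->
     has_norm L alpha1 u p ->
     bounded_in L alpha1 (Psi_num Phi B F G J tau u) (c p))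
  (h4Psilip : exists c, const2 c /\ forall tau u v p q r, 0 < tau <= 1 ->
     has_norm L a0 u p -> has_norm L a0 v q -> has_norm L alpha0 (minus u v) r ->
     bounded_in L alpha0
       (sub_expr (Psi_num Phi B F G J tau u) (Psi_num Phi B F G J tau v))
       (c p q * r))
  (h4Psilip0 : exists c, const2 c /\ forall tau u v p q r, 0 < tau <= 1 ->
     has_norm L a0 u p -> has_norm L a0 v q -> has_norm L a0 (minus u v) r ->
     bounded_in L a0
       (sub_expr (Psi_num Phi B F G J tau u) (Psi_num Phi B F G J tau v))
       (c p q * r))
  (u0 : X) (T : R) (u : R -> X)
  (hu0 : in_X L alpha1 u0) (hT : 0 < T)
  (hu : mild_solution L S B F G J alpha1 T u0 u) :
  exists CT, 0 < CT /\
    forall tau (un : nat -> X), 0 < tau <= 1 ->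
      scheme S Phi B F G J tau u0 un ->
      forall n : nat, INR n * tau <= T ->
        bounded_in L alpha0
          (fun z => z = minus (u (INR n * tau)) (un n)) (CT * tau).

Proof.
  assert (HS := csg_of_semigroup S hS). assert (HL := gen_of_semigroup L S hS hL).
  assert (Hip := rip_inner (X := X)).
  destruct h2lip as [c2 [Hc2 h2lip']]. destruct hconj as [kc hconj'].
  destruct h3f as [cf [Hcf h3f']]. destruct h3G as [cg [Hcg h3G']].
  destruct h4lip as [c4 [Hc4 h4lip']]. destruct h4f as [c5 [Hc5 h4f']].
  destruct h4Psi as [c6 [Hc6 h4Psi']]. destruct h4Psilip as [c7 [Hc7 h4Psilip']].
  destruct h4Psilip0 as [c8 [Hc8 h4Psilip0']].
  destruct (h2 alpha1 ltac:(lra)) as [c1 [Hc1 h2']].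
  set (f := fself (J := J) (F := F) (G := G) (B := B)).
  set (psi := psi_val (Phi := Phi) (J := J) (F := F) (G := G) (B := B)).
  set (E := fun v z => nonlin B F G J v (hs_conj v) z).
  assert (HEf : forall v z, E v z -> f v = z) by (intros v z; apply (fself_eq hB)).
  assert (HEp : forall tau v z, Psi_num Phi B F G J tau v z -> psi tau v = z)
    by (intros tau v z; apply (psi_val_eq hB)).
  assert (Hab : 0 <= a0 < alpha1) by lra. assert (Ha := proj1 halpha0).
  assert (Hb : 0 <= alpha1) by lra.
  destruct (embed_ball Hip HS HL Hab) as [ce [Hce Hemb]].
  assert (f_lip0 := lip_ball (L := L) a0 a0 c2 E f Hc2 HEf h2lip').
  assert (f_lip := lip_ball (L := L) a0 alpha0 c4 E f Hc4 HEf h4lip').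
  assert (f_bd := bound_ball (L := L) alpha1 alpha0 c5 E f Hc5 HEf h4f').
  assert (p_bd := fun tau Ht => bound_ball (L := L) alpha1 alpha1 c6 _ (psi tau) Hc6 (HEp tau)
    (fun v p => h4Psi' tau v p Ht)).
  assert (p_lip := fun tau Ht => lip_ball (L := L) a0 alpha0 c7 _ (psi tau) Hc7 (HEp tau)
    (fun v w p q r => h4Psilip' tau v w p q r Ht)).
  assert (p_lip0 := fun tau Ht => lip_ball (L := L) a0 a0 c8 _ (psi tau) Hc8 (HEp tau)
    (fun v w p q r => h4Psilip0' tau v w p q r Ht)).
  assert (f_bd1 : forall M v, xball (V := X) (K := L) alpha1 M v ->
    xball (V := X) (K := L) alpha1 (Rabs (c1 (ce * M)) * M) (f v)).
  { intros M v Hv. destruct (xball_has_norm L alpha1 M v Hv) as [q [Hq Hql]].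
    destruct (xball_has_norm L a0 _ v (Hemb M v Hv)) as [p [Hp Hpl]].
    destruct (proj1 (bounded_in_iff _ _ _ _) (h2' v p q Hp Hq)) as [z [Hz Bz]].
    rewrite (HEf v z Hz). apply xball_mono with (2 := Bz).
    assert (Pq := xball_nonneg _ _ _ (has_norm_xball L alpha1 q v Hq)).
    apply Rle_trans with (Rabs (c1 (ce * M)) * q).
    - apply Rmult_le_compat_r; auto. apply Rle_trans with (c1 (ce * M)); [now apply Hc1|apply Rle_abs].
    - apply Rmult_le_compat_l; auto. apply Rabs_pos. }
  destruct hu as [Hin [Hcont [g [Hg Hmild]]]].
  assert (Hmild' : forall t, 0 <= t <= T -> exists I,
    is_RInt (V := X) (fun xi => S (t - xi) (f (u xi))) 0 t I /\ u t = plus (S t u0) I).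
  { intros t Ht. destruct (Hmild t Ht) as [I [HI EI]]. exists I. split; auto.
    revert HI. apply is_RInt_ext. intros x Hx. rewrite Rmin_left, Rmax_right in Hx by lra.
    now rewrite (HEf (u x) (g x)) by (apply Hg; lra). }
  (* below, absolute values and maxima make the given constants nonnegative *)
  destruct (curve_bounded hS hL alpha1 T u ltac:(lra) (Rlt_le _ _ hT) Hin Hcont) as [M HM].
  destruct (first_order_convergence Hip HS HL Hmild' (a0 := a0) (a := alpha0) (b := alpha1) (psi := psi) Hab Ha)
    with (M := M) as [k [Hk Hmain]]; auto.
  - intros N. exists (Rabs (c2 N N)). split; [apply Rabs_pos|]. apply f_lip0.
  - intros N. exists (Rabs (c4 N N)). split; [apply Rabs_pos|]. apply f_lip.
  - intros N. exists (Rmax (Rabs (c5 N)) (Rabs (c1 (ce * N)) * N)). split.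
    + apply Rle_trans with (2 := Rmax_l _ _), Rabs_pos.
    + intros v Hv. split.
      * apply xball_mono with (1 := Rmax_l _ _). now apply f_bd.
      * apply xball_mono with (1 := Rmax_r _ _). now apply f_bd1.
  - intros N. exists (Rabs (c6 N)). split; [apply Rabs_pos|]. intros tau v Ht. now apply p_bd.
  - intros N. exists (Rabs (c8 N N)). split; [apply Rabs_pos|]. intros tau v w r Ht. now apply p_lip0.
  - intros N. exists (Rabs (c7 N N)). split; [apply Rabs_pos|]. intros tau v w r Ht. now apply p_lip.
  - intros N. exists (Rabs (cf N (Rabs kc * N) + cg N (Rabs kc * N))). split; [apply Rabs_pos|].
    intros tau v I Ht Hv HI.
    apply (local_error hS hL hcomm a0 alpha0 alpha1 N (ce * N) (Rabs (c2 (ce * N) (ce * N)))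
      (Rabs (c8 (ce * N) (ce * N)))); try apply Rabs_pos; try lra; auto.
    + intros w I' Rw Bw HI'.
      apply xball_mono with (tau * (tau * (cf N (Rabs kc * N) + cg N (Rabs kc * N)))).
      { repeat (apply Rmult_le_compat_l; [lra|]). apply Rle_abs. }
      apply (local_error_regular hS hL hU hA hcomm hPhi hB hBcl Ha Hb Hcf h3f' Hcg h3G' hconj' tau w N); auto; [lra|].
      now apply (p_bd tau Ht N w).
  - exists k. split; auto. intros tau un Htau [Hun0 Hun] n Hn. apply bounded_in_iff.
    exists (minus (u (INR n * tau)) (un n)). split; auto. apply Hmain; auto. split; auto.
    intros m. destruct (Hun m) as [p [Hp ->]]. now rewrite (HEp tau (un m) p).
Qed.
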